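(* Let $(X,d,\mu)$ be a normal space of order $\theta$ with $0<\mu(X)<\infty$, and let $\mathcal F$, $(f_Q)_{Q\in\mathcal F}$, $(h_Q)_{Q\in\mathcal F}$ and the martingale Hardy space $H^1([\Sigma_n])$ be as in the context. Let $Z$ be the closure of the linear span of $\{h_Q:Q\in\mathcal F\}$ in $H^1([\Sigma_n])$, equipped with the norm of $H^1([\Sigma_n])$. Then $$S:Z\to H^1(X,d,\mu),\qquad h_Q\mapsto f_Q\quad(Q\in\mathcal F),$$ defines a bounded linear operator.
   Context: Normal space: $X$ is a set, $d:X\times X\to[0,\infty)$ is a quasi-metric (symmetric, $d(x,y)=0$ iff $x=y$, and $d(x,y)\le K'(d(x,z)+d(z,y))$ for a fixed $K'$), $B(x,r)=\{y: d(x,y)<r\}$, and $\mu$ is a non-negative measure on $X$ defined on a $\sigma$-algebra containing the balls. $(X,d,\mu)$ is normal of order $\theta>0$ if there are constants $A_1,A_2,K_1,K_2\in(0,\infty)$ with $K_2\le1\le K_1$ and $K_0>0$ such that for all $x\in X$, $r>0$: $A_1r\le\mu(B(x,r))$ if $r\le K_1\mu(X)$; $B(x,r)=X$ if $r>K_1\mu(X)$; $A_2r\ge\mu(B(x,r))$ if $r\ge K_2\mu(\{x\})$; $B(x,r)=\{x\}$ if $r<K_2\mu(\{x\})$; and $|d(x,z)-d(y,z)|\le K_0r^{1-\theta}d(x,y)^\theta$ whenever $d(x,z)<r$, $d(y,z)<r$. Atomic $H^1(X,d,\mu)$ (Coifman–Weiss): an atom is a function $a:X\to\mathbf R$ supported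 in a ball $B$ with $\|a\|_\infty\le\mu(B)^{-1}$ and $\int a\,d\mu=0$; since $\mu(X)<\infty$ the constant function $1/\mu(X)$ is also an atom. $H^1(X,d,\mu)$ is the space of all $f=\sum_i\lambda_ia_i$ (convergence in $L^1(\mu)$) with $a_i$ atoms and $\sum|\lambda_i|<\infty$, normed by the infimum of $\sum_i|\lambda_i|$ over all such representations. Dyadic cubes (David, Christ): $\mathcal E=\{Q^k_i:k\ge0,i\in I_k\}$ is a collection of subsets of $X$ with constants $\delta\in(0,1)$, $a_0,\eta>0$, $C_1,C_2<\infty$ such that for each $k$ the $Q_i^k$ ($i\in I_k$) cover $X$ up to a $\mu$-null set; if $l\ge k$ then either $Q^l_j\subset Q^k_i$ or $Q^l_j\cap Q^k_i=\emptyset$; for each $(k,i)$ and $l<k$ there is a unique $j$ with $Q^k_i\subset Q^l_j$; $\operatorname{diam}Q^k_i\le C_1\delta^k$; each $Q^k_i$ contains a ball $B(z^k_i,a_0\delta^k)$; and $\mu\{x\in Q^k_i:\operatorname{dist}(x,X\setminus Q^k_i)\le t\delta^k\}\le C_2t^\eta\mu(Q^k_i)$ for $t\ge0$. The indexing is such that $X$ is the only cube of level $0$ (up to a null set). $G_n(X|\mathcal E)$ is the set of cubes of level $n$, and for $Q\in G_n(X|\mathcal E)$, $G_1(Q|\mathcal E)$ is the set of cubes of level $n+1$ contained in $Q$; write $G_1(Q|\mathcal E)=\{P_0,\dots,P_{N}\}$, $N=N(Q)$. Martingale $H^1$: $\Sigma_n$ is the $\sigma$-algebra generated by the cubes of levels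 $\le n$, and $H^1([\Sigma_n])$ is the martingale Hardy space with norm $\|f\|=\left\|\left(\sum_{n\ge0}|E(f|\Sigma_n)-E(f|\Sigma_{n-1})|^2\right)^{1/2}\right\|_{L^1(\mu)}$, where $E(f|\Sigma_{-1})=0$. Functions $h_{Q,i}$, $1\le i\le N(Q)$: supported in $Q$, constant on each $P_j$, taking at most three values (including $0$), with $\int h_{Q,i}\,d\mu=0$, and $\frac1C(\sum\alpha_i^2)^{1/2}\le\|\sum_i\alpha_ih_{Q,i}\|_{L^2}\le C(\sum\alpha_i^2)^{1/2}$ for all real $\alpha_i$, with $C$ independent of $Q$, $N$ and $\delta$ (such systems were constructed by Maurey; the system $\{h_{Q,i}\}$ is an unconditional basis in $H^1([\Sigma_n])$, apart from constants). Smoothing: fix $0<\beta\le\theta$; $\operatorname{Lip}_\beta(f)=\sup_{x\ne y}|f(x)-f(y)|/d(x,y)^\beta$. For each $n$, $(\psi^{(n)}_k)_k$ is a partition of unity (nonnegative functions, uniformly bounded overlap, as constructed by Macías–Segovia) with $\sum_k\psi^{(n)}_k=1$, $\operatorname{diam}(\operatorname{supp}\psi^{(n)}_k)\le\tau\delta^n$, $\operatorname{Lip}_\beta(\psi^{(n)}_k)\le(\tau\delta^n)^{-\beta}$. Put $K_n(x,y)=\sum_k\psi_k^{(n)}(x)\psi^{(n)}_k(y)/\|\psi^{(n)}_k\|_1$, and for $Q\in G_n(X|\mathcal E)$ put $\tilde\varphi_{Q,i}(x)=\int_XK_{n+1}(x,y)h_{Q,i}(y)\,d\mu(y)$ and $\varphi_{Q,i}=\tilde\varphi_{Q,i}/\|\tilde\varphi_{Q,i}\|_2$.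 Family $\mathcal F$: fix a large constant $K$; split each $G_n(X|\mathcal E)$ into $\mathcal P_{n,1},\dots,\mathcal P_{n,l}$ ($l$ depending only on $K$ and the geometry of $X$) so that $\operatorname{dist}(P,Q)\ge K\max\{\mu(P),\mu(Q)\}$ for distinct $P,Q\in\mathcal P_{n,j}$. Fix integers $m\ge2$, $0<s\le m$, $1\le j\le l$ and $i_0\ge1$, and let $\mathcal F=\bigcup_{k\ge0}\mathcal P_{mk+s,j}\cup\{X\}$, keeping only those cubes $Q\neq X$ with $N(Q)\ge i_0$. Put $\varphi_Q=\varphi_{Q,i_0}$ and $h_Q=h_{Q,i_0}$ for $Q\in\mathcal F$, $Q\ne X$, and $\varphi_X=h_X=\mathbf 1_X$. The system $f_Q$: fix $0<\alpha<\beta/2$. The parameters are chosen so that $\tau$ is sufficiently small (in particular $\tau<1/(500C_1)$), $\delta$ is sufficiently small depending on $\tau$, $\beta$ and the geometry of $X$, $K$ is sufficiently large, and $m$ is sufficiently large depending on $\alpha,\beta,\delta,\tau$ and the geometry. Then the Gram matrix $G=(\int_X\varphi_Q\varphi_P\,d\mu)_{Q,P\in\mathcal F}$ is positive definite and invertible on $\ell^2(\mathcal F)$; with $(a_{P,Q})$ the coefficients of $G^{-1/2}$, put $f_Q=\sum_{P\in\mathcal F}a_{P,Q}\varphi_P$. The $f_Q$ form an orthonormal system in $L^2(X,\mu)$. *)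

(* Defs.v *)
From HB Require Import structures.
From mathcomp Require Import all_boot all_order all_algebra finmap.
From mathcomp Require Import all_classical all_reals all_analysis.

Set Implicit Arguments.
Unset Strict Implicit.
Unset Printing Implicit Defensive.

Import Order.TTheory GRing.Theory Num.Theory.
Import numFieldNormedType.Exports.

Local Open Scope classical_set_scope.
Local Open Scope ring_scope.

Definition quasi_metric (R : realType) (X : Type) (d : X -> X -> R) : Prop :=
  [/\ forall x y, 0 <= d x y,
      forall x y, d x y = d y x,
      forall x y, d x y = 0 <-> x = y
    & exists K' : R, forall x y z, d x y <= K' * (d x z + d z y)].

Definition qball (R : realType) (X : Type) (d : X -> X -> R) (x : X) (r : R) :
  set X := [set y | d x y < r].

(* [sdist d A B] is +oo when A or B is empty; in particular
   dist(x, X \ X) = +oo. *)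
Definition sdist (R : realType) (X : Type) (d : X -> X -> R) (A B : set X) :
  \bar R := ereal_inf [set (d x y)%:E | x in A & y in B].

Definition qdiam (R : realType) (X : Type) (d : X -> X -> R) (A : set X) :
  \bar R := ereal_sup [set (d x y)%:E | x in A & y in A].

Definition lip_seminorm (R : realType) (X : Type) (d : X -> X -> R) (beta : R)
    (f : X -> R) : \bar R :=
  ereal_sup [set (`|f p.1 - f p.2| / d p.1 p.2 `^ beta)%:E
            | p in [set p : X * X | p.1 <> p.2]].

Definition normal_space_of_order (R : realType) (disp : measure_display)
    (X : measurableType disp) (mu : {measure set X -> \bar R})
    (d : X -> X -> R) (theta : R) : Prop :=
  [/\ 0 < theta, quasi_metric d,
      forall x r, measurable (qball d x r)
    & exists A1 A2 K1 K2 K0 : R,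
      [/\ [/\ 0 < A1, 0 < A2, 0 < K2, K2 <= 1 & 1 <= K1], 0 < K0 &
        forall (x : X) (r : R), 0 < r ->
        [/\ (r%:E <= K1%:E * mu setT -> (A1 * r)%:E <= mu (qball d x r))%E,
            (K1%:E * mu setT < r%:E)%E -> qball d x r = setT,
            (K2%:E * mu [set x] <= r%:E -> mu (qball d x r) <= (A2 * r)%:E)%E,
            (r%:E < K2%:E * mu [set x])%E -> qball d x r = [set x]
          & forall y z, d x z < r -> d y z < r ->
              `|d x z - d y z| <= K0 * r `^ (1 - theta) * d x y `^ theta]]].

(* Atomic Hardy space. Elements are functions, to be read modulo equality
   mu-almost everywhere; likewise for the martingale Hardy space below. *)

Definition atom (R : realType) (disp : measure_display)
    (X : measurableType disp) (mu : {measure set X -> \bar R})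
    (d : X -> X -> R) (a : X -> R) : Prop :=
  a = cst (fine (mu setT))^-1 \/
  exists x r, 0 < r /\
    [/\ measurable_fun setT a,
        forall y, ~ qball d x r y -> a y = 0,
        ('N[mu]_+oo[EFin \o a] <= ((fine (mu (qball d x r)))^-1)%:E)%E
      & \int[mu]_y a y = 0].

(* Finite sums are covered by taking lambda eventually zero. *)
Definition atomic_repr (R : realType) (disp : measure_display)
    (X : measurableType disp) (mu : {measure set X -> \bar R})
    (d : X -> X -> R) (f : X -> R) (lambda : nat -> R) (a : nat -> X -> R) :
    Prop :=
  [/\ forall i, atom mu d (a i),
      (\sum_(0 <= i <oo) `|lambda i|%:E < +oo)%E
    & (\int[mu]_x `|f x - \sum_(i < n) lambda i * a i x|%:E)%E
        @[n --> \oo] --> 0%E].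

Definition atomic_H1 (R : realType) (disp : measure_display)
    (X : measurableType disp) (mu : {measure set X -> \bar R})
    (d : X -> X -> R) : set (X -> R) :=
  [set f | measurable_fun setT f /\ exists lambda a, atomic_repr mu d f lambda a].

Definition atomic_H1_norm (R : realType) (disp : measure_display)
    (X : measurableType disp) (mu : {measure set X -> \bar R})
    (d : X -> X -> R) (f : X -> R) : \bar R :=
  ereal_inf [set s | exists lambda a, atomic_repr mu d f lambda a /\
                     s = (\sum_(0 <= i <oo) `|lambda i|%:E)%E].

(* Dyadic cubes: [E n] is the set of cubes of level n. The same subset of X may
   be a cube of several levels, so a cube of the whole collection is a pair
   (level, set). *)

Record dyadic_cubes (R : realType) (disp : measure_display)
    (X : measurableType disp) (mu : {measure set X -> \bar R})
    (d : X -> X -> R) (delta a0 eta C1 C2 : R) (E : nat -> set (set X)) :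
    Prop := DyadicCubes {
  dc_measurable : forall n Q, E n Q -> measurable Q ;
  dc_cover : forall n, mu.-negligible (~` \bigcup_(Q in E n) Q) ;
  dc_nested : forall k l P Q, (k <= l)%N -> E l P -> E k Q ->
    P `<=` Q \/ P `&` Q = set0 ;
  dc_parent : forall k l Q, (l < k)%N -> E k Q ->
    exists! P, E l P /\ Q `<=` P ;
  dc_diam : forall k Q, E k Q -> (qdiam d Q <= (C1 * delta ^+ k)%:E)%E ;
  dc_ball : forall k Q, E k Q ->
    exists z, qball d z (a0 * delta ^+ k) `<=` Q ;
  dc_boundary : forall k Q t, E k Q -> 0 <= t ->
    (mu [set x | Q x /\ sdist d [set x] (~` Q) <= (t * delta ^+ k)%:E]
       <= (C2 * t `^ eta)%:E * mu Q)%E ;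
  dc_top : exists X0, E 0%N = [set X0]
}.

Definition children (X : Type) (E : nat -> set (set X)) (n : nat) (Q : set X) :
  set (set X) := [set P | E n.+1 P /\ P `<=` Q].

(* G_1(Q|E) = {P_0, ..., P_N} has N + 1 elements. *)
Definition nchild (X : Type) (E : nat -> set (set X)) (n : nat) (Q : set X) :
  nat := (#|` fset_set (children E n Q)|).-1.

Definition sigma_measurable_fun (R : realType) (X : Type) (G : set (set X))
    (g : X -> R) : Prop :=
  forall B : set R, measurable B -> <<s G >> (g @^-1` B).

Definition is_condexp (R : realType) (disp : measure_display)
    (X : measurableType disp) (mu : {measure set X -> \bar R})
    (G : set (set X)) (f g : X -> R) : Prop :=
  [/\ sigma_measurable_fun G g,
      mu.-integrable setT (EFin \o g)
    & forall A, <<s G >> A -> \int[mu]_(x in A) g x = \int[mu]_(x in A) f x].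

(* A version of the conditional expectation E(f | <<s G >>), which exists and is
   unique mu-a.e. for integrable f. *)
Definition condexp (R : realType) (disp : measure_display)
    (X : measurableType disp) (mu : {measure set X -> \bar R})
    (G : set (set X)) (f : X -> R) : X -> R :=
  xget (cst 0) [set g | is_condexp mu G f g].

Definition cubes_upto (X : Type) (E : nat -> set (set X)) (n : nat) :
  set (set X) := \bigcup_(k in [set k | (k <= n)%N]) E k.

Definition mart_diff (R : realType) (disp : measure_display)
    (X : measurableType disp) (mu : {measure set X -> \bar R})
    (E : nat -> set (set X)) (f : X -> R) (n : nat) (x : X) : R :=
  condexp mu (cubes_upto E n) f x
  - (if n is n'.+1 then condexp mu (cubes_upto E n') f x else 0).

Definition mart_H1_norm (R : realType) (disp : measure_display)
    (X : measurableType disp) (mu : {measure set X -> \bar R})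
    (E : nat -> set (set X)) (f : X -> R) : \bar R :=
  (\int[mu]_x sqrte (\sum_(0 <= n <oo) (`|mart_diff mu E f n x| ^+ 2)%:E))%E.

(* The second condition: f agrees a.e. with a function measurable for the
   sigma-algebra generated by all the Sigma_n. *)
Definition mart_H1 (R : realType) (disp : measure_display)
    (X : measurableType disp) (mu : {measure set X -> \bar R})
    (E : nat -> set (set X)) : set (X -> R) :=
  [set f | [/\ mu.-integrable setT (EFin \o f),
               exists g, sigma_measurable_fun (\bigcup_n E n) g /\
                         {ae mu, forall x, f x = g x}
             & (mart_H1_norm mu E f < +oo)%E]].

(* The functions h_{Q,i}: [h n Q i] for Q a cube of level n, 1 <= i <= N(Q). *)

Definition norm2 (R : realType) (disp : measure_display)
    (X : measurableType disp) (mu : {measure set X -> \bar R}) (f : X -> R) : R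
  := fine ('N[mu]_2%:E[EFin \o f])%E.

Definition haar_system (R : realType) (disp : measure_display)
    (X : measurableType disp) (mu : {measure set X -> \bar R}) (C : R)
    (E : nat -> set (set X)) (h : nat -> set X -> nat -> X -> R) : Prop :=
  forall n Q, E n Q ->
    (forall i, (1 <= i <= nchild E n Q)%N ->
      [/\ measurable_fun setT (h n Q i),
          forall x, ~ Q x -> h n Q i x = 0,
          forall P x y, children E n Q P -> P x -> P y ->
            h n Q i x = h n Q i y,
          exists u v : R, forall x,
            [\/ h n Q i x = 0, h n Q i x = u | h n Q i x = v]
        & \int[mu]_x h n Q i x = 0]) /\
    (forall alpha : nat -> R,
      let N := nchild E n Q in
      let s := Num.sqrt (\sum_(1 <= i < N.+1) alpha i ^+ 2) in
      let f := fun x => \sum_(1 <= i < N.+1) alpha i * h n Q i x in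
      C^-1 * s <= norm2 mu f /\ norm2 mu f <= C * s).

(* Smoothing. The partition of unity of level n is indexed by nat, padded with
   zero functions when it is finite; M bounds the overlap, so all the sums over
   k below are pointwise finite. Since d is continuous in each variable, the
   closed support has the same diameter as the set where psi does not vanish. *)

Definition partitions_of_unity (R : realType) (disp : measure_display)
    (X : measurableType disp) (d : X -> X -> R) (beta tau delta : R)
    (M : nat) (psi : nat -> nat -> X -> R) : Prop :=
  forall n,
  [/\ forall k, measurable_fun setT (psi n k) /\ (forall x, 0 <= psi n k x),
      forall x, ([set k | psi n k x != 0%R] #<= `I_M)%card,
      forall x, \sum_(k \in [set: nat]) psi n k x = 1,
      forall k, (qdiam d [set x | psi n k x != 0%R]
                   <= (tau * delta ^+ n)%:E)%E
    & forall k, (lip_seminorm d beta (psi n k)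
                   <= ((tau * delta ^+ n) `^ (- beta))%:E)%E].

Definition smoothing_kernel (R : realType) (disp : measure_display)
    (X : measurableType disp) (mu : {measure set X -> \bar R})
    (psi : nat -> nat -> X -> R) (n : nat) (x y : X) : R :=
  \sum_(k \in [set: nat]) psi n k x * psi n k y / \int[mu]_z psi n k z.

Definition phi_tilde (R : realType) (disp : measure_display)
    (X : measurableType disp) (mu : {measure set X -> \bar R})
    (psi : nat -> nat -> X -> R) (h : nat -> set X -> nat -> X -> R)
    (n : nat) (Q : set X) (i : nat) (x : X) : R :=
  \int[mu]_y (smoothing_kernel mu psi n.+1 x y * h n Q i y).

Definition phi (R : realType) (disp : measure_display)
    (X : measurableType disp) (mu : {measure set X -> \bar R})
    (psi : nat -> nat -> X -> R) (h : nat -> set X -> nat -> X -> R)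
    (n : nat) (Q : set X) (i : nat) (x : X) : R :=
  phi_tilde mu psi h n Q i x / norm2 mu (phi_tilde mu psi h n Q i).

(* The family F: elements are pairs (level, cube); the extra element X is
   (0, setT), and all the other elements have a level >= s > 0. *)

Definition separated_splitting (R : realType) (disp : measure_display)
    (X : measurableType disp) (mu : {measure set X -> \bar R})
    (d : X -> X -> R) (K : R) (E : nat -> set (set X)) (l : nat)
    (P : nat -> 'I_l -> set (set X)) : Prop :=
  forall n,
  [/\ \bigcup_(j in [set: 'I_l]) P n j = E n,
      trivIset [set: 'I_l] (P n)
    & forall j Q Q', P n j Q -> P n j Q' -> Q <> Q' ->
        (K%:E * maxe (mu Q) (mu Q') <= sdist d Q Q')%E].

Definition familyF (X : Type) (E : nat -> set (set X)) (l : nat)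
    (P : nat -> 'I_l -> set (set X)) (m s : nat) (j : 'I_l) (i0 : nat) :
    set (nat * set X) :=
  [set p | p = (0%N, setT) \/
    exists k, [/\ p.1 = (m * k + s)%N, P p.1 j p.2
                & (i0 <= nchild E p.1 p.2)%N]].

Definition hF (R : realType) (X : Type) (h : nat -> set X -> nat -> X -> R)
    (i0 : nat) (p : nat * set X) : X -> R :=
  if p.1 == 0%N then cst 1 else h p.1 p.2 i0.

Definition phiF (R : realType) (disp : measure_display)
    (X : measurableType disp) (mu : {measure set X -> \bar R})
    (psi : nat -> nat -> X -> R) (h : nat -> set X -> nat -> X -> R)
    (i0 : nat) (p : nat * set X) : X -> R :=
  if p.1 == 0%N then cst 1 else phi mu psi h p.1 p.2 i0.

(* Matrices acting on l^2(F), for F a subset of the index type T *)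

(* The sum of an absolutely summable real family. *)
Definition usum (R : realType) (T : choiceType) (F : set T) (g : T -> R) : R :=
  fine (\esum_(p in F) (Num.max (g p) 0)%:E)
  - fine (\esum_(p in F) (Num.max (- g p) 0)%:E).

Definition ell2_sqnorm (R : realType) (T : choiceType) (F : set T)
    (c : T -> R) : \bar R := \esum_(p in F) (c p ^+ 2)%:E.

Definition mx_act (R : realType) (T : choiceType) (F : set T)
    (A : T -> T -> R) (c : T -> R) (p : T) : R :=
  usum F (fun q => A p q * c q).

Definition bounded_mx (R : realType) (T : choiceType) (F : set T)
    (A : T -> T -> R) : Prop :=
  exists B : R, forall c, (ell2_sqnorm F c < +oo)%E ->
    (forall p, F p -> summable F (fun q => (A p q * c q)%:E)) /\
    (ell2_sqnorm F (mx_act F A c) <= B%:E * ell2_sqnorm F c)%E.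

Definition positive_mx (R : realType) (T : choiceType) (F : set T)
    (A : T -> T -> R) : Prop :=
  (forall p q, F p -> F q -> A p q = A q p) /\
  forall c, (ell2_sqnorm F c < +oo)%E ->
    0 <= usum F (fun p => c p * mx_act F A c p).

(* A is the matrix of G^{-1/2}, the positive square root of the inverse of the
   operator G on l^2(F). *)
Definition is_inv_sqrt_mx (R : realType) (T : choiceType) (F : set T)
    (G A : T -> T -> R) : Prop :=
  [/\ bounded_mx F G, bounded_mx F A, positive_mx F A
    & forall c, (ell2_sqnorm F c < +oo)%E -> forall p, F p ->
        mx_act F G (mx_act F A (mx_act F A c)) p = c p /\
        mx_act F A (mx_act F A (mx_act F G c)) p = c p].

Definition gram (R : realType) (disp : measure_display)
    (X : measurableType disp) (mu : {measure set X -> \bar R})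
    (T : Type) (g : T -> X -> R) (p q : T) : R :=
  \int[mu]_x (g p x * g q x).

(* f = sum of the g_p, p in F, unconditionally in L^2(mu). *)
Definition is_L2_sum (R : realType) (disp : measure_display)
    (X : measurableType disp) (mu : {measure set X -> \bar R})
    (T : choiceType) (F : set T) (g : T -> X -> R) (f : X -> R) : Prop :=
  measurable_fun setT f /\
  forall e : R, 0 < e ->
  exists D0 : set T, [/\ finite_set D0, D0 `<=` F &
    forall D : set T, finite_set D -> D0 `<=` D -> D `<=` F ->
      ('N[mu]_2%:E[(fun x => (f x - \sum_(p \in D) g p x)%:E)] <= e%:E)%E].

Definition lin_span (R : realType) (X : Type) (T : choiceType) (F : set T)
    (g : T -> X -> R) : set (X -> R) :=
  [set f | exists D (c : T -> R), [/\ finite_set D, D `<=` F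
           & f = fun x => \sum_(p \in D) c p * g p x]].

Definition mart_H1_closure (R : realType) (disp : measure_display)
    (X : measurableType disp) (mu : {measure set X -> \bar R})
    (E : nat -> set (set X)) (V : set (X -> R)) : set (X -> R) :=
  [set f | mart_H1 mu E f /\ forall e : R, 0 < e ->
    exists g, V g /\ (mart_H1_norm mu E (f \- g)%R < e%:E)%E].

(* S is a bounded linear operator from (Z, nZ) to (Y, nY), two normed spaces of
   functions modulo mu-a.e. equality. *)
Definition bounded_linear_op (R : realType) (disp : measure_display)
    (X : measurableType disp) (mu : {measure set X -> \bar R})
    (Z : set (X -> R)) (nZ : (X -> R) -> \bar R)
    (Y : set (X -> R)) (nY : (X -> R) -> \bar R)
    (S : (X -> R) -> X -> R) : Prop :=
  [/\ forall f, Z f -> Y (S f),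
      forall (c : R) f g, Z f -> Z g ->
        {ae mu, forall x, S (fun y => c * f y + g y) x = c * S f x + S g x}
    & exists B : R, forall f, Z f -> (nY (S f) <= B%:E * nZ f)%E].

(* Main.v *)
(* Write v_Q = delta^(n/2) for a cube Q of level n, so that v_Q^2 is comparable to mu(Q) for the
   cubes of the family, and the atomic norm of phi_Q is at most a constant times v_Q. Since
   phi_Q is Hoelder continuous with mean zero, <phi_Q, phi_P> decays geometrically in the
   difference of the levels, and by separation an element of the family interacts with at most
   one element of each coarser level. Hence, apart from its entry at X, the Gram matrix is 1 + E
   with E satisfying Schur's test with weight v and a small constant, G^(-1/2) is a binomial
   series, and f_Q is a series of multiples of the phi_P that converges absolutely in the atomic
   norm.

   The functions h_Q are martingale differences, so the martingale norm of a finite sum sum c_Q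
   h_Q dominates the L^1 norm of sigma = (sum c_Q^2 h_Q^2)^(1/2). A stopping time on the sets
   where sigma > 2^k splits such a sum into pieces indexed by subcubes of a cube R, with sum
   c_Q^2 <= t^2 mu(R), in such a way that the corresponding sum of the t mu(R) is at most a
   constant times the L^1 norm of sigma. It remains to bound the atomic norm of sum c_Q f_Q, for
   one such piece, by a constant times t mu(R). Call neighbours of R the elements joined to R by
   a chain of finer elements with overlapping supports; they remain close to R. The coefficients
   of the sum with respect to the phi_P are dominated by a family living on the neighbours of R,
   which gives a function supported near R with small L^2 norm, to which the Calderon-Zygmund
   decomposition applies, plus a family that is summable against v, because neighbours of R have
   few interactions with the other elements. The operator is then extended by continuity. *)
Require Import Defs.
From HB Require Import structures.
From mathcomp Require Import all_boot all_order all_algebra finmap.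
From mathcomp Require Import all_classical all_reals all_analysis.
From mathcomp Require Import measurable_realfun ess_sup_inf lra zify.

Set Implicit Arguments.
Unset Strict Implicit.
Unset Printing Implicit Defensive.

Import Order.TTheory GRing.Theory Num.Theory.
Import numFieldNormedType.Exports.

Local Open Scope classical_set_scope.
Local Open Scope ring_scope.

(** * Absolutely summable families *)

(** Two norms of the coefficients are available and neither suffices alone. The sum of |b_p| v_p
    bounds the atomic norm of sum b_p phi_p without any localization, but for the given c_Q it is
    not bounded by the martingale norm. The l^2 norm is controlled on each piece, but gives an
    atomic bound only for functions supported near one cube, whereas f_Q spreads over X because
    G^(-1/2) does. Hence the part of the coefficients that stays near R is measured in l^2 and the
    part that leaves is measured with weight v; the passage is paid by Cauchy-Schwarz, since the
    exit costs satisfy sum v_q w_q <= C v_R^2 over the neighbours q of R. A second obstacle is that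
    a cube reduced to one point can be much heavier than delta^n. The cubes of the family have two
    children, which excludes this; in the Calderon-Zygmund decomposition, which meets all cubes,
    such a point is itself a ball. The parameters act separately: tau small preserves the L^2 norm
    of h_Q under smoothing up to a factor, K large separates the elements of one level by [rsep],
    and m large makes E small and keeps chains of finer elements close to their origin. *)

Section esum_extra.
Context {R : realType}.
Implicit Types T : choiceType.

Lemma esum_le_seq T (F : set T) (a : T -> \bar R) (B : \bar R) :
  (forall s : seq T, uniq s -> (forall p, p \in s -> F p) ->
     (\sum_(p <- s) a p <= B)%E) ->
  (\esum_(p in F) a p <= B)%E.
Proof.
move=> h; apply: ge_ereal_sup => _ [A [finA AF] <-] /=.
rewrite fsbig_finite//; apply: h => [|p]; first exact: fset_uniq.
by rewrite in_fset_set// inE => /AF.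
Qed.

Lemma sum_le_esum T (F : set T) (a : T -> \bar R) (s : seq T) :
  uniq s -> (forall p, p \in s -> F p) ->
  (\sum_(p <- s) a p <= \esum_(p in F) a p)%E.
Proof.
move=> us sF; apply: ereal_sup_ubound; exists [set` s].
  by split=> //; exact: finite_seq.
by rewrite -fsbig_seq.
Qed.

Lemma esumZ T (F : set T) (c : R) (a : T -> \bar R) :
  0 <= c -> (forall p, F p -> 0 <= a p)%E ->
  (\esum_(p in F) (c%:E * a p) = c%:E * \esum_(p in F) a p)%E.
Proof.
move=> c0 a0; have [->|cn0] := eqVneq c 0.
  by rewrite mul0e esum1// => p _; rewrite mul0e.
have cp : 0 < c by rewrite lt_def cn0.
have Z s : (forall p, p \in s -> F p) ->
    (\sum_(p <- s) (c%:E * a p) = c%:E * \sum_(p <- s) a p)%E.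
  move=> sF; rewrite big_seq [in RHS]big_seq ge0_sume_distrr// => p /sF; exact: a0.
apply/eqP; rewrite eq_le; apply/andP; split.
  apply: esum_le_seq => s us sF; rewrite Z//.
  by rewrite lee_pmul2l//; exact: sum_le_esum.
rewrite -lee_pdivlMl//.
apply: esum_le_seq => s us sF; rewrite lee_pdivlMl// -Z//.
exact: sum_le_esum.
Qed.

Lemma esum_swap T1 T2 (F1 : set T1) (F2 : set T2) (a : T1 -> T2 -> \bar R) :
  (forall p q, F1 p -> F2 q -> 0 <= a p q)%E ->
  (\esum_(p in F1) \esum_(q in F2) a p q = \esum_(q in F2) \esum_(p in F1) a p q)%E.
Proof.
move=> a0; rewrite (esum_esum (J := fun=> F2))//.
rewrite (esum_esum (J := fun=> F1))//; last by move=> *; exact: a0.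
rewrite (reindex_esum (F2 `*`` fun=> F1) _ (fun x => (x.2, x.1)))//.
split=> //=.
- by move=> [q p] [].
- by move=> [q1 p1] [q2 p2] _ _ [-> ->].
- by move=> [p q] [/= ? ?]; exists (q, p).
Qed.

Lemma esum_ge_term T (F : set T) (a : T -> \bar R) p :
  F p -> (a p <= \esum_(q in F) a q)%E.
Proof.
move=> Fp; have := @sum_le_esum T F a [:: p] isT; rewrite big_seq1; apply.
by move=> q; rewrite inE => /eqP ->.
Qed.

Lemma ge0_esum_fin_num T (F : set T) (a : T -> \bar R) :
  (forall q, F q -> 0 <= a q)%E -> (\esum_(q in F) a q < +oo)%E ->
  (\esum_(q in F) a q)%E \is a fin_num.
Proof. by move=> a0 aoo; rewrite ge0_fin_numE// esum_ge0. Qed.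

Lemma esum_delta T (F : set T) (a : T -> \bar R) p : F p -> (0 <= a p)%E ->
  (\esum_(q in F) (if q == p then a q else 0) = a p)%E.
Proof.
move=> Fp ap; rewrite (esumID [set p]); last by move=> q _; case: eqP => // ->.
rewrite [X in (_ + X)%E]esum1 ?adde0; last first.
  by move=> q [_ /= /eqP/negbTE ->].
have -> : F `&` [set p] = [set p] by apply/setIidPr => q /= ->.
by rewrite esum_set1 ?eqxx.
Qed.

Definition asum T (F : set T) (g : T -> R) : \bar R :=
  \esum_(p in F) (`|g p|)%:E.

Lemma asum_ge0 T (F : set T) (g : T -> R) : (0 <= asum F g)%E.
Proof. exact: esum_ge0. Qed.

Lemma le_asum T (F : set T) (g h : T -> R) :
  (forall p, F p -> `|g p| <= `|h p|) -> (asum F g <= asum F h)%E.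
Proof. by move=> gh; apply: le_esum => p Fp; rewrite lee_fin gh. Qed.

Lemma asumD T (F : set T) (g h : T -> R) :
  (asum F (fun p => g p + h p)%R <= asum F g + asum F h)%E.
Proof.
by rewrite -esumD//; apply: le_esum => p _; rewrite -EFinD lee_fin ler_normD.
Qed.

Lemma asumZ T (F : set T) (c : R) (g : T -> R) :
  (asum F (fun p => c * g p)%R = `|c|%:E * asum F g)%E.
Proof.
by rewrite -esumZ//; apply: eq_esum => p _; rewrite normrM EFinM.
Qed.

(** The definition of [usum] splits [g] by sign. Any other splitting into two summable nonnegative
    families gives the same value; this freedom yields additivity and the interchange of sums. *)
Lemma usum_sub T (F : set T) (g a b : T -> R) :
  (forall p, F p -> g p = a p - b p) ->
  (forall p, F p -> 0 <= a p) -> (forall p, F p -> 0 <= b p) ->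
  (\esum_(p in F) (a p)%:E < +oo)%E -> (\esum_(p in F) (b p)%:E < +oo)%E ->
  usum F g = fine (\esum_(p in F) (a p)%:E) - fine (\esum_(p in F) (b p)%:E).
Proof.
move=> gE a0 b0 aoo boo.
have sa : summable F (EFin \o a).
  rewrite /summable; apply: le_lt_trans aoo.
  by apply: le_esum => p Fp /=; rewrite lee_fin ger0_norm// a0.
have sb : summable F (EFin \o b).
  rewrite /summable; apply: le_lt_trans boo.
  by apply: le_esum => p Fp /=; rewrite lee_fin ger0_norm// b0.
have := @esumB _ _ F (EFin \o a) (EFin \o b) sa sb.
have e1 : (\esum_(i in F) ((EFin \o a) \- (EFin \o b))^\+ i)%E =
          \esum_(p in F) (Num.max (g p) 0)%:E.
  apply: eq_esum => p Fp; by rewrite funeposE /= gE// EFin_max EFinB.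
have e2 : (\esum_(i in F) ((EFin \o a) \- (EFin \o b))^\- i)%E =
          \esum_(p in F) (Num.max (- g p) 0)%:E.
  apply: eq_esum => p Fp; by rewrite funenegE /= gE// EFin_max EFinN EFinB.
rewrite e1 e2 => E.
have a0' p : F p -> (0 <= (a p)%:E)%E by move=> ?; rewrite lee_fin a0.
have b0' p : F p -> (0 <= (b p)%:E)%E by move=> ?; rewrite lee_fin b0.
have fin f : (forall p, F p -> 0 <= f p) -> (forall p, F p -> f p <= a p + b p) ->
   (\esum_(p in F) (f p)%:E)%E \is a fin_num.
  move=> f0 fab; apply: ge0_esum_fin_num; first by move=> ? ?; rewrite lee_fin f0.
  apply: (@le_lt_trans _ _ (\esum_(p in F) ((a p)%:E + (b p)%:E))%E).
    by apply: le_esum => p Fp; rewrite -EFinD lee_fin fab.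
  by rewrite esumD//; exact: lte_add_pinfty.
rewrite /usum.
have := E a0' b0'.
rewrite -[(\esum_(p in F) (Num.max (g p) 0)%:E)%E]fineK; last first.
  apply: fin => p Fp; first by rewrite le_max lexx orbT.
  by rewrite ge_max gE//; have := a0 _ Fp; have := b0 _ Fp; lra.
rewrite -[(\esum_(p in F) (Num.max (- g p) 0)%:E)%E]fineK; last first.
  apply: fin => p Fp; first by rewrite le_max lexx orbT.
  by rewrite ge_max gE//; have := a0 _ Fp; have := b0 _ Fp; lra.
rewrite -[X in _ = (X - _)%E -> _]fineK; last first.
  by apply: fin => // p Fp; have := b0 _ Fp; lra.
rewrite -[X in _ = (_ - X)%E -> _]fineK; last first.
  by apply: fin => // p Fp; have := a0 _ Fp; lra.
by rewrite -!EFinB => -[].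
Qed.

Let pos (x : R) := Num.max x 0.

Let posE (x : R) : x = pos x - pos (- x).
Proof. by rewrite /pos; case: (leP x 0) => h; case: (leP (-x) 0) => h'; lra. Qed.

Let pos_ge0 (x : R) : 0 <= pos x.
Proof. by rewrite le_max lexx orbT. Qed.

Let pos_le (x : R) : pos x <= `|x|.
Proof. by rewrite ge_max ler_norm normr_ge0. Qed.

Let pos_leN (x : R) : pos (- x) <= `|x|.
Proof. by rewrite -normrN pos_le. Qed.

Let pos_add (x : R) : `|x| = pos x + pos (- x).
Proof.
rewrite /pos; case: (leP x 0) => h; first by rewrite ler0_norm//; case: (leP (-x) 0) => h'; lra.
by rewrite gtr0_norm//; case: (leP (-x) 0) => h'; lra.
Qed.

Let asum_pos T (F : set T) (g : T -> R) : (asum F g < +oo)%E ->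
  (\esum_(p in F) (pos (g p))%:E < +oo)%E.
Proof. by apply: le_lt_trans; apply: le_esum => p _; rewrite lee_fin. Qed.

Let asum_neg T (F : set T) (g : T -> R) : (asum F g < +oo)%E ->
  (\esum_(p in F) (pos (- g p))%:E < +oo)%E.
Proof. by apply: le_lt_trans; apply: le_esum => p _; rewrite lee_fin. Qed.

Lemma eq_usum T (F : set T) (g h : T -> R) :
  (forall p, F p -> g p = h p) -> usum F g = usum F h.
Proof.
by move=> gh; rewrite /usum; congr (fine _ - fine _); apply: eq_esum => p Fp;
  rewrite gh.
Qed.

Lemma usumD T (F : set T) (g h : T -> R) :
  (asum F g < +oo)%E -> (asum F h < +oo)%E ->
  usum F (fun p => g p + h p) = usum F g + usum F h.
Proof.
move=> sg sh.
rewrite (@usum_sub _ F _ (fun p => pos (g p) + pos (h p))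
   (fun p => pos (- g p) + pos (- h p))).
- under eq_esum do rewrite EFinD.
  under [X in _ - fine X]eq_esum do rewrite EFinD.
  rewrite !esumD ?fineD//; try by move=> *; rewrite lee_fin.
  + by rewrite /usum -/(pos) /pos; lra.
  + by apply: ge0_esum_fin_num; [move=> *; rewrite lee_fin|exact: asum_neg].
  + by apply: ge0_esum_fin_num; [move=> *; rewrite lee_fin|exact: asum_neg].
  + by apply: ge0_esum_fin_num; [move=> *; rewrite lee_fin|exact: asum_pos].
  + by apply: ge0_esum_fin_num; [move=> *; rewrite lee_fin|exact: asum_pos].
- by move=> p _; rewrite {1}[g p]posE {1}[h p]posE; lra.
- by move=> p _; rewrite addr_ge0.
- by move=> p _; rewrite addr_ge0.
- under eq_esum do rewrite EFinD.
  by rewrite esumD; [exact: lte_add_pinfty (asum_pos sg) (asum_pos sh)|move=> *; rewrite lee_fin..].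
- under eq_esum do rewrite EFinD.
  by rewrite esumD; [exact: lte_add_pinfty (asum_neg sg) (asum_neg sh)|move=> *; rewrite lee_fin..].
Qed.

Lemma usumN T (F : set T) (g : T -> R) : usum F (fun p => - g p) = - usum F g.
Proof. by rewrite /usum opprB; congr (_ - fine _); apply: eq_esum => p _; rewrite opprK. Qed.

Lemma usumZ T (F : set T) (c : R) (g : T -> R) :
  usum F (fun p => c * g p) = c * usum F g.
Proof.
wlog c0 : c / 0 <= c.
  move=> h; have [/h//|c0] := leP 0 c.
  have := h (- c); rewrite oppr_ge0 => /(_ (ltW c0)).
  rewrite mulNr => /(congr1 (fun x => - x)); rewrite opprK => <-.
  by rewrite -usumN; apply: eq_usum => p _; rewrite mulNr opprK.
have E x : Num.max (c * x) 0 = c * Num.max x 0.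
  by rewrite maxr_pMr// mulr0.
rewrite /usum mulrBr.
under eq_esum do rewrite E EFinM.
under [X in _ - fine X]eq_esum do rewrite -mulrN E EFinM.
rewrite !esumZ//; try by move=> *; rewrite lee_fin le_max lexx orbT.
have [->|cn0] := eqVneq c 0; first by rewrite !mul0e !mul0r.
have muly : (c%:E * +oo = +oo :> \bar R)%E by rewrite gt0_muley// lte_fin lt_def cn0.
have f a : (0 <= a)%E -> fine (c%:E * a) = c * fine a.
  by case: a => [a||]//= _; rewrite muly /= mulr0.
by rewrite !f// esum_ge0// => *; rewrite lee_fin le_max lexx orbT.
Qed.

Lemma usum_ge0 T (F : set T) (g : T -> R) :
  (forall p, F p -> 0 <= g p) -> usum F g = fine (\esum_(p in F) (g p)%:E).
Proof.
move=> g0; rewrite /usum [X in _ - fine X]esum1 ?subr0.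
  by congr fine; apply: eq_esum => p Fp; rewrite max_l// g0.
by move=> p Fp; rewrite max_r// oppr_le0 g0.
Qed.

Lemma usum_norm T (F : set T) (g : T -> R) : (asum F g < +oo)%E ->
  (`|usum F g|%:E <= asum F g)%E.
Proof.
move=> sg; rewrite /usum.
have fp : (\esum_(p in F) (pos (g p))%:E)%E \is a fin_num.
  by apply: ge0_esum_fin_num (asum_pos sg) => *; rewrite lee_fin.
have fn : (\esum_(p in F) (pos (- g p))%:E)%E \is a fin_num.
  by apply: ge0_esum_fin_num (asum_neg sg) => *; rewrite lee_fin.
apply: (@le_trans _ _ (\esum_(p in F) (pos (g p))%:E + \esum_(p in F) (pos (- g p))%:E)%E).
  rewrite -[X in (_ <= X + _)%E]fineK// -[X in (_ <= _ + X)%E]fineK//.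
  rewrite -EFinD lee_fin ler_norml.
  have := @fine_ge0 _ (\esum_(p in F) (pos (g p))%:E)%E.
  have := @fine_ge0 _ (\esum_(p in F) (pos (- g p))%:E)%E.
  rewrite esum_ge0; last by move=> *; rewrite lee_fin.
  move=> /(_ isT) h1; rewrite esum_ge0; last by move=> *; rewrite lee_fin.
  move=> /(_ isT) h2.
  by rewrite -/(pos _); apply/andP; split; move: h1 h2; rewrite /pos; lra.
rewrite -esumD; [|by move=> *; rewrite lee_fin..].
by apply: le_esum => p _; rewrite -EFinD lee_fin -pos_add.
Qed.

Lemma usum_norm_le T (F : set T) (g : T -> R) (B : \bar R) :
  (asum F g <= B)%E -> (B < +oo)%E -> (`|usum F g|%:E <= B)%E.
Proof. by move=> gB Boo; exact: le_trans (usum_norm (le_lt_trans gB Boo)) gB. Qed.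

(** The splitting by sign is made entrywise instead of on the inner sums, so that a repeated sum
    becomes a difference of two double sums of nonnegative terms, to which Tonelli's theorem
    applies. *)
Lemma usum_usumE T T' (F : set T) (F' : set T') (h : T -> T' -> R) :
(\esum_(p in F) asum F' (h p) < +oo)%E ->
usum F (fun p => usum F' (h p)) =
fine (\esum_(p in F) \esum_(q in F') (Num.max (h p q) 0)%:E)%E -
fine (\esum_(p in F) \esum_(q in F') (Num.max (- h p q) 0)%:E)%E.
Proof.
move=> s.
have row p : F p -> (asum F' (h p) < +oo)%E.
  move=> Fp; apply: le_lt_trans s.
  exact: (esum_ge_term (fun p => asum F' (h p))).
have fp p : F p -> (\esum_(q in F') (pos (h p q))%:E)%E \is a fin_num.
  by move=> Fp; apply: ge0_esum_fin_num (asum_pos (row p Fp)) => *; rewrite lee_fin.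
have fn p : F p -> (\esum_(q in F') (pos (- h p q))%:E)%E \is a fin_num.
  by move=> Fp; apply: ge0_esum_fin_num (asum_neg (row p Fp)) => *; rewrite lee_fin.
rewrite (@usum_sub _ F _ (fun p => fine (\esum_(q in F') (pos (h p q))%:E)%E)
   (fun p => fine (\esum_(q in F') (pos (- h p q))%:E)%E)).
- congr (fine _ - fine _); apply: eq_esum => p Fp; rewrite fineK//; [exact: fp|exact: fn].
- by [].
- by move=> p Fp; rewrite fine_ge0// esum_ge0// => *; rewrite lee_fin.
- by move=> p Fp; rewrite fine_ge0// esum_ge0// => *; rewrite lee_fin.
- apply: le_lt_trans s; apply: le_esum => p Fp; rewrite fineK ?fp//.
  by apply: le_esum => q _; rewrite lee_fin.
- apply: le_lt_trans s; apply: le_esum => p Fp; rewrite fineK ?fn//.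
  by apply: le_esum => q _; rewrite lee_fin.
Qed.

Lemma usum_swap T1 T2 (F1 : set T1) (F2 : set T2) (g : T1 -> T2 -> R) :
  (\esum_(p in F1) asum F2 (g p) < +oo)%E ->
  usum F1 (fun p => usum F2 (g p)) = usum F2 (fun q => usum F1 (g ^~ q)).
Proof.
move=> s1.
have s2 : (\esum_(q in F2) asum F1 (g ^~ q) < +oo)%E.
  by rewrite /asum esum_swap.
rewrite usum_usumE// usum_usumE//; congr (fine _ - fine _); rewrite esum_swap//;
 by move=> *; rewrite lee_fin le_max lexx orbT.
Qed.

(** Enumerates a countable family as one sequence, with zeros at the codes that are not attained.
    Countably many atomic decompositions are merged into a single one in this way. *)
Lemma esum_pickle (T : countType) (a : T -> \bar R) : (forall p, 0 <= a p)%E ->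
  (\esum_(n in [set: nat]) (if @pickle_inv T n is Some p then a p else 0))%E =
  (\esum_(p in [set: T]) a p)%E.
Proof.
move=> a0; pose b n := (if @pickle_inv T n is Some p then a p else 0)%E.
transitivity (\esum_(n in (@choice.pickle T) @` [set: T]) b n)%E.
  rewrite [RHS]esum_mkcond; apply: eq_esum => n _; case: ifPn => // /negP nT.
  rewrite /b; case E : (@pickle_inv T n) => [p|//]; exfalso; apply: nT.
  by rewrite inE; exists p => //; have := @pickle_invK T n; rewrite /oapp E.
rewrite (esum_image [set: T] (@choice.pickle T) b); last by move=> p q _ _; exact: (pcan_inj pickleK_inv).
by apply: eq_esum => p _; rewrite /b pickleK_inv.
Qed.

Lemma usum_pickle (w : nat -> nat -> R) :
  (\esum_(i in [set: nat]) asum [set: nat] (w i) < +oo)%E ->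
  usum [set: nat] (fun n => if @pickle_inv (nat * nat)%type n is Some p then w p.1 p.2 else 0) =
  usum [set: nat] (fun i => usum [set: nat] (w i)).
Proof.
move=> sw; rewrite usum_usumE// /usum; congr (fine _ - fine _).
  rewrite (esum_esum (J := fun=> [set: nat])); last by move=> *; rewrite lee_fin le_max lexx orbT.
  have -> : [set: nat] `*`` (fun=> [set: nat]) = [set: nat * nat] by apply/seteqP; split.
  rewrite -[RHS](esum_pickle (T := (nat * nat)%type)); last by move=> p; rewrite lee_fin le_max lexx orbT.
  by apply: eq_esum => n _; case: pickle_inv => // ; rewrite maxxx.
rewrite (esum_esum (J := fun=> [set: nat])); last by move=> *; rewrite lee_fin le_max lexx orbT.
have -> : [set: nat] `*`` (fun=> [set: nat]) = [set: nat * nat] by apply/seteqP; split.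
rewrite -[RHS](esum_pickle (T := (nat * nat)%type)); last by move=> p; rewrite lee_fin le_max lexx orbT.
by apply: eq_esum => n _; case: pickle_inv => // ; rewrite oppr0 maxxx.
Qed.

Lemma asum_pickle (w : nat -> nat -> R) :
  asum [set: nat] (fun n => if @pickle_inv (nat * nat)%type n is Some p then w p.1 p.2 else 0) =
  (\esum_(i in [set: nat]) asum [set: nat] (w i))%E.
Proof.
rewrite (esum_esum (J := fun=> [set: nat])); last by move=> *; rewrite lee_fin.
have -> : [set: nat] `*`` (fun=> [set: nat]) = [set: nat * nat] by apply/seteqP; split.
rewrite -[RHS](esum_pickle (T := (nat * nat)%type)); last by move=> p; rewrite lee_fin.
by apply: eq_esum => n _; case: pickle_inv => // ; rewrite normr0.
Qed.

Lemma usum_sum T (F : set T) (I : Type) (s : seq I) (g : I -> T -> R) :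
  (forall i, asum F (g i) < +oo)%E ->
  usum F (fun p => \sum_(i <- s) g i p) = \sum_(i <- s) usum F (g i).
Proof.
move=> sg.
suff: (asum F (fun p => \sum_(i <- s) g i p)%R < +oo)%E /\
   usum F (fun p => \sum_(i <- s) g i p) = \sum_(i <- s) usum F (g i) by case.
elim: s => [|i s [IH1 IH2]].
  have -> : (fun p => \sum_(i <- [::]) g i p) = (fun p : T => 0 * (0:R)).
    by apply/funext => p; rewrite big_nil mulr0.
  by rewrite asumZ usumZ normr0 mul0e mul0r big_nil.
have -> : (fun p => \sum_(i <- i :: s) g i p) =
          (fun p => g i p + \sum_(i <- s) g i p).
  by apply/funext => p; rewrite big_cons.
rewrite usumD// IH2 big_cons; split=> //.
by apply: le_lt_trans (asumD _ _ _) _; exact: lte_add_pinfty.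
Qed.

Lemma usum_delta T (F : set T) (g : T -> R) p : F p ->
  usum F (fun q => if q == p then g q else 0) = g p.
Proof.
move=> Fp; rewrite /usum.
have E f : (forall x, 0 <= f x :> R) -> f 0 = 0 ->
   (\esum_(q in F) (f (if q == p then g q else 0))%:E)%E = (f (g p))%:E.
  move=> f0 f00; rewrite -(esum_delta (a := fun q => (f (g q))%:E) Fp) ?lee_fin//.
  by apply: eq_esum => q _; case: ifP => //; rewrite f00.
rewrite (E pos)//; last by rewrite /pos maxxx.
rewrite (E (fun x => pos (- x))) ?oppr0 ?/pos ?maxxx//=.
by move=> x; rewrite le_max lexx orbT.
Qed.

Lemma asum_delta T (F : set T) (g : T -> R) p : F p ->
  asum F (fun q => if q == p then g q else 0) = (`|g p|)%:E.
Proof.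
move=> Fp; rewrite -(esum_delta (a := fun q => (`|g q|)%:E) Fp) ?lee_fin//.
by apply: eq_esum => q _; case: ifP => //; rewrite normr0.
Qed.

(** Read off from the definition of the sum as a supremum over finite subsets. It reduces a series
    to a finite sum and a small remainder. *)
Lemma esum_tail_seq T (F : set T) (a : T -> \bar R) (e : R) : 0 < e ->
  (forall p, F p -> 0 <= a p)%E -> (\esum_(p in F) a p < +oo)%E ->
  exists s0 : seq T, [/\ uniq s0, forall p, p \in s0 -> F p &
    (\esum_(p in F `\` [set` s0]) a p < e%:E)%E].
Proof.
move=> e0 a0 aoo.
have fin := ge0_esum_fin_num a0 aoo.
have : (\esum_(p in F) a p - e%:E < \esum_(p in F) a p)%E.
  by rewrite lteBlDr// lteDl// lte_fin.
move=> /ereal_sup_gt[_ [A [finA AF] <-] hA].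
exists (fset_set A); split; first exact: fset_uniq.
  by move=> p; rewrite in_fset_set// inE => /AF.
have -> : [set` fset_set A] = A by rewrite fset_setK.
move: hA; rewrite [X in (X - _ < _)%E](esumID A)//.
have -> : F `&` A = A by apply/setIidPr.
rewrite esum_fset//; last by move=> p; rewrite inE => /AF; exact: a0.
have finS : (\sum_(p \in A) a p)%E \is a fin_num.
  rewrite ge0_fin_numE; last by rewrite fsume_ge0// => p /AF; exact: a0.
  apply: le_lt_trans aoo; rewrite fsbig_finite//; apply: sum_le_esum; first exact: fset_uniq.
  by move=> p; rewrite in_fset_set// inE => /AF.
have finT : (\esum_(p in F `\` A) a p)%E \is a fin_num.
  rewrite ge0_fin_numE; last by rewrite esum_ge0// => p [/a0].
  apply: le_lt_trans aoo; rewrite [leRHS](esumID A)//.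
  by rewrite leeDr// esum_ge0// => p [/a0].
have gen (x y : \bar R) : x \is a fin_num -> y \is a fin_num ->
    (x + y - e%:E < x)%E -> (y < e%:E)%E.
  by case: x => // x; case: y => // y _ _; rewrite -EFinD -?EFinB !lte_fin; lra.
exact: gen.
Qed.

End esum_extra.

(** * Series over the natural numbers and the binomial series of exponent -1/2 *)

Section nat_sums.
Context {R : realType}.

Lemma esum_nat_le (a : nat -> \bar R) (B : \bar R) :
  (forall k, 0 <= a k)%E -> (forall n, \sum_(0 <= k < n) a k <= B)%E ->
  (\esum_(k in [set: nat]) a k <= B)%E.
Proof.
move=> a0 h; rewrite -nneseries_esumT//.
by apply: lime_le; [exact: is_cvg_nneseries|apply: nearW => n; exact: h].
Qed.

Lemma sum_geo_le (x : R) n : 0 <= x -> x <= 2^-1 ->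
  \sum_(0 <= k < n) x ^+ k <= 2.
Proof.
move=> x0 x1.
suff: (1 - x) * \sum_(0 <= k < n) x ^+ k <= 1.
  have : 0 <= \sum_(0 <= k < n) x ^+ k by apply: sumr_ge0 => k _; exact: exprn_ge0.
  by move: (\sum_(_ <= _ < _) _) => S S0; nra.
suff -> : (1 - x) * \sum_(0 <= k < n) x ^+ k = 1 - x ^+ n.
  by rewrite lerBlDr lerDl exprn_ge0.
elim: n => [|n IH]; first by rewrite big_nil expr0 mulr0 subrr.
by rewrite big_nat_recr//= mulrDr IH exprS; lra.
Qed.

Lemma esum_geo_le (x : R) : 0 <= x -> x <= 2^-1 ->
  (\esum_(k in [set: nat]) (x ^+ k)%:E <= 2%:E)%E.
Proof.
move=> x0 x1; apply: esum_nat_le => [k|n]; first by rewrite lee_fin exprn_ge0.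
by rewrite sumEFin lee_fin sum_geo_le.
Qed.

Lemma usum_nat_fin n (g : nat -> R) :
  usum [set: nat] (fun k => if (k < n)%N then g k else 0) = \sum_(0 <= k < n) g k.
Proof.
transitivity (usum [set: nat] (fun k => \sum_(0 <= i < n) (if k == i then g k else 0))); last first.
  rewrite usum_sum; first by apply: eq_bigr => i _; exact: usum_delta.
  by move=> i; rewrite asum_delta// ltry.
apply: eq_usum => k _; case: ifP => kn.
  rewrite (bigD1_seq k) ?mem_index_iota ?iota_uniq//= eqxx big1 ?addr0// => i ik.
  by rewrite eq_sym (negbTE ik).
rewrite big_nat big1// => i /andP[_ i_n]; case: eqP => // ki.
by move: i_n; rewrite -ki kn.
Qed.

Lemma esum_shift i (a : nat -> \bar R) :
  (\esum_(k in [set: nat]) (if (i <= k)%N then a (k - i)%N else 0))%E =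
  (\esum_(k in [set: nat]) a k)%E.
Proof.
transitivity (\esum_(k in [set k | (i <= k)%N]) a (k - i)%N)%E.
  rewrite [RHS]esum_mkcond; apply: eq_esum => k _.
  by case: ifPn => h; [rewrite mem_set|rewrite memNset//; exact/negP].
rewrite (reindex_esum [set: nat] _ (addn i)); last first.
  split=> //=.
  - by move=> k _ /=; exact: leq_addr.
  - by move=> k l _ _ /addnI.
  - by move=> k /= ik; exists (k - i)%N => //; rewrite subnKC.
by apply: eq_esum => k _; rewrite addKn.
Qed.

Lemma usum_shift i (g : nat -> R) :
  usum [set: nat] (fun k => if (i <= k)%N then g (k - i)%N else 0) =
  usum [set: nat] g.
Proof.
rewrite /usum -[in RHS](esum_shift i (fun k => (Num.max (g k) 0)%:E)).
rewrite -[in RHS](esum_shift i (fun k => (Num.max (- g k) 0)%:E)).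
by congr (fine _ - fine _); apply: eq_esum => k _; case: ifP => // _;
  rewrite ?oppr0 maxxx.
Qed.

Lemma asum_shift i (g : nat -> R) :
  asum [set: nat] (fun k => if (i <= k)%N then g (k - i)%N else 0) =
  asum [set: nat] g.
Proof.
rewrite /asum -[RHS](esum_shift i); apply: eq_esum => k _.
by case: ifP => // _; rewrite normr0.
Qed.

Lemma asum_tail (h : nat -> R) : (asum [set: nat] h < +oo)%E ->
  (asum [set: nat] (fun k => h k.+1) < +oo)%E.
Proof.
apply: le_lt_trans; rewrite -(asum_shift 1); apply: le_asum => -[|k] _ /=.
  by rewrite normr0.
by rewrite subn1.
Qed.

Lemma usum_recl (h : nat -> R) : (asum [set: nat] h < +oo)%E ->
  usum [set: nat] h = h 0%N + usum [set: nat] (fun k => h k.+1).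
Proof.
move=> sh; rewrite -(usum_shift 1 (fun k => h k.+1)) -(usum_delta (F := [set: nat]) h (p := 0%N))//.
rewrite -usumD; first last.
- by rewrite (asum_shift 1 (fun k => h k.+1)); exact: asum_tail.
- by rewrite asum_delta// ltry.
by apply: eq_usum => -[|k] _ /=; rewrite ?addr0 ?add0r ?subn1.
Qed.

(** Telescoping. With [w k] the k-th iterate of E on x, it says that the alternating Neumann series
    inverts 1 + E. *)
Lemma usum_alt (w : nat -> R) : (asum [set: nat] w < +oo)%E ->
  usum [set: nat] (fun k => (-1) ^+ k * (w k + w k.+1)) = w 0%N.
Proof.
move=> sw.
have s1 : (asum [set: nat] (fun k => (-1) ^+ k * w k)%R < +oo)%E.
  apply: le_lt_trans sw; apply: le_asum => k _.
  by rewrite normrM normrX normrN normr1 expr1n mul1r.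
have := usum_recl s1; rewrite expr0 mul1r => /eqP; rewrite -subr_eq => /eqP <-.
rewrite -usumN -usumD//; last first.
  rewrite (_ : asum _ _ = asum [set: nat] (fun k => (-1) ^+ k.+1 * w k.+1)); first exact: asum_tail s1.
  by apply: eq_esum => k _; rewrite normrN.
by apply: eq_usum => k _; rewrite exprS; lra.
Qed.

(* The Taylor coefficients of [(1 + x)^(-1/2)]; their self-convolution, computed in [gam_conv],
   is that of [1 / (1 + x)]. *)
Fixpoint gam (k : nat) : R :=
  if k is k'.+1 then - ((2 * k'%:R + 1) / (2 * (k'%:R + 1))) * gam k' else 1.

(** This crude bound suffices, since the convergence of the series in E comes from the powers of
    E. *)
Lemma gam_le1 k : `|gam k| <= 1.
Proof.
elim: k => [|k IH] /=; first by rewrite normr1.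
rewrite normrM -[leRHS]mulr1 ler_pM// normrN ger0_norm ?divr_ge0//; try by have := ler0n R k; lra.
by rewrite ler_pdivrMr; have := ler0n R k; lra.
Qed.

Lemma gamS k : 2 * (k%:R + 1) * gam k.+1 = - (2 * k%:R + 1) * gam k.
Proof.
rewrite /= !mulNr mulrN; congr (- _); rewrite mulrA mulrCA divff ?mulr1//.
Qed.

(** The recurrence [gamS] is the differential equation 2 (1 + x) y' = - y for the generating
    function y. For S = y^2 it becomes (1 + x) S' = - S, that is (k + 1) S_(k+1) = - (k + 1) S_k.
    The auxiliary fact [sym] plays the part of the product rule: by symmetry of the convolution,
    weighting by i gives half of n S_n. *)
Lemma gam_conv k : \sum_(0 <= i < k.+1) gam i * gam (k - i) = (-1) ^+ k.
Proof.
pose S k := \sum_(0 <= i < k.+1) gam i * gam (k - i).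
have sym n : 2 * \sum_(0 <= i < n.+1) i%:R * (gam i * gam (n - i)) = n%:R * S n.
  transitivity (\sum_(0 <= i < n.+1) i%:R * (gam i * gam (n - i)) +
                \sum_(0 <= i < n.+1) (n - i)%:R * (gam (n - i) * gam i)).
    rewrite mulr2n mulrDl mul1r; congr (_ + _).
    rewrite big_nat_rev/= add0n; rewrite big_nat [RHS]big_nat.
    apply: eq_bigr => i /andP[_]; rewrite ltnS => i_n.
    by rewrite subSS subKn.
  rewrite -big_split/= /S mulr_sumr big_nat [RHS]big_nat.
  apply: eq_bigr => i /andP[_]; rewrite ltnS => i_n.
  by rewrite natrB//; lra.
elim: k => [|k IH]; first by rewrite big_nat1 subnn /= mulr1 expr0.
rewrite -[LHS]/(S k.+1) exprS -IH -/(S k).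
have k0 : k.+1%:R != 0 :> R by rewrite pnatr_eq0.
apply: (mulfI k0); rewrite -sym big_nat_recl// mul0r add0r mulr_sumr.
transitivity (\sum_(0 <= i < k.+1) - (2 * i%:R + 1) * (gam i * gam (k - i))).
  rewrite big_nat [RHS]big_nat; apply: eq_bigr => i /andP[_ ik].
  have := gamS i; rewrite natr1 => E; rewrite subSS.
  transitivity (2 * i.+1%:R * gam i.+1 * gam (k - i)); first lra.
  by rewrite E; lra.
have -> : k.+1%:R * (-1 * S k) = - (k%:R * S k + S k) by rewrite -natr1; lra.
rewrite -sym /S mulr_sumr -big_split -sumrN /=.
by apply: eq_bigr => i _; lra.
Qed.

(** A Cauchy product: the shift of the inner index makes k = i + j the common variable, the
    geometric bound on [z] permits the interchange of the sums, and [gam_conv] evaluates the inner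
    one. *)
Lemma usum_gam_gam (z : nat -> R) (e Z : R) : 0 <= e -> e <= 2^-1 ->
  (forall k, `|z k| <= Z * e ^+ k) ->
  usum [set: nat] (fun i => usum [set: nat] (fun j => gam i * (gam j * z (i + j)%N)))
  = usum [set: nat] (fun k => (-1) ^+ k * z k).
Proof.
move=> e0 e1 ze.
have Z0 : 0 <= Z by have := ze 0%N; rewrite expr0 mulr1; exact: le_trans.
pose g i k := if (i <= k)%N then gam i * (gam (k - i)%N * z k) else 0.
transitivity (usum [set: nat] (fun i => usum [set: nat] (g i))).
  apply: eq_usum => i _.
  rewrite -[LHS](usum_shift i); apply: eq_usum => k _; rewrite /g; case: ifP => // ik.
  by rewrite subnKC.
rewrite usum_swap; last first.
  apply: (@le_lt_trans _ _ (\esum_(i in [set: nat]) (Z * 2 * e ^+ i)%:E)%E).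
    apply: le_esum => i _.
    have -> : asum [set: nat] (g i) =
      asum [set: nat] (fun j => gam i * (gam j * z (i + j)%N)).
      rewrite -[RHS](asum_shift i); apply: eq_esum => k _; rewrite /g; case: ifP => // ik.
      by rewrite subnKC.
    apply: (@le_trans _ _ (\esum_(j in [set: nat]) ((Z * e ^+ i)%:E * (e ^+ j)%:E))%E).
      apply: le_esum => j _; rewrite -EFinM lee_fin !normrM.
      apply: (@le_trans _ _ (1 * (1 * (Z * e ^+ (i + j))))).
        by rewrite !ler_pM ?mulr_ge0 ?gam_le1.
      by rewrite !mul1r exprD mulrA.
    rewrite esumZ ?mulr_ge0 ?exprn_ge0//; last by move=> *; rewrite lee_fin exprn_ge0.
    rewrite (_ : Z * 2 * _ = Z * e ^+ i * 2); last lra.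
    by rewrite [leRHS]EFinM lee_wpmul2l ?lee_fin ?mulr_ge0 ?exprn_ge0// esum_geo_le.
  under eq_esum do rewrite EFinM.
  rewrite esumZ ?mulr_ge0//; last by move=> *; rewrite lee_fin exprn_ge0.
  apply: (@le_lt_trans _ _ ((Z * 2)%:E * 2%:E)%E); last by rewrite -EFinM ltry.
  by rewrite lee_wpmul2l ?lee_fin ?mulr_ge0// esum_geo_le.
apply: eq_usum => k _.
rewrite -gam_conv -(usum_nat_fin k.+1 (fun i => gam i * gam (k - i))) mulrC -usumZ.
apply: eq_usum => i _; rewrite /g ltnS; case: ifP => _; last by rewrite mulr0.
by lra.
Qed.

End nat_sums.

(** * Schur's test *)

Section kernels.
Context {R : realType} {T : choiceType} (F : set T) (v : T -> R).
Hypothesis v_gt0 : forall p, F p -> 0 < v p.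
Implicit Types (K L : T -> T -> \bar R) (c : R) (x y : T -> R).

Let v_ge0 p : F p -> 0 <= v p. Proof. by move/v_gt0/ltW. Qed.

(* Besides l^2 bounds, the weighted column sums give bounds for the norm [sum |b p| v p], which
   controls the atomic norm of [sum b p phi_p]. *)
Definition schur K c :=
  [/\ 0 <= c, forall p q, (0 <= K p q)%E,
      forall p, F p -> (\esum_(q in F) (K p q * (v q)%:E) <= (c * v p)%:E)%E &
      forall q, F q -> (\esum_(p in F) ((v p)%:E * K p q) <= (c * v q)%:E)%E].

Definition kmul K L p q : \bar R := (\esum_(r in F) (K p r * L r q))%E.

Definition kone (p q : T) : \bar R := if p == q then 1%E else 0%E.

Fixpoint kpow K n : T -> T -> \bar R :=
  if n is n'.+1 then kmul K (kpow K n') else kone.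

(* The entries of [(1 - K)^-1] for a nonnegative kernel; [kres1] omits the identity. *)
Definition kres K p q : \bar R := (\esum_(k in [set: nat]) kpow K k p q)%E.

Definition kres1 K p q : \bar R := (\esum_(k in [set: nat]) kpow K k.+1 p q)%E.

Lemma kone_ge0 p q : (0 <= kone p q)%E.
Proof. by rewrite /kone; case: ifP. Qed.

Lemma kmul_ge0 K L : (forall p q, (0 <= K p q)%E) -> (forall p q, (0 <= L p q)%E) ->
  forall p q, (0 <= kmul K L p q)%E.
Proof. by move=> K0 L0 p q; apply: esum_ge0 => r _; rewrite mule_ge0. Qed.

Lemma kpow_ge0 K n : (forall p q, (0 <= K p q)%E) ->
  forall p q, (0 <= kpow K n p q)%E.
Proof.
by move=> K0; elim: n => [|n IH] p q /=; [exact: kone_ge0|exact: kmul_ge0].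
Qed.

Lemma kres_ge0 K : (forall p q, (0 <= K p q)%E) ->
  forall p q, (0 <= kres K p q)%E.
Proof. by move=> K0 p q; apply: esum_ge0 => k _; exact: kpow_ge0. Qed.

Lemma esumZe (S : choiceType) (G : set S) (a : S -> \bar R) (b : \bar R) :
  b \is a fin_num -> (0 <= b)%E -> (forall p, G p -> 0 <= a p)%E ->
  (\esum_(p in G) (b * a p) = b * \esum_(p in G) a p)%E.
Proof. by case: b => // b _; rewrite lee_fin => b0 a0; rewrite esumZ. Qed.

Lemma schur_kone : schur kone 1.
Proof.
split=> //; first exact: kone_ge0.
- move=> p Fp; rewrite (eq_esum (b := fun q => if q == p then (v q)%:E else 0%E)); last first.
    by move=> q _; rewrite /kone eq_sym; case: ifP; rewrite ?mul1e ?mul0e.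
  by rewrite esum_delta ?mul1r// lee_fin v_ge0.
- move=> p Fp; rewrite (eq_esum (b := fun q => if q == p then (v q)%:E else 0%E)); last first.
    by move=> q _; rewrite /kone; case: ifP; rewrite ?mule1 ?mule0.
  by rewrite esum_delta ?mul1r// lee_fin v_ge0.
Qed.

Lemma schur_finr K c p q : schur K c -> F p -> F q -> K p q \is a fin_num.
Proof.
move=> [c0 K0 Kr _] Fp Fq.
have := le_trans (esum_ge_term (fun q => K p q * (v q)%:E)%E Fq) (Kr _ Fp).
have := K0 p q; case: (K p q) => //= _.
by rewrite gt0_mulye ?lte_fin ?v_gt0.
Qed.

Lemma schur_kmul K L c c' : schur K c -> schur L c' -> schur (kmul K L) (c * c').
Proof.
move=> sK sL; have [c0 K0 Kr Kc] := sK; have [c0' L0 Lr Lc] := sL.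
split; [exact: mulr_ge0|exact: kmul_ge0| |].
- move=> p Fp.
  apply: (@le_trans _ _ (\esum_(q in F) \esum_(r in F) (K p r * L r q * (v q)%:E))%E).
    apply: le_esum => q Fq; rewrite muleC /kmul -esumZ ?v_ge0//; last first.
      by move=> *; rewrite mule_ge0.
    by apply: le_esum => r Fr; rewrite muleC.
  rewrite esum_swap; last by move=> q r Fq Fr; rewrite !mule_ge0 ?lee_fin ?v_ge0.
  apply: (@le_trans _ _ (\esum_(r in F) (c'%:E * (K p r * (v r)%:E)))%E).
    apply: le_esum => r Fr.
    under eq_esum do rewrite -muleA.
    rewrite esumZe ?(schur_finr sK)//; last by move=> q Fq; rewrite mule_ge0 ?lee_fin ?v_ge0.
    by rewrite muleCA lee_wpmul2l// -EFinM Lr.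
  rewrite esumZ//; last by move=> r Fr; rewrite mule_ge0 ?lee_fin ?v_ge0.
  rewrite (mulrC c) -mulrA [leRHS]EFinM; apply: lee_wpmul2l; first by rewrite lee_fin.
  exact: Kr.
- move=> q Fq.
  apply: (@le_trans _ _ (\esum_(p in F) \esum_(r in F) ((v p)%:E * K p r * L r q))%E).
    apply: le_esum => p Fp; rewrite /kmul -esumZ ?v_ge0//; last first.
      by move=> *; rewrite mule_ge0.
    by apply: le_esum => r Fr; rewrite muleA.
  rewrite esum_swap; last by move=> p r Fp Fr; rewrite !mule_ge0 ?lee_fin ?v_ge0.
  apply: (@le_trans _ _ (\esum_(r in F) (c%:E * ((v r)%:E * L r q)))%E).
    apply: le_esum => r Fr.
    under eq_esum do rewrite muleC.
    rewrite esumZe ?(schur_finr sL)//; last by move=> p Fp; rewrite mule_ge0 ?lee_fin ?v_ge0.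
    by rewrite muleA [leRHS]muleC lee_wpmul2l// -EFinM Kc.
  rewrite esumZ//; last by move=> r Fr; rewrite mule_ge0 ?lee_fin ?v_ge0.
  rewrite -mulrA [leRHS]EFinM; apply: lee_wpmul2l; first by rewrite lee_fin.
  exact: Lc.
Qed.

Lemma schur_kpow K c n : schur K c -> schur (kpow K n) (c ^+ n).
Proof.
move=> sK; elim: n => [|n IH] /=; first exact: schur_kone.
by rewrite exprS; exact: schur_kmul.
Qed.

Lemma schur_esum (K : nat -> T -> T -> \bar R) (c : nat -> R) C :
  (forall k, schur (K k) (c k)) -> 0 <= C ->
  (\esum_(k in [set: nat]) (c k)%:E <= C%:E)%E ->
  schur (fun p q => \esum_(k in [set: nat]) K k p q)%E C.
Proof.
move=> sK C0 hC.
have K0 k p q : (0 <= K k p q)%E by have [_ + _ _] := sK k; exact.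
have c0 k : 0 <= c k by have [] := sK k.
split=> //; first by move=> p q; apply: esum_ge0 => k _.
- move=> p Fp.
  apply: (@le_trans _ _ (\esum_(q in F) \esum_(k in [set: nat]) ((v q)%:E * K k p q))%E).
    by apply: le_esum => q Fq; rewrite esumZ ?v_ge0// muleC.
  rewrite esum_swap; last by move=> q k Fq _; rewrite mule_ge0 ?lee_fin ?v_ge0.
  apply: (@le_trans _ _ (\esum_(k in [set: nat]) ((v p)%:E * (c k)%:E))%E).
    apply: le_esum => k _; rewrite -EFinM mulrC.
    have [_ _ h _] := sK k; rewrite (le_trans _ (h _ Fp))//.
    by apply: le_esum => q Fq; rewrite muleC.
  rewrite esumZ ?v_ge0//; last by move=> *; rewrite lee_fin.
  by rewrite mulrC EFinM lee_wpmul2l ?lee_fin ?v_ge0.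
- move=> q Fq.
  apply: (@le_trans _ _ (\esum_(p in F) \esum_(k in [set: nat]) ((v p)%:E * K k p q))%E).
    by apply: le_esum => p Fp; rewrite esumZ ?v_ge0// muleC.
  rewrite esum_swap; last by move=> p k Fp _; rewrite mule_ge0 ?lee_fin ?v_ge0.
  apply: (@le_trans _ _ (\esum_(k in [set: nat]) ((v q)%:E * (c k)%:E))%E).
    apply: le_esum => k _; rewrite -EFinM mulrC.
    by have [_ _ _ h] := sK k; rewrite (le_trans _ (h _ Fq)).
  rewrite esumZ ?v_ge0//; last by move=> *; rewrite lee_fin.
  by rewrite mulrC EFinM lee_wpmul2l ?lee_fin ?v_ge0.
Qed.

Lemma schur_kres K c : schur K c -> c <= 2^-1 -> schur (kres K) 2.
Proof.
move=> sK c1; apply: (schur_esum (fun k => schur_kpow k sK)) => //.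
by apply: esum_geo_le => //; have [] := sK.
Qed.

(** The constant is 1 instead of 2 because the identity is omitted. The positivity of (1 + E)^(-1/2)
    rests on this value. *)
Lemma schur_kres1 K c : schur K c -> c <= 2^-1 -> schur (kres1 K) 1.
Proof.
move=> sK c1; have c0 : 0 <= c by have [] := sK.
apply: (schur_esum (c := fun k => c ^+ k.+1) (fun k => schur_kpow k.+1 sK)) => //.
under eq_esum do rewrite exprS EFinM.
rewrite esumZ//; last by move=> *; rewrite lee_fin exprn_ge0.
apply: (@le_trans _ _ (c%:E * 2%:E)%E); first by rewrite lee_wpmul2l ?lee_fin ?esum_geo_le.
by rewrite -EFinM lee_fin; lra.
Qed.

(** Cauchy-Schwarz in additive form, with a free parameter [t]: no square roots of possibly infinite
    sums appear, and [t] is optimized only in [schur_ell2], where everything is known to be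
    finite. *)
Lemma schur_amgm K c x p (t : R) : schur K c -> F p -> 0 < t ->
  (2%:E * (\esum_(q in F) (K p q * `|x q|%:E)) <=
   (t * (c * v p))%:E + t^-1%:E * (\esum_(q in F) (K p q * (x q ^+ 2 / v q)%:E)))%E.
Proof.
move=> sK Fp t0; have t0' := ltW t0; have [c0 K0 Kr _] := sK.
have ti : 0 <= t^-1 by rewrite invr_ge0.
have x0 q : F q -> 0 <= x q ^+ 2 / v q by move=> Fq; rewrite divr_ge0 ?sqr_ge0 ?v_ge0.
rewrite -!esumZ//; first last.
- by move=> q Fq; rewrite mule_ge0 ?lee_fin.
- by move=> q Fq; rewrite mule_ge0 ?lee_fin ?x0.
apply: (@le_trans _ _ (\esum_(q in F) (t%:E * (K p q * (v q)%:E)) +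
   \esum_(q in F) (t^-1%:E * (K p q * (x q ^+ 2 / v q)%:E)))%E); last first.
  rewrite leeD2r// esumZ; first last.
  - by move=> q Fq; rewrite mule_ge0 ?lee_fin ?v_ge0.
  - by [].
  by rewrite EFinM; apply: lee_wpmul2l; [rewrite lee_fin ltW|exact: Kr].
rewrite -esumD; first last.
- by move=> q Fq; rewrite !mule_ge0 ?lee_fin ?x0.
- by move=> q Fq; rewrite !mule_ge0 ?lee_fin ?v_ge0.
apply: le_esum => q Fq.
have k0 : 0 <= fine (K p q) by rewrite fine_ge0.
rewrite -(fineK (schur_finr sK Fp Fq)) -!EFinM -EFinD lee_fin.
have vq := v_gt0 Fq; have tv : 0 < t * v q by rewrite mulr_gt0.
have h : 2 * `|x q| <= t * v q + t^-1 * (x q ^+ 2 / v q).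
  rewrite -(ler_pM2r tv) [leRHS]mulrDl.
  have -> : t^-1 * (x q ^+ 2 / v q) * (t * v q) = `|x q| ^+ 2.
    by rewrite real_normK ?num_real// mulrACA mulVf ?lt0r_neq0// mul1r divfK ?lt0r_neq0.
  by have := sqr_ge0 (t * v q - `|x q|); rewrite sqrrB; lra.
by have := ler_wpM2l k0 h; lra.
Qed.

Lemma schur_total K c x : schur K c ->
  (\esum_(p in F) ((v p)%:E * \esum_(q in F) (K p q * (x q ^+ 2 / v q)%:E)) <=
   c%:E * ell2_sqnorm F x)%E.
Proof.
move=> sK; have [c0 K0 Kr Kc] := sK.
have x0 q : F q -> 0 <= x q ^+ 2 / v q by move=> Fq; rewrite divr_ge0 ?sqr_ge0 ?v_ge0.
apply: (@le_trans _ _ (\esum_(p in F) \esum_(q in F) ((x q ^+ 2 / v q)%:E * ((v p)%:E * K p q)))%E).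
  apply: le_esum => p Fp; rewrite -esumZ ?v_ge0//; last first.
    by move=> q Fq; rewrite mule_ge0 ?lee_fin ?x0.
  by apply: le_esum => q Fq; rewrite muleA muleC.
rewrite esum_swap; last by move=> p q Fp Fq; rewrite !mule_ge0 ?lee_fin ?x0 ?v_ge0.
rewrite -esumZ//; last by move=> q Fq; rewrite lee_fin sqr_ge0.
apply: le_esum => q Fq; rewrite esumZ ?x0//; last by move=> p Fp; rewrite mule_ge0 ?lee_fin ?v_ge0.
apply: (@le_trans _ _ ((x q ^+ 2 / v q)%:E * (c * v q)%:E)%E).
  by rewrite lee_wpmul2l ?lee_fin ?x0// Kc.
by rewrite -!EFinM lee_fin mulrCA divfK// lt0r_neq0// v_gt0.
Qed.

Lemma schur_S_fin K c x p : schur K c -> F p -> (ell2_sqnorm F x < +oo)%E ->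
  (\esum_(q in F) (K p q * (x q ^+ 2 / v q)%:E) < +oo)%E.
Proof.
move=> sK Fp sx; have [c0 K0 Kr Kc] := sK.
have : (c%:E * ell2_sqnorm F x < +oo)%E.
  by rewrite lte_mul_pinfty ?lee_fin.
move=> /(le_lt_trans (schur_total x sK)) /(le_lt_trans (esum_ge_term _ Fp)).
have : (0 <= \esum_(q in F) (K p q * (x q ^+ 2 / v q)%:E))%E.
  by apply: esum_ge0 => q Fq; rewrite mule_ge0 ?lee_fin ?divr_ge0 ?sqr_ge0 ?v_ge0.
case: (\esum_(q in F) _)%E => //= [r _ _|_]; first exact: ltry.
by rewrite gt0_muley ?lte_fin ?v_gt0.
Qed.

Lemma schur_row_fin K c x p : schur K c -> F p -> (ell2_sqnorm F x < +oo)%E ->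
  (\esum_(q in F) (K p q * `|x q|%:E) < +oo)%E.
Proof.
move=> sK Fp sx; have [c0 K0 Kr Kc] := sK.
have := schur_amgm x sK Fp ltr01; have := schur_S_fin sK Fp sx.
have L0 : (0 <= \esum_(q in F) (K p q * `|x q|%:E))%E.
  by apply: esum_ge0 => q _; rewrite mule_ge0 ?lee_fin.
case: (\esum_(q in F) (K p q * `|x q|%:E))%E L0 => [r||]//; rewrite ?ltry//.
rewrite gt0_muley ?lte_fin// leye_eq invr1 mul1e => _ + /eqP.
by case: (\esum_(q in F) _)%E.
Qed.

Lemma schur_ell2 K c x y : schur K c -> (ell2_sqnorm F x < +oo)%E ->
  (forall p, F p -> `|y p|%:E <= \esum_(q in F) (K p q * `|x q|%:E))%E ->
  (ell2_sqnorm F y <= (c ^+ 2)%:E * ell2_sqnorm F x)%E.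
Proof.
move=> sK sx yx; have [c0 K0 Kr Kc] := sK.
apply: (@le_trans _ _ (\esum_(p in F) (c%:E * ((v p)%:E * \esum_(q in F) (K p q * (x q ^+ 2 / v q)%:E))))%E); last first.
  rewrite esumZ//; first by rewrite expr2 EFinM -muleA lee_wpmul2l ?lee_fin ?schur_total.
  move=> p Fp; rewrite mule_ge0 ?lee_fin ?v_ge0//.
  by apply: esum_ge0 => q Fq; rewrite mule_ge0 ?lee_fin ?divr_ge0 ?sqr_ge0 ?v_ge0.
apply: le_esum => p Fp.
have S0 : (0 <= \esum_(q in F) (K p q * (x q ^+ 2 / v q)%:E))%E.
  by apply: esum_ge0 => q Fq; rewrite mule_ge0 ?lee_fin ?divr_ge0 ?sqr_ge0 ?v_ge0.
have := schur_S_fin sK Fp sx.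
have := fun t => @schur_amgm K c x p t sK Fp.
move: S0; case: (\esum_(q in F) (K p q * (x q ^+ 2 / v q)%:E))%E => // s.
rewrite lee_fin => s0 h _.
have {}h t : 0 < t -> 2 * `|y p| <= t * (c * v p) + t^-1 * s.
  move=> t0; have : (2%:E * `|y p|%:E <= (t * (c * v p))%:E + (t^-1)%:E * s%:E)%E.
    by rewrite (le_trans _ (h _ t0))// lee_wpmul2l ?lee_fin// yx.
  by rewrite -!EFinM -EFinD lee_fin.
rewrite -!EFinM lee_fin mulrA -real_normK ?num_real//.
have A0 : 0 <= c * v p by rewrite mulr_ge0 ?v_ge0.
move: (c * v p) A0 h => A A0 h; move: (normr_ge0 (y p)).
rewrite le_eqVlt => /orP[/eqP <-|a0]; first by rewrite expr0n mulr_ge0.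
(* If A = 0, a large value of t contradicts |y p| > 0. *)
move: A0; rewrite le_eqVlt => /orP[/eqP A0|A0].
  have s1 : 0 < (s + 1) / `|y p| by rewrite divr_gt0//; lra.
  have := h _ s1; rewrite -A0 mulr0 add0r invf_div => h1.
  have : `|y p| / (s + 1) * s <= `|y p| by rewrite -mulrA ler_piMr// mulrC ler_pdivrMr; lra.
  by move=> ?; lra.
(* This t optimizes the bound and gives |y p|^2 <= A s. *)
have := h _ (divr_gt0 a0 A0); rewrite invf_div divfK ?lt0r_neq0// => h1.
have : `|y p| <= A / `|y p| * s by lra.
by rewrite mulrAC ler_pdivlMr// expr2.
Qed.

Lemma schur_bounded K c (A : T -> T -> R) : schur K c ->
  (forall p q, F p -> F q -> `|A p q|%:E <= K p q)%E -> bounded_mx F A.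
Proof.
move=> sK AK; have [c0 K0 Kr Kc] := sK; exists (c ^+ 2) => x sx.
have row p : F p -> (asum F (fun q => A p q * x q)%R < +oo)%E.
  move=> Fp; apply: le_lt_trans (schur_row_fin sK Fp sx).
  by apply: le_esum => q Fq; rewrite normrM EFinM lee_wpmul2r// AK.
split; first by move=> p /row; rewrite /summable /asum; under eq_esum do rewrite -abse_EFin.
apply: (schur_ell2 sK sx) => p Fp.
apply: le_trans (usum_norm (row _ Fp)) _.
by apply: le_esum => q Fq; rewrite normrM EFinM lee_wpmul2r// AK.
Qed.

Lemma schur_scale K c (d : R) : 0 <= d -> schur K c ->
  schur (fun p q => d%:E * K p q)%E (d * c).
Proof.
move=> d0 [c0 K0 Kr Kc]; split; first by rewrite mulr_ge0.
- by move=> p q; rewrite mule_ge0.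
- move=> p Fp; under eq_esum do rewrite -muleA.
  rewrite esumZ//; last by move=> q Fq; rewrite mule_ge0 ?lee_fin ?v_ge0.
  by rewrite -mulrA EFinM lee_wpmul2l ?lee_fin// Kr.
- move=> p Fp; under eq_esum do rewrite muleCA.
  rewrite esumZ//; last by move=> q Fq; rewrite mule_ge0 ?lee_fin ?v_ge0.
  by rewrite -mulrA EFinM lee_wpmul2l ?lee_fin// Kc.
Qed.

Lemma schur_add K L c (d : R) : schur K c -> schur L d ->
  schur (fun p q => K p q + L p q)%E (c + d).
Proof.
move=> [c0 K0 Kr Kc] [d0 L0 Lr Lc]; split; first by rewrite addr_ge0.
- by move=> p q; rewrite adde_ge0.
- move=> p Fp; under eq_esum do rewrite ge0_muleDl//.
  rewrite esumD; [|by move=> q Fq; rewrite mule_ge0 ?lee_fin ?v_ge0..].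
  by rewrite mulrDl EFinD; apply: leeD; [exact: Kr|exact: Lr].
- move=> p Fp; under eq_esum do rewrite ge0_muleDr//.
  rewrite esumD; [|by move=> q Fq; rewrite mule_ge0 ?lee_fin ?v_ge0..].
  by rewrite mulrDl EFinD; apply: leeD; [exact: Kc|exact: Lc].
Qed.

End kernels.

(** * The inverse square root of a matrix *)

Section inverse_sqrt.
Context {R : realType} {T : choiceType} (F : set T) (v : T -> R).
Hypothesis v_gt0 : forall p, F p -> 0 < v p.
Context (E : T -> T -> R).
Let aE p q : \bar R := `|E p q|%:E.
Context (c : R).
Hypothesis sE : schur F v aE c.
Hypothesis c_le : c <= 2^-1.
Hypothesis E_sym : forall p q, F p -> F q -> E p q = E q p.
Implicit Types (x y : T -> R).

Let c0 : 0 <= c. Proof. by have [] := sE. Qed.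
Let aE0 p q : (0 <= aE p q)%E. Proof. by rewrite lee_fin. Qed.
Let sP k := schur_kpow v_gt0 k sE.
Let sres := schur_kres v_gt0 sE c_le.

Fixpoint mpow k p q : R :=
  if k is k'.+1 then usum F (fun r => E p r * mpow k' r q) else (p == q)%:R.

(* [(1 + E)^(-1/2)] *)
Definition sqinv p q : R := usum [set: nat] (fun k => gam k * mpow k p q).

Let op x p := usum F (fun q => E p q * x q).
Let opk k x := iter k op x.

Lemma mpow_le k p q : F p -> F q -> (`|mpow k p q|%:E <= kpow F aE k p q)%E.
Proof.
elim: k p q => [|k IH] p q Fp Fq /=.
  by rewrite /kone; case: eqP => _; rewrite ?normr1 ?normr0.
have le : (asum F (fun r => E p r * mpow k r q)%R <= kpow F aE k.+1 p q)%E.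
  by apply: le_esum => r Fr; rewrite normrM EFinM lee_wpmul2l ?IH.
apply: usum_norm_le le _.
by rewrite -ge0_fin_numE ?(schur_finr v_gt0 (sP k.+1))// kpow_ge0.
Qed.

Let kres_fin p q : F p -> F q -> kres F aE p q \is a fin_num.
Proof. by move=> Fp Fq; rewrite (schur_finr v_gt0 sres). Qed.

Let sqinv_asum p q : F p -> F q ->
  (asum [set: nat] (fun k => gam k * mpow k p q)%R <= kres F aE p q)%E.
Proof.
move=> Fp Fq; apply: le_esum => k _; rewrite normrM.
apply: (@le_trans _ _ (`|mpow k p q|%:E)); first by rewrite lee_fin ler_piMl// gam_le1.
exact: mpow_le.
Qed.

Lemma sqinv_le p q : F p -> F q -> (`|sqinv p q|%:E <= kres F aE p q)%E.
Proof.
move=> Fp Fq; have le := sqinv_asum Fp Fq.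
apply: usum_norm_le le _.
by rewrite -ge0_fin_numE ?kres_fin// kres_ge0.
Qed.

Let ell2_fin_op x : (ell2_sqnorm F x < +oo)%E -> forall k,
  (ell2_sqnorm F (opk k x) <= ((c ^+ k) ^+ 2)%:E * ell2_sqnorm F x)%E /\
  (ell2_sqnorm F (opk k x) < +oo)%E.
Proof.
move=> sx.
have F0 y : (0 <= ell2_sqnorm F y)%E by apply: esum_ge0 => p _; rewrite lee_fin sqr_ge0.
suff h k : (ell2_sqnorm F (opk k x) <= ((c ^+ k) ^+ 2)%:E * ell2_sqnorm F x)%E.
  move=> k; split; first exact: h.
  by apply: le_lt_trans (h k) _; rewrite lte_mul_pinfty ?lee_fin ?sqr_ge0.
elim: k => [|k IH]; first by rewrite expr0 expr1n mul1e.
have fk : (ell2_sqnorm F (opk k x) < +oo)%E.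
  by apply: le_lt_trans IH _; rewrite lte_mul_pinfty ?lee_fin ?sqr_ge0.
have := @schur_ell2 _ _ F v v_gt0 aE c (opk k x) (opk k.+1 x) sE fk.
move=> h; apply: le_trans (h _) _.
  move=> p Fp /=.
  have le : (asum F (fun q => E p q * opk k x q)%R <= \esum_(q in F) (aE p q * `|opk k x q|%:E))%E.
    by apply: le_esum => q Fq; rewrite normrM EFinM.
  apply: usum_norm_le le _.
  exact: (schur_row_fin v_gt0 sE Fp fk).
have -> : (c ^+ k.+1) ^+ 2 = c ^+ 2 * (c ^+ k) ^+ 2 by rewrite (exprS c k) exprMn.
rewrite [X in (_ <= X * _)%E]EFinM -muleA; apply: lee_wpmul2l; first by rewrite lee_fin sqr_ge0.
exact: IH.
Qed.

Let asum_row K (c1 : R) x p (g : T -> R) : schur F v K c1 -> F p ->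
  (ell2_sqnorm F x < +oo)%E ->
  (forall q, F q -> `|g q|%:E <= K p q * `|x q|%:E)%E ->
  (asum F g < +oo)%E.
Proof.
move=> sK Fp sx gK; apply: le_lt_trans (schur_row_fin v_gt0 sK Fp sx).
exact: le_esum.
Qed.

Let asumE x p : F p -> (ell2_sqnorm F x < +oo)%E ->
  (asum F (fun q => E p q * x q)%R < +oo)%E.
Proof.
by move=> Fp sx; apply: (asum_row sE Fp sx) => q Fq; rewrite normrM EFinM.
Qed.

Let mpow_act k x p : (ell2_sqnorm F x < +oo)%E -> F p ->
  usum F (fun q => mpow k p q * x q) = opk k x p.
Proof.
move=> sx; elim: k p => [|k IH] p Fp /=.
  rewrite -[RHS](usum_delta x Fp); apply: eq_usum => q _.
  by rewrite eq_sym; case: eqP => _; rewrite ?mul1r ?mul0r.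
transitivity (usum F (fun q => usum F (fun r => E p r * (mpow k r q * x q)))).
  apply: eq_usum => q Fq; rewrite mulrC -usumZ; apply: eq_usum => r _; lra.
rewrite usum_swap; last first.
  apply: le_lt_trans (schur_row_fin v_gt0 (sP k.+1) Fp sx).
  apply: le_esum => q Fq /=; rewrite muleC -esumZ//; last first.
    by move=> r _; rewrite mule_ge0 ?kpow_ge0.
  apply: le_esum => r Fr; rewrite !normrM mulrA mulrC EFinM lee_wpmul2l//.
  by rewrite EFinM lee_wpmul2l// mpow_le.
by apply: eq_usum => r Fr; rewrite usumZ IH.
Qed.

Let U x p := usum [set: nat] (fun k => gam k * opk k x p).

Let opk_abs k x p : (ell2_sqnorm F x < +oo)%E -> F p ->
  (`|opk k x p|%:E <= \esum_(q in F) (kpow F aE k p q * `|x q|%:E))%E.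
Proof.
move=> sx Fp; rewrite -mpow_act//.
have le : (asum F (fun q => mpow k p q * x q)%R <=
    \esum_(q in F) (kpow F aE k p q * `|x q|%:E))%E.
  by apply: le_esum => q Fq; rewrite normrM EFinM lee_wpmul2r// mpow_le.
apply: usum_norm_le le _.
exact: (schur_row_fin v_gt0 (sP k) Fp sx).
Qed.

Let opk_abs_sum x p : (ell2_sqnorm F x < +oo)%E -> F p ->
  (asum [set: nat] (fun k => opk k x p) <=
   \esum_(q in F) (kres F aE p q * `|x q|%:E))%E.
Proof.
move=> sx Fp.
apply: (@le_trans _ _ (\esum_(k in [set: nat]) \esum_(q in F) (`|x q|%:E * kpow F aE k p q))%E).
  apply: le_esum => k _; apply: le_trans (opk_abs _ sx Fp) _.
  by apply: le_esum => q Fq; rewrite muleC.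
rewrite esum_swap; last by move=> k q _ _; rewrite mule_ge0 ?kpow_ge0.
apply: le_esum => q Fq; rewrite muleC /kres esumZ// => k _; exact: kpow_ge0.
Qed.

Let sqinv_act x p : (ell2_sqnorm F x < +oo)%E -> F p ->
  usum F (fun q => sqinv p q * x q) = U x p.
Proof.
move=> sx Fp.
transitivity (usum F (fun q => usum [set: nat] (fun k => gam k * (mpow k p q * x q)))).
  apply: eq_usum => q Fq; rewrite mulrC -usumZ; apply: eq_usum => k _; lra.
rewrite usum_swap; last first.
  apply: le_lt_trans (schur_row_fin v_gt0 sres Fp sx).
  apply: le_esum => q Fq /=; rewrite muleC /kres -esumZ//; last by move=> k _; rewrite kpow_ge0.
  apply: le_esum => k _; rewrite mulrA normrM mulrC EFinM lee_wpmul2l//.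
  rewrite normrM (@le_trans _ _ (`|mpow k p q|%:E))//; last exact: mpow_le.
  by rewrite lee_fin ler_piMl// gam_le1.
by apply: eq_usum => k _; rewrite usumZ mpow_act.
Qed.

Let U_ell2 x : (ell2_sqnorm F x < +oo)%E -> (ell2_sqnorm F (U x) < +oo)%E.
Proof.
move=> sx.
apply: (@le_lt_trans _ _ ((2 ^+ 2)%:E * ell2_sqnorm F x)%E); last first.
  rewrite lte_mul_pinfty ?lee_fin//.
apply: (schur_ell2 v_gt0 sres sx) => p Fp.
rewrite -sqinv_act//.
have le : (asum F (fun q => sqinv p q * x q)%R <= \esum_(q in F) (kres F aE p q * `|x q|%:E))%E.
  by apply: le_esum => q Fq; rewrite normrM EFinM lee_wpmul2r// sqinv_le.
apply: usum_norm_le le _.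
exact: (schur_row_fin v_gt0 sres Fp sx).
Qed.

Let opD k l x : opk k (opk l x) = opk (k + l) x.
Proof. by rewrite /opk iterD. Qed.

(** Powers of E may be applied term by term, because all terms are dominated by [Y], the Neumann
    kernel applied to |y|, which is again in l^2. *)
Let opk_U i y p : (ell2_sqnorm F y < +oo)%E -> F p ->
  opk i (U y) p = usum [set: nat] (fun j => gam j * opk (i + j) y p).
Proof.
move=> sy Fp; rewrite -(mpow_act i (U_ell2 sy) Fp).
pose Y q := fine (\esum_(r in F) (kres F aE q r * `|y r|%:E))%E.
have Yfin q : F q -> (\esum_(r in F) (kres F aE q r * `|y r|%:E))%E \is a fin_num.
  move=> Fq; rewrite ge0_fin_numE ?(schur_row_fin v_gt0 sres Fq sy)//.
  by apply: esum_ge0 => r _; rewrite mule_ge0 ?kres_ge0.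
have Y0 q : 0 <= Y q.
  by apply: fine_ge0; apply: esum_ge0 => r _; rewrite mule_ge0 ?kres_ge0.
have sY : (ell2_sqnorm F Y < +oo)%E.
  apply: (@le_lt_trans _ _ ((2 ^+ 2)%:E * ell2_sqnorm F y)%E); last first.
    by rewrite lte_mul_pinfty ?lee_fin.
  by apply: (schur_ell2 v_gt0 sres sy) => q Fq; rewrite ger0_norm// fineK// Yfin.
transitivity (usum F (fun q => usum [set: nat] (fun j => gam j * (mpow i p q * opk j y q)))).
  apply: eq_usum => q Fq; rewrite /U -usumZ; apply: eq_usum => k _; lra.
rewrite usum_swap; last first.
  apply: le_lt_trans (schur_row_fin v_gt0 (sP i) Fp sY).
  apply: le_esum => q Fq /=; rewrite ger0_norm//.
  apply: (@le_trans _ _ (`|mpow i p q|%:E * asum [set: nat] (fun j => opk j y q))%E).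
    rewrite -esumZ//; apply: le_esum => j _; rewrite -EFinM lee_fin normrM normrM.
    by rewrite ler_piMl ?mulr_ge0// gam_le1.
  apply: lee_pmul => //; [exact: asum_ge0|exact: mpow_le|].
  by rewrite /Y fineK ?Yfin// opk_abs_sum.
by apply: eq_usum => j _; rewrite usumZ mpow_act ?opD//; have [] := ell2_fin_op sy j.
Qed.

Let opk_pt x p : (ell2_sqnorm F x < +oo)%E -> F p ->
  exists Z, forall k, `|opk k x p| <= Z * c ^+ k.
Proof.
move=> sx Fp; have F0 y : (0 <= ell2_sqnorm F y)%E by apply: esum_ge0 => q _; rewrite lee_fin sqr_ge0.
exists (Num.sqrt (fine (ell2_sqnorm F x))) => k.
have [le fk] := ell2_fin_op sx k.
have h : opk k x p ^+ 2 <= (c ^+ k) ^+ 2 * fine (ell2_sqnorm F x).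
  rewrite -lee_fin [leRHS]EFinM fineK ?ge0_fin_numE//; apply: le_trans le.
  exact: (@esum_ge_term _ _ F (fun p => (opk k x p ^+ 2)%:E) p Fp).
rewrite -sqrtr_sqr mulrC -[X in X * _](ger0_norm (exprn_ge0 k c0)) -sqrtr_sqr -sqrtrM ?sqr_ge0//.
by rewrite ler_wsqrtr.
Qed.

Let UU y p : (ell2_sqnorm F y < +oo)%E -> F p ->
  U (U y) p = usum [set: nat] (fun k => (-1) ^+ k * opk k y p).
Proof.
move=> sy Fp; have [Z hZ] := opk_pt sy Fp.
rewrite -(usum_gam_gam c0 c_le hZ); apply: eq_usum => i _.
by rewrite opk_U// usumZ.
Qed.

Let ell2D x y : (ell2_sqnorm F x < +oo)%E -> (ell2_sqnorm F y < +oo)%E ->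
  (ell2_sqnorm F (fun p => x p + y p)%R < +oo)%E.
Proof.
move=> sx sy.
apply: (@le_lt_trans _ _ (2%:E * ell2_sqnorm F x + 2%:E * ell2_sqnorm F y)%E); last first.
  by apply: lte_add_pinfty; rewrite lte_mul_pinfty ?lee_fin.
rewrite -!esumZ//; try by move=> *; rewrite lee_fin sqr_ge0.
rewrite -esumD; try by move=> *; rewrite -EFinM lee_fin mulr_ge0// sqr_ge0.
apply: le_esum => p _; rewrite -!EFinM -EFinD lee_fin.
by have := sqr_ge0 (x p - y p); rewrite sqrrB sqrrD; lra.
Qed.

Let opkD k x y p : (ell2_sqnorm F x < +oo)%E -> (ell2_sqnorm F y < +oo)%E -> F p ->
  opk k (fun p => x p + y p) p = opk k x p + opk k y p.
Proof.
move=> sx sy Fp.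
rewrite -(mpow_act k (ell2D sx sy) Fp) -(mpow_act k sx Fp) -(mpow_act k sy Fp).
have row z : (ell2_sqnorm F z < +oo)%E -> (asum F (fun q => mpow k p q * z q)%R < +oo)%E.
  move=> sz; apply: (asum_row (sP k) Fp sz) => q Fq.
  by rewrite normrM EFinM lee_wpmul2r// mpow_le.
by rewrite -(usumD (row _ sx) (row _ sy)); apply: eq_usum => q _; rewrite mulrDr.
Qed.

Let alt_fin x p : (ell2_sqnorm F x < +oo)%E -> F p ->
  (asum [set: nat] (fun k => opk k x p) < +oo)%E.
Proof.
move=> sx Fp; apply: le_lt_trans (opk_abs_sum sx Fp) _.
exact: (schur_row_fin v_gt0 sres Fp sx).
Qed.

Let UUG x p : (ell2_sqnorm F x < +oo)%E -> F p ->
  U (U (fun p => x p + op x p)) p = x p.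
Proof.
move=> sx Fp; have [_ s1] := ell2_fin_op sx 1.
rewrite (UU (ell2D sx s1) Fp) -[RHS](usum_alt (w := fun k => opk k x p) (alt_fin sx Fp)).
apply: eq_usum => k _; rewrite opkD// (opD k 1) addn1 //.
Qed.

Let eq_op x y : (forall q, F q -> x q = y q) -> op x = op y.
Proof. by move=> xy; apply/funext => p; apply: eq_usum => q Fq; rewrite xy. Qed.

(** The other order of composition follows from [UU] once E is commuted with the two factors [U],
    each of which is a series in powers of E. *)
Let GUU x p : (ell2_sqnorm F x < +oo)%E -> F p ->
  U (U x) p + op (U (U x)) p = x p.
Proof.
move=> sx Fp.
have -> : op (U (U x)) p = U (U (op x)) p.
  have e q : F q -> U (U x) q = usum [set: nat] (fun k => (-1) ^+ k * opk k x q) by exact: UU.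
  have [_ s1] := ell2_fin_op sx 1.
  rewrite -[LHS]/(opk 1 (U (U x)) p) (opk_U 1 (U_ell2 sx) Fp).
  rewrite (UU (y := opk 1 x))//.
  have [Z hZ] := opk_pt s1 Fp.
  rewrite -(usum_gam_gam c0 c_le hZ); apply: eq_usum => i _.
  rewrite opk_U// usumZ; congr (_ * _); apply: eq_usum => j _; congr (_ * _).
  by rewrite opD -addnA addnC.
have [_ s1] := ell2_fin_op sx 1.
have sgn y : (ell2_sqnorm F y < +oo)%E ->
    (asum [set: nat] (fun k => (-1) ^+ k * opk k y p)%R < +oo)%E.
  move=> sy; apply: le_lt_trans (alt_fin sy Fp); apply: le_asum => k _.
  by rewrite normrM normrX normrN normr1 expr1n mul1r.
rewrite UU// (UU (y := op x))// -usumD ?sgn//.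
rewrite -[RHS](usum_alt (w := fun k => opk k x p)) ?alt_fin//.
by apply: eq_usum => k _; rewrite -mulrDr (opD k 1) addn1.
Qed.

(** Here U x = x + D x, with D the series without its first term. By [schur_kres1] the l^2 norm of D
    x is at most that of x, so |<x, D x>| <= <x, x>. *)
Let sqinv_pos x : (ell2_sqnorm F x < +oo)%E ->
  0 <= usum F (fun p => x p * U x p).
Proof.
move=> sx.
pose D p := U x p - x p.
have sres1 := schur_kres1 v_gt0 sE c_le.
have DE p : F p -> D p = usum [set: nat] (fun k => gam k.+1 * opk k.+1 x p).
  move=> Fp; rewrite /D /U usum_recl /=; first by rewrite mul1r addrAC subrr add0r.
  apply: le_lt_trans (alt_fin sx Fp); apply: le_asum => k _.
  by rewrite normrM ler_piMl// gam_le1.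
have sD : (ell2_sqnorm F D <= ell2_sqnorm F x)%E.
  have := @schur_ell2 _ _ F v v_gt0 _ _ x D sres1 sx; rewrite expr1n mul1e; apply.
  move=> p Fp; rewrite DE//.
  have le : (asum [set: nat] (fun k => gam k.+1 * opk k.+1 x p)%R <=
      \esum_(q in F) (kres1 F aE p q * `|x q|%:E))%E.
    apply: (@le_trans _ _ (\esum_(k in [set: nat]) \esum_(q in F) (`|x q|%:E * kpow F aE k.+1 p q))%E).
      apply: le_esum => k _; apply: (@le_trans _ _ (`|opk k.+1 x p|%:E)).
        by rewrite lee_fin normrM ler_piMl// gam_le1.
      apply: le_trans (opk_abs _ sx Fp) _.
      by apply: le_esum => q Fq; rewrite muleC.
    rewrite esum_swap; last by move=> k q _ _; rewrite mule_ge0 ?kpow_ge0.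
    apply: le_esum => q Fq; rewrite muleC /kres1 esumZ// => k _; exact: kpow_ge0.
  apply: usum_norm_le le _.
  exact: (schur_row_fin v_gt0 sres1 Fp sx).
have xx : (asum F (fun p => x p ^+ 2)%R < +oo)%E.
  by apply: le_lt_trans sx; apply: le_esum => p _; rewrite lee_fin ger0_norm ?sqr_ge0.
have am p : `|x p * D p| <= 2^-1 * x p ^+ 2 + 2^-1 * D p ^+ 2.
  rewrite normrM -(real_normK (num_real (x p))) -(real_normK (num_real (D p))).
  by have := sqr_ge0 (`|x p| - `|D p|); rewrite sqrrB; lra.
have xDle : (asum F (fun p => x p * D p)%R <= ell2_sqnorm F x)%E.
  apply: (@le_trans _ _ (2^-1%:E * ell2_sqnorm F x + 2^-1%:E * ell2_sqnorm F D)%E).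
    rewrite -!esumZ//; try by move=> *; rewrite lee_fin sqr_ge0.
    rewrite -esumD; try by move=> *; rewrite -EFinM lee_fin mulr_ge0// sqr_ge0.
    by apply: le_esum => p _; rewrite -!EFinM -EFinD lee_fin am.
  apply: (@le_trans _ _ (2^-1%:E * ell2_sqnorm F x + 2^-1%:E * ell2_sqnorm F x)%E).
    by rewrite leeD2l// lee_wpmul2l.
  rewrite -muleDl// -?EFinD; last 1 first.
    by rewrite ge0_fin_numE//; apply: esum_ge0 => p _; rewrite lee_fin sqr_ge0.
  by rewrite (_ : 2^-1 + 2^-1 = 1 :> R) ?mul1e//; lra.
rewrite (eq_usum (h := fun p => x p ^+ 2 + x p * D p)); last by move=> p _; rewrite /D; lra.
rewrite usumD//; last exact: le_lt_trans xDle sx.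
have := usum_norm (le_lt_trans xDle sx).
move=> /le_trans /(_ xDle); rewrite (usum_ge0 (g := fun p => x p ^+ 2)); last by move=> *; rewrite sqr_ge0.
rewrite -[X in (_ <= X)%E -> _]fineK ?lee_fin; last first.
  by rewrite ge0_fin_numE//; apply: esum_ge0 => p _; rewrite lee_fin sqr_ge0.
by rewrite /ell2_sqnorm ler_norml => /andP[]; lra.
Qed.

(** The symmetry of the power k + 1, defined as E times E^k, needs its expression as E^k times E;
    hence the joint induction. *)
Let mpow_sym k p q : F p -> F q -> mpow k p q = mpow k q p /\
  mpow k.+1 p q = usum F (fun r => mpow k p r * E r q).
Proof.
elim: k p q => [|k IH] p q Fp Fq.
  rewrite /= eq_sym; split=> //.
  rewrite (eq_usum (h := fun r => if r == q then E p r else 0)); last first.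
    by move=> r _; case: eqP => _; rewrite ?mulr1 ?mulr0.
  rewrite usum_delta// (eq_usum (h := fun r => if r == p then E r q else 0)); last first.
    by move=> r _; rewrite eq_sym; case: eqP => _; rewrite ?mul1r ?mul0r.
  by rewrite usum_delta.
have S1 : mpow k.+1 p q = mpow k.+1 q p.
  rewrite (proj2 (IH p q Fp Fq)) /=; apply: eq_usum => r Fr.
  by rewrite (proj1 (IH p r Fp Fr)) mulrC E_sym.
split=> //.
rewrite -[LHS]/(usum F (fun r => E p r * mpow k.+1 r q)).
rewrite (eq_usum (h := fun r => usum F (fun u => E p r * (mpow k r u * E u q)))); last first.
  by move=> r Fr; rewrite (proj2 (IH r q Fr Fq)) usumZ.
rewrite usum_swap; last first.
  apply: (@le_lt_trans _ _ (kmul F (kpow F aE k.+1) aE p q)).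
    apply: (@le_trans _ _ (\esum_(r in F) \esum_(u in F) (aE p r * kpow F aE k r u * aE u q))%E).
      apply: le_esum => r Fr; apply: le_esum => u Fu; rewrite !normrM mulrA EFinM.
      by rewrite lee_wpmul2r// EFinM lee_wpmul2l// mpow_le.
    rewrite esum_swap; last by move=> r u _ _; rewrite !mule_ge0 ?kpow_ge0.
    apply: le_esum => u Fu; rewrite muleC -esumZ//; last by move=> *; rewrite mule_ge0 ?kpow_ge0.
    by apply: le_esum => r Fr; rewrite muleC.
  rewrite -ge0_fin_numE; last by apply: kmul_ge0 => // *; exact: kpow_ge0.
  exact: (schur_finr v_gt0 (schur_kmul v_gt0 (sP k.+1) sE)).
apply: eq_usum => u Fu; rewrite mulrC -usumZ.
by apply: eq_usum => r _; rewrite mulrA mulrC.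
Qed.

Lemma sqinv_sym p q : F p -> F q -> sqinv p q = sqinv q p.
Proof. by move=> Fp Fq; apply: eq_usum => k _; rewrite (proj1 (mpow_sym k Fp Fq)). Qed.

(* [G = Lam (1 + E) Lam] with [Lam] diagonal; since [E] only couples indices with the same
   [lam], [G^(-1/2) = Lam^-1 (1 + E)^(-1/2)]. It is needed because the constant function of the
   family is not normalized in L^2. *)
Context (lam : T -> R) (l0 l1 : R).
Hypothesis l0_gt0 : 0 < l0.
Hypothesis lam_bd : forall p, F p -> l0 <= lam p /\ lam p <= l1.
Hypothesis lam_comm : forall p q, F p -> F q -> E p q != 0 -> lam p = lam q.

(** E preserves the level sets of [lam], and so do its powers. *)
Lemma sqinv_lam p q : F p -> F q -> lam p != lam q -> sqinv p q = 0.
Proof.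
move=> Fp Fq pq; rewrite /sqinv (eq_usum (h := fun=> 0 * 0)) ?usumZ ?mul0r// => k _.
suff -> : mpow k p q = 0 by rewrite !mulr0.
elim: k p Fp pq => [|k IH] p Fp pq /=; first by case: (eqVneq p q) pq => // ->; rewrite eqxx.
rewrite (eq_usum (h := fun=> 0 * 0)) ?usumZ ?mul0r// => r Fr.
have [->|Epr] := eqVneq (E p r) 0; first by rewrite mul0r.
by rewrite IH ?mulr0// -(lam_comm Fp Fr Epr).
Qed.

Let lam_gt0 p : F p -> 0 < lam p.
Proof. by move=> /lam_bd[h _]; exact: lt_le_trans h. Qed.

Let U_scale (w : R -> R) x p : F p ->
  usum F (fun q => sqinv p q * (w (lam q) * x q)) =
  w (lam p) * usum F (fun q => sqinv p q * x q).
Proof.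
move=> Fp; rewrite -usumZ; apply: eq_usum => q Fq.
have [->|pq] := eqVneq (lam p) (lam q); first by lra.
by rewrite sqinv_lam// !mul0r mulr0.
Qed.

Context (G : T -> T -> R).
Hypothesis GE : forall p q, F p -> F q -> G p q = lam p ^+ 2 * ((p == q)%:R + E p q).

Definition inv_sqrt p q := (lam p)^-1 * sqinv p q.

Let l1_gt0 p : F p -> 0 < l1.
Proof. by move=> Fp; have [_] := lam_bd Fp; apply: lt_le_trans; exact: lam_gt0. Qed.

Let lamV_le p : F p -> `|(lam p)^-1| <= l0^-1.
Proof.
move=> Fp; have [h _] := lam_bd Fp.
by rewrite normfV gtr0_norm ?lam_gt0// lef_pV2 ?posrE ?lam_gt0.
Qed.

Let lam2_le p : F p -> `|lam p ^+ 2| <= l1 ^+ 2.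
Proof.
move=> Fp; have [_ h] := lam_bd Fp.
by rewrite ger0_norm ?sqr_ge0// ler_sqr ?nnegrE// (ltW (lam_gt0 Fp), ltW (l1_gt0 Fp)).
Qed.

Lemma inv_sqrt_le p q : F p -> F q ->
  (`|inv_sqrt p q|%:E <= l0^-1%:E * kres F aE p q)%E.
Proof.
move=> Fp Fq; rewrite normrM EFinM; apply: lee_pmul => //; last exact: sqinv_le.
by rewrite lee_fin; exact: lamV_le.
Qed.

Lemma is_inv_sqrt_mx_inv_sqrt : is_inv_sqrt_mx F G inv_sqrt.
Proof.
have l0V : 0 <= l0^-1 by rewrite invr_ge0 ltW.
have bG : bounded_mx F G.
  apply: (schur_bounded v_gt0 (schur_scale v_gt0 (sqr_ge0 l1) (schur_add v_gt0 (schur_kone v_gt0) sE))).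
  move=> p q Fp Fq; rewrite GE// normrM EFinM; apply: lee_pmul => //.
    by rewrite lee_fin lam2_le.
  rewrite /kone /aE; case: eqP => _; rewrite -?EFinD lee_fin ?add0r//.
  by rewrite (le_trans (ler_normD _ _))// normr1.
have bA : bounded_mx F inv_sqrt.
  apply: (schur_bounded v_gt0 (schur_scale v_gt0 l0V sres)) => p q Fp Fq.
  exact: inv_sqrt_le.
have actA x p : (ell2_sqnorm F x < +oo)%E -> F p ->
    mx_act F inv_sqrt x p = (lam p)^-1 * U x p.
  move=> sx Fp; rewrite -sqinv_act// -usumZ; apply: eq_usum => q _.
  by rewrite /inv_sqrt mulrA.
have eq_U y z p : (ell2_sqnorm F y < +oo)%E -> (ell2_sqnorm F z < +oo)%E ->
    F p -> (forall q, F q -> y q = z q) -> U y p = U z p.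
  move=> sy sz Fp yz; rewrite -!sqinv_act//; apply: eq_usum => q Fq.
  by rewrite yz.
have mxfin A y : bounded_mx F A -> (ell2_sqnorm F y < +oo)%E -> (ell2_sqnorm F (mx_act F A y) < +oo)%E.
  move=> [B hB] sy; have [_ le] := hB _ sy; apply: le_lt_trans le _.
  have : (0 <= ell2_sqnorm F y)%E by apply: esum_ge0 => p _; rewrite lee_fin sqr_ge0.
  move: sy; case: (ell2_sqnorm F y) => // r _ _.
  by rewrite -EFinM ltry.
have scale_fin (w : R -> R) (W : R) y : (forall p, F p -> `|w (lam p)| <= W) ->
    (ell2_sqnorm F y < +oo)%E -> (ell2_sqnorm F (fun p => w (lam p) * y p)%R < +oo)%E.
  move=> wW sy; apply: (@le_lt_trans _ _ ((W ^+ 2)%:E * ell2_sqnorm F y)%E); last first.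
    by rewrite lte_mul_pinfty ?lee_fin ?sqr_ge0.
  rewrite -esumZ ?sqr_ge0//; last by move=> *; rewrite lee_fin sqr_ge0.
  apply: le_esum => p Fp; rewrite -EFinM lee_fin exprMn ler_wpM2r ?sqr_ge0//.
  rewrite -real_normK ?num_real// ler_sqr ?nnegrE//; first exact: wW.
  exact: le_trans (wW _ Fp).
have actAA x p : (ell2_sqnorm F x < +oo)%E -> F p ->
    mx_act F inv_sqrt (mx_act F inv_sqrt x) p = (lam p)^-1 ^+ 2 * U (U x) p.
  move=> sx Fp; have sA := mxfin _ _ bA sx.
  have sV := scale_fin (fun z => z^-1) _ _ lamV_le (U_ell2 sx).
  rewrite (actA _ _ sA Fp) expr2 -mulrA; congr (_ * _).
  rewrite (eq_U _ _ _ sA sV Fp); last by move=> q Fq; exact: actA.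
  by rewrite -(sqinv_act sV Fp) (U_scale (fun z => z^-1) _ Fp) (sqinv_act (U_ell2 sx) Fp).
have actG x p : (ell2_sqnorm F x < +oo)%E -> F p ->
    mx_act F G x p = lam p ^+ 2 * (x p + op x p).
  move=> sx Fp; rewrite /mx_act (eq_usum (h := fun q => lam p ^+ 2 *
      ((if q == p then x q else 0) + E p q * x q))); last first.
    by move=> q Fq; rewrite GE// (eq_sym p q); case: eqP => _ /=; lra.
  rewrite usumZ usumD ?usum_delta//; last exact: asumE.
  by rewrite asum_delta// ltry.
split=> //.
- split=> [p q Fp Fq|x sx].
    rewrite /inv_sqrt (sqinv_sym Fp Fq).
    have [->//|pq] := eqVneq (lam p) (lam q).
    by rewrite (sqinv_lam Fq Fp) ?mulr0// eq_sym.
  (* Division by [lam] commutes with [U], so it can be shared evenly between the two arguments: with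
     w = lam^(-1/2) the quadratic form becomes that of [U] at w x. *)
  pose w p := (Num.sqrt (lam p))^-1.
  have w0 p : F p -> 0 <= w p by move=> Fp; rewrite invr_ge0 sqrtr_ge0.
  have ww p : F p -> w p * w p = (lam p)^-1.
    by move=> Fp; rewrite /w -invfM -expr2 sqr_sqrtr// ltW// lam_gt0.
  have sw : (ell2_sqnorm F (fun p => w p * x p)%R < +oo)%E.
    apply: (scale_fin (fun z => (Num.sqrt z)^-1) (Num.sqrt l0)^-1) => // p Fp.
    have [h _] := lam_bd Fp.
    by rewrite (ger0_norm (w0 _ Fp)) lef_pV2 ?posrE ?sqrtr_gt0 ?lam_gt0// ler_wsqrtr.
  rewrite (eq_usum (h := fun p => (w p * x p) * U (fun q => w q * x q) p)).
    exact: sqinv_pos.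
  move=> p Fp; rewrite actA// -(sqinv_act sw)//.
  rewrite (U_scale (fun z => (Num.sqrt z)^-1))// sqinv_act// -/(w p) -ww//; lra.
- move=> x sx p Fp; split.
    have sA := mxfin _ _ bA sx; have sAA := mxfin _ _ bA sA.
    rewrite (actG _ _ sAA Fp) (actAA _ _ sx Fp) (eq_op (y := fun q => (lam q)^-1 ^+ 2 * U (U x) q)); last first.
      by move=> q Fq; rewrite actAA.
    rewrite -[RHS](GUU sx Fp) mulrDr; congr (_ + _).
      by rewrite mulrA -exprMn divff ?expr1n ?mul1r// lt0r_neq0// lam_gt0.
    rewrite /op -usumZ; apply: eq_usum => q Fq.
    have [->|Epq] := eqVneq (E p q) 0; first by rewrite !mul0r mulr0.
    rewrite (lam_comm Fp Fq Epq) mulrCA; congr (_ * _).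
    rewrite mulrA -exprMn divff ?expr1n ?mul1r//.
    by rewrite lt0r_neq0// lam_gt0.
  have [_ s1] := ell2_fin_op sx 1.
  pose y q := x q + op x q.
  have sy : (ell2_sqnorm F y < +oo)%E by exact: (ell2D sx s1).
  have sUy := U_ell2 sy.
  have sL := scale_fin (fun z => z ^+ 2) _ _ lam2_le sy.
  have sLU := scale_fin (fun z => z ^+ 2) _ _ lam2_le sUy.
  have sG := mxfin _ _ bG sx.
  rewrite (actAA _ _ sG Fp).
  (* The factor lam^2 is moved out through one [U], then through the other, since [U] couples only
     indices with the same [lam]. *)
  have -> : U (U (mx_act F G x)) p = U (fun q => lam q ^+ 2 * U y q) p.
    apply: (eq_U _ _ _ (U_ell2 sG) sLU Fp) => q Fq.
    rewrite (eq_U _ _ _ sG sL Fq); last by move=> r Fr; exact: actG.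
    by rewrite -(sqinv_act sL Fq) (U_scale (fun z => z ^+ 2) y Fq) (sqinv_act sy Fq).
  rewrite -(sqinv_act sLU Fp) (U_scale (fun z => z ^+ 2) _ Fp) (sqinv_act sUy Fp).
  rewrite (UUG sx Fp) mulrA -exprMn mulVf ?expr1n ?mul1r//.
  by rewrite lt0r_neq0// lam_gt0.
Qed.

End inverse_sqrt.

(** * Series in L^1 *)

Section L1.
Context {R : realType} {disp : measure_display} {X : measurableType disp}.
Variable mu : {measure set X -> \bar R}.
Implicit Types (f g : X -> R).

Definition n1 f : \bar R := (\int[mu]_x `|f x|%:E)%E.

Lemma n1_ge0 f : (0 <= n1 f)%E.
Proof. by apply: integral_ge0 => x _; rewrite lee_fin. Qed.

Lemma measurable_norm_EFin f : measurable_fun setT f ->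
  measurable_fun setT (fun x => `|f x|%:E).
Proof. by move=> mf; apply/measurable_EFinP; exact: measurableT_comp. Qed.

Lemma n1D f g : measurable_fun setT f -> measurable_fun setT g ->
  (n1 (fun x => f x + g x)%R <= n1 f + n1 g)%E.
Proof.
move=> mf mg; rewrite /n1 -ge0_integralD//; try exact: measurable_norm_EFin.
apply: ge0_le_integral => //.
- by apply: measurable_norm_EFin; exact: measurable_funD.
- by apply: emeasurable_funD; exact: measurable_norm_EFin.
- by move=> x _; rewrite -EFinD lee_fin ler_normD.
Qed.

Lemma n1Z (c : R) f : measurable_fun setT f ->
  (n1 (fun x => c * f x)%R = `|c|%:E * n1 f)%E.
Proof.
move=> mf; rewrite /n1 -ge0_integralZl//; try exact: measurable_norm_EFin.
by apply: eq_integral => x _; rewrite normrM EFinM.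
Qed.

Lemma eq_n1 f g : measurable_fun setT f -> measurable_fun setT g ->
  {ae mu, forall x, f x = g x} -> n1 f = n1 g.
Proof.
move=> mf mg fg; apply: ge0_ae_eq_integral => //; try exact: measurable_norm_EFin.
by apply: filterS fg => x /= -> _.
Qed.

Lemma n1_eq0 f : measurable_fun setT f -> n1 f = 0%E ->
  {ae mu, forall x, f x = 0}.
Proof.
move=> mf f0.
have := (ae_eq_integral_abs mu (measurableT) (f := EFin \o f)).
move=> []; first exact/measurable_EFinP.
move=> /(_ f0) h _.
by apply: filterS h => x /= /(_ I) [].
Qed.

Lemma n1_sub_eq0 f g : measurable_fun setT f -> measurable_fun setT g ->
  n1 (fun x => f x - g x) = 0%E -> {ae mu, forall x, f x = g x}.
Proof.
move=> mf mg /(n1_eq0 (measurable_funB mf mg)).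
by apply: filterS => x /eqP; rewrite subr_eq0 => /eqP.
Qed.

Lemma n1_esum (u : nat -> X -> R) : (forall k, measurable_fun setT (u k)) ->
  (\int[mu]_x asum [set: nat] (fun k => u k x) =
   \esum_(k in [set: nat]) n1 (u k))%E.
Proof.
move=> mu_; rewrite -nneseries_esumT; last by move=> k; exact: n1_ge0.
rewrite /n1 -integral_nneseries//; last by move=> k; exact: measurable_norm_EFin.
by apply: eq_integral => x _; rewrite /asum nneseries_esumT.
Qed.

Lemma measurable_asum (u : nat -> X -> R) : (forall k, measurable_fun setT (u k)) ->
  measurable_fun setT (fun x => asum [set: nat] (fun k => u k x)).
Proof.
move=> mu_; have -> : (fun x => asum [set: nat] (fun k => u k x)) =
    (fun x => \sum_(0 <= k <oo) `|u k x|%:E)%E.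
  by apply/funext => x; rewrite /asum nneseries_esumT.
by apply: ge0_emeasurable_sum => // k _ ; exact: measurable_norm_EFin.
Qed.

Lemma ae_asum_fin (u : nat -> X -> R) : (forall k, measurable_fun setT (u k)) ->
  (\esum_(k in [set: nat]) n1 (u k) < +oo)%E ->
  {ae mu, forall x, (asum [set: nat] (fun k => u k x) < +oo)%E}.
Proof.
move=> mu_ uoo.
have : mu.-integrable setT (fun x => asum [set: nat] (fun k => u k x)).
  apply/integrableP; split; first exact: measurable_asum.
  by under eq_integral do rewrite gee0_abs ?asum_ge0//; rewrite n1_esum.
move=> /(integrable_ae measurableT); apply: filterS => x /= /(_ I).
by rewrite ge0_fin_numE ?asum_ge0.
Qed.

Lemma measurable_usum (u : nat -> X -> R) : (forall k, measurable_fun setT (u k)) ->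
  measurable_fun setT (fun x => usum [set: nat] (fun k => u k x)).
Proof.
move=> mu_; apply: measurable_funB.
  apply: (measurableT_comp (f := fine)) => //.
  have -> : (fun x => \esum_(p in [set: nat]) (Num.max (u p x) 0)%:E)%E =
      (fun x => \sum_(0 <= k <oo) (Num.max (u k x) 0)%:E)%E.
    by apply/funext => x; rewrite nneseries_esumT// => k; rewrite lee_fin le_max lexx orbT.
  apply: ge0_emeasurable_sum => [k x _|k _]; first by rewrite lee_fin le_max lexx orbT.
  by apply/measurable_EFinP; apply: measurable_maxr => //; exact: mu_.
apply: (measurableT_comp (f := fine)) => //.
have -> : (fun x => \esum_(p in [set: nat]) (Num.max (- u p x) 0)%:E)%E =
    (fun x => \sum_(0 <= k <oo) (Num.max (- u k x) 0)%:E)%E.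
  by apply/funext => x; rewrite nneseries_esumT// => k; rewrite lee_fin le_max lexx orbT.
apply: ge0_emeasurable_sum => [k x _|k _]; first by rewrite lee_fin le_max lexx orbT.
apply/measurable_EFinP; apply: measurable_maxr => //.
by apply: measurableT_comp => //; exact: mu_.
Qed.

Lemma usum_partial (w : nat -> R) n : (asum [set: nat] w < +oo)%E ->
  (`|usum [set: nat] w - \sum_(k < n) w k|%:E <=
   asum [set: nat] (fun k => w (n + k)%N))%E.
Proof.
elim: n w => [|n IH] w sw; first by rewrite big_ord0 subr0 usum_norm.
have := IH (fun k => w k.+1) (asum_tail sw).
rewrite (usum_recl sw) [\sum_(k < n.+1) _]big_ord_recl /= opprD addrACA subrr add0r => /le_trans; apply.
by apply: le_asum => k _; rewrite addSn.
Qed.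

Lemma n1_usum_le (u : nat -> X -> R) n : (forall k, measurable_fun setT (u k)) ->
  (\esum_(k in [set: nat]) n1 (u k) < +oo)%E ->
  (n1 (fun x => usum [set: nat] (fun k => u k x) - \sum_(k < n) u k x)%R <=
   \esum_(k in [set: nat]) n1 (u (n + k)%N))%E.
Proof.
move=> mu_ uoo; rewrite -(n1_esum (u := fun k => u (n + k)%N))//.
apply: ae_ge0_le_integral => //.
- apply: measurable_norm_EFin; apply: measurable_funB; first exact: measurable_usum.
  by apply: measurable_sum => k; exact: mu_.
- by move=> x _; exact: asum_ge0.
- by apply: measurable_asum => k; exact: mu_.
- by apply: filterS (ae_asum_fin mu_ uoo) => x fx _; exact: usum_partial.
Qed.

Lemma esum_shift_cvg0 (a : nat -> \bar R) : (forall k, 0 <= a k)%E ->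
  (\esum_(k in [set: nat]) a k < +oo)%E ->
  (\esum_(k in [set: nat]) a (n + k)%N)%E @[n --> \oo] --> 0%E.
Proof.
move=> a0 aoo; rewrite -nneseries_esumT// in aoo.
have := nneseries_tail_cvg aoo (fun k _ => a0 k).
apply: cvg_trans; apply: near_eq_cvg; near=> n.
rewrite -nneseries_esumT//.
by under [RHS]eq_eseriesr do rewrite addnC; rewrite nneseries_addn.
Unshelve. all: by end_near. Qed.

End L1.

(** * The atomic norm *)

Section atomic_norm.
Context {R : realType} {disp : measure_display} {X : measurableType disp}.
Variables (mu : {measure set X -> \bar R}) (d : X -> X -> R).
Hypothesis mu_gt0 : (0 < mu setT)%E.
Hypothesis mu_fin : (mu setT < +oo)%E.
Hypothesis mball : forall x r, measurable (qball d x r).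
Hypothesis ball_gt0 : forall x r, 0 < r -> (0 < mu (qball d x r))%E.
Implicit Types (f g : X -> R).

Local Notation hn := (atomic_H1_norm mu d).

Let muT : mu setT \is a fin_num. Proof. by rewrite ge0_fin_numE. Qed.

Lemma mu_fin_num (A : set X) : measurable A -> mu A \is a fin_num.
Proof.
move=> mA; rewrite ge0_fin_numE//; apply: le_lt_trans mu_fin.
by apply: le_measure; rewrite ?inE.
Qed.

Lemma muT_gt0 : 0 < fine (mu setT).
Proof. by rewrite fine_gt0// mu_gt0. Qed.

Lemma qball_gt0 x r : 0 < r -> 0 < fine (mu (qball d x r)).
Proof.
move=> r0; rewrite fine_gt0// ball_gt0//=.
by have := mu_fin_num (mball x r); rewrite ge0_fin_numE.
Qed.

Lemma atom_measurable a : atom mu d a -> measurable_fun setT a.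
Proof. by case=> [->|[x [r [_ []]]]]//; exact: measurable_cst. Qed.

Lemma atom_cst : atom mu d (cst (fine (mu setT))^-1).
Proof. by left. Qed.

Lemma n1_atom a : atom mu d a -> (n1 mu a <= 1)%E.
Proof.
case=> [->|[x [r [r0 [ma a0 aN _]]]]].
  rewrite /n1 /= ger0_norm ?invr_ge0 ?(ltW muT_gt0)// integral_cst//.
  by rewrite -[X in (_ * X)%E]fineK// -EFinM mulVf// lt0r_neq0// muT_gt0.
set B := qball d x r; have mB : measurable B by exact: mball.
apply: (@le_trans _ _ (\int[mu]_(y in B) ((fine (mu B))^-1)%:E)%E); last first.
  rewrite integral_cst// -[X in (_ * X)%E]fineK ?mu_fin_num// -EFinM mulVf//.
  by rewrite lt0r_neq0// qball_gt0.
have -> : n1 mu a = (\int[mu]_(y in B) `|a y|%:E)%E.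
  rewrite /n1 [RHS]integral_mkcond; apply: eq_integral => y _; rewrite patchE.
  case: ifPn => //; rewrite notin_setE => /a0 ->; by rewrite normr0.
apply: ae_ge0_le_integral => //.
- by apply: measurable_funTS; exact: measurable_norm_EFin.
move: aN; rewrite unlock /= mu_gt0 => /ess_supP; apply: filterS => y /= h _.
exact: h.
Qed.

Lemma atom_bounded g (c : R) x r : measurable_fun setT g -> 0 < r -> 0 < c ->
  (forall y, `|g y| <= c) -> (forall y, ~ qball d x r y -> g y = 0) ->
  \int[mu]_y g y = 0 ->
  atom mu d (fun y => (c * fine (mu (qball d x r)))^-1 * g y).
Proof.
move=> mg r0 c0 gc gB ig; right; exists x, r; split=> //.
have m0 := qball_gt0 x r0.
split.
- exact: measurable_funM.
- by move=> y /gB ->; rewrite mulr0.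
- rewrite unlock /= mu_gt0; apply/ess_supP; apply: nearW => y /=.
  rewrite lee_fin normrM gtr0_norm ?invr_gt0 ?mulr_gt0// invfM mulrAC.
  rewrite ler_piMl ?invr_ge0 ?(ltW m0)// mulrC ler_pdivrMr// mul1r; exact: gc.
- have ig' : mu.-integrable setT (EFin \o g).
    apply/integrableP; split; first exact/measurable_EFinP.
    apply: (@le_lt_trans _ _ (\int[mu]_y c%:E)%E).
      apply: ge0_le_integral => //; first exact: measurable_norm_EFin.
      - by move=> y _; rewrite lee_fin.
    by rewrite integral_cst// lte_mul_pinfty ?lee_fin// ltW.
  by rewrite RintegralZl// ig mulr0.
Qed.

Lemma hn_ge0 f : (0 <= hn f)%E.
Proof.
apply: le_ereal_inf_tmp => _ [lam [a [_ ->]]].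
by apply: nneseries_ge0 => k _ _; rewrite lee_fin.
Qed.

Lemma atomic_repr_le f lam a : atomic_repr mu d f lam a ->
  (hn f <= \esum_(k in [set: nat]) `|lam k|%:E)%E.
Proof.
move=> h; apply: ereal_inf_lbound; exists lam, a; split=> //.
by rewrite nneseries_esumT.
Qed.

Lemma hn_atom_scale f (c : R) a : atom mu d a -> 0 <= c ->
  (forall x, f x = c * a x) -> (hn f <= c%:E)%E.
Proof.
move=> ata c0 fE.
pose lam k := if k == 0%N then c else 0.
have E : (\esum_(k in [set: nat]) `|lam k|%:E = c%:E)%E.
  rewrite /lam -[RHS](esum_delta (F := [set: nat]) (a := fun=> c%:E) (p := 0%N)) ?lee_fin//.
  by apply: eq_esum => k _; case: eqP => _; rewrite ?normr0// ger0_norm.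
rewrite -E; apply: (@atomic_repr_le _ _ (fun=> a)); split=> //.
  by rewrite nneseries_esumT// E ltry.
apply: cvg_near_cst; near=> n.
rewrite -[RHS](integral0 mu setT); apply: eq_integral => x _.
have n0 : (0 < n)%N by near: n; exists 1%N.
rewrite (bigD1 (Ordinal n0))//= big1 ?addr0; first by rewrite /lam eqxx fE subrr normr0.
by move=> i i0; rewrite /lam ifN ?mul0r.
Unshelve. all: by end_near. Qed.

Lemma hn_bounded g (c : R) x r : measurable_fun setT g -> 0 < r -> 0 <= c ->
  (forall y, `|g y| <= c) -> (forall y, ~ qball d x r y -> g y = 0) ->
  \int[mu]_y g y = 0 -> (hn g <= (c * fine (mu (qball d x r)))%:E)%E.
Proof.
move=> mg r0 c0 gc gB ig.
(* For c = 0 the normalization of [atom_bounded] is impossible; g is then zero times the constant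
   atom. *)
have [cE|cn0] := eqVneq c 0.
  rewrite cE mul0r; apply: (hn_atom_scale atom_cst) => // y.
  by rewrite mul0r; apply/eqP; rewrite -normr_le0 -cE.
have cp : 0 < c by rewrite lt_def cn0.
have m0 := qball_gt0 x r0.
apply: (hn_atom_scale (atom_bounded mg r0 cp gc gB ig)); first by rewrite mulr_ge0// ltW.
by move=> y; rewrite mulrA divff ?mul1r// mulf_neq0 ?lt0r_neq0.
Qed.

Lemma atomic_repr_n1 f lam a : atomic_repr mu d f lam a ->
  [/\ forall k, measurable_fun setT (fun x => lam k * a k x) ,
      forall k, (n1 mu (fun x => lam k * a k x)%R <= `|lam k|%:E)%E &
      (\esum_(k in [set: nat]) n1 mu (fun x => lam k * a k x)%R <=
       \esum_(k in [set: nat]) `|lam k|%:E)%E].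
Proof.
move=> [ata _ _].
have h k : (n1 mu (fun x => lam k * a k x)%R <= `|lam k|%:E)%E.
  rewrite n1Z; last exact: atom_measurable.
  by rewrite -[leRHS]mule1 lee_wpmul2l// n1_atom.
split=> //; last by apply: le_esum => k _.
by move=> k; apply: measurable_funM => //; exact: atom_measurable.
Qed.

(** Passes from convergence in L^1 to an absolutely convergent pointwise series, which can be
    rearranged. *)
Lemma n1_lim_usum f (u : nat -> X -> R) : measurable_fun setT f ->
  (forall k, measurable_fun setT (u k)) ->
  (\esum_(k in [set: nat]) n1 mu (u k) < +oo)%E ->
  (n1 mu (fun x => f x - \sum_(k < n) u k x)%R) @[n --> \oo] --> 0%E ->
  {ae mu, forall x, f x = usum [set: nat] (fun k => u k x)}.
Proof.
move=> mf mu_ uoo fu; apply: (n1_sub_eq0 mf (measurable_usum mu_)).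
apply/eqP; rewrite eq_le n1_ge0 andbT.
have T := esum_shift_cvg0 (fun k => n1_ge0 mu (u k)) uoo.
have fT : (n1 mu (fun x => f x - \sum_(k < n) u k x)%R +
   \esum_(k in [set: nat]) n1 mu (u (n + k)%N))%E @[n --> \oo] --> 0%E.
  by rewrite -[X in _ --> X]adde0; apply: cvgeD.
rewrite -(cvg_lim _ fT)//; apply: lime_ge; first by apply/cvg_ex; exists 0%E.
apply: nearW => n.
have ms : measurable_fun setT (fun x => \sum_(k < n) u k x).
  by apply: measurable_sum => k; exact: mu_.
apply: le_trans (leeD2l _ (n1_usum_le n mu_ uoo)).
have -> : n1 mu (fun x => (usum [set: nat] (fun k => u k x) - \sum_(k < n) u k x)%R) =
   n1 mu (fun x => (\sum_(k < n) u k x - usum [set: nat] (fun k => u k x))%R).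
  by apply: eq_integral => x _; rewrite distrC.
apply: le_trans (n1D _ _ _); rewrite ?le_eqVlt.
- by apply/orP; left; apply/eqP; apply: eq_integral => x _; rewrite addrA subrK.
- exact: measurable_funB.
- by apply: measurable_funB => //; exact: measurable_usum.
Qed.

Lemma hn_n1 f : measurable_fun setT f -> (n1 mu f <= hn f)%E.
Proof.
move=> mf; apply: le_ereal_inf_tmp => _ [lam [a [re ->]]].
have [ata lamoo cv] := re; have [m1 _ s1] := atomic_repr_n1 re.
rewrite nneseries_esumT// in lamoo *.
have uoo := le_lt_trans s1 lamoo.
rewrite (eq_n1 mf (measurable_usum m1) (n1_lim_usum mf m1 uoo cv)).
apply: le_trans s1.
have := n1_usum_le 0 m1 uoo; under eq_fun do rewrite big_ord0 subr0.
exact.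
Qed.

(** Countable subadditivity. Decompositions of the [u k] that are optimal up to (e / 2) 2^(-k) are
    merged into one sequence of atoms; the summability of the coefficients allows the double series
    to be rearranged almost everywhere, which identifies its sum with f. *)
Lemma hn_sum f (u : nat -> X -> R) : measurable_fun setT f ->
  (forall k, measurable_fun setT (u k)) ->
  (n1 mu (fun x => f x - \sum_(k < n) u k x)%R) @[n --> \oo] --> 0%E ->
  (hn f <= \esum_(k in [set: nat]) hn (u k))%E.
Proof.
move=> mf mu_ fu.
have [Soo|] := boolP (\esum_(k in [set: nat]) hn (u k) < +oo)%E; last first.
  by rewrite -leNgt => /(le_trans _); apply; rewrite leey.
apply/lee_addgt0Pr => e e0.
have hfin k : hn (u k) \is a fin_num.
  rewrite ge0_fin_numE ?hn_ge0//; apply: le_lt_trans Soo.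
  exact: (esum_ge_term (fun k => hn (u k))).
have ex k : exists la : (nat -> R) * (nat -> X -> R), atomic_repr mu d (u k) la.1 la.2 /\
    (\esum_(j in [set: nat]) `|la.1 j|%:E <= hn (u k) + (e / 2 * (2^-1) ^+ k)%:E)%E.
  have ek : 0 < e / 2 * (2^-1) ^+ k by rewrite mulr_gt0// ?divr_gt0// exprn_gt0// invr_gt0.
  have [_ [lam [a [re ->]]] lt] := lb_ereal_inf_adherent ek (hfin k).
  exists (lam, a); split=> //=.
  by rewrite -nneseries_esumT// ltW.
pose la := fun k => proj1_sig (cid (ex k)).
have re k : atomic_repr mu d (u k) (la k).1 (la k).2 by have [] := proj2_sig (cid (ex k)).
have le k : (\esum_(j in [set: nat]) `|(la k).1 j|%:E <= hn (u k) + (e / 2 * (2^-1) ^+ k)%:E)%E.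
  by have [] := proj2_sig (cid (ex k)).
pose Lam n := if @pickle_inv (nat * nat)%type n is Some p then (la p.1).1 p.2 else 0.
(* The codes that are not attained carry the constant atom with coefficient 0, as every term must be
   an atom. *)
pose A n := if @pickle_inv (nat * nat)%type n is Some p then (la p.1).2 p.2 else cst (fine (mu setT))^-1.
have tot : (\esum_(n in [set: nat]) `|Lam n|%:E <= \esum_(k in [set: nat]) hn (u k) + e%:E)%E.
  rewrite -[leLHS]/(asum [set: nat] Lam) /Lam (asum_pickle (fun i j => (la i).1 j)).
  apply: le_trans (_ : (\esum_(k in [set: nat]) (hn (u k) + (e / 2)%:E * ((2^-1) ^+ k)%:E) <= _)%E).
    by apply: le_esum => k _; rewrite -EFinM; exact: le.
  rewrite esumD; first last.
  - by move=> k _; rewrite -EFinM lee_fin mulr_ge0 ?exprn_ge0 ?divr_ge0 ?invr_ge0 ?(ltW e0).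
  - by move=> k _; exact: hn_ge0.
  rewrite leeD2l// esumZ ?divr_ge0 ?(ltW e0)//.
  apply: (@le_trans _ _ ((e / 2)%:E * 2%:E)%E).
    by rewrite lee_wpmul2l ?lee_fin ?divr_ge0 ?(ltW e0)// esum_geo_le.
  by rewrite -EFinM divfK.
have Lamoo : (\esum_(n in [set: nat]) `|Lam n|%:E < +oo)%E.
  by apply: le_lt_trans tot _; rewrite lte_add_pinfty ?ltry.
apply: le_trans tot; apply: (@atomic_repr_le _ _ A).
have atA n : atom mu d (A n).
  rewrite /A; case: pickle_inv => [p|]; last exact: atom_cst.
  by have [] := re p.1.
have reE n : n1 mu (fun x => Lam n * A n x) = (`|Lam n|%:E * n1 mu (A n))%E.
  by rewrite n1Z//; exact: atom_measurable.
have mw n : measurable_fun setT (fun x => Lam n * A n x).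
  by apply: measurable_funM => //; exact: atom_measurable.
have woo : (\esum_(n in [set: nat]) n1 mu (fun x => Lam n * A n x)%R < +oo)%E.
  apply: le_lt_trans Lamoo; apply: le_esum => n _; rewrite reE.
  by rewrite -[leRHS]mule1 lee_wpmul2l// n1_atom.
have aef : {ae mu, forall x, f x = usum [set: nat] (fun n => Lam n * A n x)}.
  have ae1 : {ae mu, forall x, f x = usum [set: nat] (fun k => u k x)}.
    apply: (n1_lim_usum mf mu_ _ fu); apply: le_lt_trans Soo.
    by apply: le_esum => k _; exact: hn_n1.
  have ae2 : {ae mu, forall x, forall k, u k x = usum [set: nat] (fun j => (la k).1 j * (la k).2 j x)}.
    apply: ae_foralln => k; have [ata lamoo cv] := re k.
    have [m1 _ s1] := atomic_repr_n1 (re k).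
    apply: (n1_lim_usum (mu_ k) m1 _ cv); apply: le_lt_trans s1 _.
    by rewrite -nneseries_esumT.
  apply: filterS3 (ae_asum_fin mw woo) ae1 ae2 => x ax e1 e2.
  have E n : Lam n * A n x =
     if @pickle_inv (nat * nat)%type n is Some p then (la p.1).1 p.2 * (la p.1).2 p.2 x else 0.
    by rewrite /Lam /A; case: pickle_inv => // ; rewrite mul0r.
  under [RHS]eq_usum do rewrite E.
  rewrite (usum_pickle (w := fun i j => (la i).1 j * (la i).2 j x)).
    by rewrite e1; apply: eq_usum => k _; exact: e2.
  rewrite -asum_pickle; apply: le_lt_trans ax; apply: le_asum => n _; by rewrite E.
split=> //; first by rewrite nneseries_esumT.
have T := esum_shift_cvg0 (fun k => n1_ge0 mu (fun x => Lam k * A k x)) woo.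
apply: (squeeze_cvge _ (cvg_cst 0%E) T); apply: nearW => n; apply/andP; split.
  by apply: integral_ge0 => x _; rewrite lee_fin.
rewrite -[X in (X <= _)%E]/(n1 mu (fun x => f x - \sum_(i < n) Lam i * A i x)).
have ms : measurable_fun setT (fun x => \sum_(i < n) Lam i * A i x).
  by apply: measurable_sum => k; exact: mw.
rewrite (eq_n1 (g := fun x => usum [set: nat] (fun n => Lam n * A n x) - \sum_(i < n) Lam i * A i x)).
- exact: n1_usum_le.
- exact: measurable_funB.
- by apply: measurable_funB => //; exact: measurable_usum.
- by apply: filterS aef => x ->.
Qed.

Lemma hn0 : hn (cst 0) = 0%E.
Proof.
apply/eqP; rewrite eq_le hn_ge0 andbT.
by apply: (hn_atom_scale atom_cst) => // x; rewrite mul0r.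
Qed.

Lemma hnD f g : measurable_fun setT f -> measurable_fun setT g ->
  (hn (fun x => f x + g x)%R <= hn f + hn g)%E.
Proof.
move=> mf mg.
pose u k := if k == 0%N then f else if k == 1%N then g else cst 0.
apply: le_trans (hn_sum (u := u) _ _ _) _.
- exact: measurable_funD.
- by move=> [|[|k]] //=; exact: measurable_cst.
- apply: cvg_near_cst; near=> n.
  rewrite /n1 -[RHS](integral0 mu setT); apply: eq_integral => x _.
  have n2 : (2 <= n)%N by near: n; exists 2%N.
  rewrite -(subnK n2) addn2 !big_ord_recl big1 /u /=; last by [].
  by rewrite addr0 subrr normr0.
rewrite -nneseries_esumT; last by move=> k; exact: hn_ge0.
rewrite (nneseries_split 0 2)//; last by move=> k _; exact: hn_ge0.
rewrite add0n big_nat_recr//= big_nat1 [X in (_ + X)%E]eseries0 ?adde0//.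
by move=> [|[|k]]//= _ _; rewrite /u hn0.
Unshelve. all: by end_near. Qed.

Lemma hnZ f (c : R) : measurable_fun setT f -> (hn (fun x => c * f x)%R <= `|c|%:E * hn f)%E.
Proof.
move=> mf; have [->|c0] := eqVneq c 0.
  rewrite normr0 mul0e (_ : (fun x => 0 * f x) = cst 0) ?hn0//.
  by apply/funext => x; rewrite mul0r.
have cp : 0 < `|c| by rewrite normr_gt0.
rewrite -lee_pdivrMl//; apply: le_ereal_inf_tmp => _ [lam [a [re ->]]].
rewrite lee_pdivrMl//.
have [ata lamoo cv] := re; have [m1 _ s1] := atomic_repr_n1 re.
rewrite nneseries_esumT// in lamoo *.
have E : (\esum_(k in [set: nat]) `|c * lam k|%:E = `|c|%:E * \esum_(k in [set: nat]) `|lam k|%:E)%E.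
  exact: asumZ.
rewrite -E; apply: (@atomic_repr_le _ _ a); split=> //.
  by rewrite nneseries_esumT// E lte_mul_pinfty.
have := cvgeZl (y := `|c|%:E) isT cv; rewrite mule0; apply: cvg_trans.
apply: near_eq_cvg; apply: nearW => n /=.
rewrite -ge0_integralZl//.
- apply: eq_integral => x _; rewrite -EFinM -normrM mulrBr; congr (`|_ - _|%:E).
  by rewrite mulr_sumr; apply: eq_bigr => i _; rewrite mulrA.
- apply: measurable_norm_EFin; apply: measurable_funB => //.
  by apply: measurable_sum => k; exact: m1.
Qed.

Lemma hn_congr f g : measurable_fun setT f -> measurable_fun setT g ->
  {ae mu, forall x, f x = g x} -> hn f = hn g.
Proof.
have half f' g' : measurable_fun setT f' -> measurable_fun setT g' ->
    {ae mu, forall x, f' x = g' x} -> (hn f' <= hn g')%E.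
  move=> mf mg fg; apply: le_ereal_inf_tmp => _ [lam [a [re ->]]].
  have [ata lamoo cv] := re; have [m1 _ s1] := atomic_repr_n1 re.
  apply: ereal_inf_lbound; exists lam, a; split=> //; split=> //.
  rewrite (_ : (fun n => _) = (fun n => (\int[mu]_x `|g' x - \sum_(i < n) lam i * a i x|%:E)%E))//.
  apply/funext => n; apply: (eq_n1 (f := fun x => f' x - \sum_(i < n) lam i * a i x)).
  - by apply: measurable_funB => //; apply: measurable_sum => k; exact: m1.
  - by apply: measurable_funB => //; apply: measurable_sum => k; exact: m1.
  - by apply: filterS fg => x ->.
move=> mf mg fg; apply/eqP; rewrite eq_le !half//.
by apply: filterS fg => x ->.
Qed.

Lemma hn_fsum (I : Type) (s : seq I) (g : I -> X -> R) :
  (forall i, measurable_fun setT (g i)) ->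
  (hn (fun x => \sum_(i <- s) g i x)%R <= \sum_(i <- s) hn (g i))%E.
Proof.
move=> mg; elim: s => [|i s IH].
  by rewrite big_nil (_ : (fun=> _) = cst 0) ?hn0//; apply/funext => x; rewrite big_nil.
rewrite big_cons (_ : (fun x => _) = (fun x => g i x + \sum_(i <- s) g i x)).
  by apply: le_trans (hnD _ _) _ => //; [exact: measurable_sum|rewrite leeD2l].
by apply/funext => x; rewrite big_cons.
Qed.

Lemma hn_fin_atomic f : measurable_fun setT f -> (hn f < +oo)%E -> atomic_H1 mu d f.
Proof.
move=> mf /ereal_inf_lt[_ [lam [a [re _]]] _]; split=> //.
by exists lam, a.
Qed.

End atomic_norm.

(** * Normal spaces and dyadic cubes *)

Section integrable_tools.
Context {R : realType} {disp : measure_display} {X : measurableType disp}.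
Variable mu : {measure set X -> \bar R}.
Hypothesis mu_fin : (mu setT < +oo)%E.
Implicit Types (f g : X -> R) (A : set X).

Definition vol A : R := fine (mu A).

Definition ig f := mu.-integrable setT (EFin \o f).

(** For a finite measure this class is an algebra of integrable functions, so products and squares
    raise no question of integrability. *)
Definition bm f := measurable_fun setT f /\ exists M : R, forall x, `|f x| <= M.

Local Notation I f := (\int[mu]_x f x).

Lemma volK A : measurable A -> (vol A)%:E = mu A.
Proof. by move=> mA; rewrite /vol fineK//; exact: mu_fin_num. Qed.

Lemma vol_ge0 A : 0 <= vol A. Proof. exact: fine_ge0. Qed.

Lemma le_vol A B : measurable A -> measurable B -> A `<=` B -> vol A <= vol B.
Proof. by move=> mA mB AB; rewrite -lee_fin !volK//; apply: le_measure; rewrite ?inE. Qed.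

Lemma ig_meas f : ig f -> measurable_fun setT f.
Proof. by move=> /integrableP[/measurable_EFinP]. Qed.

Lemma bm_cst (c : R) : bm (cst c).
Proof. by split=> //; exists `|c|. Qed.

Lemma bmD f g : bm f -> bm g -> bm (fun x => f x + g x).
Proof.
move=> [mf [M fM]] [mg [N gN]]; split; first exact: measurable_funD.
by exists (M + N) => x; rewrite (le_trans (ler_normD _ _))// lerD.
Qed.

Lemma bmM f g : bm f -> bm g -> bm (fun x => f x * g x).
Proof.
move=> [mf [M fM]] [mg [N gN]]; split; first exact: measurable_funM.
by exists (M * N) => x; rewrite normrM ler_pM.
Qed.

Lemma bmZ f (c : R) : bm f -> bm (fun x => c * f x).
Proof. by move=> bf; apply: bmM => //; exact: bm_cst. Qed.

Lemma bmN f : bm f -> bm (fun x => - f x).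
Proof.
move=> /(bmZ (-1)); rewrite (_ : (fun x => -1 * f x) = (fun x => - f x))//.
by apply/funext => x; rewrite mulN1r.
Qed.

Lemma bmB f g : bm f -> bm g -> bm (fun x => f x - g x).
Proof. by move=> bf bg; apply: bmD => //; exact: bmN. Qed.

Lemma bmX f k : bm f -> bm (fun x => f x ^+ k).
Proof.
move=> bf; elim: k => [|k IH].
  by rewrite (_ : (fun x => _) = cst 1); [exact: bm_cst|apply/funext => x; rewrite expr0].
rewrite (_ : (fun x => _) = (fun x => f x * f x ^+ k)); first exact: bmM.
by apply/funext => x; rewrite exprS.
Qed.

Lemma bm_norm f : bm f -> bm (fun x => `|f x|).
Proof.
move=> [mf [M fM]]; split; first exact: measurableT_comp.
by exists M => x; rewrite normr_id.
Qed.

Lemma bm_indic A : measurable A -> bm (\1_A).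
Proof.
move=> mA; split; first exact: measurable_indic.
by exists 1 => x; rewrite indicE; case: (_ \in _); rewrite ?normr1 ?normr0.
Qed.

Lemma bm_sum (J : Type) (s : seq J) (f : J -> X -> R) :
  (forall j, bm (f j)) -> bm (fun x => \sum_(j <- s) f j x).
Proof.
move=> bf; elim: s => [|j s IH].
  by rewrite (_ : (fun x => _) = cst 0); [exact: bm_cst|apply/funext => x; rewrite big_nil].
rewrite (_ : (fun x => _) = (fun x => f j x + \sum_(j <- s) f j x)); first exact: bmD.
by apply/funext => x; rewrite big_cons.
Qed.

Lemma bm_ig f : bm f -> ig f.
Proof.
move=> [mf [M fM]]; apply/integrableP; split; first exact/measurable_EFinP.
apply: (@le_lt_trans _ _ (\int[mu]_y `|M|%:E)%E).
  apply: ge0_le_integral => //; first exact: measurable_norm_EFin.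
  by move=> y _; rewrite lee_fin (le_trans (fM y))// ler_norm.
by rewrite integral_cst// lte_mul_pinfty ?lee_fin.
Qed.

Lemma ig_mulbm f g : ig f -> bm g -> ig (fun x => f x * g x).
Proof.
move=> igf [mg [M gM]]; have mf := ig_meas igf.
apply/integrableP; split; first by apply/measurable_EFinP; exact: measurable_funM.
move/integrableP : igf => [_ foo].
apply: (@le_lt_trans _ _ (\int[mu]_y (`|M|%:E * `|f y|%:E))%E).
  apply: ge0_le_integral => //.
  - by apply: measurable_norm_EFin; exact: measurable_funM.
  - by apply: emeasurable_funM => //; exact: measurable_norm_EFin.
  - move=> y _; rewrite -EFinM lee_fin normrM mulrC ler_wpM2r//.
    by rewrite (le_trans (gM y))// ler_norm.
rewrite ge0_integralZl//; first by rewrite lte_mul_pinfty ?lee_fin.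
exact: measurable_norm_EFin.
Qed.

Lemma igD f g : ig f -> ig g -> ig (fun x => f x + g x).
Proof. by move=> igf igg; exact: (integrableD measurableT igf igg). Qed.

Lemma igZ f (c : R) : ig f -> ig (fun x => c * f x).
Proof. by move=> igf; exact: (integrableZl measurableT c igf). Qed.

Lemma igB f g : ig f -> ig g -> ig (fun x => f x - g x).
Proof. by move=> igf igg; exact: (integrableB measurableT igf igg). Qed.

Lemma ig_sum (J : Type) (s : seq J) (f : J -> X -> R) :
  (forall j, ig (f j)) -> ig (fun x => \sum_(j <- s) f j x).
Proof.
move=> bf; elim: s => [|j s IH].
  rewrite (_ : (fun x => _) = cst 0); first exact: bm_ig (bm_cst 0).
  by apply/funext => x; rewrite big_nil.
rewrite (_ : (fun x => _) = (fun x => f j x + \sum_(j <- s) f j x)); first exact: igD.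
by apply/funext => x; rewrite big_cons.
Qed.

Lemma ig_ae f g : ig f -> measurable_fun setT g -> {ae mu, forall x, f x = g x} -> ig g.
Proof.
move=> igf mg fg; have mf := ig_meas igf; move/integrableP : igf => [_ foo].
apply/integrableP; split; first exact/measurable_EFinP.
by rewrite -[X in (X < _)%E]/(n1 mu g) -(eq_n1 mf mg fg).
Qed.

Lemma ID f g : ig f -> ig g -> I (fun x => f x + g x) = I f + I g.
Proof. by move=> igf igg; rewrite RintegralD. Qed.

Lemma IB f g : ig f -> ig g -> I (fun x => f x - g x) = I f - I g.
Proof. by move=> igf igg; rewrite RintegralB. Qed.

Lemma IZ f (c : R) : ig f -> I (fun x => c * f x) = c * I f.
Proof. by move=> igf; rewrite RintegralZl. Qed.

Lemma I0 : I (cst 0) = 0 :> R.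
Proof. by rewrite Rintegral_cst ?mul0r. Qed.

Lemma Isum (J : Type) (s : seq J) (f : J -> X -> R) :
  (forall j, ig (f j)) -> I (fun x => \sum_(j <- s) f j x) = \sum_(j <- s) I (f j).
Proof.
move=> igf; elim: s => [|j s IH].
  by rewrite big_nil -[RHS]I0; apply: eq_Rintegral => x _; rewrite big_nil.
rewrite big_cons -IH -ID//; last exact: ig_sum.
by apply: eq_Rintegral => x _; rewrite big_cons.
Qed.

Lemma I_ae f g : measurable_fun setT f -> measurable_fun setT g ->
  {ae mu, forall x, f x = g x} -> I f = I g.
Proof.
move=> mf mg fg; congr fine; apply: ae_eq_integral => //; try exact/measurable_EFinP.
by apply: filterS fg => x /= ->.
Qed.

Lemma I_ge0 f : (forall x, 0 <= f x) -> 0 <= I f.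
Proof. by move=> f0; apply: Rintegral_ge0. Qed.

Lemma I_le f g : ig f -> ig g -> (forall x, f x <= g x) -> I f <= I g.
Proof. by move=> igf igg fg; apply: le_Rintegral. Qed.

Lemma I_le_ae f g : ig f -> ig g -> {ae mu, forall x, f x <= g x} -> I f <= I g.
Proof.
move=> igf igg fg; have mf := ig_meas igf; have mg := ig_meas igg.
pose h x := Num.max (f x) (g x).
have mh : measurable_fun setT h by exact: measurable_maxr.
have gh : {ae mu, forall x, g x = h x}.
  by apply: filterS fg => x fgx; rewrite /h max_r.
rewrite (I_ae mg mh gh); apply: I_le => //; first exact: ig_ae gh.
by move=> x; rewrite le_max lexx.
Qed.

Lemma I_norm f : ig f -> `|I f| <= I (fun x => `|f x|).
Proof. by move=> igf; apply: le_normr_Rintegral. Qed.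

Lemma I_indic A : measurable A -> I (\1_A) = vol A.
Proof. by move=> mA; rewrite /Rintegral integral_indic// setIT. Qed.

Lemma I_restr A f : \int[mu]_(x in A) f x = I (fun x => f x * \1_A x).
Proof.
rewrite Rintegral_mkcond; apply: eq_Rintegral => x _; rewrite patchE indicE.
by case: (x \in A); rewrite ?mulr1 ?mulr0.
Qed.

Lemma n1_ig f : ig f -> n1 mu f = (I (fun x => `|f x|))%:E.
Proof.
move=> igf; rewrite /n1 /Rintegral fineK//.
rewrite ge0_fin_numE; first by move/integrableP : igf => [].
by apply: integral_ge0 => x _; rewrite lee_fin.
Qed.

Lemma I_partition (s : seq (set X)) (D : set X) f : ig f -> measurable D ->
  uniq s -> (forall P, P \in s -> measurable P /\ P `<=` D) ->
  (forall P Q, P \in s -> Q \in s -> P `&` Q !=set0 -> P = Q) ->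
  mu.-negligible (D `\` \bigcup_(P in [set` s]) P) ->
  {ae mu, forall x, f x * \1_D x = \sum_(P <- s) f x * \1_P x} /\
  I (fun x => f x * \1_D x) = \sum_(P <- s) I (fun x => f x * \1_P x).
Proof.
move=> igf mD us sD disj neg.
have ms P : P \in s -> bm (\1_P : X -> R) by move=> /sD[mP _]; exact: bm_indic.
have ae : {ae mu, forall x, f x * \1_D x = \sum_(P <- s) f x * \1_P x}.
  apply: (@negligibleS _ _ _ mu _ _ _ neg) => x /= h.
  apply: contrapT => nx; apply: h.
  have [Dx|nDx] := pselect (D x); last first.
    rewrite indicE memNset// mulr0 big_seq big1// => P Ps.
    rewrite indicE memNset ?mulr0// => Px; apply: nDx.
    by have [_] := sD _ Ps; exact.
  have [P Ps Px] : exists2 P, P \in s & P x.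
    apply: contrapT => h; apply: nx; split=> // -[P /= Ps Px]; apply: h; exists P.
  rewrite (bigD1_seq P)//= !indicE !mem_set// mulr1 big_seq_cond big1 ?addr0//.
  move=> Q /andP[Qs QP]; rewrite indicE memNset ?mulr0// => Qx.
  by move/eqP : QP; apply; apply: (disj _ _ Qs Ps); exists x.
split=> //.
pose u P : X -> R := if P \in s then (fun x => f x * \1_P x) else cst 0.
have igu P : ig (u P).
  rewrite /u; case: ifP => Ps; last exact: bm_ig (bm_cst 0).
  by apply: ig_mulbm => //; exact: ms.
have uE (x : X) : \sum_(P <- s) f x * \1_P x = \sum_(P <- s) u P x.
  by rewrite big_seq [RHS]big_seq; apply: eq_bigr => P Ps; rewrite /u Ps.
rewrite (@I_ae _ (fun x => \sum_(P <- s) u P x)).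
- rewrite Isum// big_seq [RHS]big_seq; apply: eq_bigr => P Ps.
  by apply: eq_Rintegral => x _; rewrite /u Ps.
- by apply: ig_meas; apply: ig_mulbm => //; exact: bm_indic.
- by apply: ig_meas; exact: ig_sum.
- by apply: filterS ae => x ->.
Qed.

End integrable_tools.

(** * Volume bounds in a normal space *)

Section geometry.
Context {R : realType} {disp : measure_display} {X : measurableType disp}.
Variables (mu : {measure set X -> \bar R}) (d : X -> X -> R).

(** The volume conditions of a normal space in terms of real numbers, with the constant of the
    quasi-metric raised to at least 1. *)
Record space_geometry (kap A1 A2 K1 K2 : R) : Prop := SpaceGeometry {
  sg_fin : (mu setT < +oo)%E ;
  sg_gt0 : (0 < mu setT)%E ;
  sg_ge0 : forall x y, 0 <= d x y ;
  sg_sym : forall x y, d x y = d y x ;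
  sg_eq0 : forall x y, d x y = 0 <-> x = y ;
  sg_kap : 1 <= kap ;
  sg_tri : forall x y z, d x y <= kap * (d x z + d z y) ;
  sg_ball : forall x r, measurable (qball d x r) ;
  sg_A1 : 0 < A1 ; sg_A2 : 0 < A2 ; sg_K1 : 0 < K1 ; sg_K2 : 0 < K2 ;
  sg_lower : forall x r, 0 < r -> r <= K1 * vol mu setT -> A1 * r <= vol mu (qball d x r) ;
  sg_full : forall x r, 0 < r -> K1 * vol mu setT < r -> qball d x r = setT ;
  sg_upper : forall x r, 0 < r -> K2 * vol mu [set x] <= r -> vol mu (qball d x r) <= A2 * r ;
  sg_point : forall x r, 0 < r -> r < K2 * vol mu [set x] -> qball d x r = [set x] }.

(** A point is a countable intersection of balls. This is needed because the volume conditions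
    involve the mass of points, and [vol] agrees with the measure on measurable sets only. *)
Lemma measurable_point : (forall x r, measurable (qball d x r)) ->
  (forall x y, 0 <= d x y) -> (forall x y, d x y = 0 <-> x = y) ->
  forall x : X, measurable [set x].
Proof.
move=> mb d0 dE x.
have -> : [set x] = \bigcap_(n in [set: nat]) qball d x n.+1%:R^-1.
  apply/seteqP; split=> [y -> n _|y h] /=.
    by rewrite /qball /= (proj2 (dE x x) erefl) invr_gt0 ltr0n.
  apply/esym/dE/eqP; rewrite eq_le d0 andbT leNgt; apply/negP => dp.
  have [n hn] := ltr_add_invr dp; rewrite add0r in hn.
  have := h n I; rewrite /qball /= => h1.
  by have := lt_trans h1 hn; rewrite ltxx.
exact: bigcapT_measurable.
Qed.

Lemma normal_geometry (theta : R) : normal_space_of_order mu d theta ->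
  (0 < mu setT)%E -> (mu setT < +oo)%E ->
  exists kap A1 A2 K1 K2 : R, space_geometry kap A1 A2 K1 K2.
Proof.
move=> [th0 [d0 dsym deq [K' dtri]] mb [A1 [A2 [K1 [K2 [K0 [[A10 A20 K20 _ K11] _ h]]]]]]] m0 moo.
have mp := measurable_point mb d0 deq.
have vK A : measurable A -> (vol mu A)%:E = mu A by move=> mA; rewrite volK.
have K10 : 0 < K1 by apply: lt_le_trans K11.
exists (Num.max K' 1), A1, A2, K1, K2; split=> //.
- by rewrite le_max lexx orbT.
- move=> x y z; apply: le_trans (dtri x y z) _.
  by rewrite ler_wpM2r ?addr_ge0// le_max lexx.
- move=> x r r0 rK; have [h1 _ _ _ _] := h x r r0.
  by rewrite -lee_fin vK//; apply: h1; rewrite -vK// -EFinM lee_fin.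
- move=> x r r0 rK; have [_ h1 _ _ _] := h x r r0.
  by apply: h1; rewrite -vK// -EFinM lte_fin.
- move=> x r r0 rK; have [_ _ h1 _ _] := h x r r0.
  by rewrite -lee_fin vK//; apply: h1; rewrite -vK// -EFinM lee_fin.
- move=> x r r0 rK; have [_ _ _ h1 _] := h x r r0.
  by apply: h1; rewrite -vK// -EFinM lte_fin.
Qed.

End geometry.

(** * Dyadic cubes and their volumes *)

Section cubes.
Context {R : realType} {disp : measure_display} {X : measurableType disp}.
Variables (mu : {measure set X -> \bar R}) (d : X -> X -> R).
Variables (kap A1 A2 K1 K2 : R).
Hypothesis G : space_geometry mu d kap A1 A2 K1 K2.
Variables (delta a0 eta C1 C2 : R) (E : nat -> set (set X)).
Hypothesis DC : dyadic_cubes mu d delta a0 eta C1 C2 E.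
Hypotheses (delta_gt0 : 0 < delta) (delta_lt1 : delta < 1) (a0_gt0 : 0 < a0).

Local Notation vol := (vol mu).
Local Notation V := (vol setT).

Let mu_fin := sg_fin G.
Let dn n : 0 < delta ^+ n. Proof. exact: exprn_gt0. Qed.

Lemma d_refl x : d x x = 0. Proof. exact/(sg_eq0 G). Qed.

Lemma vol_T_gt0 : 0 < V.
Proof. by rewrite fine_gt0// (sg_gt0 G) mu_fin. Qed.

Lemma qball_self x r : 0 < r -> qball d x r x.
Proof. by rewrite /qball /= d_refl. Qed.

Lemma ball_mu_gt0 x r : 0 < r -> (0 < mu (qball d x r))%E.
Proof.
move=> r0; rewrite -(volK mu_fin (sg_ball G x r)) lte_fin.
have [le|gt] := leP r (K1 * V).
  by apply: lt_le_trans (sg_lower G x r0 le); rewrite mulr_gt0// (sg_A1 G).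
by rewrite (sg_full G x r0 gt) vol_T_gt0.
Qed.

Lemma cube_nonempty n Q : E n Q -> exists x, Q x.
Proof.
move=> EQ; have [z zQ] := dc_ball DC EQ; exists z; apply: zQ.
by apply: qball_self; rewrite mulr_gt0.
Qed.

Lemma cube_measurable n Q : E n Q -> measurable Q.
Proof. exact: (dc_measurable DC). Qed.

Lemma cube_eq n P Q : E n P -> E n Q -> P `&` Q !=set0 -> P = Q.
Proof.
move=> EP EQ [x [Px Qx]].
have [PQ|PQ] := dc_nested DC (leqnn n) EP EQ; last first.
  by exfalso; have : (P `&` Q) x by []; rewrite PQ.
have [QP|QP] := dc_nested DC (leqnn n) EQ EP; first by apply/seteqP.
by exfalso; have : (Q `&` P) x by []; rewrite QP.
Qed.

Lemma cube_nested k l P Q : (k <= l)%N -> E l P -> E k Q -> P `&` Q !=set0 -> P `<=` Q.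
Proof.
move=> kl EP EQ [x Px]; have [//|PQ] := dc_nested DC kl EP EQ.
by exfalso; have := Px; rewrite PQ.
Qed.

Lemma cube_diam n Q x y : E n Q -> Q x -> Q y -> d x y <= C1 * delta ^+ n.
Proof.
move=> EQ Qx Qy; rewrite -lee_fin; apply: le_trans (dc_diam DC EQ).
by apply: ereal_sup_ubound; exists x => //; exists y.
Qed.

(** C1 comes without a sign, and the bound on diameters is not strict whereas balls are open; hence
    the absolute value and the added 1. *)
Definition rho1 : R := `|C1| + 1.

Lemma rho1_gt0 : 0 < rho1. Proof. by rewrite ltr_wpDl. Qed.

Lemma cube_ball n Q x : E n Q -> Q x -> Q `<=` qball d x (rho1 * delta ^+ n).
Proof.
move=> EQ Qx y Qy; rewrite /qball /=; apply: le_lt_trans (cube_diam EQ Qx Qy) _.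
by rewrite ltr_pM2r// /rho1 ltr_pwDr// ler_norm.
Qed.

(** Beyond the radius K1 mu(X) a ball is the whole space and the lower bound A1 r is no longer
    available; there mu(X) takes over, since delta^n <= 1. *)
Definition cmin : R := Num.min (A1 * a0) V.

Lemma cmin_gt0 : 0 < cmin.
Proof. by rewrite lt_min mulr_gt0 ?(sg_A1 G)// vol_T_gt0. Qed.

Lemma vol_cube_ge n Q : E n Q -> cmin * delta ^+ n <= vol Q.
Proof.
move=> EQ; have [z zQ] := dc_ball DC EQ.
have r0 : 0 < a0 * delta ^+ n by rewrite mulr_gt0.
have mB := sg_ball G z (a0 * delta ^+ n); have mQ := cube_measurable EQ.
apply: le_trans (le_vol mu_fin mB mQ zQ).
have [le|gt] := leP (a0 * delta ^+ n) (K1 * V).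
  apply: le_trans (sg_lower G z r0 le).
  by rewrite mulrA ler_pM2r// ge_min lexx.
rewrite (sg_full G z r0 gt) -[leRHS]mulr1.
apply: ler_pM; [exact: ltW cmin_gt0|exact: ltW|by rewrite ge_min lexx orbT|].
by apply: exprn_ile1; apply/ltW.
Qed.

Lemma vol_cube_gt0 n Q : E n Q -> 0 < vol Q.
Proof. by move=> EQ; apply: lt_le_trans (vol_cube_ge EQ); rewrite mulr_gt0// cmin_gt0. Qed.

Lemma sum_vol_le (s : seq (set X)) (D : set X) : measurable D -> uniq s ->
  (forall P, P \in s -> measurable P /\ P `<=` D) ->
  (forall P Q, P \in s -> Q \in s -> P `&` Q !=set0 -> P = Q) ->
  \sum_(P <- s) vol P <= vol D.
Proof.
move=> mD us sD disj.
pose u P : X -> R := if P \in s then \1_P else cst 0.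
have bu P : bm (u P).
  by rewrite /u; case: ifP => [/sD[mP _]|_]; [exact: bm_indic|exact: bm_cst].
have -> : \sum_(P <- s) vol P = \sum_(P <- s) \int[mu]_x u P x.
  rewrite big_seq [RHS]big_seq; apply: eq_bigr => P Ps.
  have [mP _] := sD _ Ps; rewrite -(I_indic mu mP); apply: eq_Rintegral => x _.
  by rewrite /u Ps.
rewrite -(Isum mu_fin); last by move=> P; exact: (bm_ig mu_fin (bu P)).
rewrite -(I_indic mu mD); apply: I_le.
- by apply: bm_ig => //; exact: bm_sum.
- by apply: bm_ig => //; exact: bm_indic.
move=> x; have [[P Ps Px]|nx] := pselect (exists2 P, P \in s & P x).
  rewrite (bigD1_seq P)//= /u Ps !indicE !mem_set//; last by have [_] := sD _ Ps; exact.
  rewrite big_seq_cond big1 ?addr0//.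
  move=> Q /andP[Qs QP]; rewrite Qs indicE memNset// => Qx.
  by move/eqP : QP; apply; apply: (disj _ _ Qs Ps); exists x.
rewrite big_seq big1; first by rewrite indicE; case: (_ \in _).
move=> P Ps; rewrite /u Ps indicE memNset// => Px; apply: nx; by exists P.
Qed.

(** Cubes of one level are disjoint and their volumes are bounded below, while the total volume is
    finite. *)
Lemma finite_cubes n : finite_set (E n).
Proof.
apply: contrapT => /infinite_set_fset inf.
pose N := Num.truncn (V / (cmin * delta ^+ n)).
have [B BE NB] := inf N.+1.
have : \sum_(P <- B) vol P <= V.
  apply: sum_vol_le => //; first exact: fset_uniq.
  - by move=> P PB; split=> //; apply: (@cube_measurable n); exact: BE.
  - by move=> P Q PB QB; apply: (@cube_eq n); exact: BE.
have : \sum_(P <- B) (cmin * delta ^+ n) <= \sum_(P <- B) vol P.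
  by rewrite big_seq [leRHS]big_seq; apply: ler_sum => P PB; apply: vol_cube_ge; exact: BE.
rewrite big_const_seq count_predT iter_addr_0 => h1 h2.
have := le_trans h1 h2; rewrite -mulr_natr -ler_pdivlMl ?mulr_gt0 ?cmin_gt0//.
rewrite mulrC leNgt => /negP; apply.
have c0 : 0 <= V / (cmin * delta ^+ n).
  by rewrite divr_ge0 ?mulr_ge0 ?(ltW vol_T_gt0) ?(ltW cmin_gt0) ?(ltW (dn n)).
apply: (@lt_le_trans _ _ N.+1%:R); last by rewrite ler_nat.
by have /andP[] := truncn_itv c0.
Qed.

Definition cubes n : seq (set X) := fset_set (E n).

Lemma cubesP n Q : (Q \in cubes n) <-> E n Q.
Proof. by rewrite /cubes in_fset_set ?inE//; exact: finite_cubes. Qed.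

Lemma cubes_uniq n : uniq (cubes n). Proof. exact: fset_uniq. Qed.

Definition kids n Q : seq (set X) := [seq P <- cubes n.+1 | `[< P `<=` Q >]].

Lemma kidsP n Q P : (P \in kids n Q) <-> (E n.+1 P /\ P `<=` Q).
Proof.
rewrite mem_filter; split; first by move=> /andP[/asboolP PQ /cubesP].
by move=> [/cubesP EP PQ]; rewrite EP andbT; exact/asboolP.
Qed.

Lemma kids_uniq n Q : uniq (kids n Q).
Proof. by rewrite filter_uniq// cubes_uniq. Qed.

Lemma I_cubes n f : ig mu f ->
  {ae mu, forall x, f x = \sum_(P <- cubes n) f x * \1_P x} /\
  \int[mu]_x f x = \sum_(P <- cubes n) \int[mu]_x (f x * \1_P x).
Proof.
move=> igf.
have one : (fun x => f x * \1_(setT) x) = f.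
  by apply/funext => x; rewrite indicE mem_set// mulr1.
have := @I_partition _ _ _ mu mu_fin (cubes n) setT f igf measurableT (cubes_uniq n).
rewrite one => h; split.
  have [ae _] : {ae mu, forall x, f x * \1_(setT) x = \sum_(P <- cubes n) f x * \1_P x} /\
      \int[mu]_x f x = \sum_(P <- cubes n) \int[mu]_x (f x * \1_P x).
    apply: h.
    - by move=> P /cubesP EP; split=> //; exact: cube_measurable EP.
    - by move=> P Q /cubesP EP /cubesP EQ; exact: (@cube_eq n).
    - apply: negligibleS (dc_cover DC n) => x [_ nx] [Q EQ Qx]; apply: nx.
      by exists Q => //; exact/cubesP.
  by apply: filterS ae => x <-; rewrite indicE mem_set// mulr1.
have [] // : {ae mu, forall x, f x * \1_(setT) x = \sum_(P <- cubes n) f x * \1_P x} /\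
      \int[mu]_x f x = \sum_(P <- cubes n) \int[mu]_x (f x * \1_P x).
apply: h.
- by move=> P /cubesP EP; split=> //; exact: cube_measurable EP.
- by move=> P Q /cubesP EP /cubesP EQ; exact: (@cube_eq n).
- apply: negligibleS (dc_cover DC n) => x [_ nx] [Q EQ Qx]; apply: nx.
  by exists Q => //; exact/cubesP.
Qed.

Lemma I_kids n Q f : E n Q -> ig mu f ->
  {ae mu, forall x, f x * \1_Q x = \sum_(P <- kids n Q) f x * \1_P x} /\
  \int[mu]_x (f x * \1_Q x) = \sum_(P <- kids n Q) \int[mu]_x (f x * \1_P x).
Proof.
move=> EQ igf; apply: I_partition => //.
- exact: cube_measurable EQ.
- exact: kids_uniq.
- by move=> P /kidsP[EP PQ]; split=> //; exact: cube_measurable EP.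
- by move=> P P' /kidsP[EP _] /kidsP[EP' _]; exact: (@cube_eq n.+1).
- apply: negligibleS (dc_cover DC n.+1) => x [Qx nx] [P EP Px]; apply: nx.
  exists P => //; apply/kidsP; split=> //.
  by apply: (cube_nested (leqnSn n) EP EQ); exists x.
Qed.

(* A cube reduced to one point can have a measure much larger than [delta ^+ n]. *)
Lemma vol_ball_le n Q x y r : E n Q -> Q x -> Q y -> x <> y ->
  rho1 * delta ^+ n <= r -> vol (qball d x r) <= A2 * r.
Proof.
move=> EQ Qx Qy xy hr.
have r0 : 0 < r by apply: lt_le_trans hr; rewrite mulr_gt0 ?rho1_gt0.
apply: (sg_upper G) => //; rewrite leNgt; apply/negP => /(sg_point G r0) B.
have : qball d x r y.
  by have := cube_ball EQ Qx Qy; rewrite /qball /= => h; exact: lt_le_trans hr.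
by rewrite B /= => yx; apply: xy.
Qed.

Definition cup : R := A2 * rho1.

Lemma cup_gt0 : 0 < cup. Proof. by rewrite mulr_gt0 ?(sg_A2 G) ?rho1_gt0. Qed.

Lemma vol_cube_le n Q x y : E n Q -> Q x -> Q y -> x <> y -> vol Q <= cup * delta ^+ n.
Proof.
move=> EQ Qx Qy xy; rewrite /cup -mulrA.
apply: le_trans (vol_ball_le EQ Qx Qy xy (lexx _)).
apply: (le_vol mu_fin); [exact: cube_measurable EQ|exact: (sg_ball G)|exact: cube_ball].
Qed.

(** The value 4 makes the costs decrease geometrically from one generation of stopping cubes to the
    next in the Calderon-Zygmund decomposition. *)
Definition creg : R := Num.max 4 (cup / (cmin * delta)).

Lemma creg_ge4 : 4 <= creg. Proof. by rewrite le_max lexx. Qed.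

(** If Q has two points, both volumes are compared with powers of delta; otherwise Q is a point and
    equals P. *)
Lemma vol_parent n Q P : E n Q -> E n.+1 P -> P `<=` Q -> vol Q <= creg * vol P.
Proof.
move=> EQ EP PQ; have P0 := vol_cube_gt0 EP.
have [[x [y [Qx [Qy xy]]]]|single] := pselect (exists x y, Q x /\ Q y /\ x <> y).
  apply: le_trans (vol_cube_le EQ Qx Qy xy) _.
  apply: (@le_trans _ _ (cup / (cmin * delta) * vol P)); last first.
    by rewrite ler_pM2r// le_max lexx orbT.
  rewrite [leRHS]mulrAC ler_pdivlMr ?mulr_gt0 ?cmin_gt0//.
  rewrite -mulrA ler_pM2l ?cup_gt0//.
  by rewrite mulrCA -exprSr; exact: vol_cube_ge EP.
have -> : Q = P.
  have [p Pp] := cube_nonempty EP.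
  apply/seteqP; split=> // q Qq; apply: contrapT => nPq; apply: single.
  exists q, p; split=> //; split; [exact: PQ|by move=> qp; apply: nPq; rewrite qp].
by rewrite ler_peMl ?(ltW P0)//; have := creg_ge4; lra.
Qed.

Definition cball : R := Num.max 1 (cup / cmin).

Lemma cball_gt0 : 0 < cball. Proof. by rewrite lt_max ltr01. Qed.

(** Atoms live on balls, so each cube needs a ball of comparable measure around it. For a cube
    reduced to a point x, a radius below K2 mu({x}) gives exactly the ball {x}, however large its
    mass. *)
Lemma cube_in_ball n Q : E n Q ->
  exists x r, [/\ 0 < r, Q `<=` qball d x r & vol (qball d x r) <= cball * vol Q].
Proof.
move=> EQ; have [x Qx] := cube_nonempty EQ; have Q0 := vol_cube_gt0 EQ.
have [[y [Qy xy]]|single] := pselect (exists y, Q y /\ x <> y).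
  exists x, (rho1 * delta ^+ n); split; first by rewrite mulr_gt0 ?rho1_gt0.
    exact: cube_ball.
  apply: le_trans (vol_ball_le EQ Qx Qy xy (lexx _)) _.
  apply: (@le_trans _ _ (cup / cmin * vol Q)); last by rewrite ler_pM2r// le_max lexx orbT.
  rewrite mulrA -/cup [leRHS]mulrAC ler_pdivlMr ?cmin_gt0// -mulrA ler_pM2l ?cup_gt0//.
  by rewrite mulrC vol_cube_ge.
have QE : Q = [set x].
  apply/seteqP; split=> [y Qy|y ->//]; apply: contrapT => /= yx; apply: single.
  by exists y; split=> // xy; apply: yx.
have r0 : 0 < K2 * vol Q / 2 by rewrite divr_gt0// mulr_gt0 ?(sg_K2 G).
have Qx' y : Q y -> y = x by rewrite QE.
exists x, (K2 * vol Q / 2); split=> //; first by move=> y /Qx' ->; exact: qball_self.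
have -> : qball d x (K2 * vol Q / 2) = Q.
  by rewrite [RHS]QE; apply: (sg_point G r0); rewrite -QE; move: r0; lra.
by rewrite ler_peMl ?(ltW Q0)// le_max lexx.
Qed.

End cubes.

(** * Calderon-Zygmund decomposition *)

Section calderon_zygmund.
Context {R : realType} {disp : measure_display} {X : measurableType disp}.
Variables (mu : {measure set X -> \bar R}) (d : X -> X -> R).
Variables (kap A1 A2 K1 K2 : R).
Hypothesis G : space_geometry mu d kap A1 A2 K1 K2.
Variables (delta a0 eta C1 C2 : R) (E : nat -> set (set X)).
Hypothesis DC : dyadic_cubes mu d delta a0 eta C1 C2 E.
Hypotheses (delta_gt0 : 0 < delta) (delta_lt1 : delta < 1) (a0_gt0 : 0 < a0).

Local Notation vol := (vol mu).
Local Notation V := (vol setT).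
Local Notation I f := (\int[mu]_x f x).
Local Notation hn := (atomic_H1_norm mu d).
Local Notation creg := (creg mu A1 A2 delta a0 C1).
Local Notation cball := (cball mu A1 A2 a0 C1).
Local Notation cmin := (cmin mu A1 a0).

Let mu_fin := sg_fin G.
Let bg := ball_mu_gt0 G.
Let creg4 : 4 <= creg. Proof. exact: creg_ge4. Qed.
Let creg0 : 0 < creg. Proof. by have := creg4; lra. Qed.
Let cball0 : 0 < cball. Proof. exact: cball_gt0. Qed.

Lemma hn_cube n Q (g : X -> R) (c : R) : E n Q -> measurable_fun setT g -> 0 <= c ->
  (forall x, `|g x| <= c) -> (forall x, ~ Q x -> g x = 0) -> I g = 0 ->
  (hn g <= (c * cball * vol Q)%:E)%E.
Proof.
move=> EQ mg c0 gc gQ ig0.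
have [x [r [r0 QB volB]]] := cube_in_ball G DC delta_gt0 delta_lt1 a0_gt0 EQ.
apply: le_trans (@hn_bounded _ _ _ mu d (sg_gt0 G) mu_fin (sg_ball G) bg g c x r mg r0 c0 gc _ ig0) _.
  by move=> y nB; apply: gQ => /QB.
by rewrite lee_fin -mulrA ler_wpM2l.
Qed.

Lemma variance (f : X -> R) (P : set X) : bm f -> measurable P -> 0 < vol P ->
  let m := I (fun x => f x * \1_P x) / vol P in
  I (fun x => (f x - m) * \1_P x) = 0 /\
  I (fun x => (f x - m) ^+ 2 * \1_P x) = I (fun x => f x ^+ 2 * \1_P x) - m ^+ 2 * vol P.
Proof.
move=> bf mP P0 m; have b1 := bm_indic (R := R) mP.
have i1 := bm_ig mu_fin (bmM bf b1); have i2 := bm_ig mu_fin b1.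
have i3 := bm_ig mu_fin (bmM (bmX 2 bf) b1).
have mE : I (fun x => f x * \1_P x) = m * vol P by rewrite /m divfK// lt0r_neq0.
split.
  transitivity (I (fun x => f x * \1_P x - m * \1_P x)).
    by apply: eq_Rintegral => x _; rewrite mulrBl.
  rewrite IB ?IZ ?I_indic//; last exact: igZ.
  by rewrite mE subrr.
transitivity (I (fun x => f x ^+ 2 * \1_P x + ((- (2 * m)) * (f x * \1_P x) + m ^+ 2 * \1_P x))).
  by apply: eq_Rintegral => x _; lra.
rewrite ID ?ID ?IZ ?I_indic//; try by [exact: igZ|apply: igD; exact: igZ].
by rewrite mE; lra.
Qed.

Lemma avg_sqr_le (f : X -> R) (P : set X) : bm f -> measurable P -> 0 < vol P ->
  (I (fun x => f x * \1_P x) / vol P) ^+ 2 * vol P <= I (fun x => f x ^+ 2 * \1_P x).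
Proof.
move=> bf mP P0; have [_] := variance bf mP P0; rewrite -subr_ge0 => <-.
apply: I_ge0 => x; rewrite mulr_ge0 ?sqr_ge0// indicE; by case: (_ \in _).
Qed.

Variable g0 : X -> R.
Hypothesis bg0 : bm g0.
Variables (N : nat) (om : R).
Hypothesis om_ge0 : 0 <= om.
Hypothesis g0_osc : forall Q x y, E N Q -> Q x -> Q y -> `|g0 x - g0 y| <= om.

(** One stopping cube costs half of this constant. The recursion inside it costs at most a quarter,
    by the value 4 in [creg], so that the induction closes. *)
Definition kcz : R := 2 * creg ^+ 2 * cball.

Let kcz0 : 0 < kcz.
Proof. by rewrite /kcz !mulr_gt0. Qed.

Let sq (a : R) (P : set X) := I (fun x => (g0 x - a) ^+ 2 * \1_P x).
Let av (P : set X) := I (fun x => g0 x * \1_P x) / vol P.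

Let bga a : bm (fun x => g0 x - a).
Proof. by apply: bmB => //; exact: bm_cst. Qed.

Let sq_ge0 a P : 0 <= sq a P.
Proof.
by apply: I_ge0 => x; rewrite mulr_ge0 ?sqr_ge0// indicE; case: (_ \in _).
Qed.

Let avE a n P : E n P -> I (fun x => (g0 x - a) * \1_P x) / vol P = av P - a.
Proof.
move=> EP; have mP := cube_measurable DC EP.
have P0 := vol_cube_gt0 G DC delta_gt0 delta_lt1 a0_gt0 EP.
have b1 := bm_indic (R := R) mP.
have -> : I (fun x => (g0 x - a) * \1_P x) = I (fun x => g0 x * \1_P x) - a * vol P; last first.
  by rewrite mulrBl mulfK// lt0r_neq0.
transitivity (I (fun x => g0 x * \1_P x - a * \1_P x)).
  by apply: eq_Rintegral => x _; rewrite mulrBl.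
rewrite IB ?IZ ?I_indic//; try exact: bm_ig.
  exact: (bm_ig mu_fin (bmM bg0 b1)).
exact: (bm_ig mu_fin (bmZ _ b1)).
Qed.

Let dev a n P : E n P ->
  [/\ (av P - a) ^+ 2 * vol P <= sq a P, sq (av P) P <= sq a P &
      I (fun x => (g0 x - av P) * \1_P x) = 0].
Proof.
move=> EP; have mP := cube_measurable DC EP.
have P0 := vol_cube_gt0 G DC delta_gt0 delta_lt1 a0_gt0 EP.
have := avg_sqr_le (bga a) mP P0; rewrite (avE a EP) => h1.
have := variance (bga a) mP P0; rewrite /= (avE a EP) => -[h2 h3].
split=> //.
  rewrite (_ : sq (av P) P = sq a P - (av P - a) ^+ 2 * vol P).
    by rewrite gerBl mulr_ge0 ?sqr_ge0// ltW.
  by rewrite -[RHS]h3; apply: eq_Rintegral => x _; congr (_ ^+ 2 * _); lra.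
by rewrite -[RHS]h2; apply: eq_Rintegral => x _; congr (_ * _); lra.
Qed.

Let osc_av n P x : n = N -> E n P -> P x -> `|g0 x - av P| <= om.
Proof.
move=> nN EP Px; have mP := cube_measurable DC EP.
have P0 := vol_cube_gt0 G DC delta_gt0 delta_lt1 a0_gt0 EP.
have b1 := bm_indic (R := R) mP.
have := avE (g0 x) EP; rewrite distrC => <-.
rewrite normrM normfV (ger0_norm (ltW P0)) ler_pdivrMr//.
apply: le_trans (I_norm (bm_ig mu_fin (bmM (bga (g0 x)) b1))) _.
rewrite -(I_indic mu mP) -(IZ om (bm_ig mu_fin b1)).
apply: I_le.
- exact: (bm_ig mu_fin (bm_norm (bmM (bga (g0 x)) b1))).
- exact: (bm_ig mu_fin (bmZ _ b1)).
move=> y; rewrite normrM indicE; case: (boolP (y \in P)) => [|_]; last by rewrite normr0 !mulr0.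
by rewrite inE => Py; rewrite normr1 !mulr1 (g0_osc (Q := P))// -nN.
Qed.

(* [g1] replaces [g0 - a] on [Q]: same integral, bounded by the stopping height, and the
   difference is a sum of atoms of controlled total mass. *)
Let good (Q : set X) (a u : R) (g1 : X -> R) :=
  [/\ measurable_fun setT g1, forall x, ~ Q x -> g1 x = 0,
      forall x, `|g1 x| <= creg * u,
      I g1 = I (fun x => (g0 x - a) * \1_Q x) &
      (hn (fun x => (g0 x - a) * \1_Q x - g1 x)%R <=
        (kcz / u * sq a Q + cball * om * vol Q)%:E)%E].

(** The pieces are disjoint and fill D up to a null set: uniform bounds are preserved while costs
    add up. The set W records where the glued function may be nonzero; it is Q in the recursion and
    a ball at the end, where D is the whole space. *)
Let glue (s : seq (set X)) (D W : set X) a u : 0 < u -> measurable D -> uniq s ->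
  (forall P, P \in s -> measurable P /\ P `<=` D) ->
  (forall P Q, P \in s -> Q \in s -> P `&` Q !=set0 -> P = Q) ->
  mu.-negligible (D `\` \bigcup_(P in [set` s]) P) ->
  (forall P, P \in s -> exists g1, good P a u g1 /\ forall x, ~ W x -> g1 x = 0) ->
  exists g1, good D a u g1 /\ forall x, ~ W x -> g1 x = 0.
Proof.
move=> u0 mD us sD disj neg ex.
have part f : ig mu f -> {ae mu, forall x, f x * \1_D x = \sum_(P <- s) f x * \1_P x} /\
    I (fun x => f x * \1_D x) = \sum_(P <- s) I (fun x => f x * \1_P x).
  by move=> igf; apply: (I_partition mu_fin igf mD us sD disj neg).
have /choice[G1 hG1] : forall P : set X, exists g1 : X -> R,
    if P \in s then good P a u g1 /\ (forall x, ~ W x -> g1 x = 0) else g1 = cst 0.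
  move=> P; case: (boolP (P \in s)) => [Ps|_]; last by exists (cst 0).
  by have [g1 ?] := ex _ Ps; exists g1.
have cu0 : 0 <= creg * u by rewrite mulr_ge0// ltW.
have G1s P : P \in s -> good P a u (G1 P) by move=> Ps; have := hG1 P; rewrite Ps => -[].
have bG P : bm (G1 P).
  have := hG1 P; case: ifP => [_ [[m _ b _ _] _]|_ ->]; last exact: bm_cst.
  by split=> //; exists (creg * u).
pose Hh P : X -> R := if P \in s then (fun x => (g0 x - a) * \1_P x - G1 P x) else cst 0.
have bH P : bm (Hh P).
  rewrite /Hh; case: ifP => Ps; last exact: bm_cst.
  by apply: (bmB _ (bG P)); apply: (bmM (bga a)); apply: bm_indic; have [] := sD _ Ps.
have bga1 : bm (fun x => (g0 x - a) * \1_D x) by exact: (bmM (bga a) (bm_indic mD)).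
exists (fun x => \sum_(P <- s) G1 P x); split; first split.
- by have [] := bm_sum s bG.
- move=> x nD; rewrite big_seq big1// => P Ps; have [_ -> //] := G1s P Ps.
  by have [_ PD] := sD _ Ps; move=> /PD.
- move=> x; have [[P Ps Px]|nx] := pselect (exists2 P, P \in s & P x).
    rewrite (bigD1_seq P)//= big_seq_cond big1 ?addr0; first by have [_ _ + _ _] := G1s P Ps.
    move=> Q /andP[Qs QP]; have [_ -> //] := G1s Q Qs => Qx.
    by move/eqP : QP; apply; apply: (disj _ _ Qs Ps); exists x.
  rewrite big_seq big1 ?normr0// => P Ps; have [_ -> //] := G1s P Ps.
  by move=> Px; apply: nx; exists P.
- rewrite (Isum mu_fin); last by move=> P; exact: (bm_ig mu_fin (bG P)).
  have [_ ->] := part _ (bm_ig mu_fin (bga a)).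
  by rewrite big_seq [RHS]big_seq; apply: eq_bigr => P Ps; have [_ _ _ + _] := G1s P Ps.
- rewrite (@hn_congr _ _ _ mu d (sg_gt0 G) mu_fin (sg_ball G) bg _ (fun x => \sum_(P <- s) Hh P x)).
  + apply: le_trans (hn_fsum (sg_gt0 G) mu_fin (sg_ball G) bg s (fun P => proj1 (bH P))) _.
    apply: (@le_trans _ _ (\sum_(P <- s) (kcz / u * sq a P + cball * om * vol P)%:E)%E).
      rewrite big_seq [leRHS]big_seq; apply: lee_sum => P Ps.
      by rewrite /Hh Ps; have [_ _ _ _] := G1s P Ps.
    rewrite sumEFin lee_fin big_split/= -!mulr_sumr.
    have [_ sqE] := part _ (bm_ig mu_fin (bmX 2 (bga a))).
    rewrite [sq a D]/sq sqE lerD2l ler_wpM2l ?mulr_ge0 ?(ltW cball0)//.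
    exact: (sum_vol_le G).
  + by have [] := bmB bga1 (bm_sum s bG).
  + by have [] := bm_sum s bH.
  + have [ae _] := part _ (bm_ig mu_fin (bga a)).
    apply: filterS ae => x ->; rewrite -sumrB big_seq [RHS]big_seq.
    by apply: eq_bigr => P Ps; rewrite /Hh Ps.
- move=> x nW; rewrite big_seq big1// => P Ps.
  by have := hG1 P; rewrite Ps => -[_]; exact.
Qed.

(* Downward induction to the level [N], where [g0] is almost constant on cubes: a child [P]
   whose mean square of [g0 - a] exceeds [u ^+ 2] is treated by induction around its own average
   [av P]. *)
Let cz_step i : forall n Q a u, (n + i = N)%N -> E n Q -> 0 < u ->
  sq a Q <= u ^+ 2 * vol Q -> exists g1, good Q a u g1.
Proof.
elim: i => [|i IH] n Q a u nN EQ u0 hu.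
  rewrite addn0 in nN; have mQ := cube_measurable DC EQ.
  have Q0 := vol_cube_gt0 G DC delta_gt0 delta_lt1 a0_gt0 EQ.
  have b1 := bm_indic (R := R) mQ.
  have [h1 h2 h3] := dev a EQ.
  have mle : `|av Q - a| <= u.
    rewrite -(@ler_pXn2r _ 2)// ?nnegrE// ?(ltW u0)// real_normK ?num_real//.
    by rewrite -(ler_pM2r Q0); exact: le_trans hu.
  (* At the last level the good part is the average; the rest has mean zero and is bounded by [om],
     hence is a multiple of an atom on a ball around Q. *)
  exists (fun x => (av Q - a) * \1_Q x); split.
  - by have [] := bmZ (av Q - a) b1.
  - by move=> x nQ; rewrite indicE memNset ?mulr0.
  - move=> x; rewrite normrM indicE; case: (_ \in _); rewrite ?normr1 ?normr0 ?mulr1 ?mulr0.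
      by apply: le_trans mle _; rewrite ler_peMl ?(ltW u0)//; have := creg4; lra.
    by rewrite mulr_ge0// ltW.
  - rewrite (IZ _ (bm_ig mu_fin b1)) I_indic//.
    by rewrite -(avE a EQ) divfK// lt0r_neq0.
  have -> : (fun x => (g0 x - a) * \1_Q x - (av Q - a) * \1_Q x) =
      (fun x => (g0 x - av Q) * \1_Q x) by apply/funext => x; lra.
  apply: le_trans (hn_cube (c := om) EQ _ om_ge0 _ _ h3) _.
  - by have [] := bmM (bga (av Q)) b1.
  - move=> x; rewrite normrM indicE; case: (boolP (x \in Q)) => [|_]; last by rewrite normr0 mulr0.
    by rewrite inE => Qx; rewrite normr1 mulr1; exact: (osc_av nN EQ Qx).
  - by move=> x nQ; rewrite indicE memNset ?mulr0.
  by rewrite lee_fin (mulrC om) lerDr mulr_ge0 ?sq_ge0// divr_ge0// ltW.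
have mQ := cube_measurable DC EQ.
have nN' : (n.+1 + i = N)%N by rewrite addSnnS.
have child P : P \in kids E n Q -> exists g1, good P a u g1.
  move=> /(kidsP G DC delta_gt0 delta_lt1 a0_gt0)[EP PQ].
  have mP := cube_measurable DC EP.
  have P0 := vol_cube_gt0 G DC delta_gt0 delta_lt1 a0_gt0 EP.
  have b1 := bm_indic (R := R) mP.
  (* A child with small mean square is not stopped and keeps both a and u. *)
  have [small|big] := leP (sq a P) (u ^+ 2 * vol P); first exact: (IH n.+1 P a u nN' EP u0 small).
  have PQle : sq a P <= sq a Q.
    apply: I_le.
    - exact: (bm_ig mu_fin (bmM (bmX 2 (bga a)) b1)).
    - exact: (bm_ig mu_fin (bmM (bmX 2 (bga a)) (bm_indic mQ))).
    - move=> x; apply: ler_wpM2l; first exact: sqr_ge0.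
      rewrite !indicE; case: (boolP (x \in P)) => // /[!inE] /PQ Qx.
      by rewrite mem_set.
  have volQP := vol_parent G DC delta_gt0 delta_lt1 a0_gt0 EQ EP PQ.
  (* The parent was not stopped, so by comparison of volumes P satisfies the bound with the height
     multiplied by [creg]. *)
  have JP : sq a P <= (creg * u) ^+ 2 * vol P.
    apply: le_trans PQle _; apply: le_trans hu _.
    apply: (@le_trans _ _ (u ^+ 2 * (creg * vol P))); first by rewrite ler_wpM2l ?sqr_ge0.
    rewrite exprMn mulrA (mulrC (u ^+ 2)) ler_pM2r// ler_wpM2r ?sqr_ge0//.
    by rewrite expr2 ler_peMl ?(ltW creg0)//; have := creg4; lra.
  have [h1 h2 h3] := dev a EP.
  have cu0 : 0 < creg * u by rewrite mulr_gt0.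
  have mle : `|av P - a| <= creg * u.
    rewrite -(@ler_pXn2r _ 2)// ?nnegrE// ?(ltW cu0)// real_normK ?num_real//.
    by rewrite -(ler_pM2r P0); exact: le_trans JP.
  (* The recursion is centred at the average over P; its good part [g2] has therefore mean zero and
     is itself a multiple of an atom. *)
  have [g2 [mg2 g2P g2c Ig2 hg2]] := IH n.+1 P (av P) (creg * u) nN' EP cu0 (le_trans h2 JP).
  exists (fun x => (av P - a) * \1_P x); split.
  - by have [] := bmZ (av P - a) b1.
  - by move=> x nP; rewrite indicE memNset ?mulr0.
  - move=> x; rewrite normrM indicE; case: (_ \in _); rewrite ?normr1 ?normr0 ?mulr1 ?mulr0//.
    exact: ltW.
  - rewrite (IZ _ (bm_ig mu_fin b1)) I_indic//.
    by rewrite -(avE a EP) divfK// lt0r_neq0.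
  have -> : (fun x => (g0 x - a) * \1_P x - (av P - a) * \1_P x) =
      (fun x => ((g0 x - av P) * \1_P x - g2 x) + g2 x) by apply/funext => x; lra.
  have mga : measurable_fun setT (fun x => (g0 x - av P) * \1_P x).
    by have [] := bmM (bga (av P)) b1.
  apply: le_trans (hnD (sg_gt0 G) mu_fin (sg_ball G) bg (measurable_funB mga mg2) mg2) _.
  have cu2 : 0 <= creg * (creg * u) by rewrite mulr_ge0// ltW.
  have hg2' := hn_cube EP mg2 cu2 g2c g2P (etrans Ig2 h3).
  apply: le_trans (leeD hg2 hg2') _; rewrite -EFinD lee_fin.
  have volP : vol P <= sq a P / u ^+ 2.
    by rewrite ler_pdivlMr ?exprn_gt0// mulrC ltW.
  have e1 : kcz / (creg * u) * sq (av P) P <= kcz / creg * (sq a P / u).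
    have -> : kcz / (creg * u) * sq (av P) P = kcz / creg * (sq (av P) P / u).
      by rewrite invfM; lra.
    rewrite ler_wpM2l ?divr_ge0 ?(ltW kcz0) ?(ltW creg0)//.
    by rewrite ler_wpM2r ?invr_ge0 ?(ltW u0).
  have e2 : creg * (creg * u) * cball * vol P <= creg ^+ 2 * cball * (sq a P / u).
    have -> : creg ^+ 2 * cball * (sq a P / u) = creg * (creg * u) * cball * (sq a P / u ^+ 2).
      rewrite expr2 [in RHS]expr2 invfM; have := divff (lt0r_neq0 u0).
      move: (u^-1) => v uv; transitivity (creg * creg * cball * sq a P * v * (u * v)); last lra.
      by rewrite uv; lra.
    by rewrite ler_wpM2l// mulr_ge0// ltW.
  have e3 : kcz / creg <= kcz / 4.
    by rewrite ler_wpM2l ?(ltW kcz0)// lef_pV2 ?posrE.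
  have S0 : 0 <= sq a P / u by rewrite divr_ge0 ?sq_ge0// ltW.
  have e4 := ler_wpM2r S0 e3.
  have -> : kcz / u * sq a P = kcz * (sq a P / u) by rewrite mulrAC mulrA.
  have : creg ^+ 2 * cball * (sq a P / u) = kcz / 2 * (sq a P / u) by rewrite /kcz; lra.
  have : 0 <= kcz * (sq a P / u) by rewrite mulr_ge0// ltW.
  by move: e1 e2 e4; lra.
have [] // := @glue (kids E n Q) Q Q a u u0 mQ (kids_uniq _ _ _).
- move=> P /(kidsP G DC delta_gt0 delta_lt1 a0_gt0)[EP PQ]; split=> //.
  exact: (cube_measurable DC EP).
- move=> P P' /(kidsP G DC delta_gt0 delta_lt1 a0_gt0)[EP _].
  move=> /(kidsP G DC delta_gt0 delta_lt1 a0_gt0)[EP' _]; exact: (cube_eq DC EP EP').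
- apply: negligibleS (dc_cover DC n.+1) => x [Qx nx] [P EP Px]; apply: nx.
  exists P => //; apply/(kidsP G DC delta_gt0 delta_lt1 a0_gt0); split=> //.
  by apply: (cube_nested DC (leqnSn n) EP EQ); exists x.
- move=> P Pk; have [g1 g1P] := child P Pk; exists g1; split=> // x nQ.
  move: Pk => /(kidsP G DC delta_gt0 delta_lt1 a0_gt0)[EP PQ].
  by have [_ -> //] := g1P; move=> /PQ.
by move=> g1 []; exists g1.
Qed.

(** The recursion starts from all cubes of level n with a = 0. As their volumes are at least [cmin]
    delta^n, the height u = t max(1, 1/cmin) dominates the mean square on each of them. The good
    part that remains is bounded, has mean zero and lives in B, so it is one multiple of an atom. *)
Lemma cz_osc n (B : set X) (Cv t : R) : (n <= N)%N -> measurable B ->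
  (exists x r, 0 < r /\ B = qball d x r) -> vol B <= Cv * delta ^+ n ->
  (forall Q, E n Q -> (exists x, Q x /\ g0 x <> 0) -> Q `<=` B) ->
  I g0 = 0 -> 0 < t -> I (fun x => g0 x ^+ 2) <= t ^+ 2 * delta ^+ n ->
  (hn g0 <= ((creg * Num.max 1 cmin^-1 * Cv + kcz) * t * delta ^+ n + cball * V * om)%:E)%E.
Proof.
move=> nN mB [z [r [r0 BE]]] volB QB Ig0 t0 ht.
have dn : 0 < delta ^+ n by exact: exprn_gt0.
have cm0 : 0 < cmin by exact: (cmin_gt0 G a0_gt0).
pose w := Num.max 1 cmin^-1; have w1 : 1 <= w by rewrite le_max lexx.
have w0 : 0 < w by apply: lt_le_trans w1.
pose u := t * w; have u0 : 0 < u by rewrite mulr_gt0.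
have sqQ Q : E n Q -> sq 0 Q <= u ^+ 2 * vol Q.
  move=> EQ; have mQ := cube_measurable DC EQ.
  apply: (@le_trans _ _ (I (fun x => g0 x ^+ 2))).
    apply: I_le.
    - exact: (bm_ig mu_fin (bmM (bmX 2 (bga 0)) (bm_indic mQ))).
    - exact: (bm_ig mu_fin (bmX 2 bg0)).
    - move=> x; rewrite subr0 indicE; case: (_ \in _); rewrite ?mulr1// mulr0.
      exact: sqr_ge0.
  apply: le_trans ht _; have -> : u ^+ 2 * vol Q = t ^+ 2 * (w ^+ 2 * vol Q) by rewrite /u; lra.
  rewrite ler_wpM2l ?sqr_ge0//.
  apply: (@le_trans _ _ (w ^+ 2 * (cmin * delta ^+ n))); last first.
    rewrite ler_wpM2l ?sqr_ge0//; exact: (vol_cube_ge G DC delta_gt0 delta_lt1 a0_gt0 EQ).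
  rewrite mulrA ler_peMl ?(ltW dn)//.
  have : w * w * cmin >= 1 * cmin^-1 * cmin.
    rewrite ler_pM2r//; apply: ler_pM => //; first by rewrite invr_ge0 ltW.
    by rewrite le_max lexx orbT.
  by rewrite mul1r mulVf ?lt0r_neq0.
have mT : measurable [set: X] by [].
have [] // := @glue (cubes E n) setT B 0 u u0 mT (cubes_uniq _ _).
- by move=> P /(cubesP G DC delta_gt0 delta_lt1 a0_gt0) EP; split=> //; exact: (cube_measurable DC EP).
- move=> P P' /(cubesP G DC delta_gt0 delta_lt1 a0_gt0) EP.
  move=> /(cubesP G DC delta_gt0 delta_lt1 a0_gt0) EP'; exact: (cube_eq DC EP EP').
- apply: negligibleS (dc_cover DC n) => x [_ nx] [P EP Px]; apply: nx.
  by exists P => //; apply/(cubesP G DC delta_gt0 delta_lt1 a0_gt0).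
- move=> Q /(cubesP G DC delta_gt0 delta_lt1 a0_gt0) EQ.
  (* On a cube where g0 vanishes the good part is taken to be zero, which keeps its support inside
     B. *)
  have [act|nact] := pselect (exists x, Q x /\ g0 x <> 0).
    have [g1 g1P] := cz_step (subnKC nN) EQ u0 (sqQ Q EQ).
    exists g1; split=> // x nB; have [_ -> //] := g1P.
    by move=> Qx; apply: nB; exact: (QB Q EQ act).
  have z0 : (fun x => (g0 x - 0) * \1_Q x) = cst 0.
    apply/funext => x; rewrite subr0 indicE; case: (boolP (x \in Q)) => [|_]; last by rewrite mulr0.
    rewrite inE => Qx; rewrite mulr1; apply: contrapT => gx; apply: nact; by exists x.
  exists (cst 0); split=> //; split=> //.
  + by move=> x; rewrite normr0 mulr_ge0// ltW.
  + by rewrite z0.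
  + rewrite [X in hn X](_ : _ = cst 0); last first.
      by apply/funext => x; have /= -> := congr1 (fun f : X -> R => f x) z0; rewrite subr0.
    rewrite hn0 lee_fin addr_ge0// mulr_ge0 ?vol_ge0//.
      by rewrite divr_ge0// ltW.
    by rewrite mulr_ge0// ltW.
move=> g1 [[mg1 _ g1c Ig1 hg1] g1B].
have oneT (f : X -> R) : (fun x => f x * \1_[set: X] x) = f.
  by apply/funext => x; rewrite indicE mem_set// mulr1.
have g00 : (fun x => g0 x - 0) = g0 by apply/funext => x; rewrite subr0.
have cu0 : 0 <= creg * u by rewrite mulr_ge0// ltW.
have hg1' : (hn g1 <= (creg * u * vol B)%:E)%E.
  rewrite BE; apply: (hn_bounded (sg_gt0 G) mu_fin (sg_ball G) bg mg1 r0 cu0 g1c).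
  - by move=> x; rewrite -BE; exact: g1B.
  - by rewrite Ig1 (oneT (fun x => g0 x - 0)) g00.
have mg0 : measurable_fun setT g0 by case: bg0.
have -> : g0 = (fun x => ((g0 x - 0) * \1_[set: X] x - g1 x) + g1 x).
  by apply/funext => x; rewrite indicE mem_set//= subr0 mulr1 subrK.
apply: le_trans (hnD (sg_gt0 G) mu_fin (sg_ball G) bg _ mg1) _.
  by apply: measurable_funB mg1; have [] := bmM (bga 0) (bm_indic (R := R) mT).
apply: le_trans (leeD hg1 hg1') _; rewrite -EFinD lee_fin.
have -> : sq 0 setT = I (fun x => g0 x ^+ 2).
  by apply: eq_Rintegral => x _; rewrite subr0 indicE mem_set// mulr1.
have e1 : kcz / u * I (fun x => g0 x ^+ 2) <= kcz * t * delta ^+ n.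
  have -> : kcz / u * I (fun x => g0 x ^+ 2) = kcz * (I (fun x => g0 x ^+ 2) / u) by lra.
  rewrite -[leRHS]mulrA ler_wpM2l ?(ltW kcz0)// ler_pdivrMr//.
  apply: le_trans ht _; have -> : t ^+ 2 * delta ^+ n = t * delta ^+ n * t by lra.
  by rewrite ler_wpM2l ?mulr_ge0 ?(ltW t0) ?(ltW dn)// /u ler_peMr// ltW.
have e2 : creg * u * vol B <= creg * w * Cv * t * delta ^+ n.
  have := ler_wpM2l cu0 volB; rewrite /u; lra.
by move: e1 e2; rewrite -/w; lra.
Qed.

End calderon_zygmund.

Section cz.
Context {R : realType} {disp : measure_display} {X : measurableType disp}.
Variables (mu : {measure set X -> \bar R}) (d : X -> X -> R).
Variables (kap A1 A2 K1 K2 : R).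
Hypothesis G : space_geometry mu d kap A1 A2 K1 K2.
Variables (delta a0 eta C1 C2 : R) (E : nat -> set (set X)).
Hypothesis DC : dyadic_cubes mu d delta a0 eta C1 C2 E.
Hypotheses (delta_gt0 : 0 < delta) (delta_lt1 : delta < 1) (a0_gt0 : 0 < a0).

Definition ccz (Cv : R) : R :=
  creg mu A1 A2 delta a0 C1 * Num.max 1 (cmin mu A1 a0)^-1 * Cv + kcz mu A1 A2 delta a0 C1.

Lemma ccz_ge0 Cv : 0 <= Cv -> 0 <= ccz Cv.
Proof.
have h := creg_ge4 mu A1 A2 delta a0 C1; have h' := cball_gt0 mu A1 A2 a0 C1.
have r0 : 0 <= creg mu A1 A2 delta a0 C1 by lra.
move=> Cv0; rewrite /ccz addr_ge0//; first by rewrite !mulr_ge0// le_max ler01.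
by rewrite /kcz !mulr_ge0// ltW.
Qed.

(** Choosing the final level N ever finer makes the oscillation term arbitrarily small, and nothing
    else depends on N. *)
Lemma cz_ball (g0 : X -> R) n (B : set X) (Cv t : R) : bm g0 ->
  (forall om, 0 < om -> exists N, (n <= N)%N /\
    forall Q x y, E N Q -> Q x -> Q y -> `|g0 x - g0 y| <= om) ->
  (exists x r, 0 < r /\ B = qball d x r) -> vol mu B <= Cv * delta ^+ n ->
  (forall Q, E n Q -> (exists x, Q x /\ g0 x <> 0) -> Q `<=` B) ->
  \int[mu]_x g0 x = 0 -> 0 < t -> \int[mu]_x (g0 x ^+ 2) <= t ^+ 2 * delta ^+ n ->
  (atomic_H1_norm mu d g0 <= (ccz Cv * t * delta ^+ n)%:E)%E.
Proof.
move=> bg0 osc Bball volB QB Ig0 t0 ht; apply/lee_addgt0Pr => e e0.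
pose c := cball mu A1 A2 a0 C1 * vol mu setT.
have c0 : 0 < c by rewrite mulr_gt0 ?cball_gt0 ?(vol_T_gt0 G).
have [N [nN oscN]] := osc (e / c) (divr_gt0 e0 c0).
have mB : measurable B by have [x [r [_ ->]]] := Bball; exact: (sg_ball G).
apply: le_trans (cz_osc G DC delta_gt0 delta_lt1 a0_gt0 bg0 (ltW (divr_gt0 e0 c0)) oscN
  nN mB Bball volB QB Ig0 t0 ht) _.
by rewrite -EFinD lee_fin -/c (mulrCA c) divff ?mulr1 ?lt0r_neq0.
Qed.

End cz.

(** * Partitions of unity and smoothing *)

Lemma sum_undup_cat (V : nmodType) (T : eqType) (s t : seq T) (f : T -> V) : uniq s ->
  \sum_(k <- undup (s ++ t)) f k = \sum_(k <- s) f k + \sum_(k <- undup (s ++ t) | k \notin s) f k.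
Proof.
move=> us; rewrite (bigID (mem s))/=; congr (_ + _).
rewrite -big_filter; apply: perm_big; apply: uniq_perm => //.
  by rewrite filter_uniq// undup_uniq.
by move=> k; rewrite mem_filter mem_undup mem_cat; case: (k \in s).
Qed.

Lemma norm_le_sqr (R : rcfType) (a b : R) : 0 <= b -> a ^+ 2 <= b ^+ 2 -> `|a| <= b.
Proof.
by move=> b0 ab; rewrite -sqrtr_sqr -[leRHS](ger0_norm b0) -(sqrtr_sqr b) ler_wsqrtr.
Qed.

Section norm2_tools.
Context {R : realType} {disp : measure_display} {X : measurableType disp}.
Variable mu : {measure set X -> \bar R}.
Hypothesis mu_fin : (mu setT < +oo)%E.
Local Notation I f := (\int[mu]_x f x).

Lemma Lnorm2E (f : X -> R) : measurable_fun setT f ->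
  ('N[mu]_2%:E[EFin \o f] = sqrte (\int[mu]_x (f x ^+ 2)%:E))%E.
Proof.
move=> mf; rewrite unlock /=.
rewrite poweR12_sqrt; last by apply: integral_ge0 => x _; rewrite lee_fin powR_ge0.
congr sqrte; apply: eq_integral => x _ /=.
by rewrite powR_mulrn// real_normK// num_real.
Qed.

Lemma norm2E (f : X -> R) : bm f -> norm2 mu f = Num.sqrt (I (fun x => f x ^+ 2)).
Proof.
move=> bf; have [mf _] := bf; rewrite /norm2 Lnorm2E//.
have := bm_ig mu_fin (bmX 2 bf) => /integrable_fin_num h.
rewrite /Rintegral; case: (\int[mu]_x _)%E (h measurableT) => //=.
Qed.

Lemma norm2_sqr (f : X -> R) : bm f -> norm2 mu f ^+ 2 = I (fun x => f x ^+ 2).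
Proof. by move=> bf; rewrite norm2E// sqr_sqrtr// I_ge0// => x; exact: sqr_ge0. Qed.

End norm2_tools.

Section partition_of_unity.
Context {R : realType} {disp : measure_display} {X : measurableType disp}.
Variables (mu : {measure set X -> \bar R}) (d : X -> X -> R).
Variables (kap A1 A2 K1 K2 : R).
Hypothesis G : space_geometry mu d kap A1 A2 K1 K2.
Variables (psi : nat -> X -> R) (M : nat) (r beta : R).
Hypotheses (r_gt0 : 0 < r) (beta_gt0 : 0 < beta).
Hypothesis psi_m : forall k, measurable_fun setT (psi k) /\ (forall x, 0 <= psi k x).
Hypothesis psi_M : forall x, ([set k | psi k x != 0%R] #<= `I_M)%card.
Hypothesis psi_one : forall x, \sum_(k \in [set: nat]) psi k x = 1.
Hypothesis psi_diam : forall k, (qdiam d [set x | psi k x != 0%R] <= r%:E)%E.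
Hypothesis psi_lip : forall k, (lip_seminorm d beta (psi k) <= (r `^ (- beta))%:E)%E.

Local Notation I f := (\int[mu]_x f x).
Local Notation vol := (vol mu).
Let mu_fin := sg_fin G.
Let psi_ge0 k x : 0 <= psi k x. Proof. by have [_] := psi_m k. Qed.

Let spt x : seq nat := fset_set [set k | psi k x != 0%R].

Let sptP x k : (k \in spt x) = (psi k x != 0).
Proof.
have fs : finite_set [set k | psi k x != 0%R].
  by apply: (card_le_finite (psi_M x)); exact: finite_II.
by rewrite in_fset_set//; apply/idP/idP; rewrite inE.
Qed.

Let size_spt x : (size (spt x) <= M)%N.
Proof. exact: geq_card_fset_set (psi_M x). Qed.

Lemma psi_sum (s : seq nat) x (m : nat -> R) : uniq s -> (forall k, psi k x != 0 -> k \in s) ->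
  \sum_(k \in [set: nat]) psi k x * m k = \sum_(k <- s) psi k x * m k.
Proof.
move=> us hs; rewrite (@fsbigE _ _ _ _ _ s)//.
  by apply: eq_bigl => k; rewrite in_setT.
by move=> k _; apply: contraNeq; rewrite mulf_eq0 negb_or => /andP[/hs].
Qed.

Let spt_sum x m : \sum_(k \in [set: nat]) psi k x * m k = \sum_(k <- spt x) psi k x * m k.
Proof. by apply: psi_sum; [exact: fset_uniq|move=> k; rewrite sptP]. Qed.

Lemma psi_sum1 (s : seq nat) x : uniq s -> (forall k, psi k x != 0 -> k \in s) ->
  \sum_(k <- s) psi k x = 1.
Proof.
move=> us hs; rewrite -[RHS](psi_one x); have := psi_sum (fun=> 1) us hs.
under eq_fsbigr do rewrite mulr1.
by move=> ->; apply: eq_bigr => k _; rewrite mulr1.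
Qed.

Lemma psi_le1 k x : psi k x <= 1.
Proof.
have [->|kx] := eqVneq (psi k x) 0; first exact: ler01.
rewrite -(@psi_sum1 (spt x) x) ?fset_uniq//; last by move=> i; rewrite sptP.
by rewrite (bigD1_seq k) ?fset_uniq ?sptP//= lerDl sumr_ge0.
Qed.

Let bpsi k : bm (psi k).
Proof.
by split; [have [] := psi_m k|exists 1 => x; rewrite ger0_norm// psi_le1].
Qed.

Let b2 f k : bm f -> bm (fun y => psi k y * f y). Proof. by move=> bf; exact: bmM. Qed.

Lemma psi_near k x y : psi k x != 0 -> psi k y != 0 -> d x y <= r.
Proof.
move=> kx ky; rewrite -lee_fin; apply: le_trans (psi_diam k).
by apply: ereal_sup_ubound; exists x => //; exists y.
Qed.

Lemma psi_holder k x y : `|psi k x - psi k y| <= r `^ (- beta) * d x y `^ beta.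
Proof.
have [->|xy] := pselect (x = y).
  by rewrite subrr normr0 mulr_ge0// powR_ge0.
have dxy : 0 < d x y.
  by rewrite lt_neqAle (sg_ge0 G) andbT; apply/eqP => /esym/(sg_eq0 G).
rewrite -ler_pdivrMr ?powR_gt0// -lee_fin; apply: le_trans (psi_lip k).
by apply: ereal_sup_ubound; exists (x, y).
Qed.

(** By Hoelder continuity [psi k] stays above half its value at x on a ball of radius r (psi k x /
    2)^(1/beta), which has positive measure. *)
Lemma psi_int_gt0 k x : psi k x != 0 -> 0 < I (psi k).
Proof.
move=> kx; have px : 0 < psi k x by rewrite lt_neqAle eq_sym kx psi_ge0.
pose b := beta^-1; pose e := psi k x / 2.
have e0 : 0 < e by rewrite divr_gt0.
pose q := r * e `^ b; have q0 : 0 < q by rewrite mulr_gt0// powR_gt0.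
have mB := sg_ball G x q.
have B0 : 0 < vol (qball d x q).
  by have := ball_mu_gt0 G x q0; rewrite -(volK mu_fin mB) lte_fin.
apply: (@lt_le_trans _ _ (e * vol (qball d x q))); first exact: mulr_gt0.
rewrite -(I_indic mu mB) -(IZ _ (bm_ig mu_fin (bm_indic mB))).
apply: I_le.
- exact: (bm_ig mu_fin (bmZ _ (bm_indic mB))).
- exact: (bm_ig mu_fin (bpsi k)).
move=> y; rewrite indicE; case: (boolP (y \in _)) => [|_]; last by rewrite mulr0.
rewrite inE mulr1 /qball /= => dy.
have h : `|psi k x - psi k y| <= e.
  apply: le_trans (psi_holder k x y) _.
  apply: (@le_trans _ _ (r `^ (- beta) * q `^ beta)).
    by rewrite ler_wpM2l ?powR_ge0// ge0_ler_powR ?nnegrE ?(sg_ge0 G) ?(ltW q0) ?(ltW dy) ?(ltW beta_gt0).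
  rewrite /q powRM ?(ltW r_gt0) ?powR_ge0// mulrA -powRD; last first.
    by rewrite (gt_eqF r_gt0) implybT.
  by rewrite addNr powRr0 mul1r -powRrM /b mulVf ?gt_eqF// powRr1 ?(ltW e0).
by have := ler_norm (psi k x - psi k y); move: h; rewrite /e; lra.
Qed.

(** The sum of the psi k is finite at each point, but infinitely many of them may be nonzero
    functions. Their series converges in L^1, which justifies integration term by term in
    [I_smooth]. *)
Lemma psi_tail (e : R) : 0 < e -> exists K, I (fun x => 1 - \sum_(k < K) psi k x) <= e.
Proof.
move=> e0.
have one x : usum [set: nat] (fun k => psi k x) = 1.
  pose n := (\max_(k <- spt x) k).+1.
  have hn k : psi k x != 0 -> (k < n)%N.
    by rewrite -sptP => ks; rewrite ltnS; apply: (@leq_bigmax_seq _ (spt x) xpredT (fun k => k) k).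
  rewrite (eq_usum (h := fun k => if (k < n)%N then psi k x else 0)); last first.
    by move=> k _; case: ifP => // /negbT; apply: contraNeq => /hn.
  rewrite usum_nat_fin; apply: psi_sum1; first exact: iota_uniq.
  by move=> k /hn kn; rewrite mem_index_iota.
have mp k := proj1 (psi_m k).
have fin_sum : (\esum_(k in [set: nat]) n1 mu (psi k) < +oo)%E.
  apply: le_lt_trans (_ : (\int[mu]_x 1%:E < +oo)%E); last by rewrite integral_cst// mul1e.
  rewrite -n1_esum//; apply: ge0_le_integral => //.
  - by move=> x _; exact: asum_ge0.
  - exact: measurable_asum.
  move=> x _; apply: esum_le_seq => s us _; rewrite sumEFin lee_fin.
  under eq_bigr do rewrite ger0_norm//.
  rewrite -(@psi_sum1 (undup (s ++ spt x)) x) ?undup_uniq//; last first.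
    by move=> k; rewrite mem_undup mem_cat sptP => ->; rewrite orbT.
  by rewrite sum_undup_cat// lerDl sumr_ge0.
have cv := esum_shift_cvg0 (fun k => n1_ge0 mu (psi k)) fin_sum.
have /fine_cvgP[_ /cvgrPdist_lt /(_ e e0)] := cv.
have fin_near : \forall n \near \oo, (\esum_(k in [set: nat]) n1 mu (psi (n + k)%N) \is a fin_num)%E.
  by have /fine_cvgP[] := cv.
move=> near_e; have := filterI fin_near near_e => -[K _ /(_ K (leqnn K)) [fK]].
rewrite sub0r normrN => hK; exists K.
rewrite -lee_fin.
have bmK : bm (fun x => 1 - \sum_(k < K) psi k x).
  by apply: bmB; [exact: bm_cst|exact: bm_sum].
apply: (@le_trans _ _ (n1 mu (fun x => 1 - \sum_(k < K) psi k x))).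
  rewrite n1_ig; last exact: (bm_ig mu_fin bmK).
  rewrite lee_fin; apply: I_le => [||x]; [exact: (bm_ig mu_fin bmK)|exact: (bm_ig mu_fin (bm_norm bmK))|].
  exact: ler_norm.
have := n1_usum_le K mp fin_sum; under [X in n1 mu X]eq_fun do rewrite one.
move=> /le_trans; apply; rewrite -(fineK fK) lee_fin.
by apply: le_trans (ltW hK); exact: ler_norm.
Qed.

(** * The smoothing operator of a partition of unity *)

Section smoothing.
Variables (h : X -> R) (H : R).
Hypotheses (bh : bm h) (Ih : I h = 0) (H0 : 0 <= H).
Hypothesis hH : {ae mu, forall x, `|h x| <= H}.

Let m k := I (fun y => psi k y * h y) / I (psi k).

Definition smooth (x : X) : R :=
  I (fun y => (\sum_(k \in [set: nat]) psi k x * psi k y / I (psi k)) * h y).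

Lemma smoothE x : smooth x = \sum_(k <- spt x) psi k x * m k.
Proof.
pose f k y := (psi k x / I (psi k)) * (psi k y * h y).
transitivity (I (fun y => \sum_(k <- spt x) f k y)).
  apply: eq_Rintegral => y _.
  have -> : \sum_(k \in [set: nat]) psi k x * psi k y / I (psi k) =
      \sum_(k \in [set: nat]) psi k x * (psi k y / I (psi k)).
    by apply: eq_fsbigr => k _; rewrite mulrA.
  rewrite spt_sum mulr_suml; apply: eq_bigr => k _; rewrite /f; lra.
have bf k : bm (f k) by apply: bmZ; exact: b2.
rewrite (Isum mu_fin); last by move=> k; exact: (bm_ig mu_fin (bf k)).
apply: eq_bigr => k _; rewrite IZ; last exact: (bm_ig mu_fin (b2 k bh)).
by rewrite /m; lra.
Qed.

Lemma smoothE_seq (s : seq nat) x : uniq s -> (forall k, psi k x != 0 -> k \in s) ->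
  smooth x = \sum_(k <- s) psi k x * m k.
Proof. by move=> us hs; rewrite smoothE -spt_sum; exact: psi_sum. Qed.

Lemma m_le k : `|m k| <= H.
Proof.
have [I0|In0] := eqVneq (I (psi k)) 0; first by rewrite /m I0 invr0 mulr0 normr0.
have Ip : 0 < I (psi k) by rewrite lt_neqAle eq_sym In0 I_ge0.
rewrite /m normrM normfV (ger0_norm (ltW Ip)) ler_pdivrMr//.
apply: le_trans (I_norm (bm_ig mu_fin (b2 k bh))) _.
rewrite -(IZ _ (bm_ig mu_fin (bpsi k))).
apply: I_le_ae.
- exact: (bm_ig mu_fin (bm_norm (b2 k bh))).
- exact: (bm_ig mu_fin (bmZ H (bpsi k))).
by apply: filterS hH => x hx; rewrite normrM (ger0_norm (psi_ge0 _ _)) mulrC ler_wpM2r.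
Qed.

Lemma smooth_le x : `|smooth x| <= H.
Proof.
rewrite smoothE; apply: le_trans (ler_norm_sum _ _ _) _.
apply: (@le_trans _ _ (\sum_(k <- spt x) psi k x * H)).
  by apply: ler_sum => k _; rewrite normrM (ger0_norm (psi_ge0 _ _)) ler_wpM2l// m_le.
rewrite -mulr_suml (@psi_sum1 (spt x) x) ?fset_uniq ?mul1r//.
by move=> k; rewrite sptP.
Qed.

Lemma smooth_spt x : smooth x != 0 -> exists y, h y != 0 /\ d x y <= r.
Proof.
rewrite smoothE => sx; apply: contrapT => no.
move/negP : sx; apply; rewrite big_seq big1// => k; rewrite sptP => kx.
rewrite /m (_ : I (fun y => psi k y * h y) = 0) ?mul0r ?mulr0//.
rewrite -[RHS](I0 mu); apply: eq_Rintegral => y _.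
apply/eqP; rewrite mulf_eq0; apply/orP; case: eqP => ky; [by left|right].
apply: contrapT => /negP hy; apply: no; exists y; split=> //.
by apply: (psi_near kx); exact/eqP.
Qed.

(** At most 2 M of the psi k are nonzero at x or at y, and each has an average of h as coefficient,
    bounded by H. *)
Lemma smooth_holder x y : `|smooth x - smooth y| <= 2 * M%:R * H * (d x y / r) `^ beta.
Proof.
pose s := undup (spt x ++ spt y).
have us : uniq s by exact: undup_uniq.
have sx k : psi k x != 0 -> k \in s by rewrite mem_undup mem_cat sptP => ->.
have sy k : psi k y != 0 -> k \in s by rewrite mem_undup mem_cat !sptP => ->; rewrite orbT.
rewrite (smoothE_seq us sx) (smoothE_seq us sy) -sumrB.
apply: le_trans (ler_norm_sum _ _ _) _.
have e k : `|psi k x * m k - psi k y * m k| <= H * (d x y / r) `^ beta.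
  rewrite -mulrBl normrM mulrC ler_pM// ?m_le//.
  apply: le_trans (psi_holder k x y) _.
  rewrite powRM ?(sg_ge0 G) ?invr_ge0 ?(ltW r_gt0)// mulrC -powR_inv1 ?(ltW r_gt0)//.
  by rewrite -powRrM mulN1r.
apply: (@le_trans _ _ (\sum_(k <- s) H * (d x y / r) `^ beta)).
  by apply: ler_sum => k _; exact: e.
rewrite big_const_seq count_predT iter_addr_0 -[leLHS]mulr_natr.
have -> : H * (d x y / r) `^ beta * (size s)%:R = (size s)%:R * (H * (d x y / r) `^ beta) by rewrite mulrC.
rewrite -[leRHS]mulrA ler_wpM2r ?mulr_ge0 ?powR_ge0// -natrM ler_nat (leq_trans (size_undup _))// size_cat mul2n -addnn.
by rewrite leq_add.
Qed.

Lemma bm_smooth : bm smooth.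
Proof.
split; last by exists H; exact: smooth_le.
rewrite (_ : smooth = fun x => usum [set: nat] (fun k => psi k x * m k)).
  apply: measurable_usum => k.
  by have [] := bmM (bpsi k) (bm_cst (m k)).
apply/funext => x; pose n := (\max_(k <- spt x) k).+1.
have hn k : psi k x != 0 -> (k < n)%N.
  by rewrite -sptP => ks; rewrite ltnS; apply: (@leq_bigmax_seq _ (spt x) xpredT (fun k => k) k).
rewrite (eq_usum (h := fun k => if (k < n)%N then psi k x * m k else 0)); last first.
  move=> k _; case: ifP => // /negbT; apply: contraNeq.
  by rewrite mulf_eq0 negb_or => /andP[/hn].
rewrite usum_nat_fin; apply: smoothE_seq; first exact: iota_uniq.
by move=> k /hn kn; rewrite mem_index_iota.
Qed.

(** For the first K functions, replacing h by its averages does not change the integral of sum psi_k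
    h. As h has mean zero, what is left is an error bounded by 2 H times the integral of the tail of
    the partition of unity. *)
Lemma I_smooth : I smooth = 0.
Proof.
apply/eqP; rewrite -normr_eq0 eq_le normr_ge0 andbT.
apply/ler_addgt0Pr => e e0; rewrite add0r.
have H2 : 0 < 2 * H + 1 by move: H0; lra.
have [K hK] := psi_tail (divr_gt0 e0 H2).
pose q x := 1 - \sum_(k < K) psi k x.
have bq : bm q by apply: bmB; [exact: bm_cst|exact: bm_sum].
have bmk k : bm (fun x => m k * psi k x) by exact: bmZ.
have q0 x : 0 <= q x.
  rewrite subr_ge0 -(@psi_sum1 (undup (index_iota 0 K ++ spt x)) x) ?undup_uniq//; last first.
    by move=> k; rewrite mem_undup mem_cat sptP => ->; rewrite orbT.
  rewrite sum_undup_cat ?iota_uniq// big_mkord.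
  by rewrite lerDl sumr_ge0.
pose S1 x := smooth x - \sum_(k < K) m k * psi k x.
have bS : bm (fun x => \sum_(k < K) m k * psi k x) by exact: bm_sum.
have bS1 : bm S1 by apply: bmB bS; exact: bm_smooth.
have S1q x : `|S1 x| <= H * q x.
  pose s := undup (index_iota 0 K ++ spt x).
  have us : uniq s by exact: undup_uniq.
  have ss k : psi k x != 0 -> k \in s by rewrite mem_undup mem_cat sptP => ->; rewrite orbT.
  have split_s (f : nat -> R) : \sum_(k <- s) f k = \sum_(k < K) f k + \sum_(k <- s | k \notin index_iota 0 K) f k.
    by rewrite sum_undup_cat ?iota_uniq// big_mkord.
  have -> : q x = \sum_(k <- s | k \notin index_iota 0 K) psi k x.
    by rewrite /q -[X in X - _](psi_sum1 us ss) split_s [in LHS]addrC addKr.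
  have -> : S1 x = \sum_(k <- s | k \notin index_iota 0 K) psi k x * m k.
    rewrite /S1 (smoothE_seq us ss) split_s addrC addrA (eq_bigr (fun k : 'I_K => psi k x * m k)); last first.
      by move=> k _; rewrite mulrC.
    by rewrite addNr add0r.
  apply: le_trans (ler_norm_sum _ _ _) _; rewrite mulr_sumr.
  by apply: ler_sum => k _; rewrite normrM (ger0_norm (psi_ge0 _ _)) mulrC ler_wpM2r// m_le.
have -> : I smooth = I S1 + I (fun x => - (q x * h x)).
  have i1 : I (fun x => \sum_(k < K) m k * psi k x) = I (fun x => \sum_(k < K) psi k x * h x).
    rewrite (Isum mu_fin); last by move=> k; exact: (bm_ig mu_fin (bmk k)).
    rewrite (Isum mu_fin); last by move=> k; exact: (bm_ig mu_fin (b2 k bh)).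
    apply: eq_bigr => k _; rewrite IZ; last exact: (bm_ig mu_fin (bpsi k)).
    rewrite /m; have [I0k|In0] := eqVneq (I (psi k)) 0; last by rewrite divfK.
    rewrite I0k mulr0 -[LHS](I0 mu); apply: eq_Rintegral => x _.
    have -> : psi k x = 0; last by rewrite mul0r.
    by apply: contrapT => /eqP /psi_int_gt0; rewrite I0k ltxx.
  have b3 : bm (fun x => \sum_(k < K) psi k x * h x) by apply: bm_sum => k; exact: b2.
  have -> : I (fun x => - (q x * h x)) = I (fun x => \sum_(k < K) psi k x * h x) - I h.
    rewrite -(IB (bm_ig mu_fin b3) (bm_ig mu_fin bh)).
    by apply: eq_Rintegral => x _; rewrite /q -mulr_suml; lra.
  rewrite Ih subr0 -i1 -(ID (bm_ig mu_fin bS1) (bm_ig mu_fin bS)).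
  by apply: eq_Rintegral => x _; rewrite /S1 subrK.
have bqh : bm (fun x => - (q x * h x)) by apply: bmN; exact: bmM.
have Hq0 : ig mu (fun x => H * q x) by exact: (bm_ig mu_fin (bmZ H bq)).
apply: (@le_trans _ _ (2 * H * I q)); last first.
  apply: (@le_trans _ _ ((2 * H + 1) * I q)).
    by rewrite ler_wpM2r// ?I_ge0// lerDl.
  by rewrite -ler_pdivlMl// mulrC.
apply: le_trans (ler_normD _ _) _.
have -> : 2 * H * I q = H * I q + H * I q by lra.
rewrite -(IZ H (bm_ig mu_fin bq)); apply: lerD.
  apply: le_trans (I_norm (bm_ig mu_fin bS1)) _.
  by apply: I_le => //; exact: (bm_ig mu_fin (bm_norm bS1)).
apply: le_trans (I_norm (bm_ig mu_fin bqh)) _.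
apply: I_le_ae => //; first exact: (bm_ig mu_fin (bm_norm bqh)).
by apply: filterS hH => x hx; rewrite normrN normrM (ger0_norm (q0 x)) mulrC ler_wpM2r.
Qed.

(** Every psi k that is nonzero at x is supported inside the ball where h = c, so all averages that
    enter at x are equal to c. *)
Lemma smooth_const (P : set X) (c : R) z x (b : R) : (forall y, P y -> h y = c) ->
  qball d z b `<=` P -> d x z < b / (2 * kap) -> r * (2 * kap) < b -> smooth x = c.
Proof.
move=> hc zP dxz rb; have kap1 := sg_kap G; have k0 : 0 < kap by lra.
rewrite smoothE (_ : \sum_(k <- _) _ = \sum_(k <- spt x) psi k x * c).
  rewrite -mulr_suml (@psi_sum1 (spt x) x) ?fset_uniq ?mul1r//.
  by move=> k; rewrite sptP.
rewrite big_seq [RHS]big_seq; apply: eq_bigr => k; rewrite sptP => kx.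
have Ip := psi_int_gt0 kx.
rewrite /m (_ : I (fun y => psi k y * h y) = c * I (psi k)) ?mulfK ?gt_eqF//.
rewrite -IZ; last exact: (bm_ig mu_fin (bpsi k)).
apply: eq_Rintegral => y _; have [->|ky] := eqVneq (psi k y) 0; first by rewrite mul0r mulr0.
rewrite mulrC hc//; apply: zP; rewrite /qball /=.
apply: le_lt_trans (sg_tri G z y x) _.
rewrite mulrC -ltr_pdivlMr// (sg_sym G z x).
have h2 := psi_near kx ky.
have h3 : r < b / (2 * kap) by rewrite ltr_pdivlMr ?mulr_gt0.
by move: dxz h2 h3; rewrite invfM; lra.
Qed.

End smoothing.
End partition_of_unity.

(** * The smoothed Haar functions *)

Lemma fset_two (K : choiceType) (A : {fset K}) : (1 < #|` A|)%N ->
  exists x y, [/\ x \in A, y \in A & x != y].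
Proof.
case eA : (enum_fset A) => [|x [|y s]]; rewrite /= ?eA// => _.
have us := fset_uniq A; rewrite eA /= inE negb_or -andbA in us.
exists x, y; split; last by case/and3P : us.
- by change (x \in enum_fset A); rewrite eA inE eqxx.
- by change (y \in enum_fset A); rewrite eA !inE eqxx orbT.
Qed.

Section phi_estimates.
Context {R : realType} {disp : measure_display} {X : measurableType disp}.
Variables (mu : {measure set X -> \bar R}) (d : X -> X -> R).
Variables (kap A1 A2 K1 K2 : R).
Hypothesis G : space_geometry mu d kap A1 A2 K1 K2.
Variables (delta a0 eta C1 C2 : R) (E : nat -> set (set X)).
Hypothesis DC : dyadic_cubes mu d delta a0 eta C1 C2 E.
Hypotheses (delta_gt0 : 0 < delta) (delta_lt1 : delta < 1) (a0_gt0 : 0 < a0).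
Variables (tau beta C : R) (M : nat).
Variables (h : nat -> set X -> nat -> X -> R) (psi : nat -> nat -> X -> R).
Hypotheses (tau_gt0 : 0 < tau) (tau_small : tau * (2 * kap) < a0).
Hypotheses (beta_gt0 : 0 < beta) (C_gt0 : 0 < C).
Hypothesis haar : haar_system mu C E h.
Hypothesis pou : partitions_of_unity d beta tau delta M psi.
Variables (i0 : nat).
Hypothesis i0_gt0 : (1 <= i0)%N.

Local Notation vol := (vol mu).
Local Notation I f := (\int[mu]_x f x).
Local Notation cm := (cmin mu A1 a0).
Local Notation cup := (cup A2 C1).

Let mu_fin := sg_fin G.
Let dn n : 0 < delta ^+ n. Proof. exact: exprn_gt0. Qed.
Let cmin0 : 0 < cm. Proof. exact: (cmin_gt0 G a0_gt0). Qed.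
Let cup0 : 0 < cup. Proof. exact: (cup_gt0 G C1). Qed.

Definition active n Q := E n Q /\ (i0 <= nchild E n Q)%N.

Definition sd n : R := Num.sqrt (delta ^+ n).

Lemma sd_gt0 n : 0 < sd n. Proof. by rewrite sqrtr_gt0. Qed.

Lemma sd_sqr n : sd n * sd n = delta ^+ n.
Proof. by rewrite -expr2 sqr_sqrtr// ltW. Qed.

(** Since i0 >= 1, the cube has N(Q) + 1 >= 2 children, which are nonempty and disjoint. Thus the
    upper volume bounds, false for heavy points, hold for the cubes of the family. *)
Lemma active_two n Q : active n Q -> exists x y, [/\ Q x, Q y & x <> y].
Proof.
move=> [EQ iQ]; have : (1 < #|` fset_set (children E n Q)|)%N.
  by move: (leq_trans i0_gt0 iQ); rewrite /nchild; case: #|` _| => [|[|]].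
have fin : finite_set (children E n Q).
  by apply: sub_finite_set (finite_cubes G DC delta_gt0 delta_lt1 a0_gt0 n.+1) => P [].
move=> /fset_two[P [P' []]]; rewrite !in_fset_set// !inE => -[EP PQ] [EP' PQ'] PP'.
have [x Px] := cube_nonempty G DC delta_gt0 a0_gt0 EP.
have [y Py] := cube_nonempty G DC delta_gt0 a0_gt0 EP'.
exists x, y; split; [exact: PQ|exact: PQ'|] => xy.
by move/eqP : PP'; apply; apply: (cube_eq DC EP EP'); exists x; split=> //; rewrite xy.
Qed.

Lemma active_vol n Q : active n Q -> vol Q <= cup * delta ^+ n.
Proof.
move=> aQ; have [EQ _] := aQ; have [x [y [Qx Qy xy]]] := active_two aQ.
exact: (vol_cube_le G DC delta_gt0 EQ Qx Qy xy).
Qed.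

Section cube.
Variables (n : nat) (Q : set X).
Hypothesis aQ : active n Q.
Let EQ : E n Q. Proof. by case: aQ. Qed.
Let hQ := h n Q i0.
Let i0Q : (1 <= i0 <= nchild E n Q)%N. Proof. by rewrite i0_gt0; case: aQ. Qed.
Let haar_i := proj1 (haar EQ) i0 i0Q.

Lemma haar_bm : bm hQ.
Proof.
have [mh _ _ [u [v uv]] _] := haar_i; split=> //.
exists (Num.max `|u| `|v|) => x; rewrite le_max.
by rewrite /hQ; have [->|->|->] := uv x; rewrite ?normr0 ?normr_ge0 ?lexx ?orbT.
Qed.

Lemma haar_spt x : ~ Q x -> hQ x = 0.
Proof. by have [_ + _ _ _] := haar_i; exact. Qed.

Lemma haar_child P x y : E n.+1 P -> P `<=` Q -> P x -> P y -> hQ x = hQ y.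
Proof. by move=> EP PQ; have [_ _ + _ _] := haar_i; apply; split. Qed.

Lemma haar_I : I hQ = 0.
Proof. by have [_ _ _ _] := haar_i. Qed.

Lemma haar_norm : C ^- 2 <= I (fun x => hQ x ^+ 2) <= C ^+ 2.
Proof.
have := proj2 (haar EQ) (fun i => if i == i0 then 1 else 0).
have mem_i0 : i0 \in index_iota 1 (nchild E n Q).+1 by rewrite mem_index_iota.
rewrite /= (bigD1_seq i0) ?iota_uniq//= eqxx expr1n big1 ?addr0 ?sqrtr1; last first.
  by move=> i /negPf ->; rewrite expr0n.
have -> : (fun x => \sum_(1 <= i < (nchild E n Q).+1) (if i == i0 then 1 else 0) * h n Q i x) = hQ.
  apply/funext => x; rewrite (bigD1_seq i0) ?iota_uniq//= eqxx mul1r big1 ?addr0//.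
  by move=> i /negPf ->; rewrite mul0r.
rewrite !mulr1 -(norm2_sqr mu_fin haar_bm) => -[h1 h2].
have n0 : 0 <= norm2 mu hQ by apply: le_trans h1; rewrite invr_ge0 ltW.
by rewrite -exprVn !ler_pXn2r ?nnegrE ?invr_ge0 ?(ltW C_gt0)// h1.
Qed.

Lemma haar_child_sqr P : E n.+1 P -> P `<=` Q ->
  forall x, P x -> I (fun y => hQ y ^+ 2 * \1_P y) = hQ x ^+ 2 * vol P.
Proof.
move=> EP PQ x Px; have mP := cube_measurable DC EP.
rewrite -(I_indic mu mP) -(IZ _ (bm_ig mu_fin (bm_indic mP))).
apply: eq_Rintegral => y _; rewrite indicE; case: (boolP (y \in P)) => [|_]; last by rewrite !mulr0.
by rewrite inE => Py; rewrite (haar_child EP PQ Px Py).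
Qed.

Definition ch : R := C / Num.sqrt (cm * delta).

Lemma ch_gt0 : 0 < ch.
Proof. by rewrite divr_gt0// sqrtr_gt0 mulr_gt0. Qed.

(** The constant value on a child is bounded by comparing the L^2 norm, at most C, with the volume
    of the child, at least [cm] delta^(n+1). *)
Lemma haar_child_le P x : E n.+1 P -> P `<=` Q -> P x -> `|hQ x| <= ch / sd n.
Proof.
move=> EP PQ Px; have mP := cube_measurable DC EP.
have h1 : hQ x ^+ 2 * vol P <= C ^+ 2.
  rewrite -(haar_child_sqr EP PQ Px); have /andP[_] := haar_norm; apply: le_trans.
  apply: I_le.
  - exact: (bm_ig mu_fin (bmM (bmX 2 haar_bm) (bm_indic mP))).
  - exact: (bm_ig mu_fin (bmX 2 haar_bm)).
  - by move=> y; rewrite indicE; case: (_ \in _); rewrite ?mulr1// mulr0 sqr_ge0.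
have s0 := sd_gt0 n; have c0 := ch_gt0.
have q0 : 0 < cm * delta by rewrite mulr_gt0.
apply: norm_le_sqr; first by rewrite divr_ge0 ?(ltW s0) ?(ltW c0).
have -> : (ch / sd n) ^+ 2 = C ^+ 2 / (cm * delta * delta ^+ n).
  by rewrite /ch !expr_div_n sqr_sqrtr ?(ltW q0)// [sd n ^+ 2]sqr_sqrtr ?(ltW (dn n))// [in RHS]invfM mulrA.
rewrite ler_pdivlMr ?mulr_gt0//; apply: le_trans h1.
rewrite ler_wpM2l ?sqr_ge0// -mulrA -exprS.
exact: (vol_cube_ge G DC delta_gt0 delta_lt1 a0_gt0 EP).
Qed.

Lemma haar_ae : {ae mu, forall x, `|hQ x| <= ch / sd n}.
Proof.
apply: negligibleS (dc_cover DC n.+1) => x /= nx [P EP Px]; apply: nx.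
have [Qx|nQ] := pselect (Q x); last first.
  by rewrite haar_spt// normr0 divr_ge0 ?(ltW ch_gt0) ?(ltW (sd_gt0 n)).
apply: (haar_child_le EP _ Px).
by apply: (cube_nested DC (leqnSn n) EP EQ); exists x.
Qed.

(** If h_Q^2 were smaller than this on every child, its integral would be smaller than C^(-2),
    because the volume of Q is at most [cup] delta^n. The child found here carries the stopping time
    argument. *)
Lemma haar_big_child : exists P, [/\ E n.+1 P, P `<=` Q &
  forall x, P x -> (C ^+ 2 * cup)^-1 / delta ^+ n <= hQ x ^+ 2].
Proof.
apply: contrapT => no.
have small P x : E n.+1 P -> P `<=` Q -> P x -> hQ x ^+ 2 < (C ^+ 2 * cup)^-1 / delta ^+ n.
  move=> EP PQ Px; rewrite ltNge; apply/negP => big; apply: no; exists P; split=> // y Py.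
  by rewrite (haar_child EP PQ Py Px).
pose b := (C ^+ 2 * cup)^-1 / delta ^+ n.
have b0 : 0 < b by apply: divr_gt0 => //; rewrite invr_gt0; apply: mulr_gt0 => //; exact: exprn_gt0.
have igh := bm_ig mu_fin (bmX 2 haar_bm).
have [_ IE] := I_kids G DC delta_gt0 delta_lt1 a0_gt0 EQ igh.
have hE : I (fun x => hQ x ^+ 2) = I (fun x => hQ x ^+ 2 * \1_Q x).
  apply: eq_Rintegral => x _; rewrite indicE; case: (boolP (x \in Q)) => [_|]; first by rewrite mulr1.
  by rewrite notin_setE => nQ; rewrite haar_spt// expr0n mulr0.
have kidP := kidsP G DC delta_gt0 delta_lt1 a0_gt0.
have term P : P \in kids E n Q -> I (fun x => hQ x ^+ 2 * \1_P x) < b * vol P.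
  move=> /kidP[EP PQ]; have [x Px] := cube_nonempty G DC delta_gt0 a0_gt0 EP.
  rewrite (haar_child_sqr EP PQ Px) ltr_pM2r; first exact: small EP PQ Px.
  exact: (vol_cube_gt0 G DC delta_gt0 delta_lt1 a0_gt0 EP).
have /andP[low _] := haar_norm; rewrite hE IE in low.
have sumv : \sum_(P <- kids E n Q) vol P <= vol Q.
  apply: (sum_vol_le G (cube_measurable DC EQ) (kids_uniq _ _ _)).
  - by move=> P /kidP[EP PQ]; split=> //; exact: (cube_measurable DC EP).
  - move=> P P' /kidP[EP _] /kidP[EP' _]; exact: (cube_eq DC EP EP').
have [P0 P0k] : exists P, P \in kids E n Q.
  apply: contrapT => nk; move: low; rewrite big_seq big1.
    by rewrite leNgt invr_gt0 exprn_gt0.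
  by move=> P Pk; exfalso; apply: nk; exists P.
have : \sum_(P <- kids E n Q) I (fun x => hQ x ^+ 2 * \1_P x) < b * vol Q.
  apply: lt_le_trans (_ : b * \sum_(P <- kids E n Q) vol P <= _); last by rewrite ler_pM2l.
  rewrite mulr_sumr (bigD1_seq P0) ?kids_uniq//= [ltRHS](bigD1_seq P0) ?kids_uniq//=.
  apply: ltr_leD; first exact: term.
  rewrite big_seq_cond [leRHS]big_seq_cond; apply: ler_sum => P /andP[Pk _]; exact: ltW (term P Pk).
move=> /(le_lt_trans low); apply/negP; rewrite -leNgt.
apply: le_trans (ler_wpM2l (ltW b0) (active_vol aQ)) _.
rewrite /b invfM.
have -> : C ^- 2 / cup / delta ^+ n * (cup * delta ^+ n) = C ^- 2 * (cup^-1 * cup) * ((delta ^+ n)^-1 * delta ^+ n) by lra.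
by rewrite !mulVf ?gt_eqF// !mulr1.
Qed.

Let r := tau * delta ^+ n.+1.
Let r0 : 0 < r. Proof. by rewrite mulr_gt0. Qed.
Let H := ch / sd n.
Let H0 : 0 <= H. Proof. by rewrite divr_ge0 ?(ltW ch_gt0) ?(ltW (sd_gt0 n)). Qed.

Let pt := phi_tilde mu psi h n Q i0.
Let ptE : pt = smooth mu (psi n.+1) hQ. Proof. by []. Qed.

Definition cb : R := Num.min 1 (cmin mu A1 (a0 / (2 * kap)) / cup).

Lemma cb_gt0 : 0 < cb.
Proof.
have := sg_kap G => k1; rewrite lt_min ltr01/=; apply: divr_gt0 => //.
by apply: (cmin_gt0 G); rewrite divr_gt0//; lra.
Qed.

(** On the ball of radius a0 delta^(n+1) / (2 kap) about the centre of a child, smoothing leaves h_Q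
    unchanged because tau is small. This ball fills at least the proportion [cb] of the child; for a
    child reduced to a point it is the whole child. *)
Lemma phi_tilde_low : cb * C ^- 2 <= I (fun x => pt x ^+ 2).
Proof.
have [p1 p2 p3 p4 p5] := pou n.+1.
have kk1 := sg_kap G; have kk : 0 < 2 * kap by lra.
have bpt : bm pt by exact: (bm_smooth G p1 p2 p3 haar_bm H0 haar_ae).
have igh := bm_ig mu_fin (bmX 2 haar_bm).
have igp := bm_ig mu_fin (bmX 2 bpt).
have [_ IE] := I_kids G DC delta_gt0 delta_lt1 a0_gt0 EQ igh.
have [_ JE] := I_kids G DC delta_gt0 delta_lt1 a0_gt0 EQ igp.
have hE : I (fun x => hQ x ^+ 2) = I (fun x => hQ x ^+ 2 * \1_Q x).
  apply: eq_Rintegral => x _; rewrite indicE; case: (boolP (x \in Q)) => [_|]; first by rewrite mulr1.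
  by rewrite notin_setE => nQ; rewrite haar_spt// expr0n mulr0.
have mQ := cube_measurable DC EQ.
apply: (@le_trans _ _ (I (fun x => pt x ^+ 2 * \1_Q x))); last first.
  apply: I_le => //; first exact: (bm_ig mu_fin (bmM (bmX 2 bpt) (bm_indic mQ))).
  by move=> x; rewrite indicE; case: (_ \in _); rewrite ?mulr1// mulr0 sqr_ge0.
apply: (@le_trans _ _ (cb * I (fun x => hQ x ^+ 2))).
  by rewrite ler_wpM2l ?(ltW cb_gt0)//; have /andP[] := haar_norm.
rewrite hE IE JE mulr_sumr big_seq [leRHS]big_seq; apply: ler_sum => P.
move=> /(kidsP G DC delta_gt0 delta_lt1 a0_gt0)[EP PQ].
have mP := cube_measurable DC EP.
have [z zP] := dc_ball DC EP.
have zz : P z by apply: zP; apply: (qball_self G); rewrite mulr_gt0.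
pose b := a0 / (2 * kap) * delta ^+ n.+1.
have bpos : 0 < b by rewrite mulr_gt0// divr_gt0.
pose B := qball d z b.
have mB : measurable B by exact: (sg_ball G).
have BP : B `<=` P.
  move=> y By; apply: zP; rewrite /qball /=; apply: lt_le_trans By _.
  rewrite /b ler_pM2r// ler_pdivrMr// ler_peMr ?(ltW a0_gt0)//; lra.
have volB : cb * vol P <= vol B.
  have [[x [Px xz]]|single] := pselect (exists x, P x /\ z <> x).
    have hP := vol_cube_le G DC delta_gt0 EP zz Px xz.
    apply: le_trans (ler_wpM2l (ltW cb_gt0) hP) _.
    apply: (@le_trans _ _ (cmin mu A1 (a0 / (2 * kap)) * delta ^+ n.+1)).
      rewrite mulrA ler_pM2r// -ler_pdivlMr// /cb ge_min lexx orbT//.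
    rewrite /B; have [le|gt] := leP b (K1 * vol setT).
      apply: le_trans (sg_lower G z bpos le); rewrite /b mulrA ler_pM2r//.
      by rewrite /cmin ge_min lexx.
    rewrite (sg_full G z bpos gt) -[leRHS]mulr1.
    apply: ler_pM; [|exact: ltW|by rewrite ge_min lexx orbT|].
      by apply/ltW/(cmin_gt0 G); rewrite divr_gt0.
    by apply: exprn_ile1; apply/ltW.
  have -> : B = P.
    apply/seteqP; split=> // x Px; have -> : x = z; last exact: (qball_self G).
    by apply: contrapT => xz; apply: single; exists x; split=> // zx; apply: xz.
  by rewrite ger_pMl ?(vol_cube_gt0 G DC delta_gt0 delta_lt1 a0_gt0 EP)// /cb ge_min lexx.
rewrite (haar_child_sqr EP PQ zz).
apply: (@le_trans _ _ (hQ z ^+ 2 * vol B)).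
  by rewrite mulrCA ler_wpM2l ?sqr_ge0.
rewrite -(I_indic mu mB) -(IZ _ (bm_ig mu_fin (bm_indic mB))).
apply: I_le.
- exact: (bm_ig mu_fin (bmZ _ (bm_indic mB))).
- exact: (bm_ig mu_fin (bmM (bmX 2 bpt) (bm_indic mP))).
move=> x; rewrite !indicE; case: (boolP (x \in B)) => [|_].
  rewrite inE => Bx; rewrite mem_set ?mulr1; last exact: BP.
  rewrite ptE (smooth_const G r0 beta_gt0 p1 p2 p3 p4 p5 haar_bm (P := P) (c := hQ z) (z := z) (b := a0 * delta ^+ n.+1))//.
  - by move=> y Py; exact: haar_child EP PQ Py zz.
  - by rewrite (sg_sym G); move: Bx; rewrite /B /qball /= /b mulrAC.
  - by rewrite /r mulrAC ltr_pM2r.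
by rewrite mulr0 mulr_ge0 ?sqr_ge0//; case: (_ \in _).
Qed.

Definition cphi : R := ch * C / Num.sqrt cb.

Lemma cphi_gt0 : 0 < cphi.
Proof. by rewrite divr_gt0 ?sqrtr_gt0 ?cb_gt0// mulr_gt0// ch_gt0. Qed.

Let ph := phi mu psi h n Q i0.

Let nrm := norm2 mu pt.

Lemma phi_tilde_bm : bm pt.
Proof.
have [p1 p2 p3 p4 p5] := pou n.+1.
exact: (bm_smooth G p1 p2 p3 haar_bm H0 haar_ae).
Qed.

Let nrm_low : Num.sqrt cb / C <= nrm.
Proof.
have n0 : 0 <= nrm by rewrite /nrm (norm2E mu_fin phi_tilde_bm) sqrtr_ge0.
rewrite -(@ler_pXn2r _ 2)// ?nnegrE ?divr_ge0 ?sqrtr_ge0 ?(ltW C_gt0)//.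
rewrite (norm2_sqr mu_fin phi_tilde_bm) expr_div_n sqr_sqrtr ?(ltW cb_gt0)//.
exact: phi_tilde_low.
Qed.

Let nrm0 : 0 < nrm.
Proof. by apply: lt_le_trans nrm_low; rewrite divr_gt0 ?sqrtr_gt0 ?cb_gt0. Qed.

Let scale_le (a b : R) : 0 <= b -> a <= ch * b -> a / nrm <= cphi * b.
Proof.
move=> b0 ab; rewrite ler_pdivrMr//; apply: le_trans ab _.
have s0 : 0 < Num.sqrt cb by rewrite sqrtr_gt0 cb_gt0.
apply: le_trans (_ : cphi * b * (Num.sqrt cb / C) <= _); last first.
  exact: (ler_wpM2l (mulr_ge0 (ltW cphi_gt0) b0) nrm_low).
have -> : cphi * b * (Num.sqrt cb / C) = ch * b * (C / C) * (Num.sqrt cb / Num.sqrt cb).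
  by rewrite /cphi; lra.
by rewrite !divff ?gt_eqF// !mulr1.
Qed.

Lemma phi_bm : bm ph.
Proof.
rewrite (_ : ph = fun x => nrm^-1 * pt x); first exact: bmZ phi_tilde_bm.
by apply/funext => x; rewrite mulrC.
Qed.

Lemma phi_le x : `|ph x| <= cphi / sd n.
Proof.
rewrite /ph /phi normrM normfV (ger0_norm (ltW nrm0)); apply: scale_le.
  by rewrite invr_ge0 ltW// sd_gt0.
have [p1 p2 p3 p4 p5] := pou n.+1.
exact: (smooth_le G p1 p2 p3 haar_bm H0 haar_ae).
Qed.

Lemma phi_spt x : ph x != 0 -> exists y, Q y /\ d x y <= tau * delta ^+ n.+1.
Proof.
rewrite /ph /phi mulf_eq0 negb_or => /andP[px _].
have [p1 p2 p3 p4 p5] := pou n.+1.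
have [y [hy dxy]] := smooth_spt G p1 p2 p3 p4 haar_bm px.
by exists y; split=> //; apply: contrapT => nQ; rewrite haar_spt ?eqxx in hy.
Qed.

Definition chol : R := cphi * (2 * M%:R) * (tau * delta) `^ (- beta).

Lemma phi_holder x y : `|ph x - ph y| <= chol / sd n * (d x y / delta ^+ n) `^ beta.
Proof.
rewrite /ph /phi -mulrBl normrM normfV (ger0_norm (ltW nrm0)).
have td : 0 < tau * delta by rewrite mulr_gt0.
have -> : chol / sd n * (d x y / delta ^+ n) `^ beta =
    cphi * ((sd n)^-1 * (2 * M%:R) * (d x y / r) `^ beta).
  have -> : (d x y / r) `^ beta = (d x y / delta ^+ n) `^ beta * (tau * delta) `^ (- beta).
    have -> : (tau * delta) `^ (- beta) = ((tau * delta)^-1) `^ beta.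
      by rewrite -powR_inv1 ?(ltW td)// -powRrM mulN1r.
    rewrite -powRM ?divr_ge0 ?invr_ge0 ?(sg_ge0 G) ?(ltW td) ?(ltW (dn n))//.
    by rewrite /r exprS mulrA [in LHS]invfM; congr (_ `^ _); lra.
  by rewrite /chol; lra.
apply: scale_le; first by rewrite !mulr_ge0 ?powR_ge0 ?invr_ge0 ?(ltW (sd_gt0 n)).
have [p1 p2 p3 p4 p5] := pou n.+1.
apply: le_trans (smooth_holder G r0 p1 p2 p3 p5 haar_bm H0 haar_ae x y) _.
by rewrite /H -/r; lra.
Qed.

Lemma phi_I : I ph = 0.
Proof.
have [p1 p2 p3 p4 p5] := pou n.+1.
have -> : I ph = nrm^-1 * I pt.
  rewrite -(IZ _ (bm_ig mu_fin phi_tilde_bm)); apply: eq_Rintegral => x _.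
  by rewrite /ph /phi mulrC.
by rewrite (I_smooth G r0 beta_gt0 p1 p2 p3 p5 haar_bm haar_I H0 haar_ae) mulr0.
Qed.

Lemma phi_I2 : I (fun x => ph x ^+ 2) = 1.
Proof.
have -> : I (fun x => ph x ^+ 2) = nrm ^- 2 * I (fun x => pt x ^+ 2).
  rewrite -(IZ _ (bm_ig mu_fin (bmX 2 phi_tilde_bm))); apply: eq_Rintegral => x _.
  by rewrite /ph /phi expr_div_n mulrC.
by rewrite -(norm2_sqr mu_fin phi_tilde_bm) mulVf// expf_eq0/= gt_eqF.
Qed.

End cube.
End phi_estimates.

(** * Chains of adjacent elements *)

Section family.
Context {R : realType} {disp : measure_display} {X : measurableType disp}.
Variables (mu : {measure set X -> \bar R}) (d : X -> X -> R).
Variables (kap A1 A2 K1 K2 : R).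
Hypothesis G : space_geometry mu d kap A1 A2 K1 K2.
Variables (delta a0 eta C1 C2 : R) (E : nat -> set (set X)).
Hypothesis DC : dyadic_cubes mu d delta a0 eta C1 C2 E.
Hypotheses (delta_gt0 : 0 < delta) (delta_lt1 : delta < 1) (a0_gt0 : 0 < a0).
Variables (tau : R).
Hypothesis tau_gt0 : 0 < tau.
Local Notation T := (nat * set X)%type.

Let kap1 : 1 <= kap. Proof. exact: sg_kap G. Qed.
Let kap0 : 0 < kap. Proof. by have := kap1; lra. Qed.
Let dn n : 0 < delta ^+ n. Proof. exact: exprn_gt0. Qed.

Definition dle n (a : R) x y := d x y <= a * delta ^+ n.

Lemma dle_tri n (a b : R) z x y : dle n a x z -> dle n b z y -> dle n (kap * (a + b)) x y.
Proof.
rewrite /dle => h1 h2; apply: le_trans (sg_tri G x y z) _.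
by rewrite -mulrA mulrDl ler_wpM2l ?(ltW kap0)// lerD.
Qed.

Lemma dle_sym n a x y : dle n a x y -> dle n a y x.
Proof. by rewrite /dle (sg_sym G). Qed.

Lemma dle_mono n (a b : R) x y : a <= b -> dle n a x y -> dle n b x y.
Proof. by move=> ab /le_trans; apply; rewrite ler_pM2r. Qed.

Lemma dle_level n k (a : R) x y : 0 <= a -> (n <= k)%N -> dle k a x y -> dle n a x y.
Proof.
move=> a0' nk /le_trans; apply; rewrite ler_wpM2l//.
by apply: ler_wiXn2l => //; exact: ltW.
Qed.

(* Contains the support of [phi_p]. *)
Definition wnb (p : T) : set X := [set x | exists y, p.2 y /\ d x y <= tau * delta ^+ p.1.+1].

Definition adj (p q : T) := wnb p `&` wnb q !=set0.

Lemma adjC p q : adj p q -> adj q p.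
Proof. by move=> [x [? ?]]; exists x. Qed.

Definition rw : R := kap * (rho1 C1 + tau).

(** The reach of a chain that leaves r through finer elements: [rw] brings it to a point of the
    neighbourhood of r, and two unit distances lead to a fixed point of the excursion and from there
    to any of its elements. *)
Definition rloc : R := kap * (rw + kap * (1 + 1)).

(** The sum of the two distances that separation must exceed: between two elements of one level
    touching a common finer element, and between r and an element of its level reached by a
    chain. *)
Definition rsep : R := kap * (rw + kap * (kap * (rw + rw) + rw)) + kap * (rloc + rw).

Lemma rw_gt0 : 0 < rw.
Proof. by rewrite mulr_gt0// addr_gt0// rho1_gt0. Qed.

Lemma rw_ge : rho1 C1 <= rw.
Proof.
have r0 := rho1_gt0 C1; have k1 := kap1.
have : 0 <= (kap - 1) * rho1 C1 by rewrite mulr_ge0 ?(ltW r0)// subr_ge0.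
have : 0 < kap * tau by rewrite mulr_gt0.
by rewrite /rw; lra.
Qed.

Lemma rw_rloc : rw <= rloc.
Proof.
have w := rw_gt0; rewrite -[leLHS]mul1r ler_pM ?(ltW w)//.
by rewrite lerDl mulr_ge0 ?(ltW kap0).
Qed.

Lemma rloc_gt0 : 0 < rloc.
Proof. exact: lt_le_trans rw_gt0 rw_rloc. Qed.

Lemma wnb_dle p x y : E p.1 p.2 -> p.2 x -> wnb p y -> dle p.1 rw x y.
Proof.
move=> Ep px [z [pz dz]]; apply: (@dle_tri _ _ _ z).
  apply: dle_mono (cube_diam DC Ep px pz).
  by rewrite /rho1; have := ler_norm C1; lra.
apply: dle_sym; apply: le_trans dz _; rewrite exprS mulrCA.
by rewrite ger_pMl ?mulr_gt0// ltW.
Qed.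

Lemma cube_wnb p x : p.2 x -> wnb p x.
Proof.
move=> px; exists x; split=> //; rewrite (d_refl G).
by rewrite mulr_ge0 ?(ltW tau_gt0) ?(ltW (dn _)).
Qed.

Lemma adj_sub p q : E q.1 q.2 -> q.2 `<=` p.2 -> adj p q.
Proof.
move=> Eq qp; have [x qx] := cube_nonempty G DC delta_gt0 a0_gt0 Eq.
by exists x; split; apply: cube_wnb => //; exact: qp.
Qed.

Variables (F : set T) (m s i0 : nat).
Hypotheses (m_gt0 : (0 < m)%N) (i0_gt0 : (1 <= i0)%N).
Hypothesis F_act : forall p, F p -> active E i0 p.1 p.2.
Hypothesis F_lev : forall p, F p -> exists k, p.1 = (m * k + s)%N.
Hypothesis F_sep : forall p q x y, F p -> F q -> p.1 = q.1 -> p.2 x -> q.2 y ->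
  dle p.1 rsep x y -> p = q.
Hypothesis m_loc : rloc * delta ^+ m <= 1.

Let FE p : F p -> E p.1 p.2. Proof. by move=> /F_act[]. Qed.

Let F_pt p : F p -> exists x, p.2 x.
Proof. by move=> /FE /(cube_nonempty G DC delta_gt0 a0_gt0). Qed.

Definition idx (p : T) := ((p.1 - s) %/ m)%N.

Lemma idxE p : F p -> p.1 = (m * idx p + s)%N.
Proof. by move=> /F_lev[k pk]; rewrite /idx pk addnK mulKn. Qed.

Lemma idx_ltn p q : F p -> F q -> (p.1 < q.1)%N = (idx p < idx q)%N.
Proof. by move=> /idxE -> /idxE ->; rewrite ltn_add2r ltn_pmul2l. Qed.

Lemma idx_eqn p q : F p -> F q -> (p.1 == q.1) = (idx p == idx q).
Proof. by move=> /idxE -> /idxE ->; rewrite eqn_add2r eqn_pmul2l. Qed.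

Lemma lev_gap p q : F p -> F q -> (p.1 < q.1)%N -> (p.1 + m <= q.1)%N.
Proof.
move=> Fp Fq; rewrite idx_ltn// (idxE Fp) (idxE Fq) => h.
by rewrite -addnA (addnC s) addnA leq_add2r -mulnSr leq_pmul2l.
Qed.

(** Both q and q' touch p, which is not coarser than they are, so their points are closer than the
    first term of [rsep]. *)
Lemma adj_coarse p q q' : F p -> F q -> F q' -> q.1 = q'.1 -> (q.1 <= p.1)%N ->
  adj p q -> adj p q' -> q = q'.
Proof.
move=> Fp Fq Fq' qq' qp [u [pu qu]] [u' [pu' qu']].
have [y qy] := F_pt Fq; have [y' qy'] := F_pt Fq'; have [z pz] := F_pt Fp.
have w0 := ltW rw_gt0.
apply: (F_sep Fq Fq' qq' qy qy').
apply: (@dle_mono _ (kap * (rw + kap * (kap * (rw + rw) + rw)))).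
  by rewrite /rsep lerDl mulr_ge0 ?addr_ge0 ?(ltW kap0) ?(ltW rloc_gt0).
apply: (@dle_tri _ _ _ u); first exact: wnb_dle (FE Fq) qy qu.
apply: (@dle_tri _ _ _ u'); last first.
  by apply: dle_sym; have := wnb_dle (FE Fq') qy' qu'; rewrite qq'.
apply: (dle_level _ qp); first by rewrite mulr_ge0 ?addr_ge0 ?(ltW kap0).
apply: (@dle_tri _ _ _ z); last exact: wnb_dle (FE Fp) pz pu'.
by apply: dle_sym; exact: wnb_dle (FE Fp) pz pu.
Qed.

Lemma adj_same p q : F p -> F q -> p.1 = q.1 -> adj p q -> p = q.
Proof.
move=> Fp Fq pq a; apply: (@adj_coarse p p q) => //.
by have [x px] := F_pt Fp; exists x; split; exact: cube_wnb.
Qed.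

(** Chains confined to the levels from n to N. The upper bound N makes the induction in [near_loc]
    well founded. *)
Inductive near (n N : nat) (r : T) : T -> Prop :=
| near_refl : F r -> (n <= r.1 <= N)%N -> near n N r r
| near_step p q : near n N r p -> F q -> (n <= q.1 <= N)%N -> adj p q -> near n N r q.

Lemma nearF n N r p : near n N r p -> F p /\ (n <= p.1 <= N)%N.
Proof. by elim. Qed.

Lemma near_trans n N r p q : near n N r p -> near n N p q -> near n N r q.
Proof.
move=> rp pq; elim: pq => [//|p' q' pp' IH Fq' q'N a].
exact: near_step IH Fq' q'N a.
Qed.

Lemma near_sym n N r p : near n N r p -> near n N p r.
Proof.
elim=> [Fr rN|p' q' rp' IH Fq' q'N a]; first exact: near_refl.
have [Fp' p'N] := nearF rp'.
apply: near_trans IH; apply: (near_step (near_refl Fq' q'N) Fp' p'N).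
exact: adjC.
Qed.

Lemma near_level n n' N N' r p : (n' <= n)%N -> (N <= N')%N -> near n N r p -> near n' N' r p.
Proof.
move=> nn NN; have bd k : (n <= k <= N)%N -> (n' <= k <= N')%N.
  by move=> /andP[h1 h2]; rewrite (leq_trans nn h1) (leq_trans h2 NN).
elim=> [Fr /bd rN|p' q' rp' IH Fq' /bd q'N a]; first exact: near_refl.
exact: near_step IH Fq' q'N a.
Qed.

(** By induction on N - r.1: following the chain step by step, each element met is r itself or
    belongs to an excursion [exc]. *)
Lemma near_loc N r p : near r.1 N r p ->
  (p.1 = r.1 -> p = r) /\ forall x y, r.2 x -> wnb p y -> dle r.1 rloc x y.
Proof.
have [i] := ubnP (N - r.1)%N; elim: i r p => // i IH r p hi rp.
have [Fr rN] : F r /\ (r.1 <= r.1 <= N)%N.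
  by elim: rp => // r' rN; split.
have w0 := ltW rw_gt0; have k0 := ltW kap0.
have self x y : r.2 x -> wnb r y -> dle r.1 rloc x y.
  by move=> rx ry; apply: (dle_mono rw_rloc); exact: wnb_dle (FE Fr) rx ry.
(* S lies in the excursion that contains p and an element q touching r, and none of the levels
   visited is coarser than that of S, so the induction hypothesis applies to S. *)
pose exc p := (r.1 < p.1)%N /\ exists S q, [/\ (r.1 < S.1)%N, near S.1 N S p, near S.1 N S q & adj r q].
(* A chain leaving [r] stays in levels finer than that of [r] between two visits to this level;
   by induction such an excursion remains close to its first element, so it cannot reach another
   element of the level of [r], by separation. *)
have far p' : exc p' -> forall x y, r.2 x -> wnb p' y -> dle r.1 rloc x y.
  move=> [_ [S [q [rS Sp Sq [u [ru qu]]]]]] x y rx p'y.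
  have [FS /andP[_ SN]] := nearF (near_sym Sq).
  have hS : (N - S.1 < i)%N.
    by apply: leq_trans (_ : (N - r.1 <= i)%N); [rewrite ltn_sub2l// (leq_trans rS)|rewrite -ltnS].
  have [z Sz] := F_pt FS.
  (* This is the induction hypothesis at S. As S is at least m levels finer than r, the distance
     [rloc] at the scale of S is at most one unit at the scale of r, by [m_loc]. *)
  have toS q' v : near S.1 N S q' -> wnb q' v -> dle r.1 1 z v.
    move=> Sq' q'v; have [_ /(_ z v Sz q'v)] := IH S q' hS Sq'.
    rewrite /dle mul1r => /le_trans; apply.
    apply: (@le_trans _ _ (rloc * (delta ^+ m * delta ^+ r.1))).
      rewrite ler_wpM2l ?(ltW rloc_gt0)// -exprD addnC.
      by apply: ler_wiXn2l; rewrite ?(ltW delta_gt0) ?(ltW delta_lt1)// lev_gap.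
    by rewrite mulrA ger_pMl.
  apply: (@dle_tri _ _ _ u); first exact: wnb_dle (FE Fr) rx ru.
  apply: (@dle_tri _ _ _ z); last exact: toS Sp p'y.
  by apply: dle_sym; exact: toS Sq qu.
have inv : p = r \/ exc p.
  elim: rp => [|p' q' rp' IHp Fq' /andP[q'1 q'N] a]; first by left.
  have [Fp' /andP[_ p'N]] := nearF rp'.
  have [lev|lev] := eqVneq r.1 q'.1.
    left; case: IHp => [p'r|ep'].
      by apply/esym/(adj_same Fr Fq' lev); rewrite -p'r.
    have [x rx] := F_pt Fr; have [y q'y] := F_pt Fq'; have [u [p'u q'u]] := a.
    apply/esym/(F_sep Fr Fq' lev rx q'y).
    apply: (@dle_mono _ (kap * (rloc + rw))).
      have e1 : 0 <= kap * (rw + rw) by apply: mulr_ge0 => //; lra.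
      have e2 : 0 <= kap * (kap * (rw + rw) + rw) by apply: mulr_ge0 => //; lra.
      by rewrite /rsep lerDr; apply: mulr_ge0 => //; lra.
    apply: (@dle_tri _ _ _ u); first exact: far ep' _ _ rx p'u.
    by apply: dle_sym; have := wnb_dle (FE Fq') q'y q'u; rewrite -lev.
  have rq' : (r.1 < q'.1)%N by rewrite ltn_neqAle lev.
  right; split=> //; case: IHp => [p'r|[_ [S [q [rS Sp Sq rq]]]]].
    have nq : near q'.1 N q' q' by apply: near_refl; rewrite ?leqnn.
    by exists q', q'; split=> //; rewrite -p'r.
  have [Sq'|q'S] := leqP S.1 q'.1.
    by exists S, q; split=> //; apply: near_step Sp Fq' _ a; rewrite Sq'.
  (* The new element is coarser than S and takes its place; it is linked to q because chains can be
     reversed and prolonged. *)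
  have nq : near q'.1 N q' q' by apply: near_refl; rewrite ?leqnn.
  exists q', q; split=> //.
  have q'p' : near q'.1 N q' p'.
    apply: (near_step nq Fp' _ (adjC a)); have [_ /andP[Sp' _]] := nearF Sp.
    by rewrite p'N (leq_trans (ltnW q'S) Sp').
  apply: near_trans q'p' _.
  by apply: near_trans (near_level (ltnW q'S) (leqnn N) (near_sym Sp)) _; apply: near_level Sq => //; exact: ltnW.
split.
  by move=> pr; case: inv => // -[]; rewrite pr ltnn.
by case: inv => [-> //|/far].
Qed.

(* The elements joined to [r] by a chain of adjacent elements of levels at least that of [r]. *)
Definition nb (r p : T) := exists N, near r.1 N r p.

Lemma nbF r p : nb r p -> F p /\ (r.1 <= p.1)%N.
Proof. by move=> [N /nearF[Fp /andP[]]]. Qed.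

Lemma nb_loc r p x y : nb r p -> r.2 x -> wnb p y -> dle r.1 rloc x y.
Proof. by move=> [N /near_loc[_]]; apply. Qed.

Lemma nb_sub r q : F r -> F q -> (r.1 <= q.1)%N -> q.2 `<=` r.2 -> nb r q.
Proof.
move=> Fr Fq rq qr; exists q.1.
apply: (near_step (near_refl Fr _) Fq); rewrite ?rq ?leqnn//.
exact: adj_sub (FE Fq) qr.
Qed.

(** Otherwise the chain from r to p, with its upper level raised if necessary, could be prolonged to
    q. *)
Lemma nb_adj r p q : nb r p -> F q -> adj p q -> ~ nb r q -> (q.1 < r.1)%N.
Proof.
move=> [N rp] Fq a nrq; rewrite ltnNge; apply/negP => rq; apply: nrq.
exists (maxn N q.1); apply: (near_step _ Fq _ a); last by rewrite rq leq_maxr.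
exact: near_level (leqnn _) (leq_maxl _ _) rp.
Qed.

End family.

(** * Almost orthogonality *)

Ltac pos :=
  match goal with
  | |- is_true (0 <= _ * _) => apply: mulr_ge0; pos
  | |- is_true (0 <= _ + _) => apply: addr_ge0; pos
  | |- is_true (0 <= _^-1) => rewrite invr_ge0; pos
  | |- is_true (0 <= _ ^+ _) => apply: exprn_ge0; pos
  | |- is_true (0 <= _ `^ _) => exact: powR_ge0
  | _ => first [done | solve [auto] | apply: ltW; solve [auto]]
  end.

Lemma ler_of_eq (R : realType) (x y : R) : x = y -> x <= y.
Proof. by move=> ->. Qed.

(** * Geometric sums over levels *)

Section geometric_sums.
Context {R : realType}.
Implicit Types (x : R).

Lemma geo_uniq x (t : seq nat) (g : nat -> nat) : 0 <= x -> x <= 2^-1 -> uniq t ->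
  {in t &, injective g} -> \sum_(k <- t) x ^+ g k <= 2.
Proof.
move=> x0 x1 ut gi; rewrite -(big_map g xpredT (fun k => x ^+ k)).
have um : uniq (map g t) by rewrite map_inj_in_uniq.
set u := map g t in um *; pose n := (\max_(k <- u) k).+1.
apply: le_trans (_ : \sum_(0 <= k < n) x ^+ k <= _); last exact: sum_geo_le.
rewrite [leRHS](bigID (mem u))/= -[leLHS]addr0 lerD//; last first.
  by apply: sumr_ge0 => k _; exact: exprn_ge0.
rewrite -[leRHS]big_filter; apply: ler_of_eq; apply: perm_big; apply: uniq_perm => //.
  by rewrite filter_uniq// iota_uniq.
move=> k; rewrite mem_filter mem_index_iota/=; case: (boolP (k \in u)) => //= ku.
by rewrite ltnS (@leq_bigmax_seq _ u xpredT (fun k => k) k).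
Qed.

Lemma geo_below x N k0 : 0 <= x -> x <= 2^-1 ->
  \sum_(0 <= k < N | (k < k0)%N) x ^+ (k0 - k) <= 2 * x.
Proof.
move=> x0 x1.
have -> : \sum_(0 <= k < N | (k < k0)%N) x ^+ (k0 - k) =
    x * \sum_(k <- [seq k <- index_iota 0 N | (k < k0)%N]) x ^+ (k0 - k).-1.
  rewrite -big_filter mulr_sumr big_seq [RHS]big_seq; apply: eq_bigr => k.
  by rewrite mem_filter => /andP[kk _]; rewrite -exprS prednK// subn_gt0.
rewrite mulrC ler_wpM2r//; apply: geo_uniq => //; first by rewrite filter_uniq// iota_uniq.
move=> i j; rewrite !mem_filter => /andP[i0 _] /andP[j0 _]; lia.
Qed.

Lemma geo_above x N k0 : 0 <= x -> x <= 2^-1 ->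
  \sum_(0 <= k < N | (k0 <= k)%N) x ^+ (k - k0) <= 2.
Proof.
move=> x0 x1; rewrite -big_filter; apply: geo_uniq => //.
  by rewrite filter_uniq// iota_uniq.
move=> i j; rewrite !mem_filter => /andP[i0 _] /andP[j0 _]; lia.
Qed.

Lemma geo_above1 x N k0 : 0 <= x -> x <= 2^-1 ->
  \sum_(0 <= k < N | (k0 < k)%N) x ^+ (k - k0) <= 2 * x.
Proof.
move=> x0 x1.
have -> : \sum_(0 <= k < N | (k0 < k)%N) x ^+ (k - k0) =
    x * \sum_(k <- [seq k <- index_iota 0 N | (k0 < k)%N]) x ^+ (k - k0).-1.
  rewrite -big_filter mulr_sumr big_seq [RHS]big_seq; apply: eq_bigr => k.
  by rewrite mem_filter => /andP[kk _]; rewrite -exprS prednK// subn_gt0.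
rewrite mulrC ler_wpM2r//; apply: geo_uniq => //; first by rewrite filter_uniq// iota_uniq.
move=> i j; rewrite !mem_filter => /andP[i0 _] /andP[j0 _]; lia.
Qed.

Lemma sum_levels (T : eqType) (s : seq T) (idx : T -> nat) (f : T -> R) (b : nat -> R) :
  (forall k, \sum_(q <- s | idx q == k) f q <= b k) ->
  exists N, \sum_(q <- s) f q <= \sum_(0 <= k < N) b k.
Proof.
move=> h; pose N := (\max_(q <- s) idx q).+1; exists N.
have idxN q : q \in s -> (idx q < N)%N.
  by move=> qs; rewrite ltnS (@leq_bigmax_seq _ s xpredT idx q).
rewrite big_mkord.
apply: (@le_trans _ _ (\sum_(k < N) \sum_(q <- s | idx q == k) f q)); last by apply: ler_sum.
apply: ler_of_eq; rewrite [LHS]big_seq (partition_big (fun q => inord (idx q) : 'I_N) xpredT)//=.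
apply: eq_bigr => k _; rewrite [RHS]big_seq_cond; apply: eq_bigl => q.
by case: (boolP (q \in s)) => //= /idxN qN; rewrite -val_eqE/= inordK.
Qed.

End geometric_sums.

(** * Entries and rows of the Gram matrix *)

Section gram_estimates.
Context {R : realType} {disp : measure_display} {X : measurableType disp}.
Variables (mu : {measure set X -> \bar R}) (d : X -> X -> R).
Variables (kap A1 A2 K1 K2 : R).
Hypothesis G : space_geometry mu d kap A1 A2 K1 K2.
Variables (delta a0 eta C1 C2 : R) (E : nat -> set (set X)).
Hypothesis DC : dyadic_cubes mu d delta a0 eta C1 C2 E.
Hypotheses (delta_gt0 : 0 < delta) (delta_lt1 : delta < 1) (a0_gt0 : 0 < a0).
Variables (tau beta : R).
Hypotheses (tau_gt0 : 0 < tau) (beta_gt0 : 0 < beta).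
Local Notation T := (nat * set X)%type.
Variables (F : set T) (m s i0 : nat).
Hypotheses (m_gt0 : (0 < m)%N) (i0_gt0 : (1 <= i0)%N).
Hypothesis F_act : forall p, F p -> active E i0 p.1 p.2.
Hypothesis F_lev : forall p, F p -> exists k, p.1 = (m * k + s)%N.
Local Notation dle := (dle d delta).
Local Notation wnb := (wnb d delta tau).
Local Notation adj := (adj d delta tau).
Local Notation rw := (rw kap C1 tau).
Local Notation rloc := (rloc kap C1 tau).
Local Notation rsep := (rsep kap C1 tau).
Local Notation idx := (idx m s).
Local Notation nb := (nb d delta tau F).
Local Notation sd := (sd delta).
Local Notation cmin := (cmin mu A1 a0).
Local Notation I f := (\int[mu]_x f x).
Hypothesis F_sep : forall p q x y, F p -> F q -> p.1 = q.1 -> p.2 x -> q.2 y ->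
  dle p.1 rsep x y -> p = q.
Hypothesis m_loc : rloc * delta ^+ m <= 1.

Variables (ph : T -> X -> R) (cs cl : R).
Hypotheses (cs_gt0 : 0 < cs) (cl_ge0 : 0 <= cl).
Hypothesis ph_bm : forall p, F p -> bm (ph p).
Hypothesis ph_le : forall p x, F p -> `|ph p x| <= cs / sd p.1.
Hypothesis ph_spt : forall p x, F p -> ph p x != 0 -> wnb p x.
Hypothesis ph_holder : forall p x y, F p ->
  `|ph p x - ph p y| <= cl / sd p.1 * (d x y / delta ^+ p.1) `^ beta.
Hypothesis ph_I : forall p, F p -> I (ph p) = 0.

Let mu_fin := sg_fin G.
Let dn n : 0 < delta ^+ n. Proof. exact: exprn_gt0. Qed.
Let sd0 n : 0 < sd n. Proof. exact: sd_gt0. Qed.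
Let FE p : F p -> E p.1 p.2. Proof. by move=> /F_act[]. Qed.
Let rw0 : 0 < rw. Proof. exact: (rw_gt0 G). Qed.
Let rloc0 : 0 < rloc. Proof. exact: (rloc_gt0 G). Qed.
Let kap0 : 0 <= kap. Proof. by have := sg_kap G; lra. Qed.
Let cmin0 : 0 < cmin. Proof. exact: (cmin_gt0 G a0_gt0). Qed.
Let rw_ge_rho : rho1 C1 <= rw. Proof. exact: (rw_ge G). Qed.
Let lev_idx p : F p -> p.1 = (m * idx p + s)%N. Proof. exact: idxE. Qed.

Let F_pt p : F p -> exists x, p.2 x.
Proof. by move=> /FE /(cube_nonempty G DC delta_gt0 a0_gt0). Qed.

(** Bounds, in units of delta^n, the volume of a ball of radius (r + rw) delta^n about a point of an
    element of level n. The added [rw], at least [rho1], puts the radius in the range of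
    [vol_ball_le] and leaves room for strict inequalities. *)
Definition big (r : R) : R := A2 * (r + rw).

Lemma vol_near p x r : F p -> p.2 x -> 0 <= r ->
  vol mu (qball d x ((r + rw) * delta ^+ p.1)) <= big r * delta ^+ p.1.
Proof.
move=> Fp px r0; have [y [z [py pz yz]]] := active_two G DC delta_gt0 delta_lt1 a0_gt0 i0_gt0 (F_act Fp).
have [w [pw xw]] : exists w, p.2 w /\ x <> w.
  by have [xy|xy] := pselect (x = y); [exists z|exists y] => //; split=> //; rewrite xy.
rewrite /big -mulrA; apply: (vol_ball_le G DC delta_gt0 (FE Fp) px pw xw).
by rewrite ler_pM2r//; apply: le_trans rw_ge_rho _; rewrite lerDr.
Qed.

Lemma dle_ball n a x y : dle n a x y -> qball d x ((a + rw) * delta ^+ n) y.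
Proof.
rewrite /dle /qball /= => /le_lt_trans; apply.
by rewrite ltr_pM2r// ltrDl.
Qed.

(** A comparison of volumes: the cubes are disjoint, have volume at least [cmin] delta^k and lie in
    one ball of controlled volume. *)
Lemma count_cubes (t : seq T) k x r n p : uniq t -> F p -> p.1 = n -> p.2 x -> 0 <= r ->
  (forall q, q \in t -> [/\ F q, q.1 = k & q.2 `<=` qball d x ((r + rw) * delta ^+ n)]) ->
  (size t)%:R * delta ^+ k <= big r / cmin * delta ^+ n.
Proof.
move=> ut Fp pn px r0 ht.
have inj : {in t &, injective (fun q : T => q.2)}.
  move=> q q' /ht[_ qk _] /ht[_ q'k _] /= qq'.
  by rewrite (surjective_pairing q) (surjective_pairing q') qk q'k qq'.
have h1 : \sum_(Q <- map (fun q : T => q.2) t) vol mu Q <= vol mu (qball d x ((r + rw) * delta ^+ n)).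
  apply: (sum_vol_le G) => //.
  - exact: (sg_ball G).
  - by rewrite map_inj_in_uniq.
  - by move=> _ /mapP[q /ht[Fq qk qB] ->]; split=> //; exact: (cube_measurable DC (FE Fq)).
  - move=> _ _ /mapP[q /ht[Fq qk _] ->] /mapP[q' /ht[Fq' q'k _] ->].
    by have := FE Fq; have := FE Fq'; rewrite qk q'k => Eq' Eq; exact: (cube_eq DC Eq Eq').
have h2 := vol_near Fp px r0; rewrite pn in h2.
rewrite mulrAC ler_pdivlMr//; apply: le_trans (le_trans h1 h2).
rewrite big_map (_ : _ * _ * _ = \sum_(q <- t) cmin * delta ^+ k); last first.
  by rewrite big_const_seq count_predT iter_addr_0 -[RHS]mulr_natr; lra.
rewrite big_seq [leRHS]big_seq; apply: ler_sum => q /ht[Fq qk _]; rewrite -qk.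
exact: (vol_cube_ge G DC delta_gt0 delta_lt1 a0_gt0 (FE Fq)).
Qed.

(* The off-diagonal part of the Gram matrix. *)
Definition gr (p q : T) : R := if p == q then 0 else I (fun x => ph p x * ph q x).

Lemma gr_sym p q : gr p q = gr q p.
Proof.
by rewrite /gr eq_sym; case: ifP => // _; apply: eq_Rintegral => x _; rewrite mulrC.
Qed.

Lemma gr_adj p q : F p -> F q -> gr p q != 0 -> adj p q.
Proof.
move=> Fp Fq; rewrite /gr; case: ifP => [|_]; first by rewrite eqxx.
move=> gpq; apply: contrapT => na; move/negP : gpq; apply; apply/eqP.
rewrite -[RHS](I0 mu); apply: eq_Rintegral => x _ /=; apply/eqP; rewrite mulf_eq0.
apply/negPn/negP; rewrite negb_or => /andP[px qx]; apply: na.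
by exists x; split; exact: ph_spt.
Qed.

Lemma gr_same p q : F p -> F q -> p.1 = q.1 -> gr p q = 0.
Proof.
move=> Fp Fq pq; apply/eqP; apply: contraT => g0.
have pE := adj_same G DC delta_gt0 delta_lt1 a0_gt0 tau_gt0 F_act F_sep Fp Fq pq (gr_adj Fp Fq g0).
by move: g0; rewrite pE /gr !eqxx.
Qed.

Definition bb : R := delta `^ beta.

Lemma bbX k : bb ^+ k = (delta ^+ k) `^ beta.
Proof. by rewrite -(@powR_mulrn _ bb k (powR_ge0 _ _)) -(@powR_mulrn _ delta k (ltW delta_gt0)) /bb -!powRrM mulrC. Qed.

Lemma bb_ge0 : 0 <= bb. Proof. exact: powR_ge0. Qed.

Lemma bb_lt1 : bb < 1.
Proof.
have e1 : 1 `^ beta = 1 :> R by rewrite powR1.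
rewrite -[ltRHS]e1 /bb; apply: gt0_ltr_powR => //; rewrite nnegrE//.
exact: ltW.
Qed.

Definition cgr : R := cl * rw `^ beta * cs * big rw.

Lemma big_gt0 r : 0 <= r -> 0 < big r.
Proof. by move=> r0; rewrite mulr_gt0 ?(sg_A2 G)// ltr_wpDl. Qed.

Lemma cgr_ge0 : 0 <= cgr.
Proof. by have b0 := big_gt0 (ltW rw0); rewrite /cgr; pos. Qed.

Let cgr0 := cgr_ge0.
Let bb0 := bb_ge0.

(** On the support of [ph q] the function [ph p] varies by a multiple of bb^(q.1 - p.1) / sd p.1,
    while [ph q] is at most cs / sd q.1 and its support has volume at most a multiple of (sd q.1)^2;
    this leaves the quotient of the weights. *)
Lemma gr_decay p q : F p -> F q -> (p.1 <= q.1)%N ->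
  `|gr p q| <= cgr * bb ^+ (q.1 - p.1) * (sd q.1 / sd p.1).
Proof.
move=> Fp Fq pq; have rhs0 : 0 <= cgr * bb ^+ (q.1 - p.1) * (sd q.1 / sd p.1).
  by pos.
rewrite /gr; case: ifP => [_|_]; first by rewrite normr0.
have [y qy] := F_pt Fq.
have bp := ph_bm Fp; have bq := ph_bm Fq.
pose B := qball d y ((rw + rw) * delta ^+ q.1).
have mB : measurable B by exact: (sg_ball G).
have bc : bm (fun x => (ph p x - ph p y) * ph q x).
  by apply: bmM => //; apply: bmB => //; exact: bm_cst.
have -> : I (fun x => ph p x * ph q x) = I (fun x => (ph p x - ph p y) * ph q x).
  have -> : I (fun x => (ph p x - ph p y) * ph q x) =
      I (fun x => ph p x * ph q x) - I (fun x => ph p y * ph q x).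
    rewrite -(IB (bm_ig mu_fin (bmM bp bq)) (bm_ig mu_fin (bmZ (ph p y) bq))).
    by apply: eq_Rintegral => x _; rewrite mulrBl.
  by rewrite (IZ _ (bm_ig mu_fin bq)) ph_I// mulr0 subr0.
pose c := cl / sd p.1 * (rw `^ beta * bb ^+ (q.1 - p.1)) * (cs / sd q.1).
apply: le_trans (I_norm (bm_ig mu_fin bc)) _.
apply: (@le_trans _ _ (c * vol mu B)).
  rewrite -(I_indic mu mB) -(IZ _ (bm_ig mu_fin (bm_indic mB))).
  apply: I_le.
  - exact: (bm_ig mu_fin (bm_norm bc)).
  - exact: (bm_ig mu_fin (bmZ _ (bm_indic mB))).
  move=> x; have c0 : 0 <= c by rewrite /c; pos.
  have [->|qx] := eqVneq (ph q x) 0.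
    by rewrite mulr0 normr0 mulr_ge0// indicE; case: (_ \in _).
  have dxy := wnb_dle G DC delta_gt0 delta_lt1 tau_gt0 (FE Fq) qy (ph_spt Fq qx).
  rewrite indicE mem_set; last exact: dle_ball.
  rewrite mulr1 normrM ler_pM//; last exact: ph_le.
  apply: le_trans (ph_holder x y Fp) _; rewrite ler_wpM2l ?divr_ge0 ?(ltW (sd0 _))//.
  rewrite bbX -powRM ?(ltW rw0) ?(ltW (dn _))// ge0_ler_powR ?nnegrE ?(ltW beta_gt0)//.
  - by rewrite divr_ge0 ?(sg_ge0 G) ?(ltW (dn _)).
  - by pos.
  - rewrite ler_pdivrMr// -mulrA -exprD subnK// (sg_sym G).
    exact: dxy.
have volB := vol_near Fq qy (ltW rw0).
apply: (@le_trans _ _ (c * (big rw * delta ^+ q.1))).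
  rewrite ler_wpM2l//.
  by rewrite /c; pos.
rewrite /c /cgr -(sd_sqr delta_gt0 q.1).
have e : (sd q.1)^-1 * sd q.1 = 1 by rewrite mulVf// gt_eqF.
apply: ler_of_eq.
transitivity (cl * rw `^ beta * cs * big rw * bb ^+ (q.1 - p.1) * (sd q.1 / sd p.1) * ((sd q.1)^-1 * sd q.1)); first by lra.
by rewrite e mulr1.
Qed.

Definition xx : R := bb ^+ m.

Lemma bb_xx p q : F p -> F q -> (p.1 <= q.1)%N -> bb ^+ (q.1 - p.1) = xx ^+ (idx q - idx p).
Proof.
move=> Fp Fq pq; rewrite /xx -exprM; congr (_ ^+ _).
by rewrite (lev_idx Fp) (lev_idx Fq) subnDr -mulnBr.
Qed.

Hypothesis xx_le : xx <= 2^-1.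
Let xx0 : 0 <= xx. Proof. by rewrite exprn_ge0// bb_ge0. Qed.

Let idx_ltn p q : F p -> F q -> (p.1 < q.1)%N = (idx p < idx q)%N.
Proof. exact: idx_ltn. Qed.
Let idx_eqn p q : F p -> F q -> (p.1 == q.1) = (idx p == idx q).
Proof. exact: idx_eqn. Qed.

(** By [adj_coarse] at most one term is nonzero, and its weight [sd q.1] cancels the denominator in
    [gr_decay]. *)
Lemma row_coarse p k (t : seq T) : uniq t -> (forall q, q \in t -> F q) -> F p -> (k < idx p)%N ->
  \sum_(q <- t | idx q == k) `|gr p q| * sd q.1 <= cgr * sd p.1 * xx ^+ (idx p - k).
Proof.
move=> ut tF Fp kp.
have rhs0 : 0 <= cgr * sd p.1 * xx ^+ (idx p - k).
  by pos.
have one q : F q -> idx q = k -> `|gr p q| * sd q.1 <= cgr * sd p.1 * xx ^+ (idx p - k).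
  move=> Fq qk; have qp : (q.1 <= p.1)%N by rewrite ltnW// idx_ltn// qk.
  have := gr_decay Fq Fp qp; rewrite gr_sym (bb_xx Fq Fp qp) qk => h.
  apply: le_trans (ler_wpM2r (ltW (sd0 q.1)) h) _.
  have e : (sd q.1)^-1 * sd q.1 = 1 by rewrite mulVf// gt_eqF.
  apply: ler_of_eq; transitivity (cgr * sd p.1 * xx ^+ (idx p - k) * ((sd q.1)^-1 * sd q.1)); first lra.
  by rewrite e mulr1.
have [[q [qt qk gq]]|none] := pselect (exists q, [/\ q \in t, idx q == k & gr p q != 0]).
  rewrite big_mkcond (bigD1_seq q)//= qk big1_seq ?addr0.
    by apply: one; [exact: tF|exact/eqP].
  move=> q' /andP[q'q q't]; case: eqP => // q'k.
  rewrite (_ : gr p q' = 0) ?normr0 ?mul0r//; apply/eqP; apply: contraT => gq'.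
  have Fq := tF _ qt; have Fq' := tF _ q't.
  have qp : (q.1 < p.1)%N by rewrite idx_ltn// (eqP qk).
  have lev : q'.1 = q.1 by apply/eqP; rewrite idx_eqn// q'k eq_sym.
  by move: q'q; rewrite (adj_coarse G DC delta_gt0 delta_lt1 a0_gt0 tau_gt0 F_act F_sep Fp Fq' Fq lev _ (gr_adj Fp Fq' gq') (gr_adj Fp Fq gq)) ?eqxx// lev ltnW.
rewrite big_seq_cond big1// => q /andP[qt qk].
rewrite (_ : gr p q = 0) ?normr0 ?mul0r//; apply/eqP; apply: contraT => gq.
by exfalso; apply: none; exists q.
Qed.

Definition cfine : R := big (kap * (rw + rw)) / cmin.

Lemma cfine_ge0 : 0 <= cfine.
Proof. by rewrite divr_ge0 ?(ltW cmin0)// ltW// big_gt0//; pos. Qed.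

(** Many finer elements may interact with p. The weight and the factor from [gr_decay] together give
    delta^(q.1), and by [count_cubes] the number of such q times this power is at most [cfine]
    delta^(p.1). *)
Lemma row_fine p k (t : seq T) : uniq t -> (forall q, q \in t -> F q) -> F p -> (idx p < k)%N ->
  \sum_(q <- t | idx q == k) `|gr p q| * sd q.1 <= cgr * cfine * sd p.1 * xx ^+ (k - idx p).
Proof.
move=> ut tF Fp kp; have [z pz] := F_pt Fp.
pose u := [seq q <- t | (idx q == k) && (gr p q != 0)].
have uu : uniq u by exact: filter_uniq.
have uP q : q \in u -> [/\ F q, q.1 = (m * k + s)%N &
    q.2 `<=` qball d z ((kap * (rw + rw) + rw) * delta ^+ p.1)].
  rewrite mem_filter => /andP[/andP[/eqP qk gq] /tF Fq]; split=> //.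
    by rewrite (lev_idx Fq) qk.
  move=> y qy; apply: dle_ball; have [w [pw qw]] := gr_adj Fp Fq gq.
  apply: (dle_tri (kap := kap) G (z := w)).
    exact: (wnb_dle G DC delta_gt0 delta_lt1 tau_gt0 (FE Fp) pz pw).
  apply: (dle_sym G); apply: (@dle_level _ _ _ d delta delta_gt0 delta_lt1 _ q.1).
  - exact: ltW.
  - by rewrite ltnW// idx_ltn// qk.
  - exact: (wnb_dle G DC delta_gt0 delta_lt1 tau_gt0 (FE Fq) qy qw).
have cnt := count_cubes uu Fp erefl pz (mulr_ge0 kap0 (addr_ge0 (ltW rw0) (ltW rw0))) uP.
set c := cgr * xx ^+ (k - idx p) / sd p.1.
have c0 : 0 <= c by rewrite /c; pos.
apply: (@le_trans _ _ (\sum_(q <- u) c * delta ^+ (m * k + s))).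
  have -> : \sum_(q <- t | idx q == k) `|gr p q| * sd q.1 = \sum_(q <- u) `|gr p q| * sd q.1.
    rewrite /u big_filter big_mkcondr; apply: eq_bigr => q _; case: ifP => // /negbFE/eqP ->.
    by rewrite normr0 mul0r.
  rewrite big_seq [leRHS]big_seq; apply: ler_sum => q qu.
  have [Fq qk _] := uP _ qu; move: qu; rewrite mem_filter => /andP[/andP[/eqP qi _] _].
  have pq : (p.1 <= q.1)%N by rewrite ltnW// idx_ltn// qi.
  apply: le_trans (ler_wpM2r (ltW (sd0 q.1)) (gr_decay Fp Fq pq)) _.
  by rewrite (bb_xx Fp Fq pq) qi -qk -(sd_sqr delta_gt0) /c; lra.
rewrite big_const_seq count_predT iter_addr_0 -[leLHS]mulr_natr -mulrA [X in _ * X]mulrC.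
apply: le_trans (ler_wpM2l c0 cnt) _.
rewrite /c -/cfine -(sd_sqr delta_gt0 p.1).
have e : (sd p.1)^-1 * sd p.1 = 1 by rewrite mulVf// gt_eqF.
apply: ler_of_eq; transitivity (cgr * cfine * sd p.1 * xx ^+ (k - idx p) * ((sd p.1)^-1 * sd p.1)); first lra.
by rewrite e mulr1.
Qed.

Definition csch : R := 2 * cgr * (1 + cfine) * xx.

Lemma gr_row p (t : seq T) : uniq t -> (forall q, q \in t -> F q) -> F p ->
  \sum_(q <- t) `|gr p q| * sd q.1 <= csch * sd p.1.
Proof.
move=> ut tF Fp; pose c1 := cgr * sd p.1; pose c2 := cgr * cfine * sd p.1.
have c10 : 0 <= c1 by rewrite /c1; pos.
have cf0 := cfine_ge0.
have c20 : 0 <= c2 by rewrite /c2; pos.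
pose b k := (if (k < idx p)%N then c1 * xx ^+ (idx p - k) else 0) +
  (if (idx p < k)%N then c2 * xx ^+ (k - idx p) else 0).
have [|N] := @sum_levels _ _ t idx (fun q => `|gr p q| * sd q.1) b.
  move=> k; rewrite /b; have [kp|kp|kp] := ltngtP k (idx p).
  - by rewrite addr0; exact: row_coarse.
  - by rewrite add0r; exact: row_fine.
  - rewrite addr0 big_seq_cond big1// => q /andP[qt /eqP qk].
    by rewrite gr_same ?normr0 ?mul0r//; [exact: tF|apply/eqP; rewrite idx_eqn ?qk ?kp//; exact: tF].
move=> /le_trans; apply; rewrite /b big_split/= -!big_mkcond/= -!mulr_sumr.
have h1 := ler_wpM2l c10 (geo_below N (idx p) xx0 xx_le).
have h2 := ler_wpM2l c20 (geo_above1 N (idx p) xx0 xx_le).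
by move: h1 h2; rewrite /c1 /c2 /csch; lra.
Qed.

(* By [nb_adj] a neighbour of [r] only interacts with non-neighbours of coarser levels than [r],
   whence the decay in the level of the neighbour. *)
Definition cexit : R := 2 * cgr * (big (rloc) / cmin).

Lemma cexit_ge0 : 0 <= cexit.
Proof. by have b0 := big_gt0 (ltW rloc0); rewrite /cexit; pos. Qed.

Lemma exit_row r q (t : seq T) : F r -> nb r q -> uniq t ->
  (forall p, p \in t -> F p /\ ~ nb r p) ->
  \sum_(p <- t) `|gr q p| * sd p.1 <= cgr * sd q.1 * xx ^+ (idx q - idx r).
Proof.
move=> Fr rq ut tF; have [Fq rq1] := nbF rq.
have irq : (idx r <= idx q)%N by rewrite leqNgt -idx_ltn// -leqNgt.
have c10 : 0 <= cgr * sd q.1 by pos.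
pose b k := if (k < idx r)%N then cgr * sd q.1 * xx ^+ (idx q - idx r) * xx ^+ (idx r - k) else 0.
have [|N] := @sum_levels _ _ t idx (fun p => `|gr q p| * sd p.1) b.
  move=> k; rewrite /b; case: ifP => kr.
    rewrite -mulrA -exprD addnBA ?(ltnW kr)// subnK//.
    by apply: row_coarse => //; [move=> p /tF[]|exact: leq_trans kr irq].
  rewrite big_seq_cond big1// => p /andP[/tF[Fp np] /eqP pk].
  rewrite (_ : gr q p = 0) ?normr0 ?mul0r//; apply/eqP; apply: contraT => g0.
  have := nb_adj rq Fp (gr_adj Fq Fp g0) np; rewrite idx_ltn// pk.
  by rewrite kr.
move=> /le_trans; apply; rewrite /b -big_mkcond/= -mulr_sumr.
have c20 : 0 <= cgr * sd q.1 * xx ^+ (idx q - idx r) by pos.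
have := ler_wpM2l c20 (geo_below N (idx r) xx0 xx_le) => /le_trans; apply.
by rewrite ler_piMr//; move: xx_le; lra.
Qed.

(** On one level the two factors [sd q.1] give a power of delta, and the neighbours, all within
    [rloc] of r, are counted by volume; the decay of the exit cost then sums over the levels. *)
Lemma exit_sum r (t : seq T) : F r -> uniq t -> (forall q, q \in t -> nb r q) ->
  \sum_(q <- t) sd q.1 * (cgr * sd q.1 * xx ^+ (idx q - idx r)) <= cexit * delta ^+ r.1.
Proof.
move=> Fr ut tF; have [z rz] := F_pt Fr.
pose c := big rloc / cmin * delta ^+ r.1.
have c0 : 0 <= c.
  by have b0 := big_gt0 (ltW rloc0); rewrite /c; pos.
pose b k := if (idx r <= k)%N then cgr * c * xx ^+ (k - idx r) else 0.
have [|N] := @sum_levels _ _ t idx (fun q => sd q.1 * (cgr * sd q.1 * xx ^+ (idx q - idx r))) b.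
  move=> k; rewrite /b; case: ifP => kr; last first.
    rewrite big_seq_cond big1// => q /andP[/tF /nbF[Fq rq] /eqP qk].
    by move: kr; rewrite -qk leqNgt -idx_ltn// -leqNgt rq.
  pose u := [seq q <- t | idx q == k]; have uu : uniq u by exact: filter_uniq.
  have uP q : q \in u -> [/\ F q, q.1 = (m * k + s)%N &
      q.2 `<=` qball d z ((rloc + rw) * delta ^+ r.1)].
    rewrite mem_filter => /andP[/eqP qk /tF rq]; have [Fq _] := nbF rq; split=> //.
      by rewrite (lev_idx Fq) qk.
    move=> y qy; apply: dle_ball.
    apply: (nb_loc G DC delta_gt0 delta_lt1 a0_gt0 tau_gt0 m_gt0 F_act F_lev F_sep m_loc rq rz).
    exact: (cube_wnb G delta_gt0 tau_gt0 qy).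
  have cnt := count_cubes uu Fr erefl rz (ltW rloc0) uP.
  rewrite -big_filter -/u.
  have -> : \sum_(q <- u) sd q.1 * (cgr * sd q.1 * xx ^+ (idx q - idx r)) =
      \sum_(q <- u) cgr * xx ^+ (k - idx r) * delta ^+ (m * k + s).
    rewrite big_seq [RHS]big_seq; apply: eq_bigr => q qu; have [Fq qk _] := uP _ qu.
    move: qu; rewrite mem_filter => /andP[/eqP qi _].
    by rewrite -qk -(sd_sqr delta_gt0) qi; lra.
  rewrite big_const_seq count_predT iter_addr_0 -[leLHS]mulr_natr.
  have c3 : 0 <= cgr * xx ^+ (k - idx r) by pos.
  by have := ler_wpM2l c3 cnt; rewrite -/c; lra.
move=> /le_trans; apply; rewrite /b -big_mkcond/= -mulr_sumr.
have := ler_wpM2l (mulr_ge0 cgr_ge0 c0) (geo_above N (idx r) xx0 xx_le).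
by rewrite /c /cexit; lra.
Qed.

End gram_estimates.

(** * Synthesis of a function from its coefficients *)

Section nonnegative_systems.
Context {R : realType} {T : choiceType} (F : set T).
Implicit Types (K L : T -> T -> \bar R) (x y s : T -> \bar R).

Definition act K x p : \bar R := (\esum_(q in F) (K p q * x q))%E.

(* The minimal nonnegative solution of [s = x + K s]. *)
Definition ksol K x p : \bar R := (\esum_(k in [set: nat]) iter k (act K) x p)%E.

Lemma act_ge0 K x p : (forall p q, (0 <= K p q)%E) -> (forall p, (0 <= x p)%E) ->
  (0 <= act K x p)%E.
Proof. by move=> K0 x0; apply: esum_ge0 => q _; exact: mule_ge0. Qed.

Lemma iter_act_ge0 K x k p : (forall p q, (0 <= K p q)%E) -> (forall p, (0 <= x p)%E) ->
  (0 <= iter k (act K) x p)%E.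
Proof. by move=> K0 x0; elim: k p => [|k IH] p //=; exact: act_ge0. Qed.

Lemma ksol_ge0 K x p : (forall p q, (0 <= K p q)%E) -> (forall p, (0 <= x p)%E) ->
  (0 <= ksol K x p)%E.
Proof. by move=> K0 x0; apply: esum_ge0 => k _; exact: iter_act_ge0. Qed.

Lemma le_act K x y p : (forall p q, (0 <= K p q)%E) ->
  (forall q, F q -> (x q <= y q)%E) -> (act K x p <= act K y p)%E.
Proof. by move=> K0 xy; apply: le_esum => q Fq; apply: lee_wpmul2l => //; exact: xy. Qed.

Lemma actD K x y p : (forall p q, (0 <= K p q)%E) -> (forall p, (0 <= x p)%E) ->
  (forall p, (0 <= y p)%E) -> act K (fun q => x q + y q)%E p = (act K x p + act K y p)%E.
Proof.
move=> K0 x0 y0; rewrite /act -esumD; [|by move=> q _; exact: mule_ge0..].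
by apply: eq_esum => q _; rewrite ge0_muleDr.
Qed.

Lemma act_addl K L x p : (forall p q, (0 <= K p q)%E) -> (forall p q, (0 <= L p q)%E) ->
  (forall p, (0 <= x p)%E) ->
  act (fun p q => K p q + L p q)%E x p = (act K x p + act L x p)%E.
Proof.
move=> K0 L0 x0; rewrite /act -esumD; [|by move=> q _; exact: mule_ge0..].
by apply: eq_esum => q _; rewrite ge0_muleDl.
Qed.

Lemma esum_mul_ge0 (S : choiceType) (D : set S) (c : \bar R) (a : S -> \bar R) :
  (0 <= c)%E -> (forall k, 0 <= a k)%E ->
  (c * (\esum_(k in D) a k) <= \esum_(k in D) (c * a k))%E.
Proof.
move=> c0 a0; case: c c0 => [r|_|//]; first by rewrite lee_fin => r0; rewrite esumZ.
have [/esum1 ->|/existsNP[k /not_implyP[Dk ak]]] := pselect (forall k, D k -> a k = 0%E).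
  by rewrite mule0; apply: esum_ge0 => k _; exact: mule_ge0.
have akp : (0 < a k)%E by rewrite lt_neqAle a0 andbT eq_sym; apply/eqP.
have := @esum_ge_term R S D (fun k => (+oo * a k)%E) k Dk; rewrite gt0_mulye// leye_eq => /eqP ->.
by rewrite leey.
Qed.

Lemma esum_mulE (S : choiceType) (D : set S) (c : \bar R) (a : S -> \bar R) :
  (0 <= c)%E -> (forall k, 0 <= a k)%E ->
  (\esum_(k in D) (c * a k) = c * (\esum_(k in D) a k))%E.
Proof.
move=> c0 a0; apply/eqP; rewrite eq_le esum_mul_ge0// andbT.
apply: esum_le_seq => t ut tD; rewrite -ge0_sume_distrr//.
apply: lee_wpmul2l => //; exact: sum_le_esum.
Qed.

Lemma ksol_fix K x p : (forall p q, (0 <= K p q)%E) -> (forall p, (0 <= x p)%E) ->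
  ksol K x p = (x p + act K (ksol K x) p)%E.
Proof.
move=> K0 x0.
have i0 k q : (0 <= iter k (act K) x q)%E by exact: iter_act_ge0.
have -> : act K (ksol K x) p = (\esum_(k in [set: nat]) iter k.+1 (act K) x p)%E.
  rewrite /act /ksol; under eq_esum do rewrite -esum_mulE//.
  by rewrite esum_swap// => q k _ _; exact: mule_ge0.
rewrite /ksol -(esum_shift 1 (fun k => iter k.+1 (act K) x p)).
rewrite -[X in (X + _)%E](esum_delta (F := [set: nat]) (a := fun k => iter k (act K) x p) (p := 0%N))//.
rewrite -esumD; first by apply: eq_esum => -[|k] _ /=; rewrite ?adde0 ?add0e// subn1.
- by move=> k _; case: ifP.
- by move=> k _; case: ifP.
Qed.

(** By induction every partial sum of the series stays below the supersolution s. *)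
Lemma ksol_min K x s : (forall p q, (0 <= K p q)%E) -> (forall p, (0 <= x p)%E) ->
  (forall p, (0 <= s p)%E) -> (forall p, F p -> x p + act K s p <= s p)%E ->
  forall p, F p -> (ksol K x p <= s p)%E.
Proof.
move=> K0 x0 s0 sup p Fp.
have i0 k q : (0 <= iter k (act K) x q)%E by exact: iter_act_ge0.
apply: esum_nat_le => // n; elim: n p Fp => [|n IH] p Fp; first by rewrite big_nil.
rewrite big_nat_recl//=; apply: le_trans (sup p Fp); rewrite leeD2l//.
apply: (@le_trans _ _ (act K (fun q => \sum_(0 <= k < n) iter k (act K) x q)%E p)).
  elim: n {IH} => [|n IHn]; first by rewrite big_nil; apply: act_ge0 => // q; rewrite big_nil.
  rewrite big_nat_recr//=; apply: (le_trans (leeD2r _ IHn)).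
  rewrite -actD//; last by move=> q; exact: sume_ge0.
  by apply: le_act => // q _; rewrite big_nat_recr.
by apply: le_act => // q Fq; exact: IH.
Qed.

(** A decomposition at the first exit: only K1 is used until the first occurrence of K2, and all of
    K afterwards. The right-hand side solves the system with kernel K, so minimality applies. *)
Lemma ksol_split K K1 x : (forall p q, (0 <= K p q)%E) ->
  (forall p, (0 <= x p)%E) -> (forall p q, (0 <= K1 p q)%E) ->
  forall K2, (forall p q, (0 <= K2 p q)%E) -> (forall p q, K p q = (K1 p q + K2 p q)%E) ->
  forall p, F p -> (ksol K x p <= ksol K1 x p + ksol K (act K2 (ksol K1 x)) p)%E.
Proof.
move=> K0 x0 K10 K2 K20 KE p Fp.
have s1 q : (0 <= ksol K1 x q)%E by exact: ksol_ge0.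
have s2 q : (0 <= act K2 (ksol K1 x) q)%E by exact: act_ge0.
have s3 q : (0 <= ksol K (act K2 (ksol K1 x)) q)%E by exact: ksol_ge0.
apply: (ksol_min K0 x0 _ _ Fp (s := fun p => (ksol K1 x p + ksol K (act K2 (ksol K1 x)) p)%E)).
  by move=> q; exact: adde_ge0.
move=> q Fq; rewrite actD// [X in (_ <= X + _)%E]ksol_fix// [X in (_ <= _ + X)%E]ksol_fix//.
have -> : act K (ksol K1 x) q = (act K1 (ksol K1 x) q + act K2 (ksol K1 x) q)%E.
  by rewrite -act_addl//; apply: eq_esum => r _; rewrite KE.
by rewrite !addeA.
Qed.

Lemma act_kmul K L x p : (forall p q, (0 <= K p q)%E) -> (forall p q, (0 <= L p q)%E) ->
  (forall p, (0 <= x p)%E) -> act (kmul F K L) x p = act K (act L x) p.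
Proof.
move=> K0 L0 x0; rewrite /act /kmul.
transitivity (\esum_(q in F) \esum_(r in F) (K p r * (L r q * x q)))%E.
  apply: eq_esum => q _; rewrite muleC -esum_mulE//; last by move=> r; exact: mule_ge0.
  by apply: eq_esum => r _; rewrite muleC muleA.
rewrite esum_swap; last by move=> *; rewrite !mule_ge0.
by apply: eq_esum => r _; rewrite esum_mulE// => q; exact: mule_ge0.
Qed.

Lemma act_kpow K x k p : (forall p q, (0 <= K p q)%E) -> (forall p, (0 <= x p)%E) -> F p ->
  act (kpow F K k) x p = iter k (act K) x p.
Proof.
move=> K0 x0; elim: k p => [|k IH] p Fp.
  rewrite /act /= -[RHS](esum_delta (F := F) (a := x) (p := p))//.
  by apply: eq_esum => q _; rewrite /kone eq_sym; case: ifP; rewrite ?mul1e ?mul0e.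
rewrite /= act_kmul//; last by move=> *; exact: kpow_ge0.
by apply: eq_esum => q Fq; rewrite IH.
Qed.

Lemma ksol_kres K x p : (forall p q, (0 <= K p q)%E) -> (forall p, (0 <= x p)%E) -> F p ->
  ksol K x p = act (kres F K) x p.
Proof.
move=> K0 x0 Fp; rewrite /ksol /act /kres.
transitivity (\esum_(q in F) \esum_(k in [set: nat]) (x q * kpow F K k p q))%E; last first.
  by apply: eq_esum => q _; rewrite [RHS]muleC; apply: esum_mulE => // k; exact: kpow_ge0.
rewrite esum_swap; last by move=> q k _ _; rewrite mule_ge0// kpow_ge0.
apply: eq_esum => k _; rewrite -[LHS]/(iter k (act K) x p) -act_kpow//.
by apply: eq_esum => q _; rewrite muleC.
Qed.

Lemma schur_mono (v : T -> R) K L c : (forall p, F p -> 0 <= v p) -> schur F v L c ->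
  (forall p q, (0 <= K p q)%E) -> (forall p q, F p -> F q -> (K p q <= L p q)%E) -> schur F v K c.
Proof.
move=> v0 [c0 L0 Lr Lc] K0 KL; split=> // p Fp.
- apply: le_trans (Lr p Fp); apply: le_esum => q Fq.
  by apply: lee_wpmul2r; [rewrite lee_fin v0|exact: KL].
- apply: le_trans (Lc p Fp); apply: le_esum => q Fq.
  by apply: lee_wpmul2l; [rewrite lee_fin v0|exact: KL].
Qed.

Lemma schur_act_l1 (v : T -> R) K c x : (forall p, F p -> 0 <= v p) -> schur F v K c ->
  (forall p, (0 <= x p)%E) ->
  (\esum_(p in F) ((v p)%:E * act K x p) <= c%:E * \esum_(q in F) ((v q)%:E * x q))%E.
Proof.
move=> v0 [c0 K0 Kr Kc] x0.
have -> : (\esum_(p in F) ((v p)%:E * act K x p) =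
    \esum_(q in F) \esum_(p in F) (x q * ((v p)%:E * K p q)))%E.
  rewrite esum_swap; last by move=> q p Fq Fp; rewrite !mule_ge0 ?lee_fin ?v0.
  apply: eq_esum => p Fp; rewrite /act -esum_mulE ?lee_fin ?v0//; last by move=> q; exact: mule_ge0.
  by apply: eq_esum => q _; rewrite muleA muleC.
rewrite -esumZ//; last by move=> q Fq; rewrite mule_ge0 ?lee_fin ?v0.
apply: le_esum => q Fq; rewrite (eq_esum (b := fun p => (x q * (if p \in F then ((v p)%:E * K p q) else 0))%E)); last first.
  by move=> p Fp; rewrite mem_set.
rewrite esum_mulE//; last by move=> p; case: ifPn => // /[!inE] Fp; rewrite mule_ge0 ?lee_fin ?v0.
apply: (@le_trans _ _ (x q * (c * v q)%:E)%E).
  apply: lee_wpmul2l => //; apply: le_trans (Kc q Fq).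
  by apply: le_esum => p Fp; rewrite mem_set.
by rewrite EFinM muleC muleA.
Qed.

End nonnegative_systems.

Section fatou_square.
Context {R : realType} {disp : measure_display} {X : measurableType disp}.
Variable mu : {measure set X -> \bar R}.

Lemma fatou_sqr (S : nat -> X -> R) (f : X -> R) (B : \bar R) : (forall N, bm (S N)) ->
  measurable_fun setT f -> {ae mu, forall x, S N x @[N --> \oo] --> f x} ->
  (forall N, \int[mu]_x (S N x ^+ 2)%:E <= B)%E -> (\int[mu]_x (f x ^+ 2)%:E <= B)%E.
Proof.
move=> bS mf Sf SB.
have mS N : measurable_fun setT (fun x => (S N x ^+ 2)%:E).
  by apply/measurable_EFinP; have [] := bmX 2 (bS N).
have ml : measurable_fun setT (fun x => limn_einf (fun N => (S N x ^+ 2)%:E)).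
  apply: measurableT_comp => //; apply: measurable_fun_limn_esup => N.
  by apply: measurableT_comp.
have l0 x : (0 <= limn_einf (fun N => (S N x ^+ 2)%:E))%E.
  rewrite limn_einf_lim; apply: lime_ge; first exact: is_cvg_einfs.
  by apply: nearW => N; apply: le_ereal_inf_tmp => _ [k _ <-]; rewrite lee_fin sqr_ge0.
have -> : (\int[mu]_x (f x ^+ 2)%:E = \int[mu]_x limn_einf (fun N => (S N x ^+ 2)%:E))%E.
  apply: ge0_ae_eq_integral => //.
  - by apply/measurable_EFinP; exact: measurable_funX.
  - by move=> x _; rewrite lee_fin sqr_ge0.
  apply: filterS Sf => x Sfx _.
  have cv : (S N x ^+ 2)%:E @[N --> \oo] --> (f x ^+ 2)%:E.
    by apply: cvg_EFin; [exact: nearW|rewrite !expr2; exact: cvgM].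
  by have [-> _] := cvg_limn_einf_sup cv.
apply: le_trans (fatou mu measurableT mS _) _.
  by move=> N x _; rewrite lee_fin sqr_ge0.
rewrite limn_einf_lim; apply: lime_le; first exact: is_cvg_einfs.
apply: nearW => N; apply: le_trans (SB N); apply: ereal_inf_lbound; exists N => //.
exact: leqnn.
Qed.

End fatou_square.

(** * Synthesis in the atomic norm and in L^2 *)

Section synthesis.
Context {R : realType} {disp : measure_display} {X : measurableType disp}.
Variables (mu : {measure set X -> \bar R}) (d : X -> X -> R).
Hypotheses (mu_gt0 : (0 < mu setT)%E) (mu_fin : (mu setT < +oo)%E).
Hypothesis mball : forall x r, measurable (qball d x r).
Hypothesis ball_gt0 : forall x r, 0 < r -> (0 < mu (qball d x r))%E.
Variables (T : choiceType) (F : set T) (v : T -> R) (lev : T -> nat) (Fl : nat -> seq T).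
Hypothesis v_gt0 : forall p, F p -> 0 < v p.
Hypothesis Fl_uniq : forall n, uniq (Fl n).
Hypothesis FlP : forall n p, (p \in Fl n) <-> (F p /\ lev p = n).
Variables (g : T -> X -> R) (cv : R).
Hypothesis cv_ge0 : 0 <= cv.
Hypothesis g_bm : forall p, F p -> bm (g p).
Hypothesis g_hn : forall p, F p -> (atomic_H1_norm mu d (g p) <= (cv * v p)%:E)%E.
Implicit Types (b : T -> R).
Local Notation hn := (atomic_H1_norm mu d).

Definition lv1 b : \bar R := (\esum_(p in F) (`|b p| * v p)%:E)%E.

Definition layer b n x : R := \sum_(p <- Fl n) b p * g p x.

(* [sum_p b p g_p], summed by levels so that almost everywhere convergence is available. *)
Definition synth b x : R := usum [set: nat] (fun n => layer b n x).

Let gb p : F p -> measurable_fun setT (g p). Proof. by case/g_bm. Qed.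

Definition upto n : seq T := flatten [seq Fl k | k <- iota 0 n].

Lemma uptoP n p : (p \in upto n) <-> (F p /\ (lev p < n)%N).
Proof.
split.
  by move=> /flatten_mapP[k]; rewrite mem_iota/= => kn /FlP[Fp ->].
move=> [Fp pn]; apply/flatten_mapP; exists (lev p); first by rewrite mem_iota.
exact/FlP.
Qed.

Lemma upto_uniq n : uniq (upto n).
Proof.
elim: n => [|n IH] //; rewrite /upto -addn1 iotaD map_cat flatten_cat /= cats0 add0n.
rewrite cat_uniq IH Fl_uniq andbT/=; apply/hasPn => p /FlP[Fp pn].
by apply/negP => /uptoP[_]; rewrite pn ltnn.
Qed.

Lemma sum_upto (V : nmodType) n (f : T -> V) :
  \sum_(k < n) \sum_(p <- Fl k) f p = \sum_(p <- upto n) f p.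
Proof. by rewrite /upto big_flatten/= big_map -(big_mkord xpredT (fun k => \sum_(p <- Fl k) f p)) /index_iota subn0. Qed.

Lemma esum_layers (f : T -> \bar R) : (forall p, F p -> 0 <= f p)%E ->
  (\esum_(n in [set: nat]) \sum_(p <- Fl n) f p <= \esum_(p in F) f p)%E.
Proof.
move=> f0; apply: esum_nat_le => [n|n].
  by rewrite big_seq; apply: sume_ge0 => p /FlP[Fp _]; exact: f0.
rewrite big_mkord sum_upto; apply: sum_le_esum; first exact: upto_uniq.
by move=> p /uptoP[].
Qed.

Lemma layer_bm b n : bm (layer b n).
Proof.
rewrite (_ : layer b n = fun x => \sum_(p <- Fl n) (if p \in Fl n then fun x => b p * g p x else cst 0) x).
  apply: bm_sum => p; case: ifP => [/FlP[Fp _]|_]; last exact: bm_cst.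
  by apply: bmZ; exact: g_bm.
by apply/funext => x; rewrite /layer big_seq [RHS]big_seq; apply: eq_bigr => p ->.
Qed.

Let layer_m b n : measurable_fun setT (layer b n). Proof. by case: (layer_bm b n). Qed.

Lemma synth_m b : measurable_fun setT (synth b).
Proof. exact: measurable_usum. Qed.

Lemma layer_hn b n : (hn (layer b n) <= \sum_(p <- Fl n) (cv * (`|b p| * v p))%:E)%E.
Proof.
pose u p : X -> R := if p \in Fl n then fun x => b p * g p x else cst 0.
have um p : measurable_fun setT (u p).
  by rewrite /u; case: ifP => // /FlP[Fp _]; apply: measurable_funM => //; exact: gb.
have -> : layer b n = fun x => \sum_(p <- Fl n) u p x.
  by apply/funext => x; rewrite /layer big_seq [RHS]big_seq; apply: eq_bigr => p pn; rewrite /u pn.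
apply: le_trans (hn_fsum mu_gt0 mu_fin mball ball_gt0 _ um) _.
rewrite big_seq [leRHS]big_seq; apply: lee_sum => p pn; rewrite /u pn.
have /FlP[Fp _] := pn.
apply: le_trans (hnZ mu_gt0 mu_fin mball ball_gt0 _ (gb Fp)) _.
apply: le_trans (lee_wpmul2l _ (g_hn Fp)) _; first by rewrite lee_fin.
by rewrite -EFinM lee_fin mulrCA.
Qed.

Let term0 b p : F p -> (0 <= (cv * (`|b p| * v p))%:E)%E.
Proof. by move=> Fp; rewrite lee_fin !mulr_ge0// ltW// v_gt0. Qed.

Lemma layers_hn b : (\esum_(n in [set: nat]) hn (layer b n) <= cv%:E * lv1 b)%E.
Proof.
rewrite /lv1 -esumZ//; last by move=> p Fp; rewrite lee_fin mulr_ge0// ltW// v_gt0.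
under [leRHS]eq_esum do rewrite -EFinM.
apply: le_trans (esum_layers (@term0 b)).
by apply: le_esum => n _; exact: layer_hn.
Qed.

Lemma layers_n1 b : (lv1 b < +oo)%E -> (\esum_(n in [set: nat]) n1 mu (layer b n) < +oo)%E.
Proof.
move=> boo; apply: (@le_lt_trans _ _ (cv%:E * lv1 b)%E); last first.
  by rewrite lte_mul_pinfty ?lee_fin//.
apply: le_trans (layers_hn b); apply: le_esum => n _.
exact: (hn_n1 mu_gt0 mu_fin mball ball_gt0 (layer_m b n)).
Qed.

Lemma synth_cvg b : (lv1 b < +oo)%E ->
  (n1 mu (fun x => synth b x - \sum_(n < N) layer b n x)%R) @[N --> \oo] --> 0%E.
Proof.
move=> boo; have fin := layers_n1 boo.
have cv0 := esum_shift_cvg0 (fun k => n1_ge0 mu (layer b k)) fin.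
apply: squeeze_cvge cv0; last first.
- exact: cvg_cst.
- by apply: nearW => N; rewrite n1_ge0/= n1_usum_le.
Qed.

Lemma synth_hn b : (lv1 b < +oo)%E -> (hn (synth b) <= cv%:E * lv1 b)%E.
Proof.
move=> boo; apply: le_trans (layers_hn b).
exact: (hn_sum mu_gt0 mu_fin mball ball_gt0 (synth_m b) (layer_m b) (synth_cvg boo)).
Qed.

Let synth_asum b : (lv1 b < +oo)%E ->
  {ae mu, forall x, (asum [set: nat] (fun n => layer b n x) < +oo)%E}.
Proof. by move=> boo; apply: ae_asum_fin => //; exact: layers_n1. Qed.

Lemma lv1D b b' : (lv1 b < +oo)%E -> (lv1 b' < +oo)%E -> (lv1 (fun p => b p + b' p)%R < +oo)%E.
Proof.
move=> boo b'oo; apply: (@le_lt_trans _ _ (lv1 b + lv1 b')%E); last exact: lte_add_pinfty.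
rewrite /lv1 -esumD; [|by move=> p Fp; rewrite lee_fin mulr_ge0// ltW// v_gt0..].
by apply: le_esum => p Fp; rewrite -EFinD lee_fin -mulrDl ler_wpM2r ?ler_normD// ltW// v_gt0.
Qed.

Lemma lv1Z (c : R) b : (lv1 b < +oo)%E -> (lv1 (fun p => c * b p)%R < +oo)%E.
Proof.
move=> boo; apply: (@le_lt_trans _ _ (`|c|%:E * lv1 b)%E); last by rewrite lte_mul_pinfty ?lee_fin.
rewrite /lv1 -esumZ//; last by move=> p Fp; rewrite lee_fin mulr_ge0// ltW// v_gt0.
by apply: le_esum => p Fp; rewrite -EFinM lee_fin normrM mulrA.
Qed.

Lemma synthD b b' : (lv1 b < +oo)%E -> (lv1 b' < +oo)%E ->
  {ae mu, forall x, synth (fun p => b p + b' p) x = synth b x + synth b' x}.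
Proof.
move=> boo b'oo; have h1 := synth_asum boo; have h2 := synth_asum b'oo.
apply: filterS2 h1 h2 => x h1 h2; rewrite /synth -usumD//; apply: eq_usum => n _.
by rewrite /layer -big_split/=; apply: eq_bigr => p _; rewrite mulrDl.
Qed.

Lemma synthZ (c : R) b x : synth (fun p => c * b p) x = c * synth b x.
Proof.
rewrite /synth -usumZ; apply: eq_usum => n _.
by rewrite /layer mulr_sumr; apply: eq_bigr => p _; rewrite mulrA.
Qed.

Lemma eq_synth b b' x : (forall p, F p -> b p = b' p) -> synth b x = synth b' x.
Proof.
move=> bb'; apply: eq_usum => n _; rewrite /layer big_seq [RHS]big_seq.
by apply: eq_bigr => p /FlP[/bb' ->].
Qed.

Lemma synth_fin (t : seq T) b x : uniq t -> (forall p, p \in t -> F p) ->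
  synth (fun p => if p \in t then b p else 0) x = \sum_(p <- t) b p * g p x.
Proof.
move=> ut tF; pose N := (\max_(p <- t) lev p).+1.
have tN p : p \in t -> (lev p < N)%N.
  by move=> pt; rewrite ltnS (@leq_bigmax_seq _ t xpredT lev p).
rewrite /synth (eq_usum (h := fun n => if (n < N)%N then layer (fun p => if p \in t then b p else 0) n x else 0)); last first.
  move=> n _; case: ifP => // /negbT nN; rewrite /layer big_seq big1// => p /FlP[_ pn].
  case: ifP => [pt|_]; last by rewrite mul0r.
  by move: nN; rewrite -pn tN.
rewrite usum_nat_fin big_mkord sum_upto.
rewrite (bigID (mem t))/= [X in _ + X]big1 ?addr0; last by move=> p /negPf ->; rewrite mul0r.
transitivity (\sum_(p <- upto N | p \in t) b p * g p x).
  by apply: eq_bigr => p ->.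
rewrite -[LHS]big_filter; apply: perm_big; apply: uniq_perm => //.
  by rewrite filter_uniq// upto_uniq.
move=> p; rewrite mem_filter; case: (boolP (p \in t)) => //= pt.
by apply/uptoP; split; [exact: tF|exact: tN].
Qed.

Variable Bg : R.
Hypothesis Bg_ge0 : 0 <= Bg.
Hypothesis bessel : forall (t : seq T) b, uniq t -> (forall p, p \in t -> F p) ->
  \int[mu]_x ((\sum_(p <- t) b p * g p x) ^+ 2) <= Bg * \sum_(p <- t) b p ^+ 2.

(** The summability against v gives convergence of the partial sums almost everywhere, and Fatou's
    lemma carries the finite inequality [bessel] over to the limit. *)
Lemma synth_L2 b : (lv1 b < +oo)%E ->
  (\int[mu]_x (synth b x ^+ 2)%:E <= Bg%:E * ell2_sqnorm F b)%E.
Proof.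
move=> boo.
pose S N x := \sum_(n < N) layer b n x.
have bS N : bm (S N) by apply: bm_sum => n; exact: layer_bm.
have mS N : measurable_fun setT (fun x => (S N x ^+ 2)%:E).
  by apply/measurable_EFinP; have [] := bmX 2 (bS N).
have SE N x : S N x = \sum_(p <- upto N) b p * g p x by rewrite /S /layer sum_upto.
have intS N : (\int[mu]_x (S N x ^+ 2)%:E <= Bg%:E * ell2_sqnorm F b)%E.
  have fS : (\int[mu]_x (S N x ^+ 2)%:E)%E = (\int[mu]_x (S N x ^+ 2))%:E.
    rewrite /Rintegral fineK//.
    exact: (integrable_fin_num measurableT (bm_ig mu_fin (bmX 2 (bS N)))).
  rewrite fS; apply: (@le_trans _ _ ((Bg * \sum_(p <- upto N) b p ^+ 2)%:E)).
    rewrite lee_fin; apply: le_trans (bessel b (upto_uniq N) _).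
      by apply: ler_of_eq; apply: eq_Rintegral => x _; rewrite SE.
    by move=> p /uptoP[].
  rewrite EFinM lee_wpmul2l ?lee_fin// -sumEFin; apply: sum_le_esum; first exact: upto_uniq.
  by move=> p /uptoP[].
apply: (fatou_sqr bS (synth_m b) _ intS).
apply: filterS (synth_asum boo) => x xoo.
apply/cvgrPdist_lt => e e0.
have l0 k : (0 <= `|layer b k x|%:E)%E by rewrite lee_fin.
have /fine_cvgP[_ /cvgrPdist_lt /(_ e e0)] := esum_shift_cvg0 (a := fun n => `|layer b n x|%:E) l0 xoo.
have fin_near : \forall N \near \oo, ((\esum_(k in [set: nat]) `|layer b (N + k) x|%:E) \is a fin_num)%E.
  by have /fine_cvgP[] := esum_shift_cvg0 (a := fun n => `|layer b n x|%:E) l0 xoo.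
apply: filterS2 fin_near => N fN; rewrite sub0r normrN => hN.
rewrite -lte_fin; apply: le_lt_trans (usum_partial N xoo) _.
rewrite /asum -(fineK fN) lte_fin; apply: le_lt_trans hN; exact: ler_norm.
Qed.

End synthesis.

(** * The orthonormal system *)

Lemma esum_finite_support (R : realType) (T : choiceType) (F : set T) (t : seq T) (f : T -> \bar R) :
  uniq t -> (forall p, 0 <= f p)%E -> (forall p, F p -> p \notin t -> f p = 0%E) ->
  (\esum_(p in F) f p <= \sum_(p <- t) f p)%E.
Proof.
move=> ut f0 ft; apply: esum_le_seq => s us sF.
rewrite (bigID (mem t))/= [X in (_ + X)%E]big_seq_cond [X in (_ + X)%E]big1 ?adde0; last first.
  by move=> p /andP[ps pt]; apply: ft => //; exact: sF.
rewrite [leRHS](bigID (mem s))/= -[leLHS]adde0 leeD//; last by apply: sume_ge0.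
rewrite -[leLHS]big_filter -[leRHS]big_filter.
rewrite (perm_big [seq p <- t | p \in s])//=; apply: uniq_perm; rewrite ?filter_uniq//.
by move=> p; rewrite !mem_filter andbC.
Qed.

(** Truncation. It splits a coefficient dominated by B + B' into a part dominated by B and a part
    dominated by B'. *)
Lemma clampP (R : realDomainType) (b B : R) : 0 <= B ->
  let b' := Num.max (- B) (Num.min b B) in `|b'| <= B /\ `|b - b'| <= Num.max 0 (`|b| - B).
Proof.
move=> B0 /=; split.
  rewrite ler_norml le_max lexx/= ge_max ge_min lexx orbT andbT.
  by apply: (le_trans _ B0); rewrite oppr_le0.
case: (leP b B) => bB; last first.
  have nB : - B <= B by apply: (le_trans _ B0); rewrite oppr_le0.
  rewrite max_r// ger0_norm ?subr_ge0 ?(ltW bB)// le_max.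
  by rewrite lerD2r ler_norm orbT.
case: (leP (- B) b) => Bb; first by rewrite subrr normr0 le_max lexx.
rewrite ltr0_norm ?subr_lt0// le_max; apply/orP; right.
by have := ler_norm (- b); rewrite normrN; lra.
Qed.

Section frame.
Context {R : realType} {disp : measure_display} {X : measurableType disp}.
Variables (mu : {measure set X -> \bar R}) (d : X -> X -> R).
Hypotheses (mu_gt0 : (0 < mu setT)%E) (mu_fin : (mu setT < +oo)%E).
Hypothesis mball : forall x r, measurable (qball d x r).
Hypothesis ball_gt0 : forall x r, 0 < r -> (0 < mu (qball d x r))%E.
Local Notation T := (nat * set X)%type.
Variables (F0 : set T) (root : T) (v : T -> R) (lev : T -> nat) (Fl : nat -> seq T).
Let F : set T := [set p | p = root \/ F0 p].
Hypothesis F0_root : ~ F0 root.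
Hypothesis v_gt0 : forall p, F p -> 0 < v p.
Hypothesis Fl_uniq : forall n, uniq (Fl n).
Hypothesis FlP : forall n p, (p \in Fl n) <-> (F p /\ lev p = n).
Variables (g : T -> X -> R) (cv c0 : R).
Hypothesis cv_ge0 : 0 <= cv.
Hypothesis g_bm : forall p, F p -> bm (g p).
Hypothesis g_hn : forall p, F p -> (atomic_H1_norm mu d (g p) <= (cv * v p)%:E)%E.
Hypothesis g_root : g root = cst 1.
Local Notation I f := (\int[mu]_x f x).
Local Notation V := (vol mu setT).
Local Notation hn := (atomic_H1_norm mu d).
Hypothesis g_I : forall p, F0 p -> I (g p) = 0.
Hypothesis g_I2 : forall p, F0 p -> I (fun x => g p x ^+ 2) = 1.
Hypotheses (c0_ge0 : 0 <= c0) (c0_le : c0 <= 2^-1).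
Hypothesis row : forall p t, uniq t -> (forall q, q \in t -> F0 q) -> F0 p ->
  \sum_(q <- t) `|gr mu g p q| * v q <= c0 * v p.
Variables (nb : T -> T -> Prop) (w : T -> T -> R) (cX cz : R).
Hypothesis cX_ge0 : 0 <= cX.
Hypothesis nbF0 : forall r p, nb r p -> F0 p.
Hypothesis exit_row : forall r q t, F0 r -> nb r q -> uniq t ->
  (forall p, p \in t -> F0 p /\ ~ nb r p) -> \sum_(p <- t) `|gr mu g q p| * v p <= w r q.
Hypothesis exit_sum : forall r t, F0 r -> uniq t -> (forall q, q \in t -> nb r q) ->
  \sum_(q <- t) v q * w r q <= cX * v r ^+ 2.
Hypothesis cz_nb : forall r (t : seq T) (b : T -> R) (a : R), F0 r -> uniq t ->
  (forall q, q \in t -> nb r q) -> 0 < a ->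
  I (fun x => (\sum_(p <- t) b p * g p x) ^+ 2) <= a ^+ 2 * v r ^+ 2 ->
  (hn (fun x => \sum_(p <- t) b p * g p x)%R <= (cz * a * v r ^+ 2)%:E)%E.

Let V0 : 0 < V. Proof. by rewrite fine_gt0// mu_gt0. Qed.
Let vp p : F p -> 0 <= v p. Proof. by move=> /v_gt0/ltW. Qed.

(** The constant function is orthogonal to the others, which have mean zero, so the element [root]
    is decoupled in this matrix. *)
Definition eo (p q : T) : R := if (p == root) || (q == root) then 0 else gr mu g p q.

Let aE p q : \bar R := `|eo p q|%:E.
Let aE0 p q : (0 <= aE p q)%E. Proof. by rewrite lee_fin. Qed.

Lemma eo_sym p q : eo p q = eo q p.
Proof. by rewrite /eo orbC gr_sym. Qed.

Lemma eo_row p (t : seq T) : uniq t -> (forall q, q \in t -> F q) -> F p ->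
  \sum_(q <- t) `|eo p q| * v q <= c0 * v p.
Proof.
move=> ut tF Fp; have [pr|pr] := eqVneq p root.
  rewrite big1 ?mulr_ge0 ?vp// => q _.
  by rewrite /eo pr eqxx normr0 mul0r.
have F0p : F0 p by case: Fp pr => [->|//]; rewrite eqxx.
have -> : \sum_(q <- t) `|eo p q| * v q = \sum_(q <- [seq q <- t | q != root]) `|gr mu g p q| * v q.
  rewrite big_filter [RHS]big_mkcond; apply: eq_bigr => q _.
  by rewrite /eo (negPf pr)/=; case: eqP => //= _; rewrite normr0 mul0r.
apply: row => //; first exact: filter_uniq.
by move=> q; rewrite mem_filter => /andP[qr /tF[qE|//]]; rewrite qE eqxx in qr.
Qed.

Lemma schur_eo : schur F v aE c0.
Proof.
have r p : F p -> (\esum_(q in F) (aE p q * (v q)%:E) <= (c0 * v p)%:E)%E.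
  move=> Fp; apply: esum_le_seq => t ut tF; rewrite /aE.
  under eq_bigr do rewrite -EFinM.
  by rewrite sumEFin lee_fin; exact: eo_row.
split=> // q Fq; apply: le_trans (r q Fq); apply: le_esum => p _.
by rewrite muleC /aE eo_sym.
Qed.

Definition lamr (p : T) : R := if p == root then Num.sqrt V else 1.

Definition lam0 : R := Num.min (Num.sqrt V) 1.

Lemma lam0_gt0 : 0 < lam0. Proof. by rewrite lt_min sqrtr_gt0 V0 ltr01. Qed.

Let l0i : 0 <= lam0^-1. Proof. by rewrite invr_ge0 ltW// lam0_gt0. Qed.

Lemma lamr_bd p : F p -> lam0 <= lamr p /\ lamr p <= Num.max (Num.sqrt V) 1.
Proof.
by move=> _; rewrite /lamr /lam0; case: ifP => _; rewrite ge_min le_max lexx ?orbT.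
Qed.

Lemma lamr_comm p q : F p -> F q -> eo p q != 0 -> lamr p = lamr q.
Proof. by move=> _ _; rewrite /eo /lamr; case: (p == root); case: (q == root); rewrite /= ?eqxx. Qed.

Lemma gram_eo p q : F p -> F q -> gram mu g p q = lamr p ^+ 2 * ((p == q)%:R + eo p q).
Proof.
move=> Fp Fq; rewrite /gram /lamr /eo.
have root_q (s : T) : F s -> s != root -> I (fun x => g root x * g s x) = 0.
  move=> [->|Fs]; first by rewrite eqxx.
  move=> _; rewrite -[RHS](g_I Fs); apply: eq_Rintegral => x _.
  by rewrite g_root mul1r.
have [->|pr] := eqVneq p root.
  rewrite addr0 sqr_sqrtr ?(ltW V0)//.
  have [<-|qr] := eqVneq root q; last by rewrite mulr0 root_q// eq_sym.
  rewrite mulr1 -(I_indic mu measurableT); apply: eq_Rintegral => x _.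
  by rewrite g_root mulr1 indicE mem_set.
rewrite expr1n mul1r; have [->|qr] := eqVneq q root.
  transitivity (0 : R); last by rewrite (negPf pr) /= addr0.
  rewrite -(root_q p Fp pr); apply: eq_Rintegral => x _; exact: mulrC.
rewrite /gr; case: eqP => [->|_] /=; last by rewrite add0r.
rewrite addr0; have Fq0 : F0 q by case: Fq qr => [->|//]; rewrite eqxx.
by rewrite -(g_I2 Fq0); apply: eq_Rintegral => x _; rewrite expr2.
Qed.

Definition am : T -> T -> R := inv_sqrt F eo lamr.

Lemma am_mx : is_inv_sqrt_mx F (gram mu g) am.
Proof.
exact: (is_inv_sqrt_mx_inv_sqrt v_gt0 schur_eo c0_le (fun p q _ _ => eo_sym p q) lam0_gt0
  lamr_bd lamr_comm gram_eo).
Qed.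

Let K := kres F aE.
Let K0 p q : (0 <= K p q)%E. Proof. exact: kres_ge0. Qed.
Let sK : schur F v K 2. Proof. exact: (schur_kres v_gt0 schur_eo c0_le). Qed.

Lemma am_le p q : F p -> F q -> (`|am p q|%:E <= lam0^-1%:E * K p q)%E.
Proof. exact: (inv_sqrt_le v_gt0 schur_eo c0_le lam0_gt0 lamr_bd). Qed.

Definition Bg : R := Num.max V 1 + 1.

Lemma Bg_ge0 : 0 <= Bg. Proof. by rewrite addr_ge0// le_max ler01 orbT. Qed.

(** Schur's test on the quadratic form: 2 |b_p b_q| <= b_p^2 v_q / v_p + b_q^2 v_p / v_q, the two
    halves having equal sums by symmetry. The diagonal contributes max(V, 1), the rest at most [c0],
    which is below 1. *)
Lemma bessel (t : seq T) (b : T -> R) : uniq t -> (forall p, p \in t -> F p) ->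
  I (fun x => (\sum_(p <- t) b p * g p x) ^+ 2) <= Bg * \sum_(p <- t) b p ^+ 2.
Proof.
move=> ut tF.
pose u p : X -> R := if p \in t then g p else cst 0.
have bu p : bm (u p) by rewrite /u; case: ifP => [/tF/g_bm//|_]; exact: bm_cst.
have uE x : \sum_(p <- t) b p * g p x = \sum_(p <- t) b p * u p x.
  by rewrite big_seq [RHS]big_seq; apply: eq_bigr => p pt; rewrite /u pt.
have -> : I (fun x => (\sum_(p <- t) b p * g p x) ^+ 2) =
    \sum_(p <- t) \sum_(q <- t) b p * b q * gram mu g p q.
  transitivity (I (fun x => \sum_(p <- t) \sum_(q <- t) b p * b q * (u p x * u q x))).
    apply: eq_Rintegral => x _; rewrite uE expr2 mulr_suml; apply: eq_bigr => p _.
    by rewrite mulr_sumr; apply: eq_bigr => q _; lra.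
  have b2 p q : bm (fun x => b p * b q * (u p x * u q x)) by apply: bmZ; exact: bmM.
  rewrite (Isum mu_fin); last by move=> p; apply: (bm_ig mu_fin); exact: bm_sum.
  rewrite big_seq [RHS]big_seq; apply: eq_bigr => p pt.
  rewrite (Isum mu_fin); last by move=> q; exact: (bm_ig mu_fin (b2 p q)).
  rewrite big_seq [RHS]big_seq; apply: eq_bigr => q qt.
  by rewrite (IZ _ (bm_ig mu_fin (bmM (bu p) (bu q)))) /u pt qt.
have term p : p \in t -> \sum_(q <- t) b p * b q * gram mu g p q <=
    Num.max V 1 * b p ^+ 2 + 2^-1 * \sum_(q <- t) `|eo p q| * (b p ^+ 2 * v q / v p + b q ^+ 2 * v p / v q).
  move=> pt; have Fp := tF _ pt; have p0 := v_gt0 Fp.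
  have lam2 : 0 <= lamr p ^+ 2 <= Num.max V 1.
    rewrite sqr_ge0/= /lamr; case: ifP => _; last by rewrite expr1n le_max lexx orbT.
    by rewrite sqr_sqrtr ?(ltW V0)// le_max lexx.
  apply: (@le_trans _ _ (\sum_(q <- t) (b p * b q * (lamr p ^+ 2 * (p == q)%:R) + `|b p| * `|b q| * `|eo p q|))).
    rewrite big_seq [leRHS]big_seq; apply: ler_sum => q qt; rewrite gram_eo//; last exact: tF.
    rewrite mulrDr mulrDr lerD2l -!normrM.
    have [->|pr] := eqVneq p root; first by rewrite /eo eqxx !mulr0 normr0.
    by rewrite /lamr (negPf pr) expr1n mul1r ler_norm.
  rewrite big_split/=; apply: lerD.
    rewrite (bigD1_seq p)//= eqxx mulr1 big1 ?addr0; last first.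
      by move=> q; rewrite eq_sym => /negPf ->; rewrite !mulr0.
    rewrite -expr2 mulrC ler_wpM2r ?sqr_ge0//; by case/andP: lam2.
  rewrite mulr_sumr big_seq [leRHS]big_seq; apply: ler_sum => q qt.
  have q0 := v_gt0 (tF _ qt).
  rewrite [leLHS]mulrC [leRHS]mulrCA ler_wpM2l//.
  have e1 : (v p)^-1 * v p = 1 by rewrite mulVf// gt_eqF.
  have e2 : (v q)^-1 * v q = 1 by rewrite mulVf// gt_eqF.
  have h : 0 <= (`|b p| * v q - `|b q| * v p) ^+ 2 / (v p * v q).
    by rewrite divr_ge0 ?sqr_ge0// mulr_ge0 ?(ltW p0) ?(ltW q0).
  have n1 : `|b p| ^+ 2 = b p ^+ 2 by rewrite real_normK// num_real.
  have n2 : `|b q| ^+ 2 = b q ^+ 2 by rewrite real_normK// num_real.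
  have : (`|b p| * v q - `|b q| * v p) ^+ 2 / (v p * v q) =
     b p ^+ 2 * v q / v p * ((v q)^-1 * v q) + b q ^+ 2 * v p / v q * ((v p)^-1 * v p)
     - 2 * `|b p| * `|b q| * ((v p)^-1 * v p) * ((v q)^-1 * v q).
    by rewrite -n1 -n2 invfM; lra.
  rewrite e1 e2 !mulr1 => hE; rewrite hE in h.
  by move: h; lra.
apply: (@le_trans _ _ (\sum_(p <- t) (Num.max V 1 * b p ^+ 2 +
    2^-1 * \sum_(q <- t) `|eo p q| * (b p ^+ 2 * v q / v p + b q ^+ 2 * v p / v q)))).
  by rewrite big_seq [leRHS]big_seq; exact: ler_sum.
rewrite big_split/= -!mulr_sumr /Bg mulrDl mul1r lerD2l.
have half (f : T -> T -> R) : (forall p q, f p q = f q p) ->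
    \sum_(p <- t) \sum_(q <- t) f p q * (b p ^+ 2 * v q / v p + b q ^+ 2 * v p / v q) =
    2 * \sum_(p <- t) (b p ^+ 2 / v p) * \sum_(q <- t) f p q * v q.
  move=> fs.
  transitivity (\sum_(p <- t) \sum_(q <- t) f p q * (b p ^+ 2 * v q / v p) +
      \sum_(p <- t) \sum_(q <- t) f p q * (b q ^+ 2 * v p / v q)).
    rewrite -big_split/=; apply: eq_bigr => p _; rewrite -big_split/=.
    by apply: eq_bigr => q _; rewrite mulrDr.
  rewrite [X in _ + X]exchange_big/= (_ : 2 * _ = \sum_(p <- t) (b p ^+ 2 / v p) * (\sum_(q <- t) f p q * v q) + \sum_(p <- t) (b p ^+ 2 / v p) * \sum_(q <- t) f p q * v q); last by lra.
  congr (_ + _); apply: eq_bigr => p _; rewrite mulr_sumr; apply: eq_bigr => q _.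
    by lra.
  by rewrite (fs q p); lra.
rewrite (half (fun p q => `|eo p q|)); last by move=> p q; rewrite eo_sym.
rewrite mulrA mulVf ?mul1r//.
rewrite big_seq [leRHS]big_seq; apply: ler_sum => p pt; have p0 := v_gt0 (tF _ pt).
apply: (@le_trans _ _ (b p ^+ 2 / v p * (c0 * v p))).
  by rewrite ler_wpM2l ?divr_ge0 ?sqr_ge0 ?(ltW p0)// eo_row//; exact: tF.
have e1 : (v p)^-1 * v p = 1 by rewrite mulVf// gt_eqF.
rewrite (_ : _ * _ = c0 * b p ^+ 2 * ((v p)^-1 * v p)); last by lra.
rewrite e1 mulr1 ler_piMl ?sqr_ge0//; move: c0_le; lra.
Qed.

Definition ff (q : T) : X -> R := synth Fl g (fun p => am p q).

Local Notation lv1 := (lv1 F v).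

Lemma am_lv1 q : F q -> (lv1 (am^~ q) <= (lam0^-1 * (2 * v q))%:E)%E.
Proof.
move=> Fq; have [_ _ _ Kc] := sK.
apply: (@le_trans _ _ (\esum_(p in F) (lam0^-1%:E * ((v p)%:E * K p q)))%E).
  apply: le_esum => p Fp; rewrite EFinM muleC muleCA lee_wpmul2l ?lee_fin ?vp//.
  exact: am_le.
rewrite esumZ//; last by move=> p Fp; rewrite mule_ge0 ?lee_fin ?vp.
by rewrite EFinM lee_wpmul2l ?lee_fin// Kc.
Qed.

Lemma am_lv1_fin q : F q -> (lv1 (am^~ q) < +oo)%E.
Proof. by move=> /am_lv1 /le_lt_trans; apply; rewrite ltry. Qed.

Lemma ff_m q : F q -> measurable_fun setT (ff q).
Proof. by move=> Fq; exact: (synth_m FlP g_bm). Qed.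

Lemma ff_hn q : F q -> (hn (ff q) <= (cv * (lam0^-1 * (2 * v q)))%:E)%E.
Proof.
move=> Fq; apply: le_trans (synth_hn mu_gt0 mu_fin mball ball_gt0 v_gt0 Fl_uniq FlP cv_ge0 g_bm g_hn (am_lv1_fin Fq)) _.
by rewrite EFinM lee_wpmul2l ?lee_fin// am_lv1.
Qed.

(** A column is the image of a unit vector under a matrix whose majorant passes Schur's test. *)
Lemma am_ell2 q : F q -> (ell2_sqnorm F (am^~ q) < +oo)%E.
Proof.
move=> Fq; pose x p : R := if p == q then 1 else 0.
have xx : (ell2_sqnorm F x = 1%:E)%E.
  rewrite /ell2_sqnorm /x -[RHS](esum_delta (F := F) (a := fun=> 1%:E) (p := q))//.
  by apply: eq_esum => p _; case: eqP => _; rewrite ?expr1n// expr0n.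
have sx : (ell2_sqnorm F x < +oo)%E by rewrite xx ltry.
apply: le_lt_trans (schur_ell2 v_gt0 (schur_scale v_gt0 l0i sK) sx (y := am^~ q) _) _.
  move=> p Fp; apply: le_trans (am_le Fp Fq) _.
  rewrite -(esum_delta (F := F) (a := (fun r => lam0^-1%:E * K p r)%E) (p := q))//; last first.
    by rewrite mule_ge0 ?lee_fin.
  apply: le_esum => r _; rewrite /x; case: eqP => _; first by rewrite normr1 mule1.
  by rewrite normr0 mule0.
by rewrite xx -EFinM ltry.
Qed.

Lemma lv1_support (t : seq T) b : uniq t -> (lv1 (fun p : T => if p \in t then b p else 0%R) < +oo)%E.
Proof.
move=> ut; pose f p := if p \in t then (`|b p| * `|v p|)%:E else 0%E.
apply: (@le_lt_trans _ _ (\esum_(p in F) f p)).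
  apply: le_esum => p Fp; rewrite /f; case: ifP => _; last by rewrite normr0 mul0r.
  by rewrite lee_fin ler_wpM2l// ler_norm.
apply: le_lt_trans (esum_finite_support ut _ _) _.
- by move=> p; rewrite /f; case: ifP => // _; rewrite lee_fin mulr_ge0.
- by move=> p _ /negPf; rewrite /f => ->.
rewrite (eq_bigr (fun p => (if p \in t then `|b p| * `|v p| else 0)%:E)) ?sumEFin ?ltry//.
by move=> p _; rewrite /f; case: ifP.
Qed.

Lemma le_lv1 b b' : (forall p, F p -> `|b p| <= `|b' p|) -> (lv1 b <= lv1 b')%E.
Proof. by move=> bb; apply: le_esum => p Fp; rewrite lee_fin ler_wpM2r ?vp// bb. Qed.

Lemma synth_split (t : seq T) b : uniq t -> (forall p, p \in t -> F p) -> (lv1 b < +oo)%E ->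
  {ae mu, forall x, synth Fl g b x = \sum_(p <- t) b p * g p x +
    synth Fl g (fun p => if p \in t then 0 else b p) x}.
Proof.
move=> ut tF boo.
have h1 : (lv1 (fun p : T => if p \in t then b p else 0%R) < +oo)%E by exact: lv1_support.
have h2 : (lv1 (fun p : T => if p \in t then 0%R else b p) < +oo)%E.
  by apply: le_lt_trans (le_lv1 _) boo => p _; case: ifP; rewrite ?normr0.
have := synthD mu_gt0 mu_fin mball ball_gt0 v_gt0 Fl_uniq FlP cv_ge0 g_bm g_hn h1 h2.
apply: filterS => x; rewrite (synth_fin Fl_uniq FlP g b x ut tF) => <-.
by apply: (eq_synth FlP) => p _; case: ifP; rewrite ?addr0 ?add0r.
Qed.

(** For unconditional convergence: once a finite set contains [s0], removing it leaves coefficients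
    of small l^2 norm, and [synth_L2] bounds the rest of the series. The summation by levels in
    [synth] agrees with this rest almost everywhere. *)
Lemma ff_L2 q : F q -> is_L2_sum mu F (fun p x => am p q * g p x) (ff q).
Proof.
move=> Fq; split; first exact: ff_m.
move=> e e0; have B0 : 0 < Bg by rewrite ltr_pwDr// le_max ler01 orbT.
have e2 : 0 < e ^+ 2 / Bg by rewrite divr_gt0// exprn_gt0.
have a0 p : F p -> (0 <= (am p q ^+ 2)%:E)%E by move=> _; rewrite lee_fin sqr_ge0.
have [s0 [us0 s0F tail]] := esum_tail_seq e2 a0 (am_ell2 Fq).
exists [set` s0]; split; first exact: finite_seq.
  by move=> p /= /s0F.
move=> D finD s0D DF; pose t : seq T := fset_set D.
have ut : uniq t by exact: fset_uniq.
have tD p : (p \in t) <-> D p by rewrite /t in_fset_set// inE.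
have tF p : p \in t -> F p by move=> /tD /DF.
pose b2 p := if p \in t then 0 else am p q.
have ae := synth_split ut tF (am_lv1_fin Fq).
have sumD x : \sum_(p \in D) am p q * g p x = \sum_(p <- t) am p q * g p x.
  by rewrite fsbig_finite.
have mb2 : measurable_fun setT (synth Fl g b2) by exact: (synth_m FlP g_bm).
have msum : measurable_fun setT (fun x => \sum_(p <- t) am p q * g p x).
  rewrite (_ : (fun x => _) = fun x => synth Fl g (fun p => if p \in t then am p q else 0) x).
    exact: (synth_m FlP g_bm).
  by apply/funext => x; rewrite (synth_fin Fl_uniq FlP).
have mdiff : measurable_fun setT (fun x => ff q x - \sum_(p \in D) am p q * g p x).
  by under eq_fun do rewrite sumD; apply: measurable_funB => //; exact: ff_m.
rewrite (_ : (fun x => _) = EFin \o (fun x => ff q x - \sum_(p \in D) am p q * g p x))// Lnorm2E//.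
have lv2 : (lv1 b2 < +oo)%E.
  by apply: le_lt_trans (le_lv1 _) (am_lv1_fin Fq) => p _; rewrite /b2; case: ifP; rewrite ?normr0.
have -> : (\int[mu]_x ((ff q x - \sum_(p \in D) am p q * g p x) ^+ 2)%:E = \int[mu]_x (synth Fl g b2 x ^+ 2)%:E)%E.
  apply: ge0_ae_eq_integral => //.
  - by apply/measurable_EFinP; exact: measurable_funX.
  - by apply/measurable_EFinP; exact: measurable_funX.
  - by move=> x _; rewrite lee_fin sqr_ge0.
  - by move=> x _; rewrite lee_fin sqr_ge0.
  by apply: filterS ae => x; rewrite /ff sumD => -> _; rewrite addrC addKr.
have ell_b2 : (ell2_sqnorm F b2 <= (e ^+ 2 / Bg)%:E)%E.
  apply: le_trans (ltW tail); apply: esum_le_seq => s us sF.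
  rewrite (bigID (mem t))/= big1 ?add0e; last by move=> p pt; rewrite /b2 pt expr0n.
  apply: (@le_trans _ _ (\sum_(p <- [seq p <- s | p \notin t]) (am p q ^+ 2)%:E)%E).
    by rewrite big_filter; apply: lee_sum => p pt; rewrite /b2 (negPf pt).
  apply: sum_le_esum.
  - exact: filter_uniq.
  - move=> p; rewrite mem_filter => /andP[pt /sF Fp]; split=> //= ps0.
    by move/negP : pt; apply; apply/tD; exact: s0D.
have h := synth_L2 mu_gt0 mu_fin mball ball_gt0 v_gt0 Fl_uniq FlP cv_ge0 g_bm g_hn Bg_ge0 bessel lv2.
have {}h : (\int[mu]_x (synth Fl g b2 x ^+ 2)%:E <= (e ^+ 2)%:E)%E.
  apply: le_trans h _; apply: le_trans (lee_wpmul2l _ ell_b2) _; first by rewrite lee_fin Bg_ge0.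
  by rewrite -EFinM lee_fin mulrC divfK// gt_eqF.
have I0' : (0 <= \int[mu]_x (synth Fl g b2 x ^+ 2)%:E)%E.
  by apply: integral_ge0 => x _; rewrite lee_fin sqr_ge0.
move: h I0'; case: (\int[mu]_x _)%E => //= y; rewrite !lee_fin => ye y0.
by rewrite -(ger0_norm (ltW e0)) -sqrtr_sqr ler_wsqrtr.
Qed.

Lemma synth_lin (t : seq T) (c : T -> R) : (forall q, q \in t -> F q) ->
  (lv1 (fun p => \sum_(q <- t) am p q * c q)%R < +oo)%E /\
  {ae mu, forall x, synth Fl g (fun p => \sum_(q <- t) am p q * c q) x =
    \sum_(q <- t) c q * ff q x}.
Proof.
elim: t => [|q t IH] tF.
  have z : (fun p => \sum_(q <- [::]) am p q * c q) = (fun p : T => 0 * (0 : R)).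
    by apply/funext => p; rewrite big_nil mul0r.
  rewrite z; split; last by apply: aeW => x; rewrite synthZ mul0r big_nil.
  rewrite /lv1 esum1 ?ltry// => p _; by rewrite mul0r normr0 mul0r.
have Fq : F q by apply: tF; rewrite inE eqxx.
have [l1 ae1] := IH (fun p pt => tF p (mem_behead (s := q :: t) pt)).
have l2 : (lv1 (fun p => c q * am p q)%R < +oo)%E := lv1Z v_gt0 (c q) (am_lv1_fin Fq).
have E' : (fun p => \sum_(q0 <- q :: t) am p q0 * c q0) =
    (fun p => c q * am p q + \sum_(q0 <- t) am p q0 * c q0).
  by apply/funext => p; rewrite big_cons mulrC.
rewrite E'; split; first exact: (lv1D v_gt0).
have ae2 := synthD mu_gt0 mu_fin mball ball_gt0 v_gt0 Fl_uniq FlP cv_ge0 g_bm g_hn l2 l1.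
by apply: filterS2 ae1 ae2 => x h1 h2; rewrite h2 h1 big_cons synthZ.
Qed.

(** * A piece of the sum localized near one element *)

Section piece.
Variables (r : T) (t : seq T) (c : T -> R) (a : R).
Hypotheses (F0r : F0 r) (ut : uniq t) (tnb : forall q, q \in t -> nb r q) (a_gt0 : 0 < a).
Hypothesis c_le : \sum_(q <- t) c q ^+ 2 <= a ^+ 2 * v r ^+ 2.

Let x q := if q \in t then c q else 0.
Let ax q : \bar R := `|x q|%:E.
(* The coefficients of [sum_q c q f_q] are dominated by [kres |E| |c|]. Splitting [|E| = K1 +
   K2] according to whether the row index is a neighbour of [r], they are dominated by [b1],
   supported on the neighbours and small in l^2, plus [b2], small in the weighted l^1 norm
   because leaving the neighbours costs [w]. *)
Let K1 p q : \bar R := if `[< nb r p >] then aE p q else 0%E.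
Let K2 p q : \bar R := if `[< nb r p >] then 0%E else aE p q.
Let b1 := ksol F K1 ax.
Let b2 := ksol F aE (act F K2 b1).
Let b p := \sum_(q <- t) am p q * c q.
Let tF q : q \in t -> F q. Proof. by move=> /tnb/nbF0; right. Qed.
Let ax0 q : (0 <= ax q)%E. Proof. by rewrite lee_fin. Qed.
Let K10 p q : (0 <= K1 p q)%E. Proof. by rewrite /K1; case: ifP. Qed.
Let K20 p q : (0 <= K2 p q)%E. Proof. by rewrite /K2; case: ifP. Qed.
Let b10 p : (0 <= b1 p)%E. Proof. exact: ksol_ge0. Qed.
Let b20 p : (0 <= b2 p)%E. Proof. by apply: ksol_ge0 => // q; exact: act_ge0. Qed.
Let sK1 : schur F v K1 c0.
Proof.
by apply: (schur_mono vp schur_eo) => // p q _ _; rewrite /K1; case: ifP.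
Qed.

Let x_ell2 : (ell2_sqnorm F x <= (a ^+ 2 * v r ^+ 2)%:E)%E.
Proof.
apply: le_trans (_ : (\sum_(q <- t) (c q ^+ 2))%:E <= _)%E; last by rewrite lee_fin.
apply: le_trans (esum_finite_support ut _ _) _.
- by move=> q; rewrite lee_fin sqr_ge0.
- by move=> q _ /negPf qt; rewrite /x qt expr0n.
by rewrite sumEFin lee_fin big_seq [leRHS]big_seq; apply: ler_sum => q qt; rewrite /x qt.
Qed.

Let b_le p : F p -> (`|b p|%:E <= lam0^-1%:E * b1 p + lam0^-1%:E * b2 p)%E.
Proof.
move=> Fp; rewrite -ge0_muleDr//.
have le2 : (ksol F aE ax p <= b1 p + b2 p)%E.
  apply: (ksol_split aE0 ax0 K10 K20 _ Fp).
  by move=> p' q'; rewrite /K1 /K2; case: ifP; rewrite ?adde0 ?add0e.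
apply: le_trans (lee_wpmul2l _ le2); last by rewrite lee_fin.
rewrite ksol_kres//.
apply: (@le_trans _ _ (\sum_(q <- t) (lam0^-1%:E * (K p q * ax q)))%E).
  apply: (@le_trans _ _ (\sum_(q <- t) `|am p q * c q|%:E)%E).
    by rewrite sumEFin lee_fin; exact: ler_norm_sum.
  rewrite big_seq [leRHS]big_seq; apply: lee_sum => q qt.
  rewrite /ax /x qt normrM EFinM muleA lee_wpmul2r ?lee_fin//; apply: am_le => //; exact: tF.
rewrite -ge0_sume_distrr; last by move=> q _; rewrite mule_ge0.
by rewrite lee_wpmul2l ?lee_fin//; exact: sum_le_esum.
Qed.

Let b1_fin p : F p -> b1 p \is a fin_num.
Proof.
move=> Fp; rewrite ge0_fin_numE// /b1 ksol_kres//.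
apply: (schur_row_fin (x := x) v_gt0 (schur_kres v_gt0 sK1 c0_le) Fp).
by apply: le_lt_trans x_ell2 _; rewrite ltry.
Qed.

Let beta p := fine (b1 p).
Let beta0 p : 0 <= beta p. Proof. exact: fine_ge0. Qed.
Let betaK p : F p -> (beta p)%:E = b1 p. Proof. by move=> Fp; rewrite fineK// b1_fin. Qed.

Let beta_out p : F p -> ~ nb r p -> beta p = 0.
Proof.
move=> Fp np; rewrite /beta /b1 ksol_fix//.
have -> : ax p = 0%E.
  by rewrite /ax /x; case: ifP => [/tnb//|_]; rewrite normr0.
rewrite add0e /act esum1// => q _; rewrite /K1; case: asboolP => // _; exact: mul0e.
Qed.

Let beta_ell2 : (ell2_sqnorm F beta <= (4 * (a ^+ 2 * v r ^+ 2))%:E)%E.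
Proof.
have xoo : (ell2_sqnorm F x < +oo)%E by apply: le_lt_trans x_ell2 _; rewrite ltry.
have := schur_ell2 (y := beta) v_gt0 (schur_kres v_gt0 sK1 c0_le) xoo.
move=> h; apply: le_trans (h _) _.
  by move=> p Fp; rewrite ger0_norm// betaK// /b1 ksol_kres.
have -> : (2 : R) ^+ 2 = 4 by lra.
rewrite [leRHS]EFinM.
by rewrite lee_wpmul2l ?lee_fin.
Qed.

Let lv1_beta : (lv1 beta < +oo)%E.
Proof.
have lx : (lv1 x < +oo)%E by exact: lv1_support.
have h := schur_act_l1 vp (schur_kres v_gt0 sK1 c0_le) ax0.
apply: (@le_lt_trans _ _ (2%:E * lv1 x)%E); last by rewrite lte_mul_pinfty ?lee_fin.
apply: le_trans (_ : _ <= \esum_(p in F) ((v p)%:E * act F (kres F K1) ax p))%E _; last first.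
  apply: le_trans h _; rewrite lee_wpmul2l ?lee_fin//; apply: le_esum => q _.
  by rewrite muleC.
apply: le_esum => p Fp; rewrite ger0_norm// EFinM muleC betaK// /b1 ksol_kres//.
Qed.

Let gq q : \bar R := (\esum_(p in F) ((v p)%:E * K2 p q))%E.

(** The number [gq q] is the cost, in the norm weighted by v, of one unit of coefficient at q
    leaving the neighbours of r. Multiplying the two bounds gives gq^2 <= v w, the form in which
    [exit_sum] is applied. *)
Let gq_le q : F q -> nb r q -> (gq q <= (v q)%:E)%E /\ (gq q <= (w r q)%:E)%E.
Proof.
move=> Fq rq; have [_ _ _ Kc] := schur_eo; split.
  apply: le_trans (_ : (c0 * v q)%:E <= _)%E; last first.
    rewrite lee_fin ler_piMl ?vp//; move: c0_le; lra.
  apply: le_trans (Kc q Fq); apply: le_esum => p Fp; rewrite lee_wpmul2l ?lee_fin ?vp//.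
  by rewrite /K2; case: ifP.
apply: esum_le_seq => s us sF.
pose s' := [seq p <- s | (p != root) && ~~ `[< nb r p >]].
have s'P p : p \in s' -> F0 p /\ ~ nb r p.
  rewrite mem_filter => /andP[/andP[pr /asboolPn np] /sF[pE|//]].
  by rewrite pE eqxx in pr.
have := exit_row F0r rq (filter_uniq _ us) s'P; rewrite -lee_fin; apply: le_trans.
rewrite -sumEFin big_filter [leRHS]big_mkcond; apply: lee_sum => p _.
rewrite /K2; case: asboolP => np; first by rewrite mule0 andbF.
rewrite andbT /aE /eo; case: eqP => pr /=; first by rewrite normr0 mule0.
have -> /= : (q == root) = false by apply/eqP => qr; apply: F0_root; rewrite -qr; exact: nbF0 rq.
by rewrite gr_sym -EFinM lee_fin mulrC.
Qed.

(** Each product satisfies 2 beta gq <= beta^2 / a + a gq^2. The first terms are summed by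
    [beta_ell2], the second ones by gq^2 <= v w and [exit_sum]; both totals are multiples of a
    v_r^2. *)
Let lv1_b2 : (\esum_(p in F) ((v p)%:E * b2 p) <= ((4 + cX) * a * v r ^+ 2)%:E)%E.
Proof.
have y0 p : (0 <= act F K2 b1 p)%E by exact: act_ge0.
apply: (@le_trans _ _ (2%:E * \esum_(p in F) ((v p)%:E * act F K2 b1 p))%E).
  apply: le_trans (schur_act_l1 vp sK y0).
  by apply: le_esum => p Fp; rewrite /b2 ksol_kres.
have -> : (\esum_(p in F) ((v p)%:E * act F K2 b1 p) = \esum_(q in F) (b1 q * gq q))%E.
  transitivity (\esum_(p in F) \esum_(q in F) (b1 q * ((v p)%:E * K2 p q)))%E.
    apply: eq_esum => p Fp; rewrite /act -esum_mulE ?lee_fin ?vp//; last first.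
      by move=> q; exact: mule_ge0.
    by apply: eq_esum => q _; rewrite muleA muleC.
  rewrite esum_swap; last by move=> p q Fp _; rewrite !mule_ge0 ?lee_fin ?vp.
  apply: eq_esum => q Fq; rewrite /gq -(betaK Fq) esumZ// => p Fp.
  by rewrite mule_ge0 ?lee_fin ?vp.
have ai : 0 <= a^-1 by rewrite invr_ge0 ltW.
pose e q : R := if `[< nb r q >] then v q * w r q else 0.
have w0 q : nb r q -> 0 <= w r q.
  by move=> rq; have := @exit_row r q [::] F0r rq isT; rewrite big_nil; apply.
have e0 q : F q -> 0 <= e q.
  by move=> Fq; rewrite /e; case: asboolP => // rq; rewrite mulr_ge0 ?vp ?w0.
apply: (@le_trans _ _ (2%:E * \esum_(q in F) (2^-1%:E * ((a^-1 * beta q ^+ 2)%:E + (a * e q)%:E)))%E).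
  rewrite lee_wpmul2l//; apply: le_esum => q Fq; rewrite -(betaK Fq) -EFinD -EFinM.
  have [rq|nq] := pselect (nb r q); last first.
    rewrite beta_out// mul0e lee_fin /e asboolF// mulr0 addr0 expr0n mulr0.
    by rewrite mulr0.
  have [g1 g2] := gq_le Fq rq.
  have gf : gq q \is a fin_num.
    rewrite ge0_fin_numE; first by apply: le_lt_trans g1 _; rewrite ltry.
    by apply: esum_ge0 => p Fp; rewrite mule_ge0 ?lee_fin ?vp.
  have g0 : 0 <= fine (gq q).
    by apply: fine_ge0; apply: esum_ge0 => p Fp; rewrite mule_ge0 ?lee_fin ?vp.
  move: g1 g2; rewrite -(fineK gf) !lee_fin => g1 g2.
  rewrite /e asboolT//; set y := fine (gq q) in g0 g1 g2 *.
  have h1 : y * y <= v q * w r q by apply: ler_pM.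
  have h2 : 0 <= a^-1 * (beta q - a * y) ^+ 2 by rewrite mulr_ge0// sqr_ge0.
  have h3 : a^-1 * (beta q - a * y) ^+ 2 = a^-1 * beta q ^+ 2 - 2 * beta q * y * (a^-1 * a) + a * (y * y) * (a^-1 * a) by lra.
  have h4 : a^-1 * a = 1 by rewrite mulVf// gt_eqF.
  have h5 := ler_wpM2l (ltW a_gt0) h1.
  by rewrite h3 h4 !mulr1 in h2; move: h2 h5; lra.
rewrite esumZ//; last first.
  by move=> q Fq; rewrite -EFinD lee_fin addr_ge0 ?mulr_ge0 ?e0 ?sqr_ge0// ltW.
rewrite muleA -EFinM mulfV ?pnatr_eq0// mul1e esumD; first last.
- by move=> q Fq; rewrite lee_fin mulr_ge0 ?e0// ltW.
- by move=> q _; rewrite lee_fin mulr_ge0 ?sqr_ge0.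
under eq_esum do rewrite EFinM.
rewrite esumZ//; last by move=> q _; rewrite lee_fin sqr_ge0.
under [X in (_ + X)%E]eq_esum do rewrite EFinM.
have e0' q : F q -> (0 <= (e q)%:E)%E by move=> Fq; rewrite lee_fin e0.
rewrite (esumZ (ltW a_gt0) e0').
have he : (\esum_(q in F) (e q)%:E <= (cX * v r ^+ 2)%:E)%E.
  apply: esum_le_seq => s us sF; rewrite sumEFin lee_fin.
  have := @exit_sum r [seq q <- s | `[< nb r q >]] F0r (filter_uniq _ us).
  rewrite big_filter -big_mkcond /=; apply.
  by move=> q; rewrite mem_filter => /andP[/asboolP].
apply: le_trans (leeD (lee_wpmul2l _ beta_ell2) (lee_wpmul2l _ he)) _.
- by rewrite lee_fin.
- by rewrite lee_fin ltW.
rewrite -!EFinM -EFinD lee_fin.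
have h4 : a^-1 * a = 1 by rewrite mulVf// gt_eqF.
apply: ler_of_eq; transitivity (4 * a * v r ^+ 2 * (a^-1 * a) + cX * a * v r ^+ 2); first lra.
by rewrite h4; lra.
Qed.

Definition cpiece : R := cz * (Num.sqrt Bg * (2 * lam0^-1)) + cv * (lam0^-1 * (4 + cX)).

(** The coefficients b are truncated at B = beta / lam0. The truncated part vanishes off the
    neighbours of r and is small in l^2, so the Calderon-Zygmund bound [cz_nb] applies; the
    remainder is dominated by b2 and bounded through [lv1_b2]. *)
Lemma piece_hn : (hn (fun y => \sum_(q <- t) c q * ff q y)%R <= (cpiece * a * v r ^+ 2)%:E)%E.
Proof.
have [lb aeb] := synth_lin c tF.
have mff : measurable_fun setT (fun y => \sum_(q <- t) c q * ff q y).
  rewrite (_ : (fun y => _) = fun y => \sum_(q <- t) (if q \in t then fun y => c q * ff q y else cst 0) y).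
    apply: measurable_sum => q; case: ifP => // qt; apply: measurable_funM => //; apply: ff_m; exact: tF.
  by apply/funext => y; rewrite big_seq [RHS]big_seq; apply: eq_bigr => q ->.
have aeb' : {ae mu, forall y, \sum_(q <- t) c q * ff q y = synth Fl g b y}.
  by apply: filterS aeb => y ->.
rewrite (hn_congr mu_gt0 mu_fin mball ball_gt0 mff (synth_m FlP g_bm b) aeb').
pose B p := lam0^-1 * beta p.
have B0 p : 0 <= B p by rewrite mulr_ge0.
pose b' p := Num.max (- B p) (Num.min (b p) (B p)).
have b'le p : `|b' p| <= B p by have [] := clampP (b p) (B0 p).
pose b'' p := b p - b' p.
have b''le p : F p -> (`|b'' p|%:E <= lam0^-1%:E * b2 p)%E.
  move=> Fp; have [_ h] := clampP (b p) (B0 p).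
  apply: (@le_trans _ _ (Num.max 0 (`|b p| - B p))%:E); first by rewrite lee_fin.
  have b2' : (0 <= lam0^-1%:E * b2 p)%E by rewrite mule_ge0 ?lee_fin.
  case: (leP 0 (`|b p| - B p)) => _ //.
  by rewrite EFinB leeBlDl//; apply: le_trans (b_le Fp) _; rewrite -betaK.
have lB : (lv1 B < +oo)%E by exact: (lv1Z v_gt0).
have lb' : (lv1 b' < +oo)%E.
  by apply: le_lt_trans (le_lv1 _) lB => p _; rewrite (ger0_norm (B0 p)).
have lb''le : (lv1 b'' <= (lam0^-1 * ((4 + cX) * a * v r ^+ 2))%:E)%E.
  apply: (@le_trans _ _ (\esum_(p in F) (lam0^-1%:E * ((v p)%:E * b2 p)))%E).
    by apply: le_esum => p Fp; rewrite EFinM muleC muleCA lee_wpmul2l ?lee_fin ?vp ?b''le.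
  rewrite esumZ//; last by move=> p Fp; rewrite mule_ge0 ?lee_fin ?vp.
  by rewrite [leRHS]EFinM; apply: lee_wpmul2l; [rewrite lee_fin|exact: lv1_b2].
have lb'' : (lv1 b'' < +oo)%E by apply: le_lt_trans lb''le _; rewrite ltry.
have aeD := synthD mu_gt0 mu_fin mball ball_gt0 v_gt0 Fl_uniq FlP cv_ge0 g_bm g_hn lb' lb''.
have bE : (fun p => b' p + b'' p) = b by apply/funext => p; rewrite /b'' addrC subrK.
rewrite bE in aeD.
have ms b0 : measurable_fun setT (synth Fl g b0) by exact: (synth_m FlP g_bm).
rewrite (hn_congr mu_gt0 mu_fin mball ball_gt0 (ms b) (measurable_funD (ms b') (ms b'')) aeD).
apply: le_trans (hnD mu_gt0 mu_fin mball ball_gt0 (ms b') (ms b'')) _.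
have h2 : (hn (synth Fl g b'') <= (cv * (lam0^-1 * ((4 + cX) * a * v r ^+ 2)))%:E)%E.
  apply: le_trans (synth_hn mu_gt0 mu_fin mball ball_gt0 v_gt0 Fl_uniq FlP cv_ge0 g_bm g_hn lb'') _.
  by rewrite EFinM lee_wpmul2l ?lee_fin.
suff h1 : (hn (synth Fl g b') <= (cz * (Num.sqrt Bg * (2 * lam0^-1)) * a * v r ^+ 2)%:E)%E.
  by apply: le_trans (leeD h1 h2) _; rewrite -EFinD lee_fin /cpiece; lra.
apply/lee_addgt0Pr => e e0.
have cv1 : 0 < cv + 1 by rewrite ltr_wpDl.
have fb0 p : F p -> (0 <= (`|b' p| * v p)%:E)%E by move=> Fp; rewrite lee_fin mulr_ge0 ?vp.
(* The bound [cz_nb] concerns finite sums, while the truncated coefficients may have infinite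
   support: a remainder that is small in the weighted norm is cut off. *)
have [s0 [us0 s0F tail]] := esum_tail_seq (divr_gt0 e0 cv1) fb0 lb'.
have aes := synth_split us0 s0F lb'.
pose d2 p := if p \in s0 then 0 else b' p.
pose s1 := [seq p <- s0 | `[< nb r p >]].
have sumE y : \sum_(p <- s0) b' p * g p y = \sum_(p <- s1) b' p * g p y.
  rewrite big_filter [RHS]big_mkcond big_seq [RHS]big_seq; apply: eq_bigr => p ps.
  case: asboolP => // np; have Bp : B p = 0 by rewrite /B beta_out ?mulr0//; exact: s0F.
  by have := b'le p; rewrite Bp normr_le0 => /eqP ->; rewrite mul0r.
have us1 : uniq s1 by exact: filter_uniq.
have s1nb p : p \in s1 -> nb r p by rewrite mem_filter => /andP[/asboolP].
have s1F p : p \in s1 -> F p by move=> /s1nb/nbF0; right.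
pose a1 := Num.sqrt Bg * (2 * lam0^-1) * a.
have B1 : 0 < Bg by rewrite ltr_pwDr// le_max ler01 orbT.
have a10 : 0 < a1 by rewrite !mulr_gt0 ?sqrtr_gt0 ?invr_gt0 ?lam0_gt0.
have l2 : I (fun y => (\sum_(p <- s1) b' p * g p y) ^+ 2) <= a1 ^+ 2 * v r ^+ 2.
  apply: le_trans (bessel b' us1 s1F) _.
  have h : \sum_(p <- s1) beta p ^+ 2 <= 4 * (a ^+ 2 * v r ^+ 2).
    rewrite -lee_fin -sumEFin; apply: le_trans beta_ell2; exact: sum_le_esum.
  have h' : \sum_(p <- s1) b' p ^+ 2 <= lam0^-1 ^+ 2 * \sum_(p <- s1) beta p ^+ 2.
    rewrite mulr_sumr; apply: ler_sum => p _; rewrite -exprMn -[leLHS]real_normK ?num_real//.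
    by rewrite ler_pXn2r ?nnegrE ?b'le ?mulr_ge0.
  have l2 := sqr_ge0 (lam0^-1 : R).
  have := le_trans h' (ler_wpM2l l2 h) => /(ler_wpM2l Bg_ge0) /le_trans; apply.
  rewrite /a1 !exprMn sqr_sqrtr ?Bg_ge0//; apply: ler_of_eq; lra.
have hcz := cz_nb (b := b') F0r us1 s1nb a10 l2.
have mS : measurable_fun setT (fun y => \sum_(p <- s1) b' p * g p y).
  rewrite (_ : (fun y => _) = synth Fl g (fun p => if p \in s1 then b' p else 0)); first exact: ms.
  by apply/funext => y; rewrite (synth_fin Fl_uniq FlP).
have aes' : {ae mu, forall y, synth Fl g b' y = \sum_(p <- s1) b' p * g p y + synth Fl g d2 y}.
  by apply: filterS aes => y ->; rewrite sumE.
rewrite (hn_congr mu_gt0 mu_fin mball ball_gt0 (ms b') (measurable_funD mS (ms d2)) aes').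
apply: le_trans (hnD mu_gt0 mu_fin mball ball_gt0 mS (ms d2)) _.
have ld2 : (lv1 d2 <= (e / (cv + 1))%:E)%E.
  apply: le_trans (ltW tail); apply: esum_le_seq => s us sF.
  rewrite (bigID (mem s0))/= big1 ?add0e; last by move=> p ps; rewrite /d2 ps normr0 mul0r.
  apply: (@le_trans _ _ (\sum_(p <- [seq p <- s | p \notin s0]) (`|b' p| * v p)%:E)%E).
    by rewrite big_filter; apply: lee_sum => p ps; rewrite /d2 (negPf ps).
  apply: sum_le_esum.
  - exact: filter_uniq.
  - by move=> p; rewrite mem_filter => /andP[ps /sF Fp]; split=> //= /(negP ps).
have ld2' : (lv1 d2 < +oo)%E by apply: le_lt_trans ld2 _; rewrite ltry.
apply: leeD.
  by apply: le_trans hcz _; rewrite lee_fin /a1; lra.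
apply: le_trans (synth_hn mu_gt0 mu_fin mball ball_gt0 v_gt0 Fl_uniq FlP cv_ge0 g_bm g_hn ld2') _.
apply: le_trans (lee_wpmul2l _ ld2) _; first by rewrite lee_fin.
rewrite -EFinM lee_fin mulrA ler_pdivrMr// mulrC ler_pM2l//; lra.
Qed.

End piece.
End frame.

(** * A stopping time argument *)

Lemma bigmax_mem (T : eqType) (u : seq T) (g : T -> nat) : u != [::] ->
  exists2 r, r \in u & g r = \max_(i <- u) g i.
Proof.
case: u => // r1 u _; elim: u r1 => [|r2 u IH] r1; first by exists r1; rewrite ?inE// big_seq1.
have [r0 r0u r0N] := IH r2; rewrite big_cons.
case: (leqP (g r1) (\max_(i <- r2 :: u) g i)) => _; first by exists r0; rewrite // inE r0u orbT.
by exists r1; rewrite // mem_head.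
Qed.

Section stopping.
Context {R : realType} {disp : measure_display} {X : measurableType disp}.
Variables (mu : {measure set X -> \bar R}) (d : X -> X -> R).
Hypotheses (mu_gt0 : (0 < mu setT)%E) (mu_fin : (mu setT < +oo)%E).
Hypothesis mball : forall x r, measurable (qball d x r).
Hypothesis ball_gt0 : forall x r, 0 < r -> (0 < mu (qball d x r))%E.
Local Notation T := (nat * set X)%type.
Variables (F0 : set T) (v : T -> R) (A : T -> set X) (h f : T -> X -> R).
Variables (nb : T -> T -> Prop) (ch0 cA cU P : R).
Hypotheses (ch0_gt0 : 0 < ch0) (cA_gt0 : 0 < cA) (cU_gt0 : 0 < cU) (P_ge0 : 0 <= P).
Hypothesis v_gt0 : forall p, F0 p -> 0 < v p.
Hypothesis F0_m : forall p, F0 p -> measurable p.2.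
Hypothesis F0_pt : forall p, F0 p -> exists x, p.2 x.
Hypothesis F0_nest : forall p q, F0 p -> F0 q -> (p.1 <= q.1)%N -> p.2 `&` q.2 !=set0 -> q.2 `<=` p.2.
Hypothesis A_m : forall p, F0 p -> measurable (A p).
Hypothesis A_sub : forall p, F0 p -> A p `<=` p.2.
Hypothesis A_vol : forall p, F0 p -> cA * v p ^+ 2 <= vol mu (A p).
Hypothesis F0_vol : forall p, F0 p -> vol mu p.2 <= cU * v p ^+ 2.
Hypothesis h_bm : forall p, F0 p -> bm (h p).
Hypothesis h_A : forall p x, F0 p -> A p x -> ch0 / v p ^+ 2 <= h p x ^+ 2.
Hypothesis f_m : forall p, F0 p -> measurable_fun setT (f p).
Hypothesis nb_sub : forall r q, F0 r -> F0 q -> (r.1 <= q.1)%N -> q.2 `<=` r.2 -> nb r q.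
Local Notation hn := (atomic_H1_norm mu d).
Local Notation I f := (\int[mu]_x f x).
Hypothesis piece : forall r (t : seq T) (c : T -> R) (a : R), F0 r -> uniq t ->
  (forall q, q \in t -> F0 q /\ nb r q) -> 0 < a -> \sum_(q <- t) c q ^+ 2 <= a ^+ 2 * v r ^+ 2 ->
  (hn (fun y => \sum_(q <- t) c q * f q y)%R <= (P * a * v r ^+ 2)%:E)%E.

Section decomposition.
Variables (D : seq T) (c : T -> R).
Hypotheses (uD : uniq D) (DF : forall q, q \in D -> F0 q) (c_neq0 : forall q, q \in D -> c q != 0).

Let s2 x := \sum_(q <- D) c q ^+ 2 * h q x ^+ 2.
Definition sqfun x := Num.sqrt (s2 x).

Let bterm q : q \in D -> bm (fun x => c q ^+ 2 * h q x ^+ 2).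
Proof. by move=> /DF Fq; apply: bmZ; apply: bmX; exact: h_bm. Qed.

Let bs2 : bm s2.
Proof.
rewrite (_ : s2 = fun x => \sum_(q <- D) (if q \in D then fun x => c q ^+ 2 * h q x ^+ 2 else cst 0) x).
  by apply: bm_sum => q; case: ifP => [/bterm//|_]; exact: bm_cst.
by apply/funext => x; rewrite /s2 big_seq [RHS]big_seq; apply: eq_bigr => q ->.
Qed.

Let s20 x : 0 <= s2 x.
Proof. by apply: sumr_ge0 => q _; rewrite mulr_ge0 ?sqr_ge0. Qed.

Let s2_term q x : q \in D -> c q ^+ 2 * h q x ^+ 2 <= s2 x.
Proof.
move=> qD; rewrite /s2 (bigD1_seq q)//= lerDl sumr_ge0// => p _.
by rewrite mulr_ge0 ?sqr_ge0.
Qed.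

Lemma sqfun_bm : bm sqfun.
Proof.
have [ms [M sM]] := bs2; split.
  rewrite (_ : sqfun = fun x => s2 x `^ 2^-1); last first.
    by apply/funext => x; rewrite powR12_sqrt.
  exact: (measurableT_comp (measurable_powR _)).
exists (Num.sqrt M) => x; rewrite ger0_norm ?sqrtr_ge0// ler_wsqrtr//.
by apply: le_trans (sM x); exact: ler_norm.
Qed.

(** A minimum over finitely many elements with nonzero coefficients. It is the base of the heights e
    2^k and ensures that every element passes the test at k = 0. *)
Let low : exists2 e : R, 0 < e & forall q x, q \in D -> A q x -> e ^+ 2 < s2 x.
Proof.
have [e e0 he] : exists2 e : R, 0 < e & forall q, q \in D -> e ^+ 2 < c q ^+ 2 * (ch0 / v q ^+ 2).
  have pos_q q : q \in D -> 0 < c q ^+ 2 * (ch0 / v q ^+ 2).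
    move=> qD; have v0 := v_gt0 (DF qD).
    apply: mulr_gt0; last by rewrite divr_gt0// exprn_gt0.
    by rewrite lt_neqAle sqr_ge0 eq_sym sqrf_eq0 c_neq0.
  elim: D pos_q => [|q t IH] pos_q; first by exists 1.
  have [|e e0 he] := IH; first by move=> p pt; apply: pos_q; rewrite inE pt orbT.
  have b0 := pos_q q (mem_head _ _); set b := _ * _ in b0.
  have sb : 0 < Num.sqrt b / 2 by rewrite divr_gt0// sqrtr_gt0.
  exists (Num.min e (Num.sqrt b / 2)); first by rewrite lt_min e0.
  have m0 : 0 <= Num.min e (Num.sqrt b / 2) by rewrite le_min !ltW.
  move=> p; rewrite inE => /orP[/eqP ->|pt].
    apply: (@le_lt_trans _ _ ((Num.sqrt b / 2) ^+ 2)).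
      by rewrite ler_pXn2r ?nnegrE ?(ltW sb)// ge_min lexx orbT.
    rewrite -/b expr_div_n sqr_sqrtr ?(ltW b0)// ltr_pdivrMr ?exprn_gt0// ltr_pMr//; lra.
  apply: le_lt_trans (he p pt); rewrite ler_pXn2r ?nnegrE ?(ltW e0)//.
  by rewrite ge_min lexx.
exists e => // q x qD Ax; apply: lt_le_trans (he q qD) _; apply: le_trans (s2_term x qD).
by rewrite ler_wpM2l ?sqr_ge0//; apply: h_A => //; exact: DF.
Qed.

Section with_base.
Variable e : R.
Hypotheses (e_gt0 : 0 < e) (e_low : forall q x, q \in D -> A q x -> e ^+ 2 < s2 x).

Let th k := e * 2 ^+ k.
Let th0 k : 0 < th k. Proof. by rewrite mulr_gt0// exprn_gt0. Qed.
Let Om k := [set x | th k ^+ 2 < s2 x].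

Let Om_m k : measurable (Om k).
Proof.
have [ms _] := bs2.
have := ms measurableT `]th k ^+ 2, +oo[%classic (measurable_itv _).
rewrite setTI; congr (measurable _); apply/seteqP; split=> x /=; rewrite in_itv/= andbT//.
Qed.

(* [q] is assigned to the last [k] for which [Om k] fills half of [A q]; the elements assigned
   to the same [k] are grouped under the maximal ones. *)
Let half q k := vol mu (A q) / 2 <= vol mu (A q `&` Om k).

(** The test holds at k = 0 by the choice of e and fails for large k because the square function is
    bounded. *)
Let stop q : q \in D -> exists k, half q k /\ ~ half q k.+1.
Proof.
move=> qD; have Fq := DF qD; have mA := A_m Fq.
have volA : 0 < vol mu (A q).
  by apply: lt_le_trans (A_vol Fq); rewrite mulr_gt0// exprn_gt0// v_gt0.
have h0 : half q 0.
  rewrite /half (_ : A q `&` Om 0 = A q); first by move: volA; lra.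
  apply/seteqP; split=> [x []//|x Ax]; split=> //.
  by rewrite /Om /= /th expr0 mulr1; exact: e_low qD Ax.
have [n hn_] : exists n, ~ half q n.
  (* With s2 <= M, the set Om n is empty because th n ^ 2 = e^2 4^n >= e^2 n > M. *)
  have [_ [M sM]] := bs2; exists (Num.truncn (M / e ^+ 2)).+1; set n := _.+1.
  suff -> : half q n = false by [].
  have e2 : 0 < e ^+ 2 by rewrite exprn_gt0.
  have MOm x : s2 x <= th n ^+ 2.
    apply: le_trans (ler_norm _) _; apply: le_trans (sM x) _.
    have M0 : 0 <= M / e ^+ 2.
      by rewrite divr_ge0 ?(ltW e2)//; apply: le_trans (sM x).
    have /andP[_ hM] := truncn_itv M0.
    have n2 : (n%:R : R) <= 2 ^+ n by rewrite -natrX ler_nat ltnW// ltn_expl.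
    rewrite /th exprMn mulrC -ler_pdivrMr//.
    apply: (@le_trans _ _ n%:R); first exact: ltW.
    apply: le_trans n2 _; rewrite expr2 ler_peMl// ?exprn_ge0// exprn_ege1//; lra.
  apply/negbTE; rewrite /half -ltNge (_ : A q `&` Om n = set0).
    by rewrite /vol measure0/= divr_gt0.
  by apply/seteqP; split=> x //= [_]; rewrite /Om /= ltNge MOm.
apply: contrapT => no; have all_half k : half q k.
  elim: k => // k hk; apply: contrapT => nk; apply: no; exists k; split=> //.
exact: hn_.
Qed.

Let stop_choice : exists kk : T -> nat, forall q, q \in D -> half q (kk q) /\ ~ half q (kk q).+1.
Proof.
have /choice[kk hk] : forall q : T, exists k, q \in D -> half q k /\ ~ half q k.+1.
  move=> q; case: (boolP (q \in D)) => [qD|_]; last by exists 0%N.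
  by have [k ?] := stop qD; exists k.
by exists kk.
Qed.

Section with_stop.
Variable kk : T -> nat.
Hypothesis kkP : forall q, q \in D -> half q (kk q) /\ ~ half q (kk q).+1.

Let top k r := forall r', r' \in D -> kk r' = k -> r.2 `<=` r'.2 -> (r'.1 <= r.1)%N -> r' = r.

Let same_level q r : F0 q -> F0 r -> q.1 = r.1 -> q.2 `&` r.2 !=set0 -> q = r.
Proof.
move=> Fq Fr qr [x [qx rx]]; rewrite (surjective_pairing q) (surjective_pairing r) qr; congr pair.
by apply/seteqP; split; apply: F0_nest; rewrite ?qr//; exists x.
Qed.

Let top_ex q : q \in D -> exists r, [/\ r \in D, kk r = kk q, q.2 `<=` r.2, (r.1 <= q.1)%N & top (kk q) r].
Proof.
have [n] := ubnP q.1; elim: n q => // n IH q qn qD.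
have [tq|ntq] := pselect (top (kk q) q); first by exists q; split.
have [r' [r'D kr' qr' r'q r'neq]] : exists r', [/\ r' \in D, kk r' = kk q, q.2 `<=` r'.2, (r'.1 <= q.1)%N & r' <> q].
  apply: contrapT => no; apply: ntq => r' r'D kr' qr' r'q.
  by apply: contrapT => r'neq; apply: no; exists r'.
have lt : (r'.1 < q.1)%N.
  rewrite ltn_neqAle r'q andbT; apply/eqP => lev; apply: r'neq.
  have [x qx] := F0_pt (DF qD); apply: same_level => //; [exact: DF|exact: DF|].
  by exists x; split=> //; exact: qr'.
have [|r [rD kr rr' rlev tr]] := IH r' _ r'D; first by rewrite (leq_trans lt)// -ltnS.
exists r; split=> //; first by rewrite kr.
- exact: subset_trans rr'.
- exact: leq_trans rlev r'q.
- by rewrite -kr'.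
Qed.

Let top_choice : exists RR : T -> T, forall q, q \in D ->
  [/\ RR q \in D, kk (RR q) = kk q, q.2 `<=` (RR q).2, ((RR q).1 <= q.1)%N & top (kk q) (RR q)].
Proof.
have /choice[RR hR] : forall q : T, exists r, q \in D ->
    [/\ r \in D, kk r = kk q, q.2 `<=` r.2, (r.1 <= q.1)%N & top (kk q) r].
  move=> q; case: (boolP (q \in D)) => [qD|_]; last by exists q.
  by have [r ?] := top_ex qD; exists r.
by exists RR.
Qed.

Section with_top.
Variable RR : T -> T.
Hypothesis RRP : forall q, q \in D ->
  [/\ RR q \in D, kk (RR q) = kk q, q.2 `<=` (RR q).2, ((RR q).1 <= q.1)%N & top (kk q) (RR q)].

Let Rs := undup (map RR D).

Let RsP r : r \in Rs -> [/\ r \in D, F0 r & top (kk r) r].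
Proof.
rewrite mem_undup => /mapP[q qD ->]; have [rD kr _ _ tr] := RRP qD.
by split=> //; [exact: DF|rewrite kr].
Qed.

Let Rs_disj r r' : r \in Rs -> r' \in Rs -> kk r = kk r' -> r.2 `&` r'.2 !=set0 -> r = r'.
Proof.
move=> /RsP[rD Fr tr] /RsP[r'D Fr' tr'] krr' [x [rx r'x]].
have [le|/ltnW le] := leqP r.1 r'.1.
  by apply: (tr' r rD krr' _ le); apply: F0_nest => //; exists x.
by apply/esym/(tr r' r'D (esym krr') _ le); apply: F0_nest => //; exists x.
Qed.

Let fam r := [seq q <- D | RR q == r].

Definition cst_stop : R := Num.sqrt (8 * cU / (ch0 * cA)).

Let cst0 : 0 < cst_stop.
Proof. by rewrite sqrtr_gt0 !divr_gt0// !mulr_gt0. Qed.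

(** Off Om_(k+1) the function s2 is at most 4 th_k^2. Each A q in the family keeps at least half of
    its volume there, and on it the q-th term is at least c_q^2 ch0 / v_q^2. Integrating s2 over r
    minus Om_(k+1) compares the two; the 8 in [cst_stop] is this 4 times the 2 from the half. *)
Let fam_sum r : r \in Rs ->
  \sum_(q <- fam r) c q ^+ 2 <= (cst_stop * th (kk r)) ^+ 2 * v r ^+ 2.
Proof.
move=> rRs; have [rD Fr tr] := RsP rRs; have v0 := v_gt0 Fr.
pose k1 := (kk r).+1; pose B := r.2 `\` Om k1.
have mr := F0_m Fr; have mB : measurable B by exact: measurableD.
have b1 := bm_indic (R := R) mB.
have up : I (fun x => s2 x * \1_B x) <= th k1 ^+ 2 * vol mu r.2.
  rewrite -(I_indic mu mr) -(IZ _ (bm_ig mu_fin (bm_indic mr))).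
  apply: I_le.
  - exact: (bm_ig mu_fin (bmM bs2 b1)).
  - exact: (bm_ig mu_fin (bmZ _ (bm_indic mr))).
  move=> x; rewrite !indicE; case: (boolP (x \in B)) => [|_].
    rewrite inE => -[rx /negP]; rewrite -leNgt => h1.
    by rewrite mem_set// !mulr1.
  by rewrite mulr0 mulr_ge0// exprn_ge0// ltW.
have famP q : q \in fam r -> [/\ q \in D, F0 q, kk q = kk r & q.2 `<=` r.2].
  rewrite mem_filter => /andP[/eqP qr qD]; have [_ kr sub _ _] := RRP qD.
  by rewrite qr in kr sub; split=> //; exact: DF.
have lower : ch0 * cA / 2 * \sum_(q <- fam r) c q ^+ 2 <= I (fun x => s2 x * \1_B x).
  pose u q : X -> R := if q \in fam r then (fun x => c q ^+ 2 * h q x ^+ 2 * \1_B x) else cst 0.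
  have bu q : bm (u q).
    by rewrite /u; case: ifP => [/famP[qD _ _ _]|_]; [apply: bmM => //; exact: bterm|exact: bm_cst].
  apply: (@le_trans _ _ (\sum_(q <- fam r) I (u q))); last first.
    rewrite -(Isum mu_fin); last by move=> q; exact: (bm_ig mu_fin (bu q)).
    apply: I_le.
    - by apply: (bm_ig mu_fin); exact: bm_sum.
    - exact: (bm_ig mu_fin (bmM bs2 b1)).
    move=> x; apply: (@le_trans _ _ (\sum_(q <- fam r) c q ^+ 2 * h q x ^+ 2 * \1_B x)).
      by rewrite big_seq [leRHS]big_seq; apply: ler_sum => q qf; rewrite /u qf.
    rewrite -mulr_suml ler_wpM2r//.
    rewrite /fam big_filter /s2 [leRHS](bigID (fun q => RR q == r))/= lerDl.
    by apply: sumr_ge0 => q _; rewrite mulr_ge0 ?sqr_ge0.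
  rewrite mulr_sumr big_seq [leRHS]big_seq; apply: ler_sum => q qf.
  have [qD Fq kq qr] := famP q qf; have mA := A_m Fq; have vq := v_gt0 Fq.
  have [_ nh] := kkP qD; rewrite kq -/k1 in nh.
  pose Aq := A q `\` Om k1; have mAq : measurable Aq by exact: measurableD.
  have volAq : cA * v q ^+ 2 / 2 <= vol mu Aq.
    have split_vol : vol mu (A q) = vol mu (A q `&` Om k1) + vol mu Aq.
      have mI : measurable (A q `&` Om k1) by exact: measurableI.
      apply/EFin_inj; rewrite EFinD !volK// -measureU//.
        by congr (mu _); rewrite setUIDK.
      by apply/seteqP; split=> x //= [[_ h1] [_ h2]].
    have := A_vol Fq; move/negP : nh; rewrite /half -ltNge; lra.
  apply: (@le_trans _ _ (c q ^+ 2 * (ch0 / v q ^+ 2) * vol mu Aq)).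
    have e1 : (v q ^+ 2)^-1 * v q ^+ 2 = 1 by rewrite mulVf// expf_neq0// gt_eqF.
    apply: le_trans (ler_wpM2l _ volAq); last by rewrite mulr_ge0 ?sqr_ge0 ?divr_ge0 ?sqr_ge0// ltW.
    rewrite (_ : _ * (cA * _ / 2) = ch0 * cA / 2 * c q ^+ 2 * ((v q ^+ 2)^-1 * v q ^+ 2)); last by lra.
    by rewrite e1 mulr1.
  rewrite /u qf -(I_indic mu mAq) -(IZ _ (bm_ig mu_fin (bm_indic mAq))).
  apply: I_le.
  - exact: (bm_ig mu_fin (bmZ _ (bm_indic mAq))).
  - exact: (bm_ig mu_fin (bmM (bterm qD) b1)).
  move=> x; rewrite !indicE; case: (boolP (x \in Aq)) => [|_]; last first.
    by rewrite mulr0; apply: mulr_ge0; [apply: mulr_ge0; exact: sqr_ge0|exact: ler0n].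
  rewrite inE => -[Ax nO]; rewrite mem_set ?mulr1; last first.
    by split=> //; apply: qr; exact: A_sub.
  by rewrite ler_wpM2l ?sqr_ge0// h_A.
have volr := F0_vol Fr.
have k2 : th k1 ^+ 2 = 4 * th (kk r) ^+ 2.
  have -> : th k1 = th (kk r) * 2 by rewrite /th /k1 exprSr mulrA.
  by move: (th (kk r)) => y; lra.
have cc : 0 < ch0 * cA by rewrite mulr_gt0.
have h1 : ch0 * cA / 2 * \sum_(q <- fam r) c q ^+ 2 <= 4 * th (kk r) ^+ 2 * (cU * v r ^+ 2).
  by apply: le_trans lower _; apply: le_trans up _; rewrite k2 ler_wpM2l// mulr_ge0// sqr_ge0.
rewrite [leRHS](_ : _ = (ch0 * cA)^-1 * (8 * (th (kk r) ^+ 2 * (cU * v r ^+ 2)))); last first.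
  rewrite exprMn [cst_stop ^+ 2]sqr_sqrtr; first by lra.
  by rewrite !divr_ge0 ?mulr_ge0 ?ltW.
by rewrite ler_pdivlMl//; move: h1; lra.
Qed.

(** For each k at most one maximal element contains x, by [Rs_disj], and a contribution requires th
    k < sqfun x. The heights double with k, so their sum is at most twice the largest. *)
Let pointwise x : \sum_(r <- Rs) th (kk r) * \1_(A r `&` Om (kk r)) x <= 2 * sqfun x.
Proof.
pose u := [seq r <- Rs | x \in A r `&` Om (kk r)].
have -> : \sum_(r <- Rs) th (kk r) * \1_(A r `&` Om (kk r)) x = \sum_(r <- u) th (kk r).
  rewrite /u big_filter [RHS]big_mkcond; apply: eq_bigr => r _.
  by rewrite indicE; case: ifP; rewrite ?mulr1 ?mulr0.
have uP r : r \in u -> [/\ r \in Rs, A r x & th (kk r) ^+ 2 < s2 x].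
  by rewrite mem_filter => /andP[/[!inE] -[Ax Ox] rRs].
have uu : uniq u by rewrite filter_uniq// undup_uniq.
have inj : {in u &, injective kk}.
  move=> r r' /uP[rRs Ax _] /uP[r'Rs A'x _] krr'; apply: Rs_disj => //.
  have [_ Fr _] := RsP rRs; have [_ Fr' _] := RsP r'Rs.
  by exists x; split; exact: A_sub.
pose N := \max_(r <- u) kk r.
have leN r : r \in u -> (kk r <= N)%N by move=> ru; exact: (@leq_bigmax_seq _ u xpredT kk r).
have [u0|[r0 [r0u r0N]]] : u = [::] \/ exists r0, r0 \in u /\ kk r0 = N.
- have [->|un] := eqVneq u [::]; first by left.
  by right; have [r0 ? ?] := bigmax_mem kk un; exists r0.
- by rewrite u0 big_nil mulr_ge0// sqrtr_ge0.
have hN : th N <= sqfun x.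
  have [_ _ h1] := uP r0 r0u; rewrite r0N in h1.
  by rewrite -(ger0_norm (ltW (th0 N))) -sqrtr_sqr ler_wsqrtr// ltW.
apply: le_trans (ler_wpM2l _ hN); last by [].
have -> : \sum_(r <- u) th (kk r) = th N * \sum_(r <- u) (2^-1) ^+ (N - kk r).
  rewrite mulr_sumr big_seq [RHS]big_seq; apply: eq_bigr => r ru.
  have -> : th N = th (kk r) * 2 ^+ (N - kk r) by rewrite /th -mulrA -exprD subnKC// leN.
  by rewrite exprVn mulfK// expf_neq0// pnatr_eq0.
rewrite mulrC ler_wpM2r ?(ltW (th0 N))//.
rewrite -(big_map kk xpredT (fun k => (2^-1 : R) ^+ (N - k))); apply: geo_uniq => //.
- by rewrite map_inj_in_uniq.
- by move=> i j /mapP[r /leN rN ->] /mapP[r' /leN r'N ->] /= h1; rewrite -[LHS](subKn rN) -[RHS](subKn r'N) h1.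
Qed.

(** By the choice of the stopping index, v_r^2 is at most 2 / cA times the volume of A r intersected
    with Om_k. Thus the total of th_k v_r^2 is bounded by integrating [pointwise]. *)
Lemma stop_total : (hn (fun y => \sum_(q <- D) c q * f q y)%R <=
  (P * cst_stop * (2 / cA) * 2 * I sqfun)%:E)%E.
Proof.
have mfq q : measurable_fun setT (if q \in D then f q else cst 0).
  by case: ifP => // qD; apply: f_m; exact: DF.
have mfam r : measurable_fun setT (fun y => \sum_(q <- fam r) c q * f q y).
  rewrite (_ : (fun y => _) = fun y => \sum_(q <- fam r) c q * (if q \in D then f q else cst 0) y).
    by apply: measurable_sum => q; apply: measurable_funM.
  apply/funext => y; rewrite big_seq [RHS]big_seq; apply: eq_bigr => q.
  by rewrite mem_filter => /andP[_ ->].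
have -> : (fun y => \sum_(q <- D) c q * f q y) = (fun y => \sum_(r <- Rs) \sum_(q <- fam r) c q * f q y).
  apply/funext => y; rewrite /fam; under [RHS]eq_bigr do rewrite big_filter big_mkcond.
  rewrite exchange_big/= big_seq [RHS]big_seq; apply: eq_bigr => q qD.
  rewrite (bigD1_seq (RR q)) ?undup_uniq ?mem_undup ?map_f//= eqxx big1 ?addr0// => r.
  by rewrite eq_sym => /negPf ->.
apply: le_trans (hn_fsum mu_gt0 mu_fin mball ball_gt0 _ mfam) _.
apply: (@le_trans _ _ (\sum_(r <- Rs) (P * (cst_stop * th (kk r)) * v r ^+ 2)%:E)%E).
  rewrite big_seq [leRHS]big_seq; apply: lee_sum => r rRs; have [rD Fr _] := RsP rRs.
  apply: piece => //; first exact: filter_uniq.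
  - move=> q; rewrite mem_filter => /andP[/eqP qr qD]; have [_ _ sub lev _] := RRP qD.
    by rewrite qr in sub lev; split; [exact: DF|apply: nb_sub => //; exact: DF].
  - exact: mulr_gt0.
  - exact: fam_sum.
rewrite sumEFin lee_fin.
have mI r : r \in Rs -> measurable (A r `&` Om (kk r)).
  by move=> /RsP[_ Fr _]; apply: measurableI => //; exact: A_m.
pose w r : X -> R := if r \in Rs then (fun x => th (kk r) * \1_(A r `&` Om (kk r)) x) else cst 0.
have bw r : bm (w r).
  by rewrite /w; case: ifP => [/mI mr|_]; [apply: bmZ; exact: bm_indic|exact: bm_cst].
have key : \sum_(r <- Rs) th (kk r) * v r ^+ 2 <= 2 / cA * (2 * I sqfun).
  apply: (@le_trans _ _ (2 / cA * \sum_(r <- Rs) I (w r))).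
    rewrite mulr_sumr big_seq [leRHS]big_seq; apply: ler_sum => r rRs.
    have [rD Fr _] := RsP rRs; have [hf _] := kkP rD.
    rewrite /w rRs (IZ _ (bm_ig mu_fin (bm_indic (mI r rRs)))) (I_indic mu (mI r rRs)).
    have h1 := A_vol Fr; rewrite /half in hf.
    have h2 : v r ^+ 2 <= 2 / cA * vol mu (A r `&` Om (kk r)).
      rewrite mulrAC ler_pdivlMr// mulrC; move: h1 hf; lra.
    by have := ler_wpM2l (ltW (th0 (kk r))) h2; lra.
  rewrite ler_wpM2l ?divr_ge0 ?(ltW cA_gt0)//.
  rewrite -(Isum mu_fin); last by move=> r; exact: (bm_ig mu_fin (bw r)).
  rewrite -(IZ _ (bm_ig mu_fin sqfun_bm)); apply: I_le.
  - by apply: (bm_ig mu_fin); exact: bm_sum.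
  - exact: (bm_ig mu_fin (bmZ _ sqfun_bm)).
  move=> x; apply: le_trans (pointwise x).
  by rewrite big_seq [leRHS]big_seq; apply: ler_sum => r rRs; rewrite /w rRs.
have Pc : 0 <= P * cst_stop by rewrite mulr_ge0// ltW.
have := ler_wpM2l Pc key; rewrite mulr_sumr => h1.
apply: (@le_trans _ _ (\sum_(r <- Rs) P * cst_stop * (th (kk r) * v r ^+ 2))); last by move: h1; lra.
by apply: ler_sum => r _; lra.
Qed.

End with_top.

Lemma stop_kk : (hn (fun y => \sum_(q <- D) c q * f q y)%R <=
  (P * cst_stop * (2 / cA) * 2 * I sqfun)%:E)%E.
Proof. by have [RR hR] := top_choice; exact: stop_total hR. Qed.

End with_stop.

Lemma stop_base : (hn (fun y => \sum_(q <- D) c q * f q y)%R <=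
  (P * cst_stop * (2 / cA) * 2 * I sqfun)%:E)%E.
Proof. by have [kk hk] := stop_choice; exact: stop_kk hk. Qed.

End with_base.

Lemma stop_neq0 : (hn (fun y => \sum_(q <- D) c q * f q y)%R <=
  (P * cst_stop * (2 / cA) * 2 * I sqfun)%:E)%E.
Proof. by have [e e0 he] := low; exact: stop_base e0 he. Qed.

End decomposition.

Definition cstop : R := P * cst_stop * (2 / cA) * 2.

(** Elements with zero coefficient are discarded first, since the base height in [low] requires all
    coefficients to be nonzero. *)
Lemma stopping_hn (D : seq T) (c : T -> R) : uniq D -> (forall q, q \in D -> F0 q) ->
  (hn (fun y => \sum_(q <- D) c q * f q y)%R <=
   (cstop * I (fun x => Num.sqrt (\sum_(q <- D) c q ^+ 2 * h q x ^+ 2)))%:E)%E.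
Proof.
move=> uD DF; pose D' := [seq q <- D | c q != 0].
have uD' : uniq D' by exact: filter_uniq.
have D'F q : q \in D' -> F0 q by rewrite mem_filter => /andP[_ /DF].
have c0 q : q \in D' -> c q != 0 by rewrite mem_filter => /andP[].
have e1 (g : T -> R) : (forall q, c q = 0 -> g q = 0) -> \sum_(q <- D) g q = \sum_(q <- D') g q.
  move=> g0; rewrite /D' big_filter [RHS]big_mkcond; apply: eq_bigr => q _.
  by case: eqP => // /g0.
have -> : (fun y => \sum_(q <- D) c q * f q y) = (fun y => \sum_(q <- D') c q * f q y).
  by apply/funext => y; apply: e1 => q ->; rewrite mul0r.
have -> : I (fun x => Num.sqrt (\sum_(q <- D) c q ^+ 2 * h q x ^+ 2)) = I (sqfun D' c).
  apply: eq_Rintegral => x _; congr Num.sqrt; apply: e1 => q ->.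
  by rewrite expr0n mul0r.
exact: stop_neq0.
Qed.

End stopping.

(** * Conditional expectations *)

Lemma bm_sqrt {R : realType} {disp : measure_display} {X : measurableType disp} (f : X -> R) :
  bm f -> bm (fun x => Num.sqrt (f x)).
Proof.
move=> [mf [M fM]]; split.
  rewrite (_ : (fun x => _) = fun x => Num.max 0 (f x) `^ 2^-1); last first.
    apply/funext => x; rewrite powR12_sqrt ?le_max ?lexx//.
    by case: (leP 0 (f x)) => // /ltW f0; rewrite sqrtr0 ler0_sqrtr.
  apply: (measurableT_comp (measurable_powR _)).
  by apply: measurable_maxr => //; exact: measurable_cst.
exists (Num.sqrt M) => x; rewrite ger0_norm ?sqrtr_ge0// ler_wsqrtr//.
by apply: le_trans (fM x); exact: ler_norm.
Qed.

Section martingale.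
Context {R : realType} {disp : measure_display} {X : measurableType disp}.
Variables (mu : {measure set X -> \bar R}) (d : X -> X -> R).
Variables (kap A1 A2 K1 K2 : R).
Hypothesis G : space_geometry mu d kap A1 A2 K1 K2.
Variables (delta a0 eta C1 C2 : R) (E : nat -> set (set X)).
Hypothesis DC : dyadic_cubes mu d delta a0 eta C1 C2 E.
Hypotheses (delta_gt0 : 0 < delta) (delta_lt1 : delta < 1) (a0_gt0 : 0 < a0).
Local Notation I f := (\int[mu]_x f x).
Let mu_fin := sg_fin G.
Let cubP := cubesP G DC delta_gt0 delta_lt1 a0_gt0.

(** An explicit version of the conditional expectation on Sigma_n. Unlike the chosen version
    [condexp], it is linear at every point on integrable functions. *)
Definition av n (f : X -> R) (x : X) : R :=
  \sum_(Q <- cubes E n) I (fun y => f y * \1_Q y) / vol mu Q * \1_Q x.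

Lemma av_cube n f Q x : E n Q -> Q x -> av n f x = I (fun y => f y * \1_Q y) / vol mu Q.
Proof.
move=> EQ Qx; rewrite /av (bigD1_seq Q) ?cubes_uniq//=; last exact/cubP.
rewrite indicE mem_set// mulr1 big_seq_cond big1 ?addr0// => P /andP[/cubP EP PQ].
rewrite indicE memNset ?mulr0// => Px; move/eqP : PQ; apply.
by apply: (cube_eq DC EP EQ); exists x.
Qed.

Lemma ae_cube n : {ae mu, forall x, exists2 Q, E n Q & Q x}.
Proof. by apply: negligibleS (dc_cover DC n) => x /= h [Q EQ Qx]; apply: h; exists Q. Qed.

Lemma avD n f g x : ig mu f -> ig mu g -> av n (fun y => f y + g y) x = av n f x + av n g x.
Proof.
move=> igf igg; rewrite /av -big_split/= big_seq [RHS]big_seq; apply: eq_bigr => Q /cubP EQ.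
have bQ := bm_indic (R := R) (cube_measurable DC EQ).
rewrite -mulrDl -mulrDl -(ID (ig_mulbm igf bQ) (ig_mulbm igg bQ)).
by congr (_ / _ * _); apply: eq_Rintegral => y _; rewrite mulrDl.
Qed.

Lemma avZ n c f x : ig mu f -> av n (fun y => c * f y) x = c * av n f x.
Proof.
move=> igf; rewrite /av mulr_sumr big_seq [RHS]big_seq; apply: eq_bigr => Q /cubP EQ.
have bQ := bm_indic (R := R) (cube_measurable DC EQ).
rewrite !mulrA -(IZ c (ig_mulbm igf bQ)); congr (_ / _ * _).
by apply: eq_Rintegral => y _; rewrite mulrA.
Qed.

Lemma av_bm n f : bm (av n f).
Proof.
rewrite (_ : av n f = fun x => \sum_(Q <- cubes E n)
    (if Q \in cubes E n then fun x => I (fun y => f y * \1_Q y) / vol mu Q * \1_Q x else cst 0) x).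
  apply: bm_sum => Q; case: ifP => [/cubP EQ|_]; last exact: bm_cst.
  by apply: bmZ; apply: bm_indic; exact: (cube_measurable DC EQ).
by apply/funext => x; rewrite /av big_seq [RHS]big_seq; apply: eq_bigr => Q ->.
Qed.

Let Gn n := cubes_upto E n.

(** The sets that contain or miss Q form a sigma-algebra, and by nestedness it contains all cubes of
    level at most n. So cubes of level n cannot be divided by Sigma_n. *)
Lemma sigma_cube n (A : set X) Q : <<s Gn n >> A -> E n Q -> Q `<=` A \/ Q `&` A = set0.
Proof.
move=> sA EQ; pose W := [set B : set X | Q `<=` B \/ Q `&` B = set0].
suff : <<s Gn n >> `<=` W by move=> /(_ A sA).
apply: smallest_sub.
- split.
  + by right; rewrite setI0.
  + move=> B [QB|QB]; [right|left]; first by rewrite setTD; apply/seteqP; split=> x //= [/QB].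
    by rewrite setTD => x Qx Bx; have : (Q `&` B) x by []; rewrite QB.
  + move=> B hB; have [[k QB]|no] := pselect (exists k, Q `<=` B k).
      by left=> x Qx; exists k => //; exact: QB.
    right; apply/seteqP; split=> x //= [Qx [k _ Bx]].
    have [QB|QB] := hB k; first by apply: no; exists k.
    by have : (Q `&` B k) x by []; rewrite QB.
- by move=> B [k /= kn EB]; exact: (dc_nested DC kn EQ EB).
Qed.

Lemma sigma_meas n (A : set X) : <<s Gn n >> A -> measurable A.
Proof.
move=> sA; suff : <<s Gn n >> `<=` measurable by exact.
apply: smallest_sub; first exact: sigma_algebra_measurable.
by move=> B [k _ EB]; exact: (cube_measurable DC EB).
Qed.

Lemma sigma_fun_const n (g : X -> R) Q x y : sigma_measurable_fun (Gn n) g -> E n Q ->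
  Q x -> Q y -> g x = g y.
Proof.
move=> sg EQ Qx Qy; have := sigma_cube (sg [set g x] (measurable_set1 _)) EQ.
case=> [/(_ y Qy) ->//|Q0]; exfalso.
by have : (Q `&` g @^-1` [set g x]) x by []; rewrite Q0.
Qed.

Lemma sigma_fun_meas n (g : X -> R) : sigma_measurable_fun (Gn n) g -> measurable_fun setT g.
Proof. by move=> sg _ B mB; rewrite setTI; apply: sigma_meas; exact: sg. Qed.

Lemma av_condexp n f : ig mu f -> is_condexp mu (Gn n) f (av n f).
Proof.
move=> igf; split.
- have sQ Q : E n Q -> @measurable _ (g_sigma_algebraType (Gn n)) Q.
    by move=> EQ; apply: sub_gen_smallest; exists n => //=.
  have : measurable_fun (setT : set (g_sigma_algebraType (Gn n))) (av n f).
    rewrite (_ : av n f = fun x => \sum_(Q <- cubes E n)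
      (if Q \in cubes E n then fun x => I (fun y => f y * \1_Q y) / vol mu Q * \1_Q x else cst 0) x); last first.
      by apply/funext => x; rewrite /av big_seq [RHS]big_seq; apply: eq_bigr => Q ->.
    apply: measurable_sum => Q; case: ifP => [/cubP EQ|_]; last exact: measurable_cst.
    by apply: measurable_funM => //; apply: measurable_indic; exact: sQ.
  by move=> ma B mB; have := ma measurableT B mB; rewrite setTI.
- exact: (bm_ig mu_fin (av_bm n f)).
- move=> A sA; have mA := sigma_meas sA; rewrite (I_restr mu A (av n f)) (I_restr mu A f).
  have bA := bm_indic (R := R) mA.
  have ig1 := ig_mulbm (bm_ig mu_fin (av_bm n f)) bA; have ig2 := ig_mulbm igf bA.
  have [_ ->] := I_cubes G DC delta_gt0 delta_lt1 a0_gt0 n ig1.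
  have [_ ->] := I_cubes G DC delta_gt0 delta_lt1 a0_gt0 n ig2.
  rewrite big_seq [RHS]big_seq; apply: eq_bigr => Q /cubP EQ.
  have mQ := cube_measurable DC EQ; have bQ := bm_indic (R := R) mQ.
  have [QA|QA] := sigma_cube sA EQ; last first.
    have z (u : X -> R) : I (fun x => u x * \1_A x * \1_Q x) = 0.
      rewrite -[RHS](I0 mu); apply: eq_Rintegral => x _ /=; rewrite !indicE.
      case: (boolP (x \in A)) => [/[!inE] Ax|_]; last by rewrite mulr0 mul0r.
      rewrite memNset ?mulr0// => Qx.
      by have : (Q `&` A) x by []; rewrite QA.
    by rewrite !z.
  have dropA (u : X -> R) : I (fun x => u x * \1_A x * \1_Q x) = I (fun x => u x * \1_Q x).
    apply: eq_Rintegral => x _; rewrite !indicE.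
    case: (boolP (x \in Q)) => [/[!inE] /QA Ax|_]; last by rewrite !mulr0.
    by rewrite mem_set// !mulr1.
  rewrite !dropA.
  transitivity (I (fun x => (I (fun y => f y * \1_Q y) / vol mu Q) * \1_Q x)).
    apply: eq_Rintegral => x _; rewrite !indicE; case: (boolP (x \in Q)) => [|_]; last by rewrite !mulr0.
    by rewrite inE => Qx; rewrite (av_cube f EQ Qx).
  rewrite (IZ _ (bm_ig mu_fin bQ)) (I_indic mu mQ) divfK// gt_eqF//.
  exact: (vol_cube_gt0 G DC delta_gt0 delta_lt1 a0_gt0 EQ).
Qed.

Lemma condexpP n f : ig mu f -> is_condexp mu (Gn n) f (condexp mu (Gn n) f).
Proof. by move=> igf; apply: (@xgetPex _ (cst 0) [set g | is_condexp mu (Gn n) f g]); exists (av n f); exact: av_condexp. Qed.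

(** Any version is constant on each cube of level n, hence equal there to its mean, which is the
    mean of f. *)
Lemma condexp_av n f : ig mu f -> {ae mu, forall x, condexp mu (Gn n) f x = av n f x}.
Proof.
move=> igf; have [sg igg gI] := condexpP n igf; set g := condexp _ _ _ in sg igg gI *.
apply: filterS (ae_cube n) => x [Q EQ Qx].
have sQ : <<s Gn n >> Q by apply: sub_gen_smallest; exists n => //=.
have mQ := cube_measurable DC EQ; have bQ := bm_indic (R := R) mQ.
have Q0 := vol_cube_gt0 G DC delta_gt0 delta_lt1 a0_gt0 EQ.
rewrite (av_cube f EQ Qx) -(I_restr mu) -(gI Q sQ) I_restr.
have -> : I (fun y => g y * \1_Q y) = I (fun y => g x * \1_Q y).
  apply: eq_Rintegral => y _; rewrite indicE; case: (boolP (y \in Q)) => [|_]; last by rewrite !mulr0.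
  by rewrite inE => Qy; rewrite (sigma_fun_const sg EQ Qy Qx).
by rewrite (IZ _ (bm_ig mu_fin bQ)) (I_indic mu mQ) mulfK// gt_eqF.
Qed.

Definition avd n f x : R := av n f x - (if n is n'.+1 then av n' f x else 0).

Lemma avdD n f g x : ig mu f -> ig mu g -> avd n (fun y => f y + g y) x = avd n f x + avd n g x.
Proof.
move=> igf igg; rewrite /avd avD//; case: n => [|n]; first by rewrite !subr0.
by rewrite avD//; lra.
Qed.

Lemma avdZ n c f x : ig mu f -> avd n (fun y => c * f y) x = c * avd n f x.
Proof.
move=> igf; rewrite /avd avZ//; case: n => [|n]; first by rewrite !subr0.
by rewrite avZ//; lra.
Qed.

Lemma avd_bm n f : bm (avd n f).
Proof.
case: n => [|n]; rewrite /avd; first by apply: bmB; [exact: av_bm|exact: bm_cst].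
by apply: bmB; exact: av_bm.
Qed.

Definition sqf f x : \bar R := sqrte (\sum_(0 <= n <oo) (avd n f x ^+ 2)%:E)%E.

Lemma measurable_sqrte : measurable_fun setT (@sqrte R).
Proof.
rewrite (_ : @sqrte R = fun x => if (0 <= x)%E then (x `^ 2^-1)%E else 0%E); last first.
  apply/funext => x; case: ifPn => [x0|]; first by rewrite poweR12_sqrt.
  move=> h; case: x h => [r| |] h; [|by rewrite leey in h|by []].
  by rewrite /sqrte ltr0_sqrtr// -lte_fin ltNge.
apply: measurable_fun_if => //.
- apply: (measurable_fun_bool true); rewrite setTI.
  rewrite (_ : _ @^-1` _ = `[0%E, +oo[%classic); first exact: emeasurable_itv.
  by apply/seteqP; split=> x /=; rewrite in_itv/= ?andbT.
- by rewrite setTI; apply: measurable_funTS; exact: measurable_poweR.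
Qed.

Lemma sqf_m f : measurable_fun setT (sqf f).
Proof.
apply: (measurableT_comp measurable_sqrte); apply: ge0_emeasurable_sum.
  by move=> n x _ _; rewrite lee_fin sqr_ge0.
by move=> n _; apply/measurable_EFinP; have [] := bmX 2 (avd_bm n f).
Qed.

Lemma sqf_ge0 f x : (0 <= sqf f x)%E. Proof. exact: sqrte_ge0. Qed.

Lemma mart_norm_sqf f : ig mu f -> mart_H1_norm mu E f = (\int[mu]_x sqf f x)%E.
Proof.
move=> igf; have cm n : measurable_fun setT (condexp mu (Gn n) f).
  by have [sg _ _] := condexpP n igf; exact: sigma_fun_meas sg.
have dm n : measurable_fun setT (mart_diff mu E f n).
  rewrite /mart_diff; case: n => [|n].
    by under eq_fun do rewrite subr0; exact: cm.
  by apply: measurable_funB; exact: cm.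
rewrite /mart_H1_norm; apply: ge0_ae_eq_integral => //.
- apply: (measurableT_comp measurable_sqrte); apply: ge0_emeasurable_sum.
    by move=> n x _ _; rewrite lee_fin sqr_ge0.
  move=> n _; apply/measurable_EFinP; apply: measurable_funX.
  by apply: measurableT_comp => //; exact: dm.
- exact: sqf_m.
- by move=> x _; exact: sqrte_ge0.
- by move=> x _; exact: sqrte_ge0.
have aeN : {ae mu, forall x, forall n, condexp mu (Gn n) f x = av n f x}.
  by apply: ae_foralln => n; exact: condexp_av.
apply: filterS aeN => x h _; rewrite /sqf; congr sqrte; apply: eq_eseriesr => n _.
rewrite real_normK ?num_real//; congr (_ ^+ 2)%:E; rewrite /mart_diff /avd h.
by case: n => // n; rewrite h.
Qed.

(** When al and be, the two norms, are finite and positive, one sums (a + b)^2 <= (1 + be/al) a^2 +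
    (1 + al/be) b^2. Infinite and zero norms are treated apart. *)
Lemma minkowski2 (a b : nat -> R) :
  (sqrte (\sum_(0 <= n <oo) ((a n + b n) ^+ 2)%:E) <=
   sqrte (\sum_(0 <= n <oo) (a n ^+ 2)%:E) + sqrte (\sum_(0 <= n <oo) (b n ^+ 2)%:E))%E.
Proof.
have sq0 (c : nat -> R) n : (0 <= (c n ^+ 2)%:E)%E by rewrite lee_fin sqr_ge0.
have S0 (c : nat -> R) : (0 <= \sum_(0 <= n <oo) (c n ^+ 2)%:E)%E by apply: nneseries_ge0.
have term (c : nat -> R) n : ((c n ^+ 2)%:E <= \sum_(0 <= n <oo) (c n ^+ 2)%:E)%E.
  by rewrite nneseries_esumT//; apply: (esum_ge_term (fun n => (c n ^+ 2)%:E)).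
have := S0 a; have := S0 b; have := term a; have := term b.
case eA : (\sum_(0 <= n <oo) (a n ^+ 2)%:E)%E => [A| |] //; last first.
  by rewrite addye ?leey// gt_eqF// (lt_le_trans _ (sqrte_ge0 _)).
case eB : (\sum_(0 <= n <oo) (b n ^+ 2)%:E)%E => [B| |] //; last first.
  by move=> *; rewrite addey ?leey.
move=> tb ta; rewrite !lee_fin => B0 A0; rewrite /= -EFinD.
have [Az|A0'] := eqVneq A 0.
  have az n : a n = 0.
    by apply/eqP; rewrite -sqrf_eq0 eq_le sqr_ge0 andbT; have := ta n; rewrite Az lee_fin.
  under eq_eseriesr do rewrite az add0r.
  by rewrite eB /= Az sqrtr0 add0r.
have [b0|B0'] := eqVneq B 0.
  have bz n : b n = 0.
    by apply/eqP; rewrite -sqrf_eq0 eq_le sqr_ge0 andbT; have := tb n; rewrite b0 lee_fin.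
  under eq_eseriesr do rewrite bz addr0.
  by rewrite eA /= b0 sqrtr0 addr0.
have Ap : 0 < A by rewrite lt_neqAle eq_sym A0'.
have Bp : 0 < B by rewrite lt_neqAle eq_sym B0'.
set al := Num.sqrt A; set be := Num.sqrt B.
have al0 : 0 < al by rewrite sqrtr_gt0.
have be0 : 0 < be by rewrite sqrtr_gt0.
have al2 : al * al = A by rewrite -expr2 sqr_sqrtr.
have be2 : be * be = B by rewrite -expr2 sqr_sqrtr.
have le : (\sum_(0 <= n <oo) ((a n + b n) ^+ 2)%:E <= ((al + be) ^+ 2)%:E)%E.
  apply: (@le_trans _ _ (((al + be) / al)%:E * \sum_(0 <= n <oo) (a n ^+ 2)%:E +
      ((al + be) / be)%:E * \sum_(0 <= n <oo) (b n ^+ 2)%:E)%E); last first.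
    rewrite eA eB -!EFinM -EFinD lee_fin -al2 -be2.
    have e1 : al^-1 * al = 1 by rewrite mulVf// gt_eqF.
    have e2 : be^-1 * be = 1 by rewrite mulVf// gt_eqF.
    apply: ler_of_eq; transitivity ((al + be) * al * (al^-1 * al) + (al + be) * be * (be^-1 * be)); first lra.
    by rewrite e1 e2; lra.
  have c1 : 0 <= (al + be) / al by rewrite divr_ge0 ?addr_ge0 ?ltW.
  have c2 : 0 <= (al + be) / be by rewrite divr_ge0 ?addr_ge0 ?ltW.
  rewrite -!nneseriesZl//; try by move=> *; rewrite lee_fin sqr_ge0.
  rewrite -nneseriesD; first last.
  - by move=> n _; rewrite mule_ge0 ?lee_fin ?sqr_ge0.
  - by move=> n _; rewrite mule_ge0 ?lee_fin ?sqr_ge0.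
  apply: lee_nneseries => n _; first by rewrite lee_fin sqr_ge0.
  rewrite -!EFinM -EFinD lee_fin.
  have h : 0 <= (be * a n - al * b n) ^+ 2 / (al * be) by rewrite divr_ge0 ?sqr_ge0// mulr_ge0 ?ltW.
  have e1 : al^-1 * al = 1 by rewrite mulVf// gt_eqF.
  have e2 : be^-1 * be = 1 by rewrite mulVf// gt_eqF.
  have hE : (be * a n - al * b n) ^+ 2 / (al * be) =
      be / al * (be^-1 * be) * a n ^+ 2 + al / be * (al^-1 * al) * b n ^+ 2 - 2 * a n * b n * (al^-1 * al) * (be^-1 * be).
    by rewrite invfM; lra.
  rewrite hE e1 e2 !mulr1 in h.
  have -> : (al + be) / al = 1 + be / al by rewrite mulrDl divff ?gt_eqF.
  have -> : (al + be) / be = 1 + al / be by rewrite mulrDl divff ?gt_eqF// addrC.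
  by move: h; lra.
have ab0 : (0 <= ((al + be) ^+ 2)%:E)%E by rewrite lee_fin sqr_ge0.
apply: le_trans (_ : sqrte ((al + be) ^+ 2)%:E <= _)%E; first by rewrite lee_sqrt.
by rewrite /= sqrtr_sqr ger0_norm// addr_ge0 ?ltW.
Qed.

Lemma mart_normD f g : ig mu f -> ig mu g ->
  (mart_H1_norm mu E (fun x => f x + g x)%R <= mart_H1_norm mu E f + mart_H1_norm mu E g)%E.
Proof.
move=> igf igg; rewrite !mart_norm_sqf//; last exact: igD.
rewrite -ge0_integralD//; try exact: sqf_m; try by move=> x _; exact: sqf_ge0.
apply: ge0_le_integral => //; try by move=> x _; exact: sqf_ge0.
- exact: sqf_m.
- by apply: emeasurable_funD; exact: sqf_m.
move=> x _; rewrite /sqf.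
have -> : (\sum_(0 <= n <oo) (avd n (fun x => f x + g x) x ^+ 2)%:E =
    \sum_(0 <= n <oo) ((avd n f x + avd n g x) ^+ 2)%:E)%E.
  by apply: eq_eseriesr => n _; rewrite avdD.
exact: minkowski2.
Qed.

Lemma mart_normZ c f : ig mu f ->
  mart_H1_norm mu E (fun x => c * f x) = (`|c|%:E * mart_H1_norm mu E f)%E.
Proof.
move=> igf; rewrite !mart_norm_sqf//; last exact: igZ.
rewrite -ge0_integralZl//; [|exact: sqf_m|by move=> x _; exact: sqf_ge0].
apply: eq_integral => x _; rewrite /sqf.
have -> : (\sum_(0 <= n <oo) (avd n (fun x => c * f x) x ^+ 2)%:E =
    (c ^+ 2)%:E * \sum_(0 <= n <oo) (avd n f x ^+ 2)%:E)%E.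
  rewrite -nneseriesZl; last by move=> n _; rewrite lee_fin sqr_ge0.
  by apply: eq_eseriesr => n _; rewrite avdZ// exprMn EFinM.
rewrite sqrteM ?lee_fin ?sqr_ge0//.
by rewrite /= sqrtr_sqr.
Qed.

Lemma mart_norm_low f (N : nat) (sg : X -> R) : ig mu f -> bm sg -> (forall x, 0 <= sg x) ->
  {ae mu, forall x, sg x <= \sum_(n < N) avd n f x ^+ 2} ->
  ((I (fun x => Num.sqrt (sg x)))%:E <= mart_H1_norm mu E f)%E.
Proof.
move=> igf [msg [M sgM]] sg0 aes; rewrite mart_norm_sqf//.
have bs := bm_sqrt (conj msg (ex_intro _ M sgM)).
have -> : (I (fun x => Num.sqrt (sg x)))%:E = (\int[mu]_x (Num.sqrt (sg x))%:E)%E.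
  by rewrite /Rintegral fineK//; exact: (integrable_fin_num measurableT (bm_ig mu_fin bs)).
apply: ae_ge0_le_integral => //.
- by apply/measurable_EFinP; case: bs.
- by move=> x _; exact: sqf_ge0.
- exact: sqf_m.
apply: filterS aes => x h _; rewrite -[leLHS]/(sqrte (sg x)%:E) /sqf.
have s0 : (0 <= \sum_(0 <= n <oo) (avd n f x ^+ 2)%:E)%E.
  by apply: nneseries_ge0 => n _ _; rewrite lee_fin sqr_ge0.
rewrite lee_sqrt//; apply: (@le_trans _ _ (\sum_(n < N) avd n f x ^+ 2)%:E); first by rewrite lee_fin.
rewrite -sumEFin -(big_mkord xpredT (fun n => (avd n f x ^+ 2)%:E)).
by apply: nneseries_lim_ge => n _ _; rewrite lee_fin sqr_ge0.
Qed.

End martingale.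

(** * Martingale differences of sums of Haar functions *)

Section haar_martingale.
Context {R : realType} {disp : measure_display} {X : measurableType disp}.
Variables (mu : {measure set X -> \bar R}) (d : X -> X -> R).
Variables (kap A1 A2 K1 K2 : R).
Hypothesis G : space_geometry mu d kap A1 A2 K1 K2.
Variables (delta a0 eta C1 C2 : R) (E : nat -> set (set X)).
Hypothesis DC : dyadic_cubes mu d delta a0 eta C1 C2 E.
Hypotheses (delta_gt0 : 0 < delta) (delta_lt1 : delta < 1) (a0_gt0 : 0 < a0).
Variables (C : R) (h : nat -> set X -> nat -> X -> R).
Hypothesis haar : haar_system mu C E h.
Variable i0 : nat.
Hypothesis i0_gt0 : (1 <= i0)%N.
Local Notation I f := (\int[mu]_x f x).
Local Notation T := (nat * set X)%type.
Local Notation hh q := (h q.1 q.2 i0).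
Let mu_fin := sg_fin G.
Local Notation av := (av mu E).
Local Notation avd := (avd mu E).

Lemma av_sum n (J : eqType) (s : seq J) (f : J -> X -> R) x : (forall j, j \in s -> ig mu (f j)) ->
  av n (fun y => \sum_(j <- s) f j y) x = \sum_(j <- s) av n (f j) x.
Proof.
elim: s => [|j s IH] igf.
  rewrite big_nil; under [X in av _ X]eq_fun do rewrite big_nil.
  by rewrite /av big1// => Q _; under eq_Rintegral do rewrite mul0r; rewrite (I0 mu) !mul0r.
have igs : ig mu (fun y => \sum_(j <- s) f j y).
  rewrite (_ : (fun y => _) = fun y => \sum_(i <- s) (if i \in s then f i else cst 0) y).
    apply: (ig_sum mu_fin) => i; case: ifP => [is_|_]; first by apply: igf; rewrite inE is_ orbT.
    exact: (bm_ig mu_fin (bm_cst 0)).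
  by apply/funext => y; rewrite big_seq [RHS]big_seq; apply: eq_bigr => i ->.
under [X in av _ X]eq_fun do rewrite big_cons.
rewrite big_cons (avD G DC)//; last by apply: igf; rewrite mem_head.
by rewrite IH// => i is_; apply: igf; rewrite inE is_ orbT.
Qed.

Definition allcubes x := forall n, exists2 Q, E n Q & Q x.

Lemma ae_allcubes : {ae mu, forall x, allcubes x}.
Proof. by apply: ae_foralln => n; exact: (ae_cube DC n). Qed.

Lemma av_cst n (b : R) x : allcubes x -> av n (fun=> b) x = b.
Proof.
move=> /(_ n)[Q EQ Qx]; rewrite (av_cube G DC delta_gt0 delta_lt1 a0_gt0 _ EQ Qx).
have mQ := cube_measurable DC EQ.
rewrite (IZ b (bm_ig mu_fin (bm_indic mQ))) (I_indic mu mQ) mulfK// gt_eqF//.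
exact: (vol_cube_gt0 G DC delta_gt0 delta_lt1 a0_gt0 EQ).
Qed.

(** On cubes finer than q the function h_q is constant, so averaging leaves it unchanged; a cube
    that is not finer either contains q, where the mean is zero, or misses it. *)
Lemma av_haar n q x : active E i0 q.1 q.2 -> allcubes x ->
  av n (hh q) x = if (q.1 < n)%N then hh q x else 0.
Proof.
move=> aq ax; have [EQ _] := aq; have [P EP Px] := ax n.
rewrite (av_cube G DC delta_gt0 delta_lt1 a0_gt0 _ EP Px).
have mP := cube_measurable DC EP.
have hs := haar_spt haar i0_gt0 aq.
have P0 := vol_cube_gt0 G DC delta_gt0 delta_lt1 a0_gt0 EP.
case: ltnP => [qn|nq].
  have -> : I (fun y => hh q y * \1_P y) = I (fun y => hh q x * \1_P y).
    apply: eq_Rintegral => y _; rewrite indicE; case: (boolP (y \in P)) => [|_]; last by rewrite !mulr0.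
    rewrite inE => Py; congr (_ * _); have [Qx|nQx] := pselect (q.2 x).
      have [P' EP' P'x] := ax q.1.+1.
      have P'Q : P' `<=` q.2 by apply: (cube_nested DC (leqnSn _) EP' EQ); exists x.
      apply: (haar_child haar i0_gt0 aq EP' P'Q _ P'x).
      by apply: (cube_nested DC qn EP EP' _ Py); exists x.
    rewrite !hs// => Qy; apply: nQx; apply: (cube_nested DC (ltnW qn) EP EQ _ Px).
    by exists y.
  by rewrite (IZ _ (bm_ig mu_fin (bm_indic mP))) (I_indic mu mP) mulfK// gt_eqF.
have [PQ|QP] := pselect (P `&` q.2 !=set0).
  have QP : q.2 `<=` P by apply: (cube_nested DC nq EQ EP); rewrite setIC.
  have -> : I (fun y => hh q y * \1_P y) = I (hh q).
    apply: eq_Rintegral => y _; rewrite indicE; case: (boolP (y \in P)) => [_|]; first by rewrite mulr1.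
    by rewrite notin_setE => nP; rewrite hs ?mul0r// => /QP.
  by rewrite (haar_I haar i0_gt0 aq) mul0r.
have -> : I (fun y => hh q y * \1_P y) = I (cst 0).
  apply: eq_Rintegral => y _; rewrite indicE; case: (boolP (y \in P)) => [|_]; last by rewrite mulr0.
  by rewrite inE => Py; rewrite hs ?mul0r// => Qy; apply: QP; exists y.
by rewrite (I0 mu) mul0r.
Qed.

Lemma sum_by_level (D : seq T) (f : T -> R) N : (forall q, q \in D -> (q.1 < N)%N) ->
  \sum_(q <- D) f q = \sum_(k < N) \sum_(q <- D | q.1 == k) f q.
Proof.
move=> DN; rewrite (exchange_big_dep predT)//= big_seq [RHS]big_seq.
apply: eq_bigr => q qD; by rewrite (big_pred1 (Ordinal (DN q qD)))// => k /=; rewrite -val_eqE/= eq_sym.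
Qed.

(** The difference of index k + 1 is the sum of the c_q h_q over q of level k. At a given point at
    most one of them is nonzero, as cubes of one level are disjoint, so the square of the sum is the
    sum of the squares. The constant b is the difference of index 0. *)
Lemma mart_norm_haar (D : seq T) (c : T -> R) (b : R) : uniq D ->
  (forall q, q \in D -> active E i0 q.1 q.2) ->
  ((I (fun x => Num.sqrt (b ^+ 2 + \sum_(q <- D) c q ^+ 2 * hh q x ^+ 2)))%:E <=
   mart_H1_norm mu E (fun x => b + \sum_(q <- D) c q * hh q x)%R)%E.
Proof.
move=> uD Da.
have bmh q : q \in D -> bm (hh q) by move=> /Da aq; exact: (haar_bm haar i0_gt0 aq).
pose hD q x := if q \in D then hh q x else 0.
have bmD_ q : bm (hD q).
  by rewrite /hD; case: (boolP (q \in D)) => [/bmh//|_]; exact: bm_cst.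
have eD (u : T -> R -> R) x : \sum_(q <- D) u q (hh q x) = \sum_(q <- D) u q (hD q x).
  by rewrite big_seq [RHS]big_seq; apply: eq_bigr => q; rewrite /hD => ->.
have bmS : bm (fun x => \sum_(q <- D) c q * hh q x).
  under eq_fun do rewrite (eD (fun q z => c q * z)).
  by apply: bm_sum => q; exact: bmZ.
pose N := (\max_(q <- D) q.1).+1.
have DN q : q \in D -> (q.1 < N)%N by move=> qD; rewrite ltnS (@leq_bigmax_seq _ D xpredT (fun q : T => q.1)).
apply: (mart_norm_low G DC delta_gt0 delta_lt1 a0_gt0 (N := N.+1)).
- by apply: (bm_ig mu_fin); apply: (bmD (bm_cst b)).
- apply: (bmD (bm_cst (b ^+ 2))); under eq_fun do rewrite (eD (fun q z => c q ^+ 2 * z ^+ 2)).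
  by apply: bm_sum => q; apply: bmZ; exact: bmX.
- move=> x; rewrite addr_ge0 ?sqr_ge0// sumr_ge0// => q _.
  by rewrite mulr_ge0 ?sqr_ge0.
apply: filterS ae_allcubes => x ax.
have avf n : av n (fun x => b + \sum_(q <- D) c q * hh q x) x =
    b + \sum_(q <- D) c q * (if (q.1 < n)%N then hh q x else 0).
  rewrite (avD G DC delta_gt0 delta_lt1 a0_gt0 n x (bm_ig mu_fin (bm_cst b)) (bm_ig mu_fin bmS)).
  rewrite (av_cst n b ax); congr (_ + _); rewrite av_sum; last first.
    by move=> q /bmh bq; apply: (bm_ig mu_fin); exact: bmZ.
  rewrite big_seq [RHS]big_seq; apply: eq_bigr => q qD.
  by rewrite (avZ G DC delta_gt0 delta_lt1 a0_gt0) ?(av_haar n (Da q qD) ax)//; exact: (bm_ig mu_fin (bmh q qD)).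
have avf0 : av 0 (fun x => b + \sum_(q <- D) c q * hh q x) x = b.
  by rewrite avf big1 ?addr0// => q _; rewrite ltn0 mulr0.
rewrite big_ord_recl/= /avd avf0 subr0 lerD2l (sum_by_level _ DN) ler_sum// => k _.
rewrite -[bump 0 k]/(k.+1) !avf opprD addrACA subrr add0r -sumrB.
have -> : \sum_(q <- D) (c q * (if (q.1 < k.+1)%N then hh q x else 0) -
    c q * (if (q.1 < k)%N then hh q x else 0)) = \sum_(q <- D | q.1 == k) c q * hh q x.
  rewrite [RHS]big_mkcond; apply: eq_bigr => q _; rewrite ltnS leq_eqVlt.
  by case: eqP => [->|_]/=; rewrite ?ltnn ?mulr0 ?subr0 ?subrr.
have [[q0 [q0D q0k q0x]]|no] := pselect (exists q, [/\ q \in D, q.1 == k & q.2 x]); last first.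
  by rewrite !big1_seq ?expr0n// => q /andP[qk qD];
    rewrite (haar_spt haar i0_gt0 (Da q qD)) ?expr0n ?mulr0// => qx; apply: no; exists q.
have z q : q \in D -> q.1 == k -> q != q0 -> hh q x = 0.
  move=> qD qk qq0; apply: (haar_spt haar i0_gt0 (Da q qD)) => qx; move/eqP : qq0; apply.
  have l1 : q.1 = q0.1 by rewrite (eqP qk) (eqP q0k).
  have [E1 _] := Da q qD; have [E2 _] := Da q0 q0D; rewrite -l1 in E2.
  have l2 : q.2 = q0.2 by apply: (cube_eq DC E1 E2); exists x.
  by move: l1 l2; case: (q) (q0) => [? ?] [? ?] /= -> ->.
have one (u : T -> R) : (forall q, q \in D -> q.1 == k -> q != q0 -> u q = 0) ->
    \sum_(q <- D | q.1 == k) u q = u q0.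
  move=> u0; rewrite big_mkcond (bigD1_seq q0)//= q0k big1_seq ?addr0// => q /andP[qq0 qD].
  by case: ifP => // qk; exact: u0.
rewrite !one ?exprMn// => q qD qk qq0; first by rewrite (z q)// mulr0.
by rewrite (z q)// expr0n mulr0.
Qed.
End haar_martingale.

(** * Extension of a densely defined bounded operator *)

Section extension.
Context {R : realType} {disp : measure_display} {X : measurableType disp}.
Variables (mu : {measure set X -> \bar R}) (d : X -> X -> R).
Hypotheses (mu_gt0 : (0 < mu setT)%E) (mu_fin : (mu setT < +oo)%E).
Hypothesis mball : forall x r, measurable (qball d x r).
Hypothesis ball_gt0 : forall x r, 0 < r -> (0 < mu (qball d x r))%E.
Local Notation hn := (atomic_H1_norm mu d).
Variables (nz : (X -> R) -> \bar R) (W : (X -> R) -> (X -> R) -> Prop) (B : R).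
Hypothesis nz_ge0 : forall f, (0 <= nz f)%E.
Hypothesis nzD : forall f g, ig mu f -> ig mu g -> (nz (fun x => f x + g x)%R <= nz f + nz g)%E.
Hypothesis nzZ : forall c f, ig mu f -> nz (fun x => c * f x) = (`|c|%:E * nz f)%E.
Hypothesis W_dom : forall g G, W g G -> ig mu g /\ measurable_fun setT G.
Hypothesis W_lin : forall c g G g' G', W g G -> W g' G' ->
  W (fun x => c * g x + g' x) (fun x => c * G x + G' x).
Hypothesis B_ge0 : 0 <= B.
Hypothesis W_bound : forall g G, W g G -> (hn G <= B%:E * nz g)%E.

Let nz_sub f g h : ig mu f -> ig mu g -> (forall x, h x = f x - g x) -> (nz h <= nz f + nz g)%E.
Proof.
move=> igf igg hE; have -> : h = fun x => f x + -1 * g x.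
  by apply/funext => x; rewrite hE mulN1r.
have := nzD igf (igZ (-1) igg).
by rewrite (nzZ _ igg) normrN1 mul1e.
Qed.

(** Membership in the closure of the graph [W]. The operator is given as a relation because a
    combination may be written in several ways; the bound makes it single-valued up to null sets. *)
Definition ext (f Ff : X -> R) := measurable_fun setT Ff /\ forall e : R, 0 < e ->
  exists g G, [/\ W g G, (nz (fun x => f x - g x)%R <= e%:E)%E &
    (hn (fun x => Ff x - G x)%R <= e%:E)%E].

Lemma ext_W g G : W g G -> ext g G.
Proof.
move=> WgG; have [igg mG] := W_dom WgG; split=> // e e0; exists g, G; split=> //.
  have -> : (fun x => g x - g x) = fun x => 0 * g x by apply/funext => x; rewrite subrr mul0r.
  by rewrite nzZ// normr0 mul0e lee_fin ltW.
have -> : (fun x => G x - G x) = cst 0 by apply/funext => x; rewrite subrr.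
by rewrite hn0// lee_fin ltW.
Qed.

Lemma ext_bound f Ff : ig mu f -> (nz f < +oo)%E -> ext f Ff -> (hn Ff <= B%:E * nz f)%E.
Proof.
move=> igf nzf [mF h]; apply/lee_addgt0Pr => e e0.
have B1 : 0 < 1 + B by rewrite ltr_pwDl.
have e1 : 0 < e / (1 + B) by rewrite divr_gt0.
have [g [G [WgG h1 h2]]] := h _ e1; have [igg mG] := W_dom WgG.
have -> : Ff = fun x => (Ff x - G x) + G x by apply/funext => x; rewrite subrK.
apply: le_trans (hnD mu_gt0 mu_fin mball ball_gt0 (measurable_funB mF mG) mG) _.
have ng : (nz g <= nz f + (e / (1 + B))%:E)%E.
  apply: (@le_trans _ _ (nz f + nz (fun x => f x - g x)%R)%E); last by rewrite leeD2l.
  by apply: nz_sub => //; [exact: igB|move=> x; rewrite opprB addrC subrK].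
apply: (@le_trans _ _ ((e / (1 + B))%:E + B%:E * (nz f + (e / (1 + B))%:E))%E).
  by apply: leeD => //; apply: le_trans (W_bound WgG) _; rewrite lee_wpmul2l// lee_fin.
have nf : nz f \is a fin_num by rewrite ge0_fin_numE.
rewrite -(fineK nf) -EFinD -!EFinM -!EFinD lee_fin.
have : e / (1 + B) * (1 + B) = e by rewrite divfK// gt_eqF.
lra.
Qed.

Lemma ext_lin c f Ff g Gg : ig mu f -> ig mu g -> ext f Ff -> ext g Gg ->
  ext (fun x => c * f x + g x) (fun x => c * Ff x + Gg x).
Proof.
move=> igf igg [mF hF_] [mG hG]; split.
  by apply: measurable_funD => //; apply: measurable_funM => //; exact: measurable_cst.
move=> e e0; have c1 : 0 < `|c| + 1 by rewrite ltr_wpDl.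
have e1 : 0 < e / (`|c| + 1) by rewrite divr_gt0.
have [f1 [F1 [W1 a1 b1]]] := hF_ _ e1; have [g1 [G1 [W2 a2 b2]]] := hG _ e1.
have [igf1 mF1] := W_dom W1; have [igg1 mG1] := W_dom W2.
have ee : `|c| * (e / (`|c| + 1)) + e / (`|c| + 1) = e.
  have : e / (`|c| + 1) * (`|c| + 1) = e by rewrite divfK// gt_eqF.
  lra.
exists (fun x => c * f1 x + g1 x), (fun x => c * F1 x + G1 x); split; first exact: W_lin.
- have -> : (fun x => c * f x + g x - (c * f1 x + g1 x)) = fun x => c * (f x - f1 x) + (g x - g1 x).
    by apply/funext => x; lra.
  have i1 := igB igf igf1; have i2 := igB igg igg1.
  apply: le_trans (nzD (igZ c i1) i2) _.
  rewrite (nzZ c i1) -[X in (_ <= X%:E)%E]ee EFinD EFinM.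
  by apply: leeD => //; rewrite lee_wpmul2l// lee_fin.
- have -> : (fun x => c * Ff x + Gg x - (c * F1 x + G1 x)) = fun x => c * (Ff x - F1 x) + (Gg x - G1 x).
    by apply/funext => x; lra.
  have i1 := measurable_funB mF mF1; have i2 := measurable_funB mG mG1.
  have i3 : measurable_fun setT (fun x => c * (Ff x - F1 x)).
    by apply: measurable_funM => //; exact: measurable_cst.
  apply: le_trans (hnD mu_gt0 mu_fin mball ball_gt0 i3 i2) _.
  rewrite -[X in (_ <= X%:E)%E]ee EFinD EFinM; apply: leeD => //.
  apply: le_trans (hnZ mu_gt0 mu_fin mball ball_gt0 c i1) _.
  by apply: lee_wpmul2l; [rewrite lee_fin|exact: b1].
Qed.

(** The difference of the two values is a value at 0, so the bound makes its atomic norm, and with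
    it its L^1 norm, vanish. *)
Lemma ext_uniq f F1 F2 : ig mu f -> ext f F1 -> ext f F2 -> {ae mu, forall x, F1 x = F2 x}.
Proof.
move=> igf e1 e2; have e3 := ext_lin (-1) igf igf e2 e1.
have i0 : ig mu (fun x => -1 * f x + f x) by apply: igD => //; exact: igZ.
have z : nz (fun x => -1 * f x + f x) = 0%E.
  have -> : (fun x => -1 * f x + f x) = fun x => 0 * f x by apply/funext => x; rewrite mulN1r addNr mul0r.
  by rewrite nzZ// normr0 mul0e.
have := ext_bound i0 _ e3; rewrite z mule0 => /(_ (ltry _)) h0.
have [m1 _] := e1; have [m2 _] := e2; have [m3 _] := e3.
have := le_trans (hn_n1 mu_gt0 mu_fin mball ball_gt0 m3) h0 => h1.
have : n1 mu (fun x => -1 * F2 x + F1 x) = 0%E by apply/eqP; rewrite eq_le h1 n1_ge0.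
move=> /(n1_eq0 m3); apply: filterS => x hx; lra.
Qed.

(** With approximants of f at distance 2^(-k), the successive differences of their images are
    summable in the atomic norm. Their pointwise series defines the value, and [hn_sum] controls its
    tails. *)
Lemma ext_ex f : ig mu f -> (nz f < +oo)%E ->
  (forall e : R, 0 < e -> exists g G, W g G /\ (nz (fun x => f x - g x)%R <= e%:E)%E) ->
  exists Ff, ext f Ff.
Proof.
move=> igf nzf app.
have p2 k : 0 < (2^-1 : R) ^+ k by rewrite exprn_gt0.
have /choice[gG gGP] : forall k : nat, exists z : (X -> R) * (X -> R),
    W z.1 z.2 /\ (nz (fun x => f x - z.1 x)%R <= (2^-1 ^+ k)%:E)%E.
  by move=> k; have [g [G ?]] := app _ (p2 k); exists (g, G).
pose g k := (gG k).1; pose Gk k := (gG k).2.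
have Wk k : W (g k) (Gk k) by have [] := gGP k.
have nk k : (nz (fun x => f x - g k x)%R <= (2^-1 ^+ k)%:E)%E by have [] := gGP k.
have igk k : ig mu (g k) by have [] := W_dom (Wk k).
have mk k : measurable_fun setT (Gk k) by have [] := W_dom (Wk k).
pose u k x := if k is k'.+1 then -1 * Gk k' x + Gk k'.+1 x else Gk 0 x.
have nf : nz f \is a fin_num by rewrite ge0_fin_numE.
(* The 3 comes from 2^(-k) + 2^(-k-1) = 3 2^(-k-1); the norm of f enters through the first term
   only. *)
pose M := B * (fine (nz f) + 3).
have M0 : 0 <= M by rewrite mulr_ge0// addr_ge0// fine_ge0.
have mu_ k : measurable_fun setT (u k).
  case: k => [|k]; first exact: mk.
  by apply: measurable_funD => //; apply: measurable_funM => //; exact: measurable_cst.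
have hu k : (hn (u k) <= (M * 2^-1 ^+ k)%:E)%E.
  case: k => [|k].
    apply: le_trans (W_bound (Wk 0)) _; rewrite expr0 mulr1 /M EFinM lee_wpmul2l ?lee_fin//.
    apply: (@le_trans _ _ (nz f + 1%:E)%E); last by rewrite -(fineK nf) -EFinD lee_fin; lra.
    apply: (@le_trans _ _ (nz f + nz (fun x => f x - g 0 x)%R)%E); last by rewrite leeD2l//; exact: (nk 0).
    by apply: nz_sub => //; [exact: igB|move=> x; rewrite opprB addrC subrK].
  apply: le_trans (W_bound (W_lin (-1) (Wk k) (Wk k.+1))) _.
  rewrite /M -mulrA EFinM lee_wpmul2l ?lee_fin//.
  apply: (@le_trans _ _ (nz (fun x => f x - g k x)%R + nz (fun x => f x - g k.+1 x)%R)%E).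
    by apply: nz_sub; [exact: igB..|move=> x; lra].
  apply: le_trans (leeD (nk k) (nk k.+1)) _; rewrite -EFinD lee_fin exprS.
  have h1 := p2 k; have h2 : 0 <= fine (nz f) * 2^-1 ^+ k by rewrite mulr_ge0 ?fine_ge0// ltW.
  lra.
have hu0 k : (0 <= hn (u k))%E by exact: hn_ge0.
have hfin : (\esum_(k in [set: nat]) hn (u k) < +oo)%E.
  apply: (@le_lt_trans _ _ (M * 2)%:E); last exact: ltry.
  apply: esum_le_seq => s us _; apply: (@le_trans _ _ (\sum_(k <- s) (M * 2^-1 ^+ k)%:E)%E).
    by apply: lee_sum => k _; exact: hu.
  rewrite sumEFin lee_fin -mulr_sumr ler_wpM2l//.
  by apply: (@geo_uniq _ _ s id) => //; rewrite ?invr_ge0//; move=> ? ?.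
have nu k : (n1 mu (u k) <= hn (u k))%E by exact: hn_n1.
have nfin : (\esum_(k in [set: nat]) n1 mu (u k) < +oo)%E.
  by apply: le_lt_trans hfin; apply: le_esum => k _.
pose Ff x := usum [set: nat] (fun k => u k x).
have mF : measurable_fun setT Ff by exact: measurable_usum.
have tele n x : \sum_(k < n.+1) u k x = Gk n x.
  elim: n => [|n IH]; first by rewrite big_ord_recl big_ord0 addr0.
  by rewrite big_ord_recr/= IH; lra.
exists Ff; split=> // e e0.
have tailE n : (hn (fun x => Ff x - Gk n x)%R <= \esum_(k in [set: nat]) hn (u (n.+1 + k)%N))%E.
  apply: (hn_sum mu_gt0 mu_fin mball ball_gt0); [exact: measurable_funB|by move=> k|].
  have cv0 := esum_shift_cvg0 (fun k => n1_ge0 mu (u k)) nfin.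
  have cv1 : (\esum_(k in [set: nat]) n1 mu (u (m + n.+1 + k)%N))%E @[m --> \oo] --> 0%E.
    by have := cv0; rewrite -(cvg_shiftn n.+1).
  apply: squeeze_cvge cv1; last first; first exact: cvg_cst.
  apply: nearW => m; rewrite n1_ge0/= [(m + _)%N]addnC.
  have -> : (fun x => Ff x - Gk n x - \sum_(k < m) u (n.+1 + k)%N x) =
      fun x => Ff x - \sum_(k < n.+1 + m) u k x.
    by apply/funext => x; rewrite big_split_ord/= tele; lra.
  exact: n1_usum_le.
have /fine_cvgP[fn /cvgrPdist_le /(_ e e0) near1] := esum_shift_cvg0 hu0 hfin.
have c2 : (2^-1 : R) ^+ n @[n --> \oo] --> 0 by apply: cvg_expr; rewrite ger0_norm ?invr_ge0//; lra.
have /cvgrPdist_le /(_ e e0) near2 := c2.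
have [N _ hN] := filterI fn (filterI near1 near2).
have [f1 [f2 _]] := hN N.+1 (leqnSn N); have [_ [_ f3]] := hN N (leqnn N).
exists (g N), (Gk N); split=> //.
- apply: le_trans (nk N) _; by rewrite lee_fin; move: f3; rewrite sub0r normrN ger0_norm.
- apply: le_trans (tailE N) _; rewrite -(fineK f1) lee_fin.
  by move: f2; rewrite /= sub0r normrN; apply: le_trans; exact: ler_norm.
Qed.

Definition extop f : X -> R := xget (cst 0) (ext f).

Lemma extopP f : ig mu f -> (nz f < +oo)%E ->
  (forall e : R, 0 < e -> exists g G, W g G /\ (nz (fun x => f x - g x)%R <= e%:E)%E) ->
  ext f (extop f).
Proof. by move=> h1 h2 h3; exact: (@xgetPex _ (cst 0) (ext f) (ext_ex h1 h2 h3)). Qed.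

End extension.

(** * The operator *)

Lemma sum_supported (R : pzRingType) (T : eqType) (s D : seq T) (c u : T -> R) : uniq s -> uniq D ->
  {subset D <= s} -> \sum_(q <- s) (if q \in D then c q else 0) * u q = \sum_(q <- D) c q * u q.
Proof.
move=> us uD Ds; rewrite (eq_bigr (fun q => if q \in D then c q * u q else 0)); last first.
  by move=> q _; case: ifP => //; rewrite mul0r.
rewrite -big_mkcond -big_filter; apply: perm_big; apply: uniq_perm => //; first exact: filter_uniq.
by move=> q; rewrite mem_filter; case: (boolP (q \in D)) => // /Ds.
Qed.

Section instance.
Context {R : realType} {disp : measure_display} {X : measurableType disp}.
Variables (mu : {measure set X -> \bar R}) (d : X -> X -> R).
Variables (kap A1 A2 K1 K2 : R).
Hypothesis G : space_geometry mu d kap A1 A2 K1 K2.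
Variables (delta a0 eta C1 C2 : R) (E : nat -> set (set X)).
Hypothesis DC : dyadic_cubes mu d delta a0 eta C1 C2 E.
Hypotheses (delta_gt0 : 0 < delta) (delta_lt1 : delta < 1) (a0_gt0 : 0 < a0).
Variables (tau beta C : R) (M : nat).
Variables (h : nat -> set X -> nat -> X -> R) (psi : nat -> nat -> X -> R).
Hypotheses (tau_gt0 : 0 < tau) (tau_small : tau * (2 * kap) < a0).
Hypotheses (beta_gt0 : 0 < beta) (C_gt0 : 0 < C).
Hypothesis haar : haar_system mu C E h.
Hypothesis pou : partitions_of_unity d beta tau delta M psi.
Variables (K : R) (l : nat) (P : nat -> 'I_l -> set (set X)) (m s : nat) (j : 'I_l) (i0 : nat).
Hypothesis sep : separated_splitting mu d K E P.
Hypotheses (m_gt0 : (0 < m)%N) (s_gt0 : (0 < s)%N) (i0_gt0 : (1 <= i0)%N).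
Local Notation T := (nat * set X)%type.
Local Notation I f := (\int[mu]_x f x).
Local Notation hn := (atomic_H1_norm mu d).
Local Notation V := (vol mu setT).
Local Notation rw := (rw kap C1 tau).
Local Notation rloc := (rloc kap C1 tau).
Local Notation rsep := (rsep kap C1 tau).
Local Notation big := (big kap A2 C1 tau).
Local Notation cmin := (cmin mu A1 a0).
Local Notation cs := (cphi mu kap A1 A2 delta a0 C1 C).
Local Notation cl := (chol mu kap A1 A2 delta a0 C1 tau beta C M).
Local Notation c0 := (csch mu kap A1 A2 delta a0 C1 tau beta m cs cl).
Hypothesis K_large : rsep < K * cmin.
Hypothesis m_loc : rloc * delta ^+ m <= 1.
Hypothesis xx_le : xx delta beta m <= 2^-1.
Hypothesis c0_le : c0 <= 2^-1.

Let mu_fin := sg_fin G.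
Let mu_gt0 := sg_gt0 G.
Let mball := sg_ball G.
Let ball_gt0 := ball_mu_gt0 G.
Let V0 : 0 < V. Proof. exact: (vol_T_gt0 G). Qed.
Let dn n : 0 < delta ^+ n. Proof. exact: exprn_gt0. Qed.
Let sd0 n : 0 < sd delta n. Proof. exact: sd_gt0. Qed.
Let rw0 : 0 < rw. Proof. exact: (rw_gt0 G). Qed.
Let rloc0 : 0 < rloc. Proof. exact: (rloc_gt0 G). Qed.
Let kap0 : 0 < kap. Proof. by have := sg_kap G; lra. Qed.
Let cs0 : 0 < cs. Proof. exact: (cphi_gt0 G). Qed.
Let cl0 : 0 <= cl. Proof. by apply: mulr_ge0; [apply: mulr_ge0; [exact: ltW|rewrite mulr_ge0]|exact: powR_ge0]. Qed.

Let F0 : set T := [set p | exists k, [/\ p.1 = (m * k + s)%N, P p.1 j p.2 & (i0 <= nchild E p.1 p.2)%N]].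
Let root : T := (0%N, setT).
Let F : set T := familyF E P m s j i0.
Let g := phiF mu psi h i0.
Let v (p : T) := sd delta p.1.
Let nb := nb d delta tau F0.

Let F0_act p : F0 p -> active E i0 p.1 p.2.
Proof.
move=> [k [_ Pp ip]]; split=> //; have [<- _ _] := sep p.1.
by exists j.
Qed.

Let F0_lev p : F0 p -> exists k, p.1 = (m * k + s)%N.
Proof. by move=> [k [? _ _]]; exists k. Qed.

Let F0_pos p : F0 p -> (0 < p.1)%N.
Proof. by move=> [k [-> _ _]]; rewrite ltn_addl. Qed.

(** Turns separation in terms of measure into separation in terms of distance: K mu(p) is at least K
    [cmin] delta^(p.1), which exceeds [rsep] delta^(p.1). *)
Let F0_sep p q x y : F0 p -> F0 q -> p.1 = q.1 -> p.2 x -> q.2 y ->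
  dle d delta p.1 rsep x y -> p = q.
Proof.
move=> Fp Fq pq px qy xy; apply: contrapT => npq.
have [k [_ Pp _]] := Fp; have [k' [_ Pq _]] := Fq; rewrite -pq in Pq.
have n2 : p.2 <> q.2.
  by move=> e2; apply: npq; move: pq e2; case: (p) (q) => [? ?] [? ?] /= -> ->.
have [_ _ /(_ j _ _ Pp Pq n2) hK] := sep p.1.
have [EQ _] := F0_act Fp; have mp := cube_measurable DC EQ.
have vp := vol_cube_ge G DC delta_gt0 delta_lt1 a0_gt0 EQ.
have K0 : 0 < K.
  have c1 : 0 < cmin := cmin_gt0 G a0_gt0; have rs : 0 < rsep.
    by rewrite /rsep addr_gt0// !mulr_gt0// !addr_gt0// !mulr_gt0// !addr_gt0// mulr_gt0// addr_gt0.
  by rewrite -(pmulr_lgt0 _ c1) (lt_trans rs).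
have : (K%:E * (vol mu p.2)%:E <= (d x y)%:E)%E.
  apply: (@le_trans _ _ (K%:E * maxe (mu p.2) (mu q.2))%E).
    by rewrite lee_wpmul2l ?lee_fin ?(ltW K0)// (volK mu_fin mp) le_max lexx.
  apply: le_trans hK _; apply: ereal_inf_lbound.
  by exists x => //; exists y.
rewrite -EFinM lee_fin => h1; move: xy; rewrite /dle => xy.
have h2 : K * (cmin * delta ^+ p.1) <= K * vol mu p.2 by rewrite ler_wpM2l// ltW.
have h3 : rsep * delta ^+ p.1 < K * cmin * delta ^+ p.1 by rewrite ltr_pM2r.
by have := lt_le_trans h3 (le_trans (ler_of_eq (esym (mulrA _ _ _))) (le_trans h2 (le_trans h1 xy))); rewrite ltxx.
Qed.

Let F0_root : ~ F0 root. Proof. by move=> /F0_pos. Qed.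

Let FE : F = [set p | p = root \/ F0 p]. Proof. by []. Qed.

Let gE p : F0 p -> g p = phi mu psi h p.1 p.2 i0.
Proof. by move=> /F0_pos; rewrite /g /phiF; case: eqP => [->|]. Qed.

Let hE p : F0 p -> hF h i0 p = h p.1 p.2 i0.
Proof. by move=> /F0_pos; rewrite /hF; case: eqP => [->|]. Qed.

Let g_bm0 p : F0 p -> bm (g p).
Proof.
move=> Fp; rewrite gE//.
exact: (phi_bm G DC delta_gt0 delta_lt1 a0_gt0 C_gt0 haar pou i0_gt0 (F0_act Fp)).
Qed.

Let g_le p x : F0 p -> `|g p x| <= cs / sd delta p.1.
Proof.
move=> Fp; rewrite gE//.
exact: (phi_le G DC delta_gt0 delta_lt1 a0_gt0 tau_gt0 tau_small beta_gt0 C_gt0 haar pou i0_gt0 (F0_act Fp)).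
Qed.

Let g_spt p x : F0 p -> g p x != 0 -> wnb d delta tau p x.
Proof.
move=> Fp; rewrite gE// => px.
have [y [py xy]] := phi_spt G haar pou i0_gt0 (F0_act Fp) px.
by exists y; split=> //; rewrite (sg_sym G).
Qed.

Let g_holder p x y : F0 p -> `|g p x - g p y| <= cl / sd delta p.1 * (d x y / delta ^+ p.1) `^ beta.
Proof.
move=> Fp; rewrite gE//.
exact: (phi_holder G DC delta_gt0 delta_lt1 a0_gt0 tau_gt0 tau_small beta_gt0 C_gt0 haar pou i0_gt0 (F0_act Fp)).
Qed.

Let g_I p : F0 p -> I (g p) = 0.
Proof.
move=> Fp; rewrite gE//.
exact: (phi_I G DC delta_gt0 delta_lt1 a0_gt0 tau_gt0 beta_gt0 C_gt0 haar pou i0_gt0 (F0_act Fp)).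
Qed.

Let g_I2 p : F0 p -> I (fun x => g p x ^+ 2) = 1.
Proof.
move=> Fp; rewrite gE//.
exact: (phi_I2 G DC delta_gt0 delta_lt1 a0_gt0 tau_gt0 tau_small beta_gt0 C_gt0 haar pou i0_gt0 (F0_act Fp)).
Qed.

Let g_root : g root = cst 1. Proof. by []. Qed.

Let g_bm p : [set p | p = root \/ F0 p] p -> bm (g p).
Proof. by move=> [->|/g_bm0//]; rewrite g_root; exact: bm_cst. Qed.

Let v_gt0 p : [set p | p = root \/ F0 p] p -> 0 < v p. Proof. by move=> _; exact: sd0. Qed.

Let vsq p : v p ^+ 2 = delta ^+ p.1. Proof. by rewrite expr2 /v sd_sqr. Qed.

(** Because s > 0, all other elements have positive level, and level 0 is free for the element X. *)
Definition Flev n : seq T :=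
  if n is 0%N then [:: root] else [seq p <- [seq (n, Q) | Q <- cubes E n] | `[< F0 p >]].

Let Fl_uniq n : uniq (Flev n).
Proof.
case: n => // n; rewrite /Flev filter_uniq// map_inj_uniq ?cubes_uniq//.
by move=> x y [].
Qed.

Let FlP n p : (p \in Flev n) <-> ([set p | p = root \/ F0 p] p /\ p.1 = n).
Proof.
case: n => [|n]; rewrite /Flev.
  rewrite inE; split=> [/eqP ->|[[->//|/F0_pos]]]; first by split=> //; left.
  by move=> p0 p1; rewrite p1 in p0.
rewrite mem_filter; split.
  by move=> /andP[/asboolP Fp /mapP[Q _ pE]]; split; [right|rewrite pE].
move=> [[->//|Fp] pn]; apply/andP; split; first exact/asboolP.
apply/mapP; exists p.2; last by rewrite -pn; case: (p).
by apply/(cubesP G DC delta_gt0 delta_lt1 a0_gt0); rewrite -pn; have [] := F0_act Fp.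
Qed.

Let cv := Num.max V (cs * big rw).
Let cv0 : 0 <= cv. Proof. by rewrite le_max (ltW V0). Qed.

Let g_hn p : [set p | p = root \/ F0 p] p -> (hn (g p) <= (cv * v p)%:E)%E.
Proof.
move=> [->|Fp].
  rewrite /v /sd expr0 sqrtr1 mulr1; apply: (@le_trans _ _ V%:E); last first.
    by rewrite lee_fin /cv le_max lexx.
  apply: (hn_atom_scale (a := cst V^-1)); [left|exact: ltW|] => // x.
  by rewrite /= mulfV// gt_eqF.
have [x px] : exists x, p.2 x by have [EQ _] := F0_act Fp; exact: (cube_nonempty G DC delta_gt0 a0_gt0 EQ).
have [EQ _] := F0_act Fp.
have r0 : 0 < (rw + rw) * delta ^+ p.1 by rewrite mulr_gt0// addr_gt0.
have hb : (hn (g p) <= (cs / sd delta p.1 * vol mu (qball d x ((rw + rw) * delta ^+ p.1)))%:E)%E.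
  apply: (hn_bounded mu_gt0 mu_fin mball ball_gt0) => //.
  - by have [] := g_bm0 Fp.
  - by rewrite divr_ge0// ltW.
  - by move=> y; exact: g_le.
  - move=> y; apply: contra_notP => /eqP py; apply: (dle_ball G C1 delta_gt0 tau_gt0).
    exact: (wnb_dle G DC delta_gt0 delta_lt1 tau_gt0 EQ px (g_spt Fp py)).
  - exact: g_I.
apply: le_trans hb _; rewrite lee_fin.
have vn := vol_near G DC delta_gt0 delta_lt1 a0_gt0 tau_gt0 i0_gt0 F0_act Fp px (ltW rw0).
apply: (@le_trans _ _ (cs / sd delta p.1 * (big rw * delta ^+ p.1))).
  by rewrite ler_wpM2l// divr_ge0// ltW.
have -> : cs / sd delta p.1 * (big rw * delta ^+ p.1) = cs * big rw * v p.
  have e := mulVf (lt0r_neq0 (sd0 p.1)); rewrite -sd_sqr// /v.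
  transitivity (cs * big rw * sd delta p.1 * ((sd delta p.1)^-1 * sd delta p.1)); first lra.
  by rewrite e mulr1.
by rewrite ler_wpM2r ?(ltW (sd0 _))// /cv le_max lexx orbT.
Qed.

Let c00 : 0 <= c0.
Proof.
have x0 : 0 <= xx delta beta m by rewrite exprn_ge0// powR_ge0.
rewrite /csch; apply: mulr_ge0 => //; apply: mulr_ge0; last first.
  by rewrite addr_ge0// (cfine_ge0 G C1 a0_gt0).
by rewrite mulr_ge0// (cgr_ge0 G C1).
Qed.

Let row p t : uniq t -> (forall q, q \in t -> F0 q) -> F0 p ->
  \sum_(q <- t) `|gr mu g p q| * v q <= c0 * v p.
Proof.
exact: (gr_row G DC delta_gt0 delta_lt1 a0_gt0 tau_gt0 beta_gt0 m_gt0 i0_gt0 F0_act F0_lev F0_sep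
  cs0 cl0 g_bm0 g_le g_spt g_holder g_I xx_le).
Qed.

Let w (r q : T) := cgr kap A2 C1 tau beta cs cl * sd delta q.1 * xx delta beta m ^+ (idx m s q - idx m s r).

Let exit1 r q t : F0 r -> nb r q -> uniq t ->
  (forall p, p \in t -> F0 p /\ ~ nb r p) -> \sum_(p <- t) `|gr mu g q p| * v p <= w r q.
Proof.
exact: (exit_row G DC delta_gt0 delta_lt1 a0_gt0 tau_gt0 beta_gt0 m_gt0 i0_gt0 F0_act F0_lev F0_sep
  cs0 cl0 g_bm0 g_le g_spt g_holder g_I xx_le).
Qed.

Let cX := cexit mu kap A1 A2 a0 C1 tau beta cs cl.
Let cX0 : 0 <= cX. Proof. exact: (cexit_ge0 G C1 a0_gt0 beta tau_gt0 cs0 cl0). Qed.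

Let exit2 r t : F0 r -> uniq t -> (forall q, q \in t -> nb r q) ->
  \sum_(q <- t) v q * w r q <= cX * v r ^+ 2.
Proof.
rewrite vsq; exact: (exit_sum G DC delta_gt0 delta_lt1 a0_gt0 tau_gt0 m_gt0 i0_gt0 F0_act F0_lev F0_sep
  m_loc cs0 cl0 xx_le).
Qed.

Let nbF0 r p : nb r p -> F0 p. Proof. by move=> /nbF[]. Qed.

Let osc (u : X -> R) := forall om, 0 < om -> exists N0, forall N, (N0 <= N)%N ->
  forall Q x y, E N Q -> Q x -> Q y -> `|u x - u y| <= om.

(** Hoelder continuity and shrinking diameters of cubes; this provides the terminal condition of the
    Calderon-Zygmund decomposition. *)
Let osc_phi p : F0 p -> osc (g p).
Proof.
move=> Fp om om0; pose c := cl / sd delta p.1 * (rho1 C1 / delta ^+ p.1) `^ beta.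
have r1 := rho1_gt0 C1; have bb1 := bb_lt1 delta_gt0 delta_lt1 beta_gt0.
have c_ge0 : 0 <= c by rewrite mulr_ge0 ?powR_ge0// divr_ge0// ltW.
have : (bb delta beta) ^+ n @[n --> \oo] --> (0 : R).
  by apply: cvg_expr; rewrite ger0_norm// powR_ge0.
have e0 : 0 < om / (c + 1) by rewrite divr_gt0// ltr_wpDl.
move=> /cvgrPdist_le /(_ _ e0)[N0 _ hN0]; exists N0 => N N0N Q x y EQ Qx Qy.
apply: le_trans (g_holder x y Fp) _.
have dxy : d x y <= rho1 C1 * delta ^+ N.
  have [x' []] : exists z, Q z /\ qball d x (rho1 C1 * delta ^+ N) y.
    by exists x; split=> //; exact: (cube_ball DC delta_gt0 EQ Qx).
  by move=> _ /ltW.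
apply: (@le_trans _ _ (c * bb delta beta ^+ N)).
  have cl1 : 0 <= cl / sd delta p.1 by rewrite divr_ge0// ltW.
  have rd : 0 <= rho1 C1 / delta ^+ p.1 by rewrite divr_ge0// ltW.
  rewrite /c bbX// -[leRHS]mulrA; apply: ler_wpM2l => //; rewrite -powRM ?(ltW (dn N))//.
  have q0 : 0 <= (delta ^+ p.1)^-1 by rewrite invr_ge0 ltW.
  rewrite ge0_ler_powR ?nnegrE ?(ltW beta_gt0)//.
  - by rewrite mulr_ge0// (sg_ge0 G).
  - by rewrite mulr_ge0// ltW.
  - by rewrite mulrAC ler_wpM2r.
have := hN0 N N0N; rewrite /= sub0r normrN ger0_norm; last by rewrite exprn_ge0// powR_ge0.
move=> hb; apply: le_trans (ler_wpM2l c_ge0 hb) _.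
have : om / (c + 1) * (c + 1) = om by rewrite divfK// gt_eqF// ltr_wpDl.
by have := ltW e0; lra.
Qed.

Let osc_sum (t : seq T) (b : T -> R) : (forall q, q \in t -> F0 q) ->
  osc (fun x => \sum_(p <- t) b p * g p x).
Proof.
elim: t => [|p t IH] tF om om0.
  by exists 0%N => N _ Q x y _ _ _; rewrite !big_nil subrr normr0 ltW.
have b1 : 0 < `|b p| + 1 by rewrite ltr_wpDl.
have e1 : 0 < om / 2 / (`|b p| + 1) by rewrite !divr_gt0.
have [N1 h1] := osc_phi (tF p (mem_head _ _)) e1.
have e2 : 0 < om / 2 by rewrite divr_gt0.
have [N2 h2] := IH (fun q qt => tF q (mem_behead (s := p :: t) qt)) _ e2.
exists (maxn N1 N2) => N; rewrite geq_max => /andP[n1 n2] Q x y EQ Qx Qy.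
rewrite !big_cons.
have -> (a1 a2 a3 a4 : R) : a1 + a2 - (a3 + a4) = (a1 - a3) + (a2 - a4) by lra.
apply: le_trans (ler_normD _ _) _; rewrite -mulrBr normrM.
have l1 := ler_wpM2l (normr_ge0 (b p)) (h1 N n1 Q x y EQ Qx Qy).
have l2 := h2 N n2 Q x y EQ Qx Qy.
have : om / 2 / (`|b p| + 1) * (`|b p| + 1) = om / 2 by rewrite divfK// gt_eqF.
by have := ltW e1; lra.
Qed.

Let Cv := big (kap * (rloc + rho1 C1)).
Let cz := ccz mu A1 A2 delta a0 C1 Cv.

Let rB0 : 0 <= kap * (rloc + rho1 C1).
Proof. by rewrite ltW// mulr_gt0// addr_gt0// rho1_gt0. Qed.

(** All supports lie within [rloc] of r, at the scale of r. Hence a cube of the level of r on which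
    the sum is not identically zero lies in a ball of comparable radius about a point of r, as
    [cz_ball] demands. *)
Let cz_nb r (t : seq T) (b : T -> R) (a : R) : F0 r -> uniq t ->
  (forall q, q \in t -> nb r q) -> 0 < a ->
  I (fun x => (\sum_(p <- t) b p * g p x) ^+ 2) <= a ^+ 2 * v r ^+ 2 ->
  (hn (fun x => \sum_(p <- t) b p * g p x)%R <= (cz * a * v r ^+ 2)%:E)%E.
Proof.
move=> Fr ut tnb a_gt0; rewrite vsq => hI.
have tF q : q \in t -> F0 q by move=> /tnb/nbF0.
have [EQ _] := F0_act Fr; have [x rx] := cube_nonempty G DC delta_gt0 a0_gt0 EQ.
have gt_bm (p : T) : bm (if p \in t then g p else cst 0).
  by case: ifP => [/tF/g_bm0|_] //; exact: bm_cst.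
have sumE : (fun x => \sum_(p <- t) b p * g p x) =
    fun x => \sum_(p <- t) b p * (if p \in t then g p else cst 0) x.
  by apply/funext => y; rewrite big_seq [RHS]big_seq; apply: eq_bigr => p ->.
apply: (cz_ball G DC delta_gt0 delta_lt1 a0_gt0
  (B := qball d x ((kap * (rloc + rho1 C1) + rw) * delta ^+ r.1))).
- by rewrite sumE; apply: bm_sum => p; exact: bmZ.
- move=> om om0; have [N0 hN] := osc_sum b tF om0; exists (maxn r.1 N0).
  split; first exact: leq_maxl.
  exact: (hN _ (leq_maxr _ _)).
- exists x, ((kap * (rloc + rho1 C1) + rw) * delta ^+ r.1); split=> //.
  by rewrite mulr_gt0// ltr_wpDl.
- exact: (vol_near G DC delta_gt0 delta_lt1 a0_gt0 tau_gt0 i0_gt0 F0_act Fr rx rB0).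
- move=> Q EQ' [y [Qy uy]] z Qz; apply: (dle_ball G C1 delta_gt0 tau_gt0).
  have [p pt py] : exists2 p, p \in t & g p y != 0.
    apply: contrapT => no; apply: uy; rewrite big_seq big1// => p pt.
    case: (eqVneq (g p y) 0) => [->|py]; first by rewrite mulr0.
    by exfalso; apply: no; exists p.
  have xy := nb_loc G DC delta_gt0 delta_lt1 a0_gt0 tau_gt0 m_gt0 F0_act F0_lev F0_sep m_loc
    (tnb p pt) rx (g_spt (tF p pt) py).
  apply: (dle_tri G xy); rewrite /dle ltW//.
  exact: (cube_ball DC delta_gt0 EQ' Qy Qz).
- rewrite sumE (Isum mu_fin); last by move=> p; apply: (bm_ig mu_fin); exact: bmZ.
  rewrite big_seq big1// => p pt; rewrite (IZ _ (bm_ig mu_fin (gt_bm p))) pt g_I ?mulr0//.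
  exact: tF.
- exact: a_gt0.
- exact: hI.
Qed.

Definition coef := am mu F0 root g.
Definition fsys := ff mu F0 root Flev g.

Lemma coef_inv_sqrt : is_inv_sqrt_mx F (gram mu g) coef.
Proof. exact: (am_mx mu_gt0 mu_fin v_gt0 g_root g_I g_I2 c00 c0_le row). Qed.

Lemma fsys_L2 q : F q -> is_L2_sum mu F (fun p x => coef p q * g p x) (fsys q).
Proof.
exact: (ff_L2 mu_gt0 mu_fin mball ball_gt0 v_gt0 Fl_uniq FlP cv0 g_bm g_hn g_root g_I g_I2 c00 c0_le row).
Qed.

Lemma fsys_m q : F q -> measurable_fun setT (fsys q).
Proof. by move=> Fq; exact: (ff_m mu FlP g_bm Fq). Qed.

Let kroot := cv * ((lam0 mu)^-1 * (2 * v root)).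

Lemma fsys_root : (hn (fsys root) <= kroot%:E)%E.
Proof.
apply: (ff_hn mu_gt0 mu_fin mball ball_gt0 v_gt0 Fl_uniq FlP cv0 g_bm g_hn c00 c0_le row).
by left.
Qed.

Let kroot0 : 0 <= kroot.
Proof.
have l0 : 0 <= (lam0 mu)^-1 by rewrite invr_ge0 ltW// lam0_gt0.
by apply: mulr_ge0 => //; apply: mulr_ge0 => //; apply: mulr_ge0 => //; exact: (ltW (sd0 _)).
Qed.

Let Pc := cpiece mu cv cX cz.

Let Pc0 : 0 <= Pc.
Proof.
have l0 := lam0_gt0 mu_gt0 mu_fin; rewrite /Pc /cpiece.
have cz0 : 0 <= cz by apply: ccz_ge0; apply: ltW; exact: (big_gt0 G).
apply: addr_ge0; apply: mulr_ge0 => //.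
  by rewrite mulr_ge0 ?sqrtr_ge0// mulr_ge0// invr_ge0 ltW.
by rewrite mulr_ge0 ?addr_ge0// invr_ge0 ltW.
Qed.

Let piece r (t : seq T) (c : T -> R) (a : R) : F0 r -> uniq t ->
  (forall q, q \in t -> F0 q /\ nb r q) -> 0 < a -> \sum_(q <- t) c q ^+ 2 <= a ^+ 2 * v r ^+ 2 ->
  (hn (fun y => \sum_(q <- t) c q * fsys q y)%R <= (Pc * a * v r ^+ 2)%:E)%E.
Proof.
move=> Fr ut tP a_gt0 hc.
exact (piece_hn mu_gt0 mu_fin mball ball_gt0 F0_root v_gt0 Fl_uniq FlP cv0 g_bm g_hn g_root g_I g_I2
  c00 c0_le row nbF0 exit1 exit2 cz_nb Fr ut (fun q qt => proj2 (tP q qt)) a_gt0 hc).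
Qed.

Let kstop := cstop (C ^+ 2 * cup A2 C1)^-1 (cmin * delta) (cup A2 C1) Pc.

(** The sets A required by the stopping time argument are the children given by [haar_big_child].
    They are one level finer, whence the factor delta in the lower bound of their volume. *)
Lemma fsys_stop (D : seq T) (c : T -> R) : uniq D -> (forall q, q \in D -> F0 q) ->
  (hn (fun y => \sum_(q <- D) c q * fsys q y)%R <=
   (kstop * I (fun x => Num.sqrt (\sum_(q <- D) c q ^+ 2 * h q.1 q.2 i0 x ^+ 2)))%:E)%E.
Proof.
have /choice[A AP] : forall p : T, exists A : set X, F0 p -> [/\ E p.1.+1 A, A `<=` p.2 &
    forall x, A x -> (C ^+ 2 * cup A2 C1)^-1 / delta ^+ p.1 <= h p.1 p.2 i0 x ^+ 2].
  move=> p; have [Fp|nF] := pselect (F0 p); last by exists set0.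
  by have [A ?] := haar_big_child G DC delta_gt0 delta_lt1 a0_gt0 C_gt0 haar i0_gt0 (F0_act Fp); exists A.
have EF p : F0 p -> E p.1 p.2 by move=> /F0_act[].
have cup0 := cup_gt0 G C1.
apply: (stopping_hn mu_gt0 mu_fin mball ball_gt0 (F0 := F0) (v := v) (A := A)
  (h := fun p => h p.1 p.2 i0) (f := fsys) (nb := nb)) => //.
- by rewrite invr_gt0 mulr_gt0// exprn_gt0.
- by rewrite mulr_gt0// (cmin_gt0 G).
- by move=> p _; exact: sd0.
- by move=> p /EF EQ; exact: (cube_measurable DC EQ).
- by move=> p /EF EQ; exact: (cube_nonempty G DC delta_gt0 a0_gt0 EQ).
- move=> p q /EF Ep /EF Eq pq [x [px qx]]; apply: (cube_nested DC pq Eq Ep).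
  by exists x.
- by move=> p /AP[EA _ _]; exact: (cube_measurable DC EA).
- by move=> p /AP[].
- move=> p /AP[EA _ _]; rewrite vsq -mulrA -exprS.
  exact: (vol_cube_ge G DC delta_gt0 delta_lt1 a0_gt0 EA).
- move=> p /F0_act ap; rewrite vsq.
  exact: (active_vol G DC delta_gt0 delta_lt1 a0_gt0 i0_gt0 ap).
- by move=> p /F0_act ap; exact: (haar_bm haar i0_gt0 ap).
- by move=> p x /AP[_ _ hA] Ax; rewrite vsq; exact: hA.
- by move=> p Fp; apply: fsys_m; right.
- move=> r q Fr Fq; exact: (nb_sub G DC delta_gt0 a0_gt0 tau_gt0 F0_act Fr Fq).
Qed.

Let bm_hF q : F q -> bm (hF h i0 q).
Proof.
move=> [->|Fq]; first exact: bm_cst.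
by rewrite hE//; exact: (haar_bm haar i0_gt0 (F0_act Fq)).
Qed.

Definition kmain : R := kroot / V + kstop.

Let cstop0 : 0 <= kstop.
Proof.
have cup0 := cup_gt0 G C1; have cm := cmin_gt0 G a0_gt0.
rewrite /kstop /cstop; apply: mulr_ge0 => //; apply: mulr_ge0; last by rewrite divr_ge0// mulr_ge0// ltW.
by apply: mulr_ge0 => //; exact: sqrtr_ge0.
Qed.

Lemma kmain_ge0 : 0 <= kmain.
Proof. by rewrite addr_ge0// divr_ge0// ltW. Qed.

(** The coefficient b of the constant function is treated apart. Both |b| mu(X) and the integral of
    the square function of the other terms are at most the integral J of the full square function,
    which the martingale norm dominates. *)
Lemma fsys_main (D : seq T) (c : T -> R) : uniq D -> (forall q, q \in D -> F q) ->
  (hn (fun y => \sum_(q <- D) c q * fsys q y)%R <=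
   kmain%:E * mart_H1_norm mu E (fun y => \sum_(q <- D) c q * hF h i0 q y)%R)%E.
Proof.
move=> uD DF; pose D0 := [seq q <- D | q != root]; pose b := if root \in D then c root else 0.
have split_root (u : T -> R) : \sum_(q <- D) c q * u q = b * u root + \sum_(q <- D0) c q * u q.
  rewrite /b /D0 big_filter; case: (boolP (root \in D)) => rD; first by rewrite (bigD1_seq root).
  rewrite mul0r add0r big_seq [RHS]big_seq_cond; apply: eq_bigl => q.
  by case: (boolP (q \in D)) => //= qD; apply/esym/eqP => qr; rewrite -qr qD in rD.
have uD0 : uniq D0 by exact: filter_uniq.
have D0F q : q \in D0 -> F0 q.
  by rewrite mem_filter => /andP[/eqP qr /DF[]].
have -> : (fun y => \sum_(q <- D) c q * fsys q y) =
    fun y => b * fsys root y + \sum_(q <- D0) c q * fsys q y.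
  by apply/funext => y; rewrite split_root.
have -> : (fun y => \sum_(q <- D) c q * hF h i0 q y) =
    fun y => b + \sum_(q <- D0) c q * h q.1 q.2 i0 y.
  apply/funext => y; rewrite split_root {1}/hF/= mulr1; congr (_ + _).
  by rewrite big_seq [RHS]big_seq; apply: eq_bigr => q /D0F/hE ->.
have mr : measurable_fun setT (fsys root) by apply: fsys_m; left.
have mbr : measurable_fun setT (fun y => b * fsys root y).
  by apply: measurable_funM => //; exact: measurable_cst.
have mD0 : measurable_fun setT (fun y => \sum_(q <- D0) c q * fsys q y).
  rewrite (_ : (fun y => _) = fun y => \sum_(q <- D0) c q * (if q \in D0 then fsys q else cst 0) y).
    apply: measurable_sum => q; apply: measurable_funM; first exact: measurable_cst.
    by case: ifP => [/D0F Fq|_]; [apply: fsys_m; right|exact: measurable_cst].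
  by apply/funext => y; rewrite big_seq [RHS]big_seq; apply: eq_bigr => q ->.
apply: le_trans (hnD mu_gt0 mu_fin mball ball_gt0 mbr mD0) _.
have low := mart_norm_haar G DC delta_gt0 delta_lt1 a0_gt0 haar i0_gt0 c b uD0
  (fun q qD => F0_act (D0F q qD)).
apply: (@le_trans _ _ (kmain%:E * (I (fun x => Num.sqrt (b ^+ 2 + \sum_(q <- D0) c q ^+ 2 * h q.1 q.2 i0 x ^+ 2)))%:E)%E); last first.
  by rewrite lee_wpmul2l// lee_fin kmain_ge0.
pose s2 x := \sum_(q <- D0) c q ^+ 2 * h q.1 q.2 i0 x ^+ 2.
have bs2 : bm s2.
  rewrite (_ : s2 = fun x => \sum_(q <- D0) c q ^+ 2 * (if q \in D0 then h q.1 q.2 i0 else cst 0) x ^+ 2).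
    apply: bm_sum => q; apply: bmZ; apply: bmX.
    by case: ifP => [/D0F Fq|_]; [exact: (haar_bm haar i0_gt0 (F0_act Fq))|exact: bm_cst].
  by apply/funext => y; rewrite /s2 big_seq [RHS]big_seq; apply: eq_bigr => q ->.
have s20 x : 0 <= s2 x by rewrite sumr_ge0// => q _; rewrite mulr_ge0 ?sqr_ge0.
have bs := bm_sqrt (bmD (bm_cst (b ^+ 2)) bs2); have bs' := bm_sqrt bs2.
rewrite -[I (fun x => Num.sqrt (b ^+ 2 + _))]/(I (fun x => Num.sqrt (b ^+ 2 + s2 x))).
set J := I (fun x => Num.sqrt (b ^+ 2 + s2 x)).
have J1 : `|b| * V <= J.
  rewrite -(I_indic mu measurableT) -(IZ _ (bm_ig mu_fin (bm_indic measurableT))).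
  apply: (I_le (bm_ig mu_fin (bmZ _ (bm_indic measurableT))) (bm_ig mu_fin bs)) => x.
  by rewrite indicE mem_set// mulr1 -sqrtr_sqr ler_wsqrtr// lerDl.
have J2 : I (fun x => Num.sqrt (s2 x)) <= J.
  apply: (I_le (bm_ig mu_fin bs') (bm_ig mu_fin bs)) => x.
  by rewrite ler_wsqrtr// lerDr sqr_ge0.
apply: (@le_trans _ _ ((`|b| * kroot)%:E + (kstop * I (fun x => Num.sqrt (s2 x)))%:E)%E).
  apply: leeD; last exact: fsys_stop.
  apply: le_trans (hnZ mu_gt0 mu_fin mball ball_gt0 b mr) _.
  by rewrite EFinM lee_wpmul2l ?lee_fin// fsys_root.
rewrite -EFinD -EFinM lee_fin /kmain mulrDl; apply: lerD; last exact: ler_wpM2l.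
rewrite mulrC -[leRHS]mulrA; apply: ler_wpM2l => //.
by rewrite [leRHS]mulrC ler_pdivlMr.
Qed.

Let W (f1 f2 : X -> R) := exists (D : seq T) (c : T -> R), [/\ uniq D, forall q, q \in D -> F q,
  f1 = fun x => \sum_(q <- D) c q * hF h i0 q x & f2 = fun x => \sum_(q <- D) c q * fsys q x].

Let nz := mart_H1_norm mu E.

Let W_dom f1 f2 : W f1 f2 -> ig mu f1 /\ measurable_fun setT f2.
Proof.
move=> [D [c [uD DF -> ->]]]; split.
  rewrite (_ : (fun y => _) = fun y => \sum_(q <- D) c q * (if q \in D then hF h i0 q else cst 0) y).
    apply: (bm_ig mu_fin); apply: bm_sum => q; apply: bmZ.
    by case: ifP => [/DF/bm_hF//|_]; exact: bm_cst.
  by apply/funext => y; rewrite big_seq [RHS]big_seq; apply: eq_bigr => q ->.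
rewrite (_ : (fun y => _) = fun y => \sum_(q <- D) c q * (if q \in D then fsys q else cst 0) y).
  apply: measurable_sum => q; apply: measurable_funM; first exact: measurable_cst.
  by case: ifP => [/DF Fq|_]; [exact: fsys_m|exact: measurable_cst].
by apply/funext => y; rewrite big_seq [RHS]big_seq; apply: eq_bigr => q ->.
Qed.

Let W_lin a f1 f2 g1 g2 : W f1 f2 -> W g1 g2 ->
  W (fun x => a * f1 x + g1 x) (fun x => a * f2 x + g2 x).
Proof.
move=> [D [c [uD DF -> ->]]] [D' [c' [uD' DF' -> ->]]].
pose D2 := undup (D ++ D'); have u2 : uniq D2 by exact: undup_uniq.
pose c2 q := a * (if q \in D then c q else 0) + (if q \in D' then c' q else 0).
have DD2 : {subset D <= D2} by move=> q qD; rewrite mem_undup mem_cat qD.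
have D'D2 : {subset D' <= D2} by move=> q qD; rewrite mem_undup mem_cat qD orbT.
have e (u : T -> R) : a * (\sum_(q <- D) c q * u q) + \sum_(q <- D') c' q * u q = \sum_(q <- D2) c2 q * u q.
  rewrite -(sum_supported c u u2 uD DD2) -(sum_supported c' u u2 uD' D'D2) mulr_sumr -big_split/=.
  by apply: eq_bigr => q _; rewrite /c2 mulrDl mulrA.
exists D2, c2; split=> //; last 2 first.
- by apply/funext => x; rewrite e.
- by apply/funext => x; rewrite e.
by move=> q; rewrite mem_undup mem_cat => /orP[/DF|/DF'].
Qed.

Let W_bound f1 f2 : W f1 f2 -> (hn f2 <= kmain%:E * nz f1)%E.
Proof. by move=> [D [c [uD DF -> ->]]]; exact: fsys_main. Qed.

Let nz_ge0 f : (0 <= nz f)%E.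
Proof. by apply: integral_ge0 => x _; exact: sqrte_ge0. Qed.

Let nzD f1 f2 : ig mu f1 -> ig mu f2 -> (nz (fun x => f1 x + f2 x)%R <= nz f1 + nz f2)%E.
Proof. exact: (mart_normD G DC delta_gt0 delta_lt1 a0_gt0). Qed.

Let nzZ a f : ig mu f -> nz (fun x => a * f x) = (`|a|%:E * nz f)%E.
Proof. exact: (mart_normZ G DC delta_gt0 delta_lt1 a0_gt0). Qed.

Lemma operator_exists : exists (a : T -> T -> R) (f : T -> X -> R),
  [/\ is_inv_sqrt_mx F (gram mu (phiF mu psi h i0)) a,
      forall Q, F Q -> is_L2_sum mu F (fun p x => a p Q * phiF mu psi h i0 p x) (f Q)
    & exists S : (X -> R) -> X -> R,
        bounded_linear_op mu
          (mart_H1_closure mu E (lin_span F (hF h i0))) (mart_H1_norm mu E)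
          (atomic_H1 mu d) (atomic_H1_norm mu d) S /\
        forall Q, F Q -> {ae mu, forall x, S (hF h i0 Q) x = f Q x}].
Proof.
exists coef, fsys; split; [exact: coef_inv_sqrt|exact: fsys_L2|].
pose Z := mart_H1_closure mu E (lin_span F (hF h i0)).
have ZP f : Z f -> [/\ ig mu f, (nz f < +oo)%E & forall e : R, 0 < e ->
    exists f1 f2, W f1 f2 /\ (nz (fun x => f x - f1 x)%R <= e%:E)%E].
  move=> [[igf _ nf] app]; split=> // e e0; have [f1 [[D [c [finD DF ->]]] hf]] := app e e0.
  pose t : seq T := fset_set D.
  have sE x : \sum_(p \in D) c p * hF h i0 p x = \sum_(p <- t) c p * hF h i0 p x.
    by rewrite fsbig_finite.
  exists (fun x => \sum_(p <- t) c p * hF h i0 p x), (fun x => \sum_(p <- t) c p * fsys p x).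
  split.
    exists t, c; split=> //; first exact: fset_uniq.
    by move=> q; rewrite /t in_fset_set// inE => /DF.
  have -> : (fun x => f x - \sum_(p <- t) c p * hF h i0 p x) =
      (f \- (fun x => \sum_(p \in D) c p * hF h i0 p x))%R.
    by apply/funext => x /=; rewrite sE.
  exact: ltW.
pose S := extop mu d nz W.
have SP f : Z f -> ext mu d nz W f (S f).
  move=> /ZP[igf nf app].
  exact: (extopP mu_gt0 mu_fin mball ball_gt0 nz_ge0 nzD nzZ W_dom W_lin kmain_ge0 W_bound igf nf app).
have Sbound f : Z f -> (hn (S f) <= kmain%:E * nz f)%E.
  move=> Zf; have [igf nf _] := ZP f Zf.
  exact: (ext_bound mu_gt0 mu_fin mball ball_gt0 nz_ge0 nzD nzZ W_dom kmain_ge0 W_bound igf nf (SP f Zf)).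
(* The value [S f] is an arbitrary choice, so linearity and the values on the h_Q are obtained up to
   null sets, through uniqueness. *)
have Suniq f f2 : ig mu f -> ext mu d nz W f f2 -> {ae mu, forall x, S f x = f2 x}.
  move=> igf ef; have eS : ext mu d nz W f (S f) by apply: (@xgetPex _ (cst 0) (ext mu d nz W f)); exists f2.
  exact: (ext_uniq mu_gt0 mu_fin mball ball_gt0 nz_ge0 nzD nzZ W_dom W_lin kmain_ge0 W_bound igf eS ef).
exists S; split.
  split.
  - move=> f Zf; have [igf nf _] := ZP f Zf; have [mS _] := SP f Zf.
    apply: (hn_fin_atomic mS); apply: le_lt_trans (Sbound f Zf) _.
    by rewrite lte_mul_pinfty ?lee_fin ?kmain_ge0.
  - move=> c f f' Zf Zf'; have [igf _ _] := ZP f Zf; have [igf' _ _] := ZP f' Zf'.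
    apply: Suniq; first by apply: igD => //; exact: igZ.
    exact: (ext_lin mu_gt0 mu_fin mball ball_gt0 nzD nzZ W_dom W_lin c igf igf' (SP f Zf) (SP f' Zf')).
  - by exists kmain => f; exact: Sbound.
move=> Q FQ; apply: Suniq; first by apply: (bm_ig mu_fin); exact: bm_hF.
apply: (ext_W d nzZ W_dom); exists [:: Q], (fun=> 1); split=> //.
- by move=> q; rewrite inE => /eqP ->.
- by apply/funext => x; rewrite big_cons big_nil mul1r addr0.
- by apply/funext => x; rewrite big_cons big_nil mul1r addr0.
Qed.

End instance.

Theorem theorem9 (R : realType) (disp : measure_display)
    (X : measurableType disp) (mu : {measure set X -> \bar R})
    (d : X -> X -> R) (theta : R)
    (normal_X : normal_space_of_order mu d theta)
    (mu_gt0 : (0 < mu setT)%E) (mu_fin : (mu setT < +oo)%E)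
    (beta : R) (beta_gt0 : 0 < beta) (beta_le : beta <= theta)
    (* constants of the cubes, of the h_{Q,i} and of the partitions of unity *)
    (a0 eta C1 C2 C : R) (M : nat)
    (a0_gt0 : 0 < a0) (eta_gt0 : 0 < eta) (C_gt0 : 0 < C) :
  exists2 tau0 : R, 0 < tau0 &
  forall tau : R, 0 < tau -> tau < tau0 -> tau * (500 * C1) < 1 ->
  exists2 delta0 : R, 0 < delta0 &
  forall delta : R, 0 < delta -> delta < 1 -> delta < delta0 ->
  exists Kmin : R,
  forall alpha : R, 0 < alpha -> alpha < beta / 2 ->
  exists mmin : nat,
  forall (K : R) (m : nat), Kmin <= K -> (mmin <= m)%N -> (2 <= m)%N ->
  forall (E : nat -> set (set X)) (h : nat -> set X -> nat -> X -> R)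
    (psi : nat -> nat -> X -> R) (l : nat) (P : nat -> 'I_l -> set (set X))
    (s : nat) (j : 'I_l) (i0 : nat),
  dyadic_cubes mu d delta a0 eta C1 C2 E ->
  haar_system mu C E h ->
  partitions_of_unity d beta tau delta M psi ->
  separated_splitting mu d K E P ->
  (0 < s <= m)%N -> (1 <= i0)%N ->
  let F := familyF E P m s j i0 in
  exists (a : nat * set X -> nat * set X -> R) (f : nat * set X -> X -> R),
  [/\ is_inv_sqrt_mx F (gram mu (phiF mu psi h i0)) a,
      forall Q, F Q ->
        is_L2_sum mu F (fun p x => a p Q * phiF mu psi h i0 p x) (f Q)
    & exists S : (X -> R) -> X -> R,
        bounded_linear_op mu
          (mart_H1_closure mu E (lin_span F (hF h i0))) (mart_H1_norm mu E)
          (atomic_H1 mu d) (atomic_H1_norm mu d) S /\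
        forall Q, F Q -> {ae mu, forall x, S (hF h i0 Q) x = f Q x}].
Proof.
have [kap [A1 [A2 [K1 [K2 G]]]]] := normal_geometry normal_X mu_gt0 mu_fin.
have kap1 := sg_kap G; have kap2 : 0 < 2 * kap by lra.
(* With this bound, smoothing at the scale tau delta^(n+1) does not alter h_Q near the centres of
   the children of Q. *)
exists (a0 / (2 * kap)); first exact: divr_gt0.
move=> tau tau_gt0; rewrite ltr_pdivlMr// => tau_small _.
exists 1 => // delta delta_gt0 delta_lt1 _.
pose rs := rsep kap C1 tau; pose cm := cmin mu A1 a0.
have cm0 : 0 < cm := cmin_gt0 G a0_gt0.
(* Volumes of cubes are at least [cm] delta^n, so K times the volume exceeds [rsep] delta^n; the
   added 1 makes this strict. *)
exists (rs / cm + 1) => alpha _ _.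
pose cs := cphi mu kap A1 A2 delta a0 C1 C.
pose cl := chol mu kap A1 A2 delta a0 C1 tau beta C M.
pose kc := 2 * cgr kap A2 C1 tau beta cs cl * (1 + cfine mu kap A1 A2 a0 C1 tau).
have bb0 : 0 <= bb delta beta := powR_ge0 _ _.
have small (b r : R) : 0 <= b -> b < 1 -> 0 < r -> exists N, forall n, (N <= n)%N -> b ^+ n <= r.
  move=> b0 b1 r0; have : b ^+ n @[n --> \oo] --> (0 : R) by apply: cvg_expr; rewrite ger0_norm.
  move=> /cvgrPdist_le /(_ r r0)[N _ hN]; exists N => n /hN/=.
  by rewrite sub0r normrN ger0_norm// exprn_ge0.
have rl0 := rloc_gt0 G C1 tau_gt0.
(* This gives [m_loc]: the reach of chains from the next coarsest level of the family is at most one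
   unit of the current level. *)
have [N1 h1] := small delta (rloc kap C1 tau)^-1 (ltW delta_gt0) delta_lt1 ltac:(by rewrite invr_gt0).
have kc1 : 0 < `|kc| + 1 by rewrite ltr_wpDl.
(* Dividing by |kc| + 1 gives two bounds at once: the decay factor between consecutive levels of the
   family and the constant of Schur's test are both at most 1/2. *)
have [N2 h2] := small _ (2^-1 / (`|kc| + 1)) bb0 (bb_lt1 delta_gt0 delta_lt1 beta_gt0)
  ltac:(by rewrite divr_gt0// invr_gt0).
exists (maxn N1 N2) => K m K_min; rewrite geq_max => /andP[/h1 m1 /h2 m2] m_ge2.
move=> E h psi l P s j i0 DC haar pou sep /andP[s_gt0 _] i0_gt0.
have x_le : xx delta beta m * (`|kc| + 1) <= 2^-1 by rewrite -ler_pdivlMr.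
have x0 : 0 <= xx delta beta m by rewrite exprn_ge0.
have kx : 0 <= `|kc| * xx delta beta m by rewrite mulr_ge0.
have m_gt0 : (0 < m)%N := ltnW m_ge2.
have K_large : rs < K * cm.
  have : (rs / cm + 1) * cm <= K * cm by rewrite ler_wpM2r// ltW.
  by apply: lt_le_trans; rewrite mulrDl divfK ?gt_eqF// mul1r ltrDl.
have m_loc : rloc kap C1 tau * delta ^+ m <= 1.
  by have := ler_wpM2l (ltW rl0) m1; rewrite mulfV ?gt_eqF.
have xx_le : xx delta beta m <= 2^-1 by lra.
have c0_le : csch mu kap A1 A2 delta a0 C1 tau beta m cs cl <= 2^-1.
  rewrite /csch -/kc; apply: (@le_trans _ _ (`|kc| * xx delta beta m)); last lra.
  by apply: ler_wpM2r => //; exact: ler_norm.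
move=> F; exact (operator_exists G DC delta_gt0 delta_lt1 a0_gt0 tau_gt0 tau_small beta_gt0 C_gt0
  haar pou j sep m_gt0 s_gt0 i0_gt0 K_large m_loc xx_le c0_le).
Qed.
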